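(* Let $\mathbf{T}_{\underline s,\underline\kappa}\subset\mathbf{G}_{\underline s,\underline\kappa}=\mathrm{U}(V_{\underline s,\underline\kappa})$ be the embedded relatively unramified anisotropic torus. (1) $\mathbf{T}_{\underline s,\underline\kappa}(K)$ is contained in a unique maximal compact subgroup of $\mathbf{G}_{\underline s,\underline\kappa}(K)$. (2) $\mathcal{T}^\circ_{\underline s,\underline\kappa}(\mathcal{O}_K)$ is contained in a unique maximal parahoric subgroup of $\mathbf{G}_{\underline s,\underline\kappa}(K)$, where $\mathcal{T}^\circ_{\underline s,\underline\kappa}$ is the identity component of the Néron model of $\mathbf{T}_{\underline s,\underline\kappa}$.
   Context: $K/\mathbb{Q}_p$ is a finite extension, $p\neq2$; $E/K$ is a ramified quadratic extension with $\mathrm{Gal}(E/K)=\{1,\tau\}$. For $s=2r$ even: $K_r$, $K_s$, $E_s$ are the unramified extensions of $K$, $K$, $E$ of degrees $r,s,s$; $\sigma\in\mathrm{Gal}(E_s/K)$ is the element of order $s$ fixing $E$ and inducing Frobenius on $K_s$; $\tau_s$ is the nontrivial element fixing $K_s$; $\eta=\tau_s\sigma^r$; $L_r=E_s^\eta$; $\mathbf{T}_s=\mathrm{Res}_{L_r/K}\mathrm{U}_1(E_s/L_r)$, where $\mathrm{U}_1(F'/F)$ is the norm-one torus. Fix a uniformizer $\pi_L$ of $L=L_r$ with $\mathrm{Tr}_{L/K_r}\pi_L=0$. For $\kappa\in L_r^\times$, $V_{s,\kappa}$ is the $E$-vector space $E_s$ with Hermitian form $\phi_\kappa(x,y)=\mathrm{Tr}_{E_s/E}(\kappa\pi_L^{-1}x\,\eta(y))$,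 and $\mathbf{T}_s(K)=\{\alpha\in E_s: N_{E_s/L_r}\alpha=1\}$ acts on it by multiplication. For $s=1$: $\mathbf{T}_1=\mathrm{U}_1(E/K)$, and for $\kappa\in K^\times$, $V_{1,\kappa}=E$ with $\phi_\kappa(x,y)=\kappa\pi_K^{-1}x\,\tau(y)$ ($\pi_K$ a uniformizer of $K$). $\underline s=(s_1,\dots,s_j)$ is a tuple with all $s_i$ even, except that possibly the last entry $s_j$ equals $1$; $\underline\kappa=(\kappa_1,\dots,\kappa_j)$ with $\kappa_i\in L_{s_i/2}^\times$ if $s_i$ is even and $\kappa_j\in K^\times$ if $s_j=1$. $V_{\underline s,\underline\kappa}=\bigoplus_iV_{s_i,\kappa_i}$ (orthogonal sum), $\mathbf{G}_{\underline s,\underline\kappa}=\mathrm{U}(V_{\underline s,\underline\kappa})$, and $\mathbf{T}_{\underline s,\underline\kappa}$ is the image of $\prod_i\mathbf{T}_{s_i}$ in $\mathbf{G}_{\underline s,\underline\kappa}$. A parahoric subgroup is $\mathcal{G}_F^\circ(\mathcal{O}_K)$ for a facet $F$ of the Bruhat–Tits building, where $\mathcal{G}_F^\circ$ is the identity component of the smooth model of $\mathbf{G}_{\underline s,\underline\kappa}$ attached to the pointwise fixer of $F$. *)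

(* Defs.v *)
From HB Require Import structures.
From mathcomp Require Import all_boot all_order all_algebra finmap.
From mathcomp Require Import boolp classical_sets reals topology.

Set Implicit Arguments.
Unset Strict Implicit.
Unset Printing Implicit Defensive.

Import Order.TTheory GRing.Theory Num.Theory.

Local Open Scope classical_set_scope.
Local Open Scope ring_scope.

(* All fields live inside one algebraic closure Omega of Q_p, as sets of
   elements of Omega; absv is the absolute value of Omega extending the p-adic
   one. *)

Section Fields.
Variables (R : realType) (Omega : closedFieldType) (absv : Omega -> R).
Implicit Types (F L : set Omega) (f : Omega -> Omega).

(* Q_p is the closure of Q in Omega. *)
Definition Qp : set Omega :=
  [set x | forall e : R, 0 < e -> exists a : rat, absv (x - ratr a) < e].

Record padic_closure (p : nat) : Prop := PadicClosure {
  absv_ge0 : forall x, 0 <= absv x;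
  absv_eq0 : forall x, absv x = 0 <-> x = 0;
  absvM : forall x y, absv (x * y) = absv x * absv y;
  absvD : forall x y, absv (x + y) <= Num.max (absv x) (absv y);
  absv_p : absv p%:R = p%:R^-1;
  (* Q_p is complete: Cauchy sequences of rationals converge in Omega *)
  Qp_complete : forall u : nat -> rat,
    (forall e : R, 0 < e -> exists N, forall m n, (N <= m)%N -> (N <= n)%N ->
       absv (ratr (u m - u n)) < e) ->
    exists x, forall e : R, 0 < e -> exists N, forall n, (N <= n)%N ->
      absv (x - ratr (u n)) < e;
  algebraic_Qp : forall x, exists P : {poly Omega},
    [/\ P != 0, forall k, Qp P`_k & root P x] }.

Definition is_subfield F : Prop :=
  [/\ F 1, forall x y, F x -> F y -> F (x - y)
    & forall x y, F x -> F y -> F (x / y)].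

Definition ext_basis F L n (b : 'I_n -> Omega) : Prop :=
  [/\ forall k, L (b k),
      forall x, L x -> exists2 c : 'I_n -> Omega,
        (forall k, F (c k)) & x = \sum_k c k * b k
    & forall c : 'I_n -> Omega, (forall k, F (c k)) ->
        \sum_k c k * b k = 0 -> forall k, c k = 0].

Definition ext_of_degree F L (n : nat) : Prop :=
  [/\ is_subfield L, F `<=` L & exists b : 'I_n -> Omega, ext_basis F L b].

(* Residue fields are finite here, so a finite extension is unramified iff its
   ramification index is 1. *)
Definition same_values F L : Prop :=
  forall x, L x -> exists2 y, F y & absv x = absv y.

(* The unramified extension of F of degree n inside Omega: the only L which
   qualifies is the union below. *)
Definition unr F (n : nat) : set Omega :=
  [set x | exists2 L, ext_of_degree F L n /\ same_values F L & L x].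

(* The maximal unramified extension of F. *)
Definition max_unr F : set Omega := [set x | exists n, unr F n x].

Definition residue_card F (q : nat) : Prop :=
  exists2 r : 'I_q -> Omega, (forall k, F (r k) /\ absv (r k) <= 1) &
    forall x, F x -> absv x <= 1 -> exists! k, absv (x - r k) < 1.

Definition uniformizer F (x : Omega) : Prop :=
  [/\ F x, x != 0, absv x < 1
    & forall y, F y -> absv y < 1 -> absv y <= absv x].

(* f restricts to an element of Gal(L / F). *)
Definition gal_aut L F f : Prop :=
  [/\ forall x, F x -> f x = x,
      forall x y, L x -> L y -> f (x + y) = f x + f y /\ f (x * y) = f x * f y,
      forall x, L x -> L (f x)
    & forall y, L y -> exists2 x, L x & f x = y].

End Fields.

Section Groups.
Variables (R : realType) (Omega : closedFieldType) (absv : Omega -> R) (n : nat).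
Implicit Types (G Q : set 'M[Omega]_n).

Definition is_subgroup G Q : Prop :=
  [/\ Q `<=` G, Q 1%:M, forall g h, Q g -> Q h -> Q (g *m h)
    & forall g, Q g -> Q (invmx g)].

Definition mx_open (O : set 'M[Omega]_n) : Prop :=
  forall g, O g -> exists2 e : R, 0 < e &
    forall h : 'M_n, (forall i k, absv (h i k - g i k) < e) -> O h.

Definition mx_compact Q : Prop :=
  forall (I : choiceType) (f : I -> set 'M[Omega]_n),
    (forall i, mx_open (f i)) -> Q `<=` \bigcup_i f i ->
    finite_subset_cover setT f Q.

Definition compact_subgroup G Q : Prop := is_subgroup G Q /\ mx_compact Q.

Definition bounded_subgroup G Q : Prop :=
  is_subgroup G Q /\ exists C : R, forall g, Q g -> forall i k, absv (g i k) <= C.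

(* Used for tori, which have a largest bounded subgroup. *)
Definition max_bounded G : set 'M[Omega]_n :=
  [set g | exists2 Q, bounded_subgroup G Q & Q g].

Definition maximal_among (P : set 'M[Omega]_n -> Prop) Q : Prop :=
  P Q /\ forall Q', P Q' -> Q `<=` Q' -> Q' = Q.

End Groups.

(* The Hermitian space E^n with Gram matrix H, for E/K ramified quadratic:
   phi(x, y) = x^T H tau(y), linear in x and tau-linear in y.  Here tau is the
   nontrivial automorphism of E^ur / K^ur.  As E/K is totally ramified,
   E (x)_K K^ur is the field E^ur and Gal(E/K) = Gal(E^ur / K^ur). *)
Section Unitary.
Variables (R : realType) (Omega : closedFieldType) (absv : Omega -> R).
Variables (K E : set Omega) (tau : Omega -> Omega).
Variables (n : nat) (H : 'M[Omega]_n).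
Implicit Types (F : set Omega) (g u : 'M[Omega]_n) (x y : 'cV[Omega]_n).
Implicit Types (P : 'M[Omega]_n) (alpha : 'cV[Omega]_n -> R).

Definition mx_over m l F (A : 'M[Omega]_(m, l)) : Prop := forall i k, F (A i k).

Definition herm_form x y : Omega := (x^T *m H *m map_mx tau y) 0 0.

(* U(V)(K) for F = E, and U(V)(K^ur) for F = E^ur. *)
Definition unitary F : set 'M[Omega]_n :=
  [set g | [/\ mx_over F g, g \in unitmx & g^T *m H *m map_mx tau g = H]].

(* The K-algebra K[Res_(E/K) M_n], as functions on the K^ur-points M_n(E^ur):
   it is generated by the K-linear functionals Tr_(E/K)(a * g_(i,k)), a in E.
   Restriction to a closed subgroup X yields K[X]. *)
Inductive regular : ('M[Omega]_n -> Omega) -> Prop :=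
| regular_const c : K c -> regular (fun=> c)
| regular_coord a i k : E a ->
    regular (fun g => a * g i k + tau (a * g i k))
| regular_add f1 f2 : regular f1 -> regular f2 -> regular (fun g => f1 g + f2 g)
| regular_mul f1 f2 : regular f1 -> regular f2 -> regular (fun g => f1 g * f2 g).

(* Let X be a smooth K-group with points in M_n(E^ur), and B a subgroup of
   X(K^ur) which is the group of O_(K^ur)-points of a smooth affine O_K-model
   of X.  By Bruhat-Tits that model is unique, and its coordinate ring is
     { f in K[X] | f(B) is contained in O_(K^ur) }. *)
Definition model_ring (B : set 'M[Omega]_n) : set ('M[Omega]_n -> Omega) :=
  [set f | regular f /\ forall g, B g -> absv (f g) <= 1].

(* f is idempotent in the coordinate ring of the special fibre, that is modulo
   the uniformizer of K (which is also one of K^ur). *)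
Definition special_idempotent (B : set 'M[Omega]_n) f : Prop :=
  model_ring B f /\ forall g, B g -> absv (f g ^+ 2 - f g) < 1.

(* The O_K-points of the identity component of the model (for X connected):
   the O_K-points of the model whose reduction lies in the same connected
   component of the special fibre as 1, that is, is not separated from 1 by an
   idempotent. *)
Definition identity_component (B : set 'M[Omega]_n) : set 'M[Omega]_n :=
  [set g | [/\ B g, mx_over E g &
     forall f, special_idempotent B f -> absv (f g - f 1%:M) < 1]].

(* The Bruhat-Tits building of U(V), p odd: the self-dual norms on V = E^n
   that are split by a basis.

   A norm split by a basis extends canonically to V (x)_E Omega, by the same
   formula, independently of the basis.  We work with the extension: its
   restriction to V (x)_E E^ur is the image of the norm in the building over
   K^ur, on which U(V)(K^ur) acts. *)
Definition split_norm P (c : 'I_n -> R) : 'cV[Omega]_n -> R :=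
  fun x => \big[Num.max/0]_(k < n) (c k * absv ((invmx P *m x) k 0)).

Definition split_by P alpha : Prop :=
  exists2 c : 'I_n -> R, (forall k, 0 < c k) & alpha = split_norm P c.

Definition self_dual alpha : Prop :=
  forall y, mx_over E y ->
    alpha y = sup [set absv (herm_form x y) / alpha x
                  | x in [set x | mx_over E x /\ x != 0]].

Definition building : set ('cV[Omega]_n -> R) :=
  [set alpha | self_dual alpha /\
     exists P, [/\ mx_over E P, P \in unitmx & split_by P alpha]].

Definition fixes g alpha : Prop := forall x, alpha (g *m x) = alpha x.

(* A Witt basis: the columns e_k of P satisfy phi(e_k, e_l) = 0 for
   l <> nu k, e_k and e_(nu k) span a hyperbolic plane if nu k <> k, and the
   fixed points of nu index an orthogonal basis of an anisotropic space V_0.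
   It determines the maximal K-split torus
     S = { diag(t) | t_(nu k) = t_k^-1, t_k = 1 if nu k = k }
   (in the basis P), with cocharacter lattice [cochar nu].  As p is odd, a
   self-dual norm adapted to the Witt decomposition is split by P. *)
Definition witt_basis P (nu : 'I_n -> 'I_n) : Prop :=
  [/\ mx_over E P /\ P \in unitmx,
      involutive nu,
      forall k l, l != nu k -> herm_form (col k P) (col l P) = 0,
      forall k, nu k != k -> herm_form (col k P) (col (nu k) P) = 1
    & forall x, mx_over E x -> x != 0 ->
        (forall k, nu k != k -> x k 0 = 0) ->
        herm_form (P *m x) (P *m x) != 0].

Definition apartment P : set ('cV[Omega]_n -> R) :=
  [set alpha | building alpha /\ split_by P alpha].

Definition cochar (nu : 'I_n -> 'I_n) : set ('I_n -> int) :=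
  [set l | forall k, l (nu k) = - l k].

(* The weights of S on End(V) are the a_(k, l) : t |-> t_k / t_l; the nonzero
   ones are exactly the roots of U(V) relative to S.  The root group U_a(K)
   consists of the u such that u - 1 lies in the sum of the weight spaces of
   End(V) for the positive multiples of a. *)
Definition is_root (nu : 'I_n -> 'I_n) (k l : 'I_n) : Prop :=
  exists2 lam, cochar nu lam & lam k != lam l.

Definition root_group P nu (k l : 'I_n) : set 'M[Omega]_n :=
  [set u | unitary E u /\
     forall k' l', (invmx P *m u *m P - 1%:M) k' l' != 0 ->
       exists2 m : nat, (0 < m)%N & forall lam : 'I_n -> int, cochar nu lam ->
         lam k' - lam l' = (lam k - lam l) *+ m].

(* The affine roots (closed half-apartments) are the fixed point sets in the
   apartment of the nontrivial elements of the root groups; a facet is a class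
   of points of an apartment lying in the same affine roots. *)
Definition facet (F : set ('cV[Omega]_n -> R)) : Prop :=
  exists P nu, witt_basis P nu /\ exists2 alpha, apartment P alpha &
    F = [set beta | apartment P beta /\
           forall k l u, is_root nu k l -> root_group P nu k l u ->
             (fixes u alpha <-> fixes u beta)].

(* The pointwise fixer of F in U(V)(K^ur). *)
Definition fixer (F : set ('cV[Omega]_n -> R)) : set 'M[Omega]_n :=
  [set g | unitary (max_unr absv E) g /\ forall alpha, F alpha -> fixes g alpha].

Definition parahoric (Q : set 'M[Omega]_n) : Prop :=
  exists2 F, facet F & Q = identity_component (fixer F).

Definition maximal_parahoric : set 'M[Omega]_n -> Prop :=
  maximal_among parahoric.

Definition maximal_compact : set 'M[Omega]_n -> Prop :=
  maximal_among (compact_subgroup absv (unitary E)).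

End Unitary.

(* The pieces V_(s, kappa) and T_s.  sigma is the element of Gal(E^ur / E)
   inducing Frobenius on K^ur; sigma and tau restrict to the elements sigma and
   tau_s of Gal(E_s / K), for all s at once. *)
Section Pieces.
Variables (R : realType) (Omega : closedFieldType) (absv : Omega -> R).
Variables (K E : set Omega) (tau sigma : Omega -> Omega).

(* eta = tau_s sigma^r for s = 2r; for s = 1 this is tau. *)
Definition eta (s : nat) (x : Omega) : Omega := tau (iter s./2 sigma x).

(* L_r = E_s^eta for s = 2r; K for s = 1. *)
Definition Lfield (s : nat) : set Omega :=
  if s == 1%N then K else [set x | unr absv E s x /\ eta s x = x].

(* Tr_(L_r / K_r): tau commutes with eta, hence preserves L_r; it fixes K_r and
   is nontrivial on the quadratic extension L_r of K_r. *)
Definition traceL (x : Omega) : Omega := x + tau x.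

(* Tr_(E_s / E), as E_s / E is cyclic of degree s with group <sigma>. *)
Definition trace (s : nat) (x : Omega) : Omega := \sum_(i < s) iter i sigma x.

(* phi_kappa; w is the fixed uniformizer of Lfield s. *)
Definition phi (s : nat) (w kappa x y : Omega) : Omega :=
  trace s (kappa * w^-1 * x * eta s y).

Variables (s : nat) (b : 'I_s -> Omega).

(* The matrix of multiplication by a on E_s, in the E-basis b. *)
Definition mult_mx (a : Omega) : 'M[Omega]_s :=
  xget 0 [set A | mx_over E A /\ forall l, a * b l = \sum_k A k l * b k].

(* T_s(K), the kernel of N_(E_s / L)(a) = a * eta a. *)
Definition torus_K : set 'M[Omega]_s :=
  [set A | exists2 a, unr absv E s a /\ a * eta s a = 1 & A = mult_mx a].

(* T_s(K^ur), the kernel of the norm a * eta(a) on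
   E_s (x)_K K^ur = E_s (x)_E E^ur; the element \sum_k b_k (x) c_k acts by
   \sum_k c_k *: mult_mx b_k, and eta maps it to \sum_k eta(b_k) (x) tau(c_k). *)
Definition torus_Kur : set 'M[Omega]_s :=
  [set A | exists2 c : 'I_s -> Omega, (forall k, max_unr absv E (c k)) &
     A = \sum_k c k *: mult_mx (b k) /\
     A *m (\sum_k tau (c k) *: mult_mx (eta s (b k))) = 1%:M].

End Pieces.

(* The sums V_(s, kappa), for a tuple s of length j, in coordinates given by
   E-bases b i of the E_(s i). *)
Section Sums.
Variables (R : realType) (Omega : closedFieldType) (absv : Omega -> R).
Variables (K E : set Omega) (tau sigma : Omega -> Omega).
Variables (j : nat) (s : 'I_j -> nat) (b : forall i, 'I_(s i) -> Omega).

Definition gram (varpi : nat -> Omega) (kappa : 'I_j -> Omega) :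
    'M[Omega]_(\sum_i s i) :=
  \mxdiag_i (\matrix_(k, l)
    phi tau sigma (s i) (varpi (s i)) (kappa i) (b k) (b l)).

Definition sum_torus (T : forall i, set 'M[Omega]_(s i)) :
    set 'M[Omega]_(\sum_i s i) :=
  [set A | exists2 B, (forall i, T i (B i)) & A = \mxdiag_i B i].

Definition torusK : set 'M[Omega]_(\sum_i s i) :=
  sum_torus (fun i => torus_K absv E tau sigma (b (i := i))).

Definition torusKur : set 'M[Omega]_(\sum_i s i) :=
  sum_torus (fun i => torus_Kur absv E tau sigma (b (i := i))).

(* The O_K-points of the identity component of the Neron model: the Neron
   model (locally of finite type) and the Neron model of finite type, whose
   O_(K^ur)-points are the largest bounded subgroup of T(K^ur), have the same
   identity component, and the latter is smooth and affine. *)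
Definition torus_Neron0 : set 'M[Omega]_(\sum_i s i) :=
  identity_component absv K E tau (max_bounded absv torusKur).

End Sums.

(* Main.v *)
(** On E_s let xi = eta(z) / z, for z a root of unity of order q^s - 1: it has
   norm one and generates the integers of E_s over those of E. Hence a norm on
   V invariant under these elements of the pieces is max_i c_i |x_i|, where x_i
   is the component of x in E_(s_i) and the odd piece, of dimension one, is
   unique. Self-duality forces c_i^2 = |kappa_i / varpi_i|, so there is exactly
   one invariant point alpha in the building.
   (1) A compact group Q containing T(K) makes sup_(g in Q) alpha(g x)
   invariant, hence of the above shape; comparing with the dual norm shows that
   Q fixes alpha. The stabilizer of alpha is compact, so it is the only maximal
   compact subgroup containing T(K).
   (2) The elements xi lie in the neutral component of the Neron model: the path
   y(t) = 1 + t (z - 1) from 1 to z yields a path eta(y) / y in the torus, and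
   by Gauss's lemma an idempotent of the special fibre is constant along it.
   Hence all points of a facet whose parahoric subgroup contains that component
   equal alpha. Conversely {alpha} is a facet: alpha is split by a Witt basis,
   and unipotent elements of the root groups which fix alpha determine each
   coefficient of alpha. For a coefficient whose square is an odd power of
   |Pi|, long roots suffice; otherwise one needs a second coefficient in the
   value group of E, which exists since a single piece with such values and of
   dimension at most two is anisotropic modulo smaller values. *)

Require Import Defs.
From HB Require Import structures.
From mathcomp Require Import all_boot all_order all_algebra finmap.
From mathcomp Require Import cyclic separable cyclotomic.
From mathcomp Require Import boolp classical_sets reals topology.
From mathcomp Require Import ring lra zify.

Set Implicit Arguments.
Unset Strict Implicit.
Unset Printing Implicit Defensive.

Import Order.TTheory GRing.Theory Num.Theory.

Local Open Scope classical_set_scope.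
Local Open Scope ring_scope.

(** * Ultrametric absolute values *)

(** Norms live on Omega^n but are compared on E^n: a split norm is determined by its restriction to
    E^n, and E is complete with finite residue field. Only finitely many torus elements matter, one
    [gen i] for each even piece; this is why it is enough to connect these elements to 1. The parity
    condition on the coefficients comes from ramification. Pi is chosen with tau Pi = - Pi, so the
    elements of trace zero in E are the K-multiples of Pi and have odd valuation. They parametrise
    the long root groups, which therefore pin down exactly the coefficients whose square has odd
    valuation. A short root group has all of E as parameters, but it bounds only a product of two
    coefficients; the bounds for the four sign choices, together with the products prescribed by
    self-duality, isolate each factor. That 2 is a unit enters through square roots near 1, through
    the halves in the Siegel transformations, and through y + tau y being congruent to 2 y. *)

Section Valued.
Variables (R : realType) (p : nat) (Omega : closedFieldType).
Variable absv : Omega -> R.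
Hypotheses (p_prime : prime p) (Hp : padic_closure absv p).
Implicit Types (x y z : Omega) (F L W : set Omega).

Local Lemma av_ge0 x : 0 <= absv x. Proof. exact: (absv_ge0 Hp). Qed.

Lemma av_eq0 x : (absv x == 0) = (x == 0).
Proof. by apply/eqP/eqP => /(absv_eq0 Hp). Qed.

Lemma av0 : absv 0 = 0. Proof. exact/(absv_eq0 Hp). Qed.

Lemma av_gt0 x : (0 < absv x) = (x != 0).
Proof. by rewrite lt_def av_eq0 av_ge0 andbT. Qed.

Lemma avM x y : absv (x * y) = absv x * absv y. Proof. exact: (absvM Hp). Qed.

Lemma av1 : absv 1 = 1.
Proof.
have h : absv 1 * absv 1 = absv 1 by rewrite -avM mulr1.
have n0 : absv 1 != 0 by rewrite av_eq0 oner_eq0.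
by apply: (mulfI n0); rewrite h mulr1.
Qed.

Lemma avX x n : absv (x ^+ n) = absv x ^+ n.
Proof. by elim: n => [|n IH]; rewrite ?expr0 ?av1 // !exprS avM IH. Qed.

Lemma avN x : absv (- x) = absv x.
Proof.
have h : absv (- 1) = 1.
  have : absv (-1) ^+ 2 = 1 by rewrite -avX sqrrN expr1n av1.
  by move/eqP; rewrite sqrp_eq1 ?av_ge0 // => /eqP.
by rewrite -mulN1r avM h mul1r.
Qed.

Lemma avV x : absv x^-1 = (absv x)^-1.
Proof.
have [->|x0] := eqVneq x 0; first by rewrite invr0 av0 invr0.
have n0 : absv x != 0 by rewrite av_eq0.
by apply: (mulfI n0); rewrite -avM !divff // av1.
Qed.

Lemma avXz x (n : int) : absv (x ^ n) = absv x ^ n.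
Proof. by case: n => n; rewrite ?NegzE -?exprnP -?exprnN ?avX // avV avX. Qed.

Lemma av_prod (I : Type) (r : seq I) (P : pred I) (f : I -> Omega) :
  absv (\prod_(i <- r | P i) f i) = \prod_(i <- r | P i) absv (f i).
Proof. exact: (big_morph absv avM av1). Qed.

Lemma avD_le x y (C : R) : absv x <= C -> absv y <= C -> absv (x + y) <= C.
Proof. by move=> hx hy; rewrite (le_trans (absvD Hp x y)) // ge_max hx hy. Qed.

Lemma avB_le x y (C : R) : absv x <= C -> absv y <= C -> absv (x - y) <= C.
Proof. by move=> hx hy; apply: avD_le; rewrite ?avN. Qed.

Lemma avD_lt x y (C : R) : absv x < C -> absv y < C -> absv (x + y) < C.
Proof. by move=> hx hy; rewrite (le_lt_trans (absvD Hp x y)) // gt_max hx hy. Qed.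

Lemma avB_lt x y (C : R) : absv x < C -> absv y < C -> absv (x - y) < C.
Proof. by move=> hx hy; apply: avD_lt; rewrite ?avN. Qed.

Lemma av_sum_le (I : Type) (r : seq I) (P : pred I) (f : I -> Omega) (C : R) :
  0 <= C -> (forall i, P i -> absv (f i) <= C) ->
  absv (\sum_(i <- r | P i) f i) <= C.
Proof.
move=> C0 h; elim/big_ind: _ => //; first by rewrite av0.
by move=> x y; apply: avD_le.
Qed.

Lemma av_sum_lt (I : Type) (r : seq I) (P : pred I) (f : I -> Omega) (C : R) :
  0 < C -> (forall i, P i -> absv (f i) < C) ->
  absv (\sum_(i <- r | P i) f i) < C.
Proof.
move=> C0 h; elim/big_ind: _ => //; first by rewrite av0.
by move=> x y; apply: avD_lt.
Qed.

Lemma avD_eqr x y : absv x < absv y -> absv (x + y) = absv y.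
Proof.
move=> h; apply/eqP; rewrite eq_le avD_le ?(ltW h) //=.
rewrite leNgt; apply/negP => h2.
suff : absv y < absv y by rewrite ltxx.
rewrite -{1}[y](addKr x) addrC; apply: avB_lt => //.
Qed.

Lemma av_close x y : absv (x - y) < absv y -> absv x = absv y.
Proof. by move=> h; rewrite -[x](subrK y) avD_eqr. Qed.

Lemma av_distC x y : absv (x - y) = absv (y - x).
Proof. by rewrite -avN opprB. Qed.

Lemma av_nat m : absv m%:R <= 1.
Proof.
by elim: m => [|m IH]; rewrite ?av0 ?ler01 // -addn1 natrD avD_le ?av1.
Qed.

Lemma p_gt0 : 0 < p%:R :> R. Proof. by rewrite ltr0n prime_gt0. Qed.

Lemma av_p_lt1 : absv p%:R < 1.
Proof. by rewrite (absv_p Hp) invf_lt1 ?p_gt0 // ltr1n prime_gt1. Qed.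

Lemma av_p_gt0 : 0 < absv p%:R.
Proof. by rewrite (absv_p Hp) invr_gt0 p_gt0. Qed.

(** If |m| were less than 1 like |p|, Bezout's identity would give |1| < 1. *)
Lemma av_coprime m : coprime p m -> absv m%:R = 1.
Proof.
move=> /eqP cop; have [k l e _] := egcdnP m (prime_gt0 p_prime).
rewrite cop in e; apply/eqP; rewrite eq_le av_nat /= leNgt; apply/negP => lt.
suff : absv 1 < 1 by rewrite av1 ltxx.
have -> : 1 = k%:R * p%:R - l%:R * m%:R :> Omega.
  by rewrite -!natrM e natrD addrAC subrr add0r.
have aux a b : absv b < 1 -> absv (a%:R * b) < 1.
  by move=> hb; rewrite avM (le_lt_trans _ hb) // ler_piMl ?av_ge0 ?av_nat.
by apply: avB_lt; apply: aux; rewrite ?av_p_lt1.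
Qed.

(** Omega has characteristic zero: split off the factors p, which is nonzero because |p| = 1/p; what
    remains is prime to p and has absolute value 1. *)
Lemma nat_neq0 m : (0 < m)%N -> m%:R != 0 :> Omega.
Proof.
elim/ltn_ind: m => m IH m0.
have [/dvdnP[k e]|nd] := boolP (p %| m)%N; last first.
  by rewrite -av_gt0 av_coprime ?ltr01 // prime_coprime.
have p0 : p%:R != 0 :> Omega by rewrite -av_gt0 av_p_gt0.
rewrite e natrM mulf_neq0 // IH //.
  by rewrite e -{1}[k]muln1 ltn_pmul2l ?prime_gt1 //; case: k e m0 => // ->.
by case: k e m0 => // ->.
Qed.

Lemma av_odd2 : p <> 2%N -> absv 2%:R = 1.
Proof.
by move=> /eqP p2; rewrite av_coprime // prime_coprime // dvdn_prime2.
Qed.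

Lemma av_root_unity x m : (0 < m)%N -> x ^+ m = 1 -> absv x = 1.
Proof.
move=> m0 h; have : absv x ^+ m = 1 by rewrite -avX h av1.
by move/eqP; rewrite pexpr_eq1 ?av_ge0 // => /eqP.
Qed.

Lemma intr_neq0 (m : int) : m != 0 -> m%:~R != 0 :> Omega.
Proof.
case: m => m /= h; first by rewrite -pmulrn nat_neq0 // lt0n.
by rewrite NegzE mulrNz -pmulrn oppr_eq0 nat_neq0.
Qed.

(** Since nonzero integers stay nonzero in Omega, [ratr] may be computed from any fraction
    representing a, not only the reduced one. This makes it a field morphism into Omega. *)
Lemma ratr_frac (a : rat) (m n : int) : n != 0 -> a = m%:~R / n%:~R ->
  ratr a = m%:~R / n%:~R :> Omega.
Proof.
move=> n0 e; rewrite /ratr.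
have d0 : denq a != 0 by exact: denq_neq0.
apply: (canLR (mulfK (intr_neq0 d0))); rewrite mulrAC.
apply: (canRL (mulfK (intr_neq0 n0))); rewrite -!intrM.
congr (_ %:~R); apply: (@intr_inj rat); rewrite !intrM.
have dQ : (denq a)%:~R != 0 :> rat by rewrite intr_eq0.
have nQ : n%:~R != 0 :> rat by rewrite intr_eq0.
have ea : (numq a)%:~R = a * (denq a)%:~R by rewrite numqE.
by rewrite ea {1}e; field.
Qed.

Lemma ratrB' (a b : rat) : ratr (a - b) = ratr a - ratr b :> Omega.
Proof.
have da : denq a != 0 by exact: denq_neq0.
have db : denq b != 0 by exact: denq_neq0.
rewrite (@ratr_frac (a - b) (numq a * denq b - numq b * denq a) (denq a * denq b)).
- rewrite /ratr !rmorphB !rmorphM /=.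
  have := intr_neq0 da; have := intr_neq0 db => h1 h2.
  by field; rewrite h1 h2.
- by rewrite mulf_neq0.
- rewrite !rmorphB !rmorphM /=.
  rewrite -{1}[a]divq_num_den -{1}[b]divq_num_den.
  have h1 : (denq a)%:~R != 0 :> rat by rewrite intr_eq0.
  have h2 : (denq b)%:~R != 0 :> rat by rewrite intr_eq0.
  by field; rewrite h1 h2.
Qed.

Lemma ratrM' (a b : rat) : ratr (a * b) = ratr a * ratr b :> Omega.
Proof.
have da : denq a != 0 by exact: denq_neq0.
have db : denq b != 0 by exact: denq_neq0.
rewrite (@ratr_frac (a * b) (numq a * numq b) (denq a * denq b)).
- rewrite /ratr !rmorphM /=.
  have := intr_neq0 da; have := intr_neq0 db => h1 h2.
  by field; rewrite h1 h2.
- by rewrite mulf_neq0.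
- rewrite !rmorphM /= -{1}[a]divq_num_den -{1}[b]divq_num_den.
  have h1 : (denq a)%:~R != 0 :> rat by rewrite intr_eq0.
  have h2 : (denq b)%:~R != 0 :> rat by rewrite intr_eq0.
  by field; rewrite h1 h2.
Qed.

Lemma ratr1' : ratr 1 = 1 :> Omega.
Proof. by rewrite (@ratr_frac 1 1 1) // divr1. Qed.

Lemma ratrV' (a : rat) : ratr a^-1 = (ratr a)^-1 :> Omega.
Proof.
have [->|a0] := eqVneq a 0.
  by rewrite invr0 (@ratr_frac 0 0 1) ?mul0r ?invr0 // divr1.
have h : ratr a * ratr a^-1 = 1 :> Omega by rewrite -ratrM' divff ?ratr1'.
have n0 : ratr a != 0 :> Omega.
  by apply/eqP => e; move: h; rewrite e mul0r => /eqP; rewrite eq_sym oner_eq0.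
by apply: (mulfI n0); rewrite h divff.
Qed.

End Valued.

(** * Subfields given as sets, and matrices with entries in them *)

Section Subfield.
Variables (Omega : closedFieldType) (F : set Omega).
Hypothesis hF : is_subfield F.

Lemma sf1 : F 1. Proof. by case: hF. Qed.
Lemma sfB x y : F x -> F y -> F (x - y). Proof. by case: hF => _ + _; apply. Qed.
Lemma sf_div x y : F x -> F y -> F (x / y). Proof. by case: hF => _ _; apply. Qed.
Lemma sf0 : F 0. Proof. by rewrite -(subrr 1); apply: sfB; apply: sf1. Qed.
Lemma sfN x : F x -> F (- x). Proof. by rewrite -sub0r; apply/sfB/sf0. Qed.
Lemma sfD x y : F x -> F y -> F (x + y).
Proof. by move=> hx hy; rewrite -[y]opprK; apply: sfB => //; apply: sfN. Qed.
Lemma sfV x : F x -> F x^-1.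
Proof. by move=> hx; rewrite -div1r; apply: sf_div => //; apply: sf1. Qed.
Lemma sfM x y : F x -> F y -> F (x * y).
Proof. by move=> hx hy; rewrite -[y]invrK; apply: sf_div => //; apply: sfV. Qed.
Lemma sfX x n : F x -> F (x ^+ n).
Proof. by move=> hx; elim: n => [|n IH]; rewrite ?exprS; [apply: sf1|apply: sfM]. Qed.
Lemma sfXz x (n : int) : F x -> F (x ^ n).
Proof. by move=> hx; case: n => n; rewrite ?NegzE -?exprnP -?exprnN; last apply: sfV; apply: sfX. Qed.
Lemma sf_sum (I : Type) (r : seq I) (P : pred I) (f : I -> Omega) :
  (forall i, P i -> F (f i)) -> F (\sum_(i <- r | P i) f i).
Proof. by move=> h; elim/big_ind: _ => //; [apply: sf0|apply: sfD]. Qed.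
Lemma sf_prod (I : Type) (r : seq I) (P : pred I) (f : I -> Omega) :
  (forall i, P i -> F (f i)) -> F (\prod_(i <- r | P i) f i).
Proof. by move=> h; elim/big_ind: _ => //; [apply: sf1|apply: sfM]. Qed.
Lemma sf_nat n : F n%:R.
Proof. by elim: n => [|n IH]; [apply: sf0|rewrite -addn1 natrD; apply/sfD/sf1]. Qed.
Lemma mxo_mul m n l (A : 'M_(m, n)) (B : 'M_(n, l)) :
  mx_over F A -> mx_over F B -> mx_over F (A *m B).
Proof. by move=> hA hB i k; rewrite mxE; apply: sf_sum => t _; apply: sfM. Qed.
Lemma mxoD m n (A B : 'M_(m, n)) : mx_over F A -> mx_over F B -> mx_over F (A + B).
Proof. by move=> hA hB i k; rewrite mxE; apply: sfD. Qed.
Lemma mxoB m n (A B : 'M_(m, n)) : mx_over F A -> mx_over F B -> mx_over F (A - B).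
Proof. by move=> hA hB i k; rewrite !mxE; apply: sfB. Qed.
Lemma mxoZ m n a (A : 'M_(m, n)) : F a -> mx_over F A -> mx_over F (a *: A).
Proof. by move=> ha hA i k; rewrite mxE; apply: sfM. Qed.
Lemma mxo_tr m n (A : 'M_(m, n)) : mx_over F A -> mx_over F A^T.
Proof. by move=> hA i k; rewrite mxE. Qed.
Lemma mxo_scalar n a : F a -> mx_over F (a%:M : 'M_n).
Proof. by move=> ha i k; rewrite mxE; case: (_ == _); rewrite ?mulr1n ?mulr0n //; apply: sf0. Qed.
Lemma mxo0 m n : mx_over F (0 : 'M_(m, n)).
Proof. by move=> i k; rewrite mxE; apply: sf0. Qed.
Lemma mxo_delta m n i k : mx_over F (delta_mx i k : 'M_(m, n)).
Proof. by move=> i' k'; rewrite mxE; apply: sf_nat. Qed.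
Lemma mxo_sum m n (I : Type) (r : seq I) (P : pred I) (f : I -> 'M_(m, n)) :
  (forall i, P i -> mx_over F (f i)) -> mx_over F (\sum_(i <- r | P i) f i).
Proof. by move=> h; elim/big_ind: _ => //; [apply: mxo0|apply: mxoD]. Qed.
Lemma det_over n (A : 'M_n) : mx_over F A -> F (\det A).
Proof.
move=> hA; apply: sf_sum => s _; apply: sfM; last exact: sf_prod.
by apply/sfX/sfN/sf1.
Qed.
Lemma mxo_inv n (A : 'M_n) : mx_over F A -> mx_over F (invmx A).
Proof.
move=> hA; rewrite /invmx; case: ifP => // _; apply: mxoZ.
  exact/sfV/det_over.
move=> i k; rewrite mxE; apply: sfM; first by apply/sfX/sfN/sf1.
by apply: det_over => i' k'; rewrite !mxE.
Qed.

(** F is turned into a type so that a singular matrix over F is singular over an integral domain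
    whose elements are those of F; its kernel vector then has entries in F and not merely in
    Omega. *)
Definition sf_pred : {pred Omega} := fun x => `[< F x >].
Lemma sf_predP : divring_closed sf_pred.
Proof.
split; first by apply/asboolP/sf1.
- by move=> x y /asboolP hx /asboolP hy; apply/asboolP/sfB.
- by move=> x y /asboolP hx /asboolP hy; apply/asboolP/sf_div.
Qed.
HB.instance Definition _ := GRing.isDivringClosed.Build Omega sf_pred sf_predP.
Definition sf_type := {x | x \in sf_pred}.
HB.instance Definition _ := SubChoice.on sf_type.
HB.instance Definition _ := [SubChoice_isSubComUnitRing of sf_type by <:].
HB.instance Definition _ := [SubComUnitRing_isSubIntegralDomain of sf_type by <:].

Lemma det0_over n (A : 'M_n) : mx_over F A -> \det A = 0 ->
  exists v : 'rV_n, [/\ v != 0, mx_over F v & v *m A = 0].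
Proof.
move=> hA dA.
have mem x : F x -> x \in sf_pred by move=> hx; apply/asboolP.
pose A' : 'M[sf_type]_n := \matrix_(i, k) exist _ (A i k) (mem _ (hA i k)).
have eA : map_mx val A' = A by apply/matrixP => i k; rewrite !mxE.
have : \det A' == 0.
  have e : val (\det A') = \det (map_mx val A') by rewrite det_map_mx.
  by rewrite -val_eqE /= e eA dA.
move/det0P => [v v0 hv]; exists (map_mx val v); split.
- apply: contraNneq v0 => e; apply/eqP/matrixP => i k; apply: val_inj.
  by move/matrixP/(_ i k): e; rewrite !mxE.
- by move=> i k; rewrite mxE; apply/asboolP/(valP (v i k)).
- by rewrite -eA -map_mxM hv map_mx0.
Qed.

End Subfield.

(** * The residue field of Omega *)

Section Residue.
Local Open Scope quotient_scope.
Variables (R : realType) (p : nat) (Omega : closedFieldType).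
Variable absv : Omega -> R.
Hypotheses (p_prime : prime p) (Hp : padic_closure absv p).

Definition vring : {pred Omega} := fun x => absv x <= 1.
Lemma vringP : subring_closed vring.
Proof.
split; rewrite ?unfold_in /vring ?(av1 Hp) //.
- by move=> x y; rewrite !unfold_in => hx hy; apply: (avB_le Hp).
- by move=> x y; rewrite !unfold_in => hx hy; rewrite (avM Hp) mulr_ile1 ?(absv_ge0 Hp).
Qed.
HB.instance Definition _ := GRing.isSubringClosed.Build Omega vring vringP.
Definition vring_type := {x | x \in vring}.
HB.instance Definition _ := SubChoice.on vring_type.
HB.instance Definition _ := [SubChoice_isSubComNzRing of vring_type by <:].

Definition vmax : {pred vring_type} := fun x => absv (val x) < 1.
Lemma vmaxP : idealr_closed vmax.
Proof.
split; rewrite ?unfold_in /vmax /= ?(av0 Hp) ?(av1 Hp) ?ltr01 ?ltxx //.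
move=> a x y; rewrite !unfold_in /= => hx hy; apply: (avD_lt Hp) => //.
rewrite (avM Hp) (le_lt_trans _ hx) // ler_piMl ?(absv_ge0 Hp) //.
exact: (valP a).
Qed.
HB.instance Definition _ := isIdealr.Build vring_type vmax vmaxP.

(** The residue field is presented by a reduction map on all of Omega, meaningful only on integral
    elements. The four rules are all that later sections assume, so the quotient ring never appears
    again. *)
Lemma residue_field : exists (k : fieldType) (red : Omega -> k),
  [/\ red 1 = 1,
      forall x y, absv x <= 1 -> absv y <= 1 -> red (x + y) = red x + red y,
      forall x y, absv x <= 1 -> absv y <= 1 -> red (x * y) = red x * red y &
      forall x, absv x <= 1 -> (red x == 0) = (absv x < 1)].
Proof.
pose Q := {ideal_quot vmax}.
(* The inverse of a class is that of the inverse of a representative, which is integral when the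
   class is nonzero. The factor [x != 0] makes the inverse of 0 equal to 0 for any
   representative. *)
pose sq (x : Q) : Q :=
  \pi_Q (insubd 0 (val (repr x))^-1) *+ (x != 0).
have piE (a b : vring_type) : (\pi_Q a == \pi_Q b) = (absv (val a - val b) < 1).
  by rewrite -Quotient.idealrBE.
have pi0E (a : vring_type) : (\pi_Q a == 0) = (absv (val a) < 1).
  by rewrite -(rmorph0 (\pi_Q)) piE /= subr0.
have sqV : forall x : Q, x != 0 -> sq x * x = 1.
  move=> x x0; rewrite /sq x0 mulr1n -{2}[x]reprK.
  have n1 : ~~ (absv (val (repr x)) < 1) by rewrite -pi0E reprK.
  have e1 : absv (val (repr x)) = 1.
    by apply/eqP; rewrite eq_le [X in _ && X]leNgt n1 andbT; exact: (valP (repr x)).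
  have m1 : (val (repr x))^-1 \in vring.
    by rewrite unfold_in /vring (avV Hp) e1 invr1.
  have n0 : val (repr x) != 0 by rewrite -(av_gt0 Hp) e1 ltr01.
  rewrite -rmorphM -(rmorph1 (\pi_Q)); congr (\pi_Q _); apply: val_inj.
  by rewrite /= insubdK // mulVf.
have sq0 : sq 0 = 0 by rewrite /sq eqxx mulr0n.
pose k : fieldType := HB.pack Q (GRing.ComNzRing_isField.Build Q sqV sq0).
exists k, (fun x => \pi_Q (insubd 0 x)).
have iK x : absv x <= 1 -> val (insubd (0 : vring_type) x) = x.
  by move=> hx; rewrite insubdK.
split.
- rewrite -[RHS](rmorph1 (\pi_Q)); congr (\pi_Q _); apply: val_inj.
  by rewrite iK ?(av1 Hp).
- move=> x y hx hy; rewrite -[RHS](rmorphD (\pi_Q)); congr (\pi_Q _); apply: val_inj.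
  by rewrite /= !iK // (avD_le Hp).
- move=> x y hx hy; rewrite -[RHS](rmorphM (\pi_Q)); congr (\pi_Q _); apply: val_inj.
  by rewrite /= !iK // (avM Hp) mulr_ile1 ?(absv_ge0 Hp).
- by move=> x hx; rewrite [LHS]pi0E iK.
Qed.
End Residue.

(** * Complete subfields *)

Section Complete.
Variables (R : realType) (p : nat) (Omega : closedFieldType).
Variable absv : Omega -> R.
Hypotheses (p_prime : prime p) (Hp : padic_closure absv p).
Implicit Types (x y z : Omega) (F L W : set Omega).

Definition cauchy_seq (u : nat -> Omega) := forall e : R, 0 < e ->
  exists N, forall m n, (N <= m)%N -> (N <= n)%N -> absv (u m - u n) < e.
Definition converges (u : nat -> Omega) x := forall e : R, 0 < e ->
  exists N, forall n, (N <= n)%N -> absv (x - u n) < e.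
Definition vcomplete F := forall u, (forall n, F (u n)) -> cauchy_seq u ->
  exists2 x, F x & converges u x.
Definition vclosed W := forall x,
  (forall e : R, 0 < e -> exists2 w, W w & absv (x - w) < e) -> W x.

Definition lin_span F n (b : 'I_n -> Omega) : set Omega :=
  [set x | exists2 c : 'I_n -> Omega, (forall k, F (c k)) &
     x = \sum_k c k * b k].

Definition lin_free F n (b : 'I_n -> Omega) : Prop :=
  forall c : 'I_n -> Omega, (forall k, F (c k)) ->
    \sum_k c k * b k = 0 -> forall k, c k = 0.

Lemma archi_inv (e : R) : 0 < e ->
  exists N, forall n, (N <= n)%N -> n.+1%:R^-1 < e.
Proof.
move=> e0; exists (Num.bound e^-1) => n hn.
have h : e^-1 < n.+1%:R.
  have e1 : 0 <= e^-1 by rewrite invr_ge0 ltW.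
  by rewrite (lt_le_trans (archi_boundP e1)) // ler_nat ltnW.
by rewrite -[e]invrK ltf_pV2 // posrE ?ltr0n // invr_gt0.
Qed.

Lemma uniform_rank n (P : 'I_n -> nat -> Prop) :
  (forall k, exists N, forall m, (N <= m)%N -> P k m) ->
  exists N, forall k m, (N <= m)%N -> P k m.
Proof.
move=> /choice[f hf]; exists (\max_k f k) => k m hm; apply: hf.
by apply: leq_trans hm; apply: leq_bigmax.
Qed.

Lemma complete_closed W : vcomplete W -> vclosed W.
Proof.
move=> cW x hx.
have /choice[u hu] : forall n : nat, exists w, W w /\ absv (x - w) < n.+1%:R^-1.
  move=> n; have [|w Ww hw] := hx n.+1%:R^-1; first by rewrite invr_gt0 ltr0n.
  by exists w.
have cu : cauchy_seq u.
  move=> e e0; have [N hN] := archi_inv e0; exists N => m n hm hn.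
  rewrite -[u m](subrK x) -addrA (avD_lt Hp) //.
    by rewrite (av_distC Hp); apply: lt_trans (hN _ hm); case: (hu m).
  by apply: lt_trans (hN _ hn); case: (hu n).
have [y Wy hy] := cW u (fun n => (hu n).1) cu.
suff -> : x = y by [].
apply/eqP; rewrite -subr_eq0 -(av_eq0 Hp) eq_le (absv_ge0 Hp) andbT leNgt.
apply/negP => d0.
have [N hN] := hy _ d0; have [M hM] := archi_inv d0.
pose m := maxn N M.
suff : absv ((x - u m) - (y - u m)) < absv (x - y).
  by rewrite opprB addrA subrK ltxx.
apply: (avB_lt Hp); last by rewrite hN // leq_maxl.
by apply: lt_trans (hM m _); rewrite ?leq_maxr //; case: (hu m).
Qed.

Lemma span_complete F n (b : 'I_n -> Omega) (C : R) :
  is_subfield F -> vcomplete F ->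
  (forall c, (forall k, F (c k)) -> forall k,
     absv (c k) <= C * absv (\sum_l c l * b l)) ->
  vcomplete (lin_span F b).
Proof.
move=> sF cF hC u hu cu.
have /choice[c hc] : forall m, exists c : 'I_n -> Omega,
    (forall k, F (c k)) /\ u m = \sum_k c k * b k.
  by move=> m; have [c ? ?] := hu m; exists c.
have ck m k : F (c m k) by case: (hc m).
have uc m : u m = \sum_k c m k * b k by case: (hc m).
have C0 (k : 'I_n) : 0 <= C.
  have := hC (fun=> 1) (fun=> sf1 sF) k; rewrite (av1 Hp).
  case: (leP 0 C) => // Cn /(lt_le_trans ltr01).
  by rewrite ltNge nmulr_rle0 ?(absv_ge0 Hp).
have cauc k : cauchy_seq (fun m => c m k).
  move=> e e0; have e1 : 0 < e / (C + 1).
    by rewrite divr_gt0 // ltr_wpDl ?ltr01 ?(C0 k).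
  have [N hN] := cu _ e1; exists N => m l hm hl.
  have := hC (fun i => c m i - c l i) (fun i => sfB sF (ck m i) (ck l i)) k.
  under eq_bigr do rewrite mulrBl.
  rewrite sumrB -!uc => h; apply: (le_lt_trans h).
  have := hN _ _ hm hl; rewrite ltr_pdivlMr ?ltr_wpDl ?ltr01 ?(C0 k) // => h2.
  by apply: le_lt_trans h2; rewrite mulrC ler_wpM2l ?(absv_ge0 Hp) // lerDl ler01.
have /choice[d hd] : forall k, exists x, F x /\ converges (fun m => c m k) x.
  by move=> k; have [x Fx hx] := cF _ (fun m => ck m k) (cauc k); exists x.
exists (\sum_k d k * b k); first by exists d => // k; case: (hd k).
move=> e e0.
have [N hN] : exists N, forall k m, (N <= m)%N -> absv ((d k - c m k) * b k) < e.
  apply: uniform_rank => k.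
  have b1 : 0 < absv (b k) + 1 by rewrite ltr_wpDl ?ltr01 ?(absv_ge0 Hp).
  have [|N hN] := (hd k).2 (e / (absv (b k) + 1)); first by rewrite divr_gt0.
  exists N => m /hN; rewrite ltr_pdivlMr // (avM Hp); apply: le_lt_trans.
  by rewrite ler_wpM2l ?(absv_ge0 Hp) // lerDl ler01.
exists N => m hm; rewrite uc -sumrB; apply: (av_sum_lt Hp) => // k _.
by rewrite -mulrBl; apply: hN.
Qed.

(** Induction on n. The span of the first n vectors is complete by the induction hypothesis, hence
    closed, so the last vector has a positive distance e from it. This bounds the last coordinate by
    1/e times the norm; subtracting the last term bounds the others. *)
Lemma coord_bound F n (b : 'I_n -> Omega) :
  is_subfield F -> vcomplete F -> lin_free F b ->
  exists2 C : R, 0 < C & forall c, (forall k, F (c k)) -> forall k,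
     absv (c k) <= C * absv (\sum_l c l * b l).
Proof.
move=> sF cF; elim: n b => [|n IH] b fb.
  by exists 1 => // c _ [].
pose w i := widen_ord (leqnSn n) i.
pose ext (c : 'I_n -> Omega) t (k : 'I_n.+1) :=
  if insub (val k) is Some i then c i else t.
have extw c t i : ext c t (w i) = c i.
  by rewrite /ext /= valK.
have extm c t : ext c t ord_max = t.
  by rewrite /ext /= insubF ?ltnn.
have Fext c t : (forall k, F (c k)) -> F t -> forall k, F (ext c t k).
  by move=> hc ht k; rewrite /ext; case: insubP => //.
have fb' : lin_free F (fun i => b (w i)).
  move=> c hc e k; rewrite -(extw c 0); apply: (fb (ext c 0)).
    by apply: Fext => //; apply: sf0.
  rewrite big_ord_recr /= extm mul0r addr0 -[RHS]e.
  by apply: eq_bigr => i _; rewrite extw.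
have [C C0 hC] := IH _ fb'.
have clW : vclosed (lin_span F (fun i => b (w i))).
  by apply: complete_closed; apply: (span_complete sF cF hC).
have [e e0 he] : exists2 e : R, 0 < e &
    forall x, lin_span F (fun i => b (w i)) x -> e <= absv (b ord_max - x).
  apply: contrapT => H.
  have [c hc eb] : lin_span F (fun i => b (w i)) (b ord_max).
    apply: clW => e e0; apply: contrapT => H2; apply: H; exists e => // x hx.
    by rewrite leNgt; apply/negP => hlt; apply: H2; exists x.
  have := fb (ext c (-1)) (Fext _ _ hc (sfN sF (sf1 sF))).
  rewrite big_ord_recr /= extm eb mulN1r => h.
  suff hh : \sum_(i < n) ext c (-1) (w i) * b (w i) - \sum_k c k * b (w k) = 0.
    by have /eqP := h hh ord_max; rewrite extm oppr_eq0 oner_eq0.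
  by rewrite -sumrB big1 // => i _; rewrite extw subrr.
have main c : (forall k, F (c k)) ->
    absv (c ord_max) <= e^-1 * absv (\sum_l c l * b l).
  move=> hc; have [->|t0] := eqVneq (c ord_max) 0.
    by rewrite (av0 Hp) mulr_ge0 ?(absv_ge0 Hp) // invr_ge0 ltW.
  rewrite mulrC ler_pdivlMr //.
  have -> : \sum_l c l * b l =
      c ord_max * (b ord_max - \sum_i (- c (w i) / c ord_max) * b (w i)).
    rewrite big_ord_recr /= mulrBr addrC; congr (_ + _).
    rewrite mulr_sumr -sumrN; apply: eq_bigr => i _.
    by rewrite mulrA mulNr mulrN [_ * (_ / _)]mulrC divfK // mulNr opprK.
  rewrite (avM Hp) ler_wpM2l ?(absv_ge0 Hp) // he //.
  exists (fun i => - c (w i) / c ord_max) => // i.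
  by apply: sf_div => //; apply: sfN.
exists (e^-1 + C * (1 + absv (b ord_max) / e)) => [|c hc k].
  by rewrite addr_gt0 ?invr_gt0 // mulr_gt0 // ltr_wpDr ?ltr01 // divr_ge0 ?(absv_ge0 Hp) // ltW.
set x := \sum_l _.
have x0 : 0 <= absv x by exact: (absv_ge0 Hp).
have ei : 0 <= e^-1 by rewrite invr_ge0 ltW.
have b0 : 0 <= absv (b ord_max) by exact: (absv_ge0 Hp).
have hm := main c hc; rewrite -/x in hm.
have [kn|] := unliftP ord_max k; last first.
  move=> ->; apply: (le_trans hm); rewrite ler_wpM2r // lerDl mulr_ge0 ?ltW //.
  by rewrite ltr_wpDr ?ltr01 // divr_ge0 // ltW.
move=> ek; have -> : k = w kn by rewrite ek; apply: val_inj; rewrite /= /bump leqNgt ltn_ord.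
have := hC (fun i => c (w i)) (fun i => hc _) kn.
move/le_trans; apply.
have -> : \sum_l c (w l) * b (w l) = x - c ord_max * b ord_max.
  by rewrite /x big_ord_recr /= addrK.
apply: (@le_trans _ _ (C * (1 + absv (b ord_max) / e) * absv x)); last first.
  by rewrite ler_wpM2r // lerDr.
rewrite -mulrA ler_wpM2l ?(ltW C0) //; apply: (avB_le Hp).
  by rewrite ler_peMl // lerDl mulr_ge0.
rewrite (avM Hp) mulrDl mul1r ler_wpDl //.
by rewrite [leLHS]mulrC -mulrA ler_wpM2l.
Qed.

Lemma ext_complete F L n : is_subfield F -> vcomplete F ->
  ext_of_degree F L n -> vcomplete L.
Proof.
move=> sF cF [sL FL [b [bL bs bf]]].
have -> : L = lin_span F b.
  apply/seteqP; split=> [x /bs|x [c hc ->]] //.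
  by apply: (sf_sum sL) => k _; apply: (sfM sL) => //; apply: FL.
by have [C _ hC] := coord_bound sF cF bf; apply: (span_complete sF cF hC).
Qed.

Lemma Qp_subfield : is_subfield (Qp absv).
Proof.
split.
- by move=> e e0; exists 1; rewrite (ratr1' p_prime Hp) subrr (av0 Hp).
- move=> x y hx hy e e0; have [a ha] := hx e e0; have [b hb] := hy e e0.
  by exists (a - b); rewrite (ratrB' p_prime Hp) opprD addrACA -opprD (avB_lt Hp).
move=> x y hx hy e e0; have [->|y0] := eqVneq y 0.
  by exists (1 - 1); rewrite (ratrB' p_prime Hp) subrr invr0 mulr0 subrr (av0 Hp).
have vy : 0 < absv y by rewrite (av_gt0 Hp).
pose M := absv x + 1.
have M0 : 0 < M by rewrite ltr_wpDl ?ltr01 ?(absv_ge0 Hp).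
have [|a] := hx (Num.min 1 (e * absv y)).
  by rewrite lt_min ltr01 mulr_gt0.
rewrite lt_min => /andP[a1 a2].
have [|b] := hy (Num.min (absv y) (e * absv y ^+ 2 / M)).
  by rewrite lt_min vy divr_gt0 // mulr_gt0 // exprn_gt0.
rewrite lt_min => /andP[b1 b2].
have vb : absv (ratr b) = absv y by apply: (av_close Hp); rewrite (av_distC Hp).
have va : absv (ratr a) <= M.
  rewrite -[ratr a](subrK x); apply: (avD_le Hp); last by rewrite lerDl ler01.
  by rewrite (av_distC Hp) (le_trans (ltW a1)) // lerDr (absv_ge0 Hp).
have b0 : ratr b != 0 :> Omega by rewrite -(av_gt0 Hp) vb.
exists (a / b); rewrite (ratrM' p_prime Hp) (ratrV' p_prime Hp).
move: (ratr a) (ratr b) a1 a2 b1 b2 vb va b0 => A B a1 a2 b1 b2 vb va b0.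
have -> : x / y - A / B = (x - A) / y + A * (B - y) / (y * B).
  by field; rewrite y0 b0.
apply: (avD_lt Hp); rewrite !(avM Hp) !(avV Hp) ?(avM Hp) ?vb.
  by rewrite ltr_pdivrMr.
rewrite ltr_pdivrMr ?mulr_gt0 // -expr2 (av_distC Hp).
move: b2; rewrite ltr_pdivlMr // mulrC; apply: le_lt_trans.
by rewrite ler_wpM2r // (absv_ge0 Hp).
Qed.

(** Completeness is assumed for rational sequences only; a sequence in Q_p is replaced by rationals
    a n at distance less than 1/(n+1) from its terms. *)
Lemma Qp_vcomplete : vcomplete (Qp absv).
Proof.
move=> u hu cu.
have /choice[a ha] : forall n : nat, exists a, absv (u n - ratr a) < n.+1%:R^-1.
  by move=> n; apply: hu; rewrite invr_gt0 ltr0n.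
have [e e0|x hx] := Qp_complete Hp (u := a).
  have [N hN] := cu _ e0; have [M hM] := archi_inv e0.
  exists (maxn N M) => m n; rewrite !geq_max => /andP[m1 m2] /andP[n1 n2].
  rewrite (ratrB' p_prime Hp).
  have -> : ratr (a m) - ratr (a n) =
     (u m - u n) - (u m - ratr (a m)) + (u n - ratr (a n)) :> Omega by ring.
  apply: (avD_lt Hp); last by apply: lt_trans (hM _ n2).
  by apply: (avB_lt Hp); [apply: hN|apply: lt_trans (hM _ m2)].
exists x.
  by move=> e /hx[N hN]; exists (a N); apply: hN.
move=> e e0; have [N hN] := hx _ e0; have [M hM] := archi_inv e0.
exists (maxn N M) => n; rewrite !geq_max => /andP[n1 n2].
rewrite -[x](subrK (ratr (a n))) -addrA (avD_lt Hp) ?hN //.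
by rewrite (av_distC Hp); apply: lt_trans (hM _ n2).
Qed.

End Complete.

(** * Unramified extensions and roots of unity *)

(** Fermat's argument without inverses: multiplication by a nonzero x permutes the nonzero elements
    of S, so comparing products gives x^(|S| - 1) = 1. *)
Lemma mulclosed_pow (k : fieldType) (S : seq k) :
  uniq S -> 0 \in S -> (forall x y, x \in S -> y \in S -> x * y \in S) ->
  forall x, x \in S -> x ^+ size S = x.
Proof.
move=> uS S0 SM x xS.
have sS : size S = (size (rem 0 S)).+1.
  by rewrite size_rem // prednK //; case: S S0 {uS SM xS}.
have [->|x0] := eqVneq x 0; first by rewrite sS expr0n.
set T := rem 0 S.
have uT : uniq T by rewrite rem_uniq.
have memT y : (y \in T) = (y != 0) && (y \in S) by rewrite mem_rem_uniq.
have pT : perm_eq [seq x * y | y <- T] T.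
  apply: uniq_perm => //; first by rewrite map_inj_uniq //; apply: mulfI.
  have uxT : uniq [seq x * y | y <- T] by rewrite map_inj_uniq //; apply: mulfI.
  have sub : {subset [seq x * y | y <- T] <= T}.
    move=> z /mapP[y]; rewrite memT => /andP[y0 yS] ->.
    by rewrite memT mulf_neq0 //= SM.
  by have [] := uniq_min_size uxT sub; rewrite ?size_map.
have n0 : \prod_(y <- T) y != 0.
  by rewrite prodf_seq_neq0; apply/allP => y; rewrite memT => /andP[].
have : x ^+ size T * \prod_(y <- T) y = \prod_(y <- T) y.
  rewrite -[RHS](perm_big _ pT) big_map big_split /=; congr (_ * _).
  by rewrite big_const_seq count_predT iter_mulr_1.
move/(canRL (mulfK n0)); rewrite divff // => h.
by rewrite sS exprS -/T h mulr1.
Qed.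

Lemma geometric_lt (R : realType) (M e : R) : 0 <= M -> M < 1 -> 0 < e ->
  exists N, forall n, (N <= n)%N -> M ^+ n < e.
Proof.
move=> M0 M1 e0; have [M00|Mn] := eqVneq M 0.
  by exists 1%N => -[|n] // _; rewrite M00 expr0n.
have Mp : 0 < M by rewrite lt_def Mn.
have a0 : 0 < M^-1 - 1 by rewrite subr_gt0 invf_gt1.
have bern n : 1 + (M^-1 - 1) *+ n <= M^-1 ^+ n.
  elim: n => [|n IH]; first by rewrite expr0 mulr0n addr0.
  rewrite exprS; apply: (@le_trans _ _ (M^-1 * (1 + (M^-1 - 1) *+ n))).
    have t0 : 0 <= (M^-1 - 1) *+ n by rewrite mulrn_wge0 // ltW.
    by rewrite mulrS; move: (_ *+ n) t0 => t t0; nra.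
  by rewrite ler_wpM2l // invr_ge0.
have e1 : 0 <= e^-1 / (M^-1 - 1) by rewrite divr_ge0 ?invr_ge0 // ltW.
exists (Num.bound (e^-1 / (M^-1 - 1))) => n hn.
have h : e^-1 < M^-1 ^+ n.
  apply: (lt_le_trans _ (bern n)); apply: ltr_pwDl => //.
  rewrite -mulr_natr mulrC -ler_pdivrMr //.
  by rewrite (le_trans (ltW (archi_boundP e1))) // ler_nat.
by move: h; rewrite exprVn ltf_pV2 // posrE exprn_gt0.
Qed.

Section Local.
Variables (R : realType) (p : nat) (Omega : closedFieldType).
Variable absv : Omega -> R.
Hypotheses (p_prime : prime p) (Hp : padic_closure absv p).
Variables (k : fieldType) (red : Omega -> k).
Hypotheses (red1 : red 1 = 1)
  (redD : forall x y, absv x <= 1 -> absv y <= 1 -> red (x + y) = red x + red y)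
  (redM : forall x y, absv x <= 1 -> absv y <= 1 -> red (x * y) = red x * red y)
  (red_eq0 : forall x, absv x <= 1 -> (red x == 0) = (absv x < 1)).
Implicit Types (x y z : Omega) (F L W : set Omega).
Local Notation ge0 := (absv_ge0 Hp).

Lemma red0 : red 0 = 0.
Proof. by apply/eqP; rewrite red_eq0 ?(av0 Hp). Qed.

Lemma redN x : absv x <= 1 -> red (- x) = - red x.
Proof.
move=> hx; apply/eqP; rewrite -addr_eq0 -redD ?(avN Hp) //.
by rewrite addNr red0.
Qed.

Lemma redB x y : absv x <= 1 -> absv y <= 1 -> red (x - y) = red x - red y.
Proof. by move=> hx hy; rewrite redD ?(avN Hp) // redN. Qed.

Lemma red_eq x y : absv x <= 1 -> absv y <= 1 ->
  (red x == red y) = (absv (x - y) < 1).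
Proof. by move=> hx hy; rewrite -subr_eq0 -redB // red_eq0 // (avB_le Hp). Qed.

Lemma avX_le1 x n : absv x <= 1 -> absv (x ^+ n) <= 1.
Proof. by move=> hx; rewrite (avX Hp) exprn_ile1 ?ge0. Qed.

Lemma avM_le1 x y : absv x <= 1 -> absv y <= 1 -> absv (x * y) <= 1.
Proof. by move=> hx hy; rewrite (avM Hp) mulr_ile1 ?ge0. Qed.

Lemma redX x n : absv x <= 1 -> red (x ^+ n) = red x ^+ n.
Proof.
move=> hx; elim: n => [|n IH]; first by rewrite !expr0.
by rewrite !exprS redM ?avX_le1 // IH.
Qed.

Lemma red_sum (I : Type) (r : seq I) (P : pred I) (f : I -> Omega) :
  (forall i, P i -> absv (f i) <= 1) ->
  red (\sum_(i <- r | P i) f i) = \sum_(i <- r | P i) red (f i).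
Proof.
move=> h; elim: r => [|a r IH]; first by rewrite !big_nil red0.
rewrite !big_cons; case: ifP => // Pa; rewrite redD ?IH ?h //.
exact: (av_sum_le Hp).
Qed.

Lemma red_nat n : red n%:R = n%:R.
Proof.
elim: n => [|n IH]; first exact: red0.
by rewrite -addn1 !natrD redD ?(av_nat Hp) ?(av1 Hp) // IH red1.
Qed.

(** Orthonormality for the absolute value: |sum of c_i t_i| is the maximum of the |c_i|. Only one
    inequality is stated, the other following from |t_i| <= 1. *)
Definition v_orthonormal F n (t : 'I_n -> Omega) : Prop :=
  (forall i, absv (t i) <= 1) /\
  forall c : 'I_n -> Omega, (forall i, F (c i)) ->
    forall i, absv (c i) <= absv (\sum_l c l * t l).

Lemma v_orthonormal_free F n (t : 'I_n -> Omega) : v_orthonormal F t -> lin_free F t.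
Proof.
move=> [_ h] c hc e i; have := h c hc i; rewrite e (av0 Hp) => h2.
by apply/eqP; rewrite -(av_eq0 Hp) eq_le h2 ge0.
Qed.

(** A singular change of basis would have a kernel vector over F, that is, a relation among the t
    i. *)
Lemma basis_change F L n (b t : 'I_n -> Omega) : is_subfield F ->
  ext_basis F L b -> (forall i, L (t i)) -> lin_free F t -> ext_basis F L t.
Proof.
move=> sF [bL bs bf] tL ft.
have /choice[m hm] : forall i, exists c : 'I_n -> Omega,
    (forall l, F (c l)) /\ t i = \sum_l c l * b l.
  by move=> i; have [c ? ?] := bs _ (tL i); exists c.
pose M : 'M_n := \matrix_(i, l) m i l.
have FM : mx_over F M by move=> i l; rewrite mxE; case: (hm i).
have dM : M \in unitmx.
  rewrite unitmxE unitfE; apply/eqP => dM.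
  have [v [v0 Fv vM]] := det0_over sF FM dM.
  case/eqP: v0; apply/rowP => i; rewrite mxE.
  apply: (ft (fun i => v 0 i)) => //.
  under eq_bigr do rewrite (hm _).2 mulr_sumr.
  rewrite exchange_big /= big1 // => l _.
  under eq_bigr do rewrite mulrA.
  rewrite -mulr_suml; suff -> : \sum_i v 0 i * m i l = 0 by rewrite mul0r.
  move/rowP/(_ l): vM; rewrite !mxE => hh; rewrite -[RHS]hh.
  by apply: eq_bigr => i' _; rewrite mxE.
split=> // x /bs[c hc ->].
pose d := (\row_l c l) *m invmx M.
have dF : mx_over F d.
  by apply: (mxo_mul sF); [move=> i l; rewrite mxE|apply: (mxo_inv sF)].
exists (fun i => d 0 i) => //.
under [RHS]eq_bigr do rewrite (hm _).2 mulr_sumr.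
rewrite exchange_big /=; apply: eq_bigr => l _.
under [RHS]eq_bigr do rewrite mulrA.
rewrite -mulr_suml; congr (_ * _).
have h : (d *m M) 0 l = c l by rewrite /d mulmxKV // mxE.
by rewrite -[LHS]h mxE; apply: eq_bigr => i' _; rewrite [M _ _]mxE.
Qed.

Lemma lin_spanB F n (b : 'I_n -> Omega) x y : is_subfield F ->
  lin_span F b x -> lin_span F b y -> lin_span F b (x - y).
Proof.
move=> sF [c hc ->] [d hd ->]; exists (fun i => c i - d i) => [i|].
  exact: (sfB sF).
by rewrite -sumrB; apply: eq_bigr => i _; rewrite mulrBl.
Qed.

Lemma lin_spanZ F n (b : 'I_n -> Omega) a x : is_subfield F ->
  F a -> lin_span F b x -> lin_span F b (a * x).
Proof.
move=> sF ha [c hc ->]; exists (fun i => a * c i) => [i|]; first exact: (sfM sF).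
by rewrite mulr_sumr; apply: eq_bigr => i _; rewrite mulrA.
Qed.

Lemma lin_span0 F n (b : 'I_n -> Omega) : is_subfield F -> lin_span F b 0.
Proof.
move=> sF; exists (fun=> 0) => [i|]; first exact: (sf0 sF).
by rewrite big1 // => i _; rewrite mul0r.
Qed.

Lemma lin_spanD F n (b : 'I_n -> Omega) x y : is_subfield F ->
  lin_span F b x -> lin_span F b y -> lin_span F b (x + y).
Proof.
move=> sF hx hy; rewrite -[y]opprK -[- y]sub0r.
by apply: lin_spanB => //; apply: lin_spanB => //; apply: lin_span0.
Qed.

Lemma lin_span_sum F n (b : 'I_n -> Omega) (I : Type) (r : seq I) (f : I -> Omega) :
  is_subfield F -> (forall i, lin_span F b (f i)) ->
  lin_span F b (\sum_(i <- r) f i).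
Proof.
move=> sF h; elim/big_ind: _ => // [|x y]; first exact: lin_span0.
exact: lin_spanD.
Qed.

Lemma lin_span_mem F n (b : 'I_n -> Omega) i : is_subfield F -> lin_span F b (b i).
Proof.
move=> sF; exists (fun l => (l == i)%:R) => [l|]; first exact: (sf_nat sF).
by rewrite (bigD1 i) //= eqxx mul1r big1 ?addr0 // => l /negPf->; rewrite mul0r.
Qed.

(** For y nonzero the products y b_i are again a basis of the span; expanding 1 in this basis yields
    the inverse of y. *)
Lemma span_subfield F n (b : 'I_n -> Omega) : is_subfield F -> lin_free F b ->
  lin_span F b 1 -> (forall i l, lin_span F b (b i * b l)) ->
  is_subfield (lin_span F b).
Proof.
move=> sF fb b1 bM.
have sM x y : lin_span F b x -> lin_span F b y -> lin_span F b (x * y).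
  move=> [c hc ->] [d hd ->]; rewrite mulr_suml; apply: lin_span_sum => // i.
  rewrite mulr_sumr; apply: lin_span_sum => // l.
  by rewrite mulrACA; apply: lin_spanZ => //; apply: (sfM sF).
split=> // [x y|x y hx hy]; first exact: lin_spanB.
apply: (sM _ _) => //.
have [->|y0] := eqVneq y 0; first by rewrite invr0; apply: lin_span0.
have [] := @basis_change F (lin_span F b) n b (fun i => y * b i) sF.
- by split=> [i|z [c hc ->]|//]; [apply: lin_span_mem|exists c].
- by move=> i; apply: sM => //; apply: lin_span_mem.
- move=> c hc e; apply: fb => //; apply: (mulfI y0); rewrite mulr0 -[RHS]e.
  by rewrite mulr_sumr; apply: eq_bigr => i _; rewrite mulrCA.
move=> _ /(_ 1 b1)[c hc e] _; exists c => //.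
apply: (mulfI y0); rewrite divff // e mulr_sumr.
by apply: eq_bigr => i _; rewrite mulrCA.
Qed.

End Local.

(** * Residues over a field with q residues, and roots of unity of order q^n - 1 *)

Section Local2.
Variables (R : realType) (p : nat) (Omega : closedFieldType).
Variable absv : Omega -> R.
Hypotheses (p_prime : prime p) (Hp : padic_closure absv p).
Variables (k : fieldType) (red : Omega -> k).
Hypotheses (red1 : red 1 = 1)
  (redD : forall x y, absv x <= 1 -> absv y <= 1 -> red (x + y) = red x + red y)
  (redM : forall x y, absv x <= 1 -> absv y <= 1 -> red (x * y) = red x * red y)
  (red_eq0 : forall x, absv x <= 1 -> (red x == 0) = (absv x < 1)).
Implicit Types (x y z : Omega) (L W : set Omega).
Local Notation ge0 := (absv_ge0 Hp).
Variables (F : set Omega) (q : nat).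
Hypotheses (sF : is_subfield F) (rF : residue_card absv F q).
Hypothesis p_odd : p <> 2%N.
Let redX' := redX Hp red1 redM.
Let red0' := red0 Hp red_eq0.
Let redN' := redN Hp redD red_eq0.
Let red_eq' := red_eq Hp redD red_eq0.
Let red_sum' := red_sum Hp redD red_eq0.
Let red_nat' := red_nat Hp red1 redD red_eq0.

Lemma q_gt1 : (1 < q)%N.
Proof.
have [r _ hr] := rF.
have [i0 []] : exists! k, absv (0 - r k) < 1.
  by apply: hr; [apply: (sf0 sF)|rewrite (av0 Hp)].
have [i1 []] : exists! k, absv (1 - r k) < 1.
  by apply: hr; [apply: (sf1 sF)|rewrite (av1 Hp)].
rewrite ltnNge => h1 _ h0 _; apply/negP => qle.
have e : i0 = i1.
  by apply: ord_inj; have := ltn_ord i0; have := ltn_ord i1; move: qle; clear; lia.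
have : absv ((1 - r i1) - (0 - r i1)) < 1 by apply: (avB_lt Hp) => //; rewrite -e.
have -> : 1 - r i1 - (0 - r i1) = 1 by ring.
by rewrite (av1 Hp) ltxx.
Qed.

Lemma q_eq0 : (q == 0)%N = false.
Proof. by move: q_gt1; clear; lia. Qed.

(** The residues are those of the q^n combinations of the t_i with coefficients among the chosen
    representatives; orthonormality is what keeps these residues distinct. *)
Lemma red_count n (t : 'I_n -> Omega) : v_orthonormal absv F t ->
  exists S : seq k, [/\ uniq S, size S = (q ^ n)%N,
    forall x, lin_span F t x -> absv x <= 1 -> red x \in S &
    forall y : k, y \in S -> exists2 x, lin_span F t x /\ absv x <= 1 & red x = y].
Proof.
move=> [t1 ht]; have [r r1 hr] := rF.
pose g (f : {ffun 'I_n -> 'I_q}) := \sum_i r (f i) * t i.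
have Fg f : lin_span F t (g f) by exists (fun i => r (f i)) => // i; case: (r1 (f i)).
have g1 f : absv (g f) <= 1.
  apply: (av_sum_le Hp) => // i _; rewrite (avM Hp) mulr_ile1 ?ge0 //.
  by case: (r1 (f i)).
have gi : injective (fun f => red (g f)).
  move=> f f' /eqP; rewrite red_eq' //; rewrite /g -sumrB.
  under eq_bigr do rewrite -mulrBl.
  move=> h; apply/ffunP => i.
  have h2 := ht (fun i => r (f i) - r (f' i)).
  have h3 : absv (r (f i) - r (f' i)) < 1.
    by apply: le_lt_trans h; apply: h2 => l; apply: (sfB sF); case: (r1 (f l)); case: (r1 (f' l)).
  have [Fr vr] := r1 (f i).
  have [l [_ ul]] := hr _ Fr vr.
  by rewrite -(ul (f i)) ?subrr ?(av0 Hp) // (ul _ h3).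
exists (codom (fun f => red (g f))); split.
- exact/injectiveP.
- by rewrite size_codom card_ffun !card_ord.
- move=> x [c hc ex] x1.
  have c1 i : absv (c i) <= 1 by apply: le_trans (ht c hc i) _; rewrite -ex.
  have /choice[f hf] : forall i, exists l, absv (c i - r l) < 1.
    by move=> i; have [l [h _]] := hr _ (hc i) (c1 i); exists l.
  suff -> : red x = red (g [ffun i => f i]) by exact: codom_f.
  apply/eqP; rewrite red_eq' // ex -sumrB; apply: (av_sum_lt Hp) => // i _.
  rewrite ffunE -mulrBl (avM Hp); apply: le_lt_trans (hf i).
  by rewrite ler_piMr ?ge0.
- by move=> y /codomP[f ->]; exists (g f).
Qed.

(** The q^n residues form a multiplicatively closed set containing 0, so they are roots of X^(q^n) -
    X, which has no room for further roots. *)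
Lemma red_pow n (t : 'I_n -> Omega) : (0 < n)%N -> v_orthonormal absv F t ->
  (forall x y, lin_span F t x -> lin_span F t y -> lin_span F t (x * y)) ->
  (forall x, lin_span F t x -> absv x <= 1 -> red x ^+ (q ^ n)%N = red x) /\
  (forall y : k, y ^+ (q ^ n)%N = y ->
     exists2 x, lin_span F t x /\ absv x <= 1 & red x = y).
Proof.
move=> n0 ot tM; have [S [uS sS S1 S2]] := red_count ot.
have t0 : lin_span F t 0.
  exists (fun=> 0); first by move=> _; apply: (sf0 sF).
  by rewrite big1 // => i _; rewrite mul0r.
have S0 : 0 \in S by rewrite -red0'; apply: S1; rewrite ?(av0 Hp).
have SM (x y : k) : x \in S -> y \in S -> x * y \in S.
  move=> /S2[a [ta a1] <-] /S2[b [tb b1] <-].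
  by rewrite -redM //; apply: S1; [apply: tM|apply: (avM_le1 Hp)].
have powS (x : k) : x \in S -> x ^+ (q ^ n)%N = x by rewrite -sS; apply: mulclosed_pow.
split=> [x tx x1|y hy]; first by apply: powS; apply: S1.
apply: S2; apply/negPn/negP => yS.
have qn1 : (1 < q ^ n)%N by rewrite -{1}(exp1n n) ltn_exp2r ?q_gt1.
pose P : {poly k} := 'X^(q ^ n)%N - 'X.
have sP : size P = (q ^ n).+1.
  by rewrite size_polyDl size_polyXn // size_polyN size_polyX ltnS.
have P0 : P != 0 by rewrite -size_poly_eq0 sP.
have rP : all (root P) (y :: S).
  apply/allP => z zS; rewrite rootE !hornerE subr_eq0; apply/eqP.
  by move: zS; rewrite inE => /orP[/eqP->|/powS].
have : (size (y :: S) < size P)%N.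
  by apply: max_poly_roots => //=; rewrite yS.
by rewrite /= sS sP ltnn.
Qed.

Let one_t (i : 'I_1) : Omega := 1.

Lemma one_orthonormal : v_orthonormal absv F one_t.
Proof.
split=> [i|c hc i]; first by rewrite (av1 Hp).
by rewrite big_ord1 mulr1 [i]ord1.
Qed.

Lemma one_span x : lin_span F one_t x <-> F x.
Proof.
split=> [[c hc ->]|hx]; first by rewrite big_ord1 mulr1.
by exists (fun=> x) => //; rewrite big_ord1 mulr1.
Qed.

Lemma red_powF x : F x -> absv x <= 1 -> red x ^+ q = red x.
Proof.
move=> Fx x1; have [|h _] := red_pow (ltn0Sn 0) one_orthonormal.
  by move=> a b /one_span Fa /one_span Fb; apply/one_span; apply: (sfM sF).
by have := h x; rewrite expn1; apply=> //; apply/one_span.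
Qed.

Lemma red_liftF (y : k) : y ^+ q = y -> exists2 x, F x /\ absv x <= 1 & red x = y.
Proof.
move=> hy; have [|_ h] := red_pow (ltn0Sn 0) one_orthonormal.
  by move=> a b /one_span Fa /one_span Fb; apply/one_span; apply: (sfM sF).
have [|x [/one_span Fx x1] e] := h y; first by rewrite expn1.
by exists x.
Qed.

(* (X + 1)^q - X^q - 1 vanishes on the q elements of the residue field of F. *)
Lemma frob_poly : ('X + 1) ^+ q = 'X^q + 1 :> {poly k}.
Proof.
apply/eqP; rewrite -subr_eq0; apply/eqP.
have [S [uS sS S1 S2]] := red_count one_orthonormal; rewrite expn1 in sS.
apply: (@roots_geq_poly_eq0 _ _ S) => //.
  apply/allP => y /S2[x [/one_span Fx x1] <-]; rewrite rootE !hornerE /= subr_eq0.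
  apply/eqP; rewrite red_powF // -red1 -redD ?(av1 Hp) // red_powF //.
    by apply: (sfD sF) => //; apply: (sf1 sF).
  by rewrite (avD_le Hp) ?(av1 Hp).
rewrite sS.
have -> : ('X + 1) ^+ q - ('X^q + 1) = \sum_(i < q) 'X^i *+ 'C(q, i) - 1 :> {poly k}.
  have [m ->] : exists m, q = m.+1 by exists q.-1; rewrite prednK // ltnW ?q_gt1.
  rewrite [X in X ^+ _ - _]addrC exprDn big_ord_recr /= subnn expr0 mul1r binn mulr1n.
  under eq_bigr do rewrite expr1n mul1r.
  by rewrite opprD addrA addrK.
have q0 := ltnW q_gt1.
apply: leq_trans (size_polyD _ _) _; rewrite geq_max size_polyN size_poly1 q0 andbT.
apply: leq_trans (size_sum _ _ _) _; apply/bigmax_leqP => i _.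
by rewrite -scaler_nat (leq_trans (size_scale_leq _ _)) // size_polyXn.
Qed.

Lemma frobD (x y : k) : (x + y) ^+ q = x ^+ q + y ^+ q.
Proof.
have [->|y0] := eqVneq y 0; first by rewrite addr0 expr0n q_eq0 addr0.
have -> : x + y = (x / y + 1) * y by rewrite mulrDl mul1r divfK.
rewrite exprMn; have /(congr1 (fun P => P.[x / y])) := frob_poly.
rewrite !hornerE /= => ->; rewrite mulrDl mul1r expr_div_n divfK //.
by rewrite expf_neq0.
Qed.

Lemma frob_sum (I : Type) (r : seq I) (P : pred I) (f : I -> k) :
  (\sum_(i <- r | P i) f i) ^+ q = \sum_(i <- r | P i) f i ^+ q.
Proof.
elim/big_rec2: _ => [|i y x _ IH]; last by rewrite frobD IH.
by rewrite expr0n q_eq0.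
Qed.

(** Differentiate (X + 1)^q = X^q + 1 and evaluate at 0. Nothing is assumed about q being a power of
    p. *)
Lemma q_red0 : q%:R = 0 :> k.
Proof.
have /(congr1 (fun P => P^`().[0])) := frob_poly.
rewrite deriv_exp !derivE !hornerMn !hornerE /= ?add0r ?expr1n ?expr0n.
rewrite -scaler_nat hornerZ hornerXn expr0n.
by rewrite (_ : (q.-1 == 0)%N = false) ?mulr0 //; move: q_gt1; clear; lia.
Qed.

Lemma av_q_lt1 : absv q%:R < 1.
Proof. by rewrite -red_eq0 ?(av_nat Hp) // red_nat' q_red0. Qed.

(** The q-th power map fixes the residue of -1; for even q this would give 1 = -1, whereas 2 is a
    unit. *)
Lemma q_odd : odd q.
Proof.
have q1 := q_gt1.
have h : (-1 : k) ^+ q = -1.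
  rewrite -red1 -redN' ?(av1 Hp) // red_powF ?(avN Hp) ?(av1 Hp) //.
  exact/(sfN sF)/(sf1 sF).
apply/negPn/negP => ev; move: h; rewrite -signr_odd (negPf ev) expr0 => /eqP.
rewrite -subr_eq0 opprK -[1 + 1]/(2%:R : k) -red_nat' red_eq0 ?(av_nat Hp) //.
by rewrite (av_odd2 p_prime Hp p_odd) ltxx.
Qed.

Lemma q_gt2 : (2 < q)%N.
Proof. by have := q_gt1; have := q_odd; case: (q) => [|[|[|]]]. Qed.

Lemma av_qn1 n : (0 < n)%N -> absv (q ^ n - 1)%:R = 1.
Proof.
move=> n0; rewrite natrB ?expn_gt0 ?(ltnW q_gt1) // addrC.
rewrite -(avN Hp) opprD opprK mulr1n -[RHS](av1 Hp) -[X in absv X]addrC addrC.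
rewrite -[X in absv (X - _)]mulr1n addrC.
rewrite (avD_eqr Hp) ?(av1 Hp) // (avN Hp) natrX (avX Hp).
by rewrite exprn_ilt1 ?ge0 ?av_q_lt1 // -lt0n.
Qed.

(** If z were not 1, the sum of the z^i for i < m would vanish; but it is congruent to m, which is a
    unit. *)
Lemma unity_close z m : z ^+ m = 1 -> absv m%:R = 1 -> absv (z - 1) < 1 -> z = 1.
Proof.
move=> zm m1 z1; apply/eqP; rewrite -subr_eq0; apply/negPn/negP => n0.
have : (z - 1) * \sum_(i < m) z ^+ i = 0 by rewrite -subrX1 zm subrr.
move/eqP; rewrite mulf_eq0 (negPf n0) /= => /eqP h.
have vz : absv z <= 1.
  by rewrite -[z](subrK 1) (avD_le Hp) ?(av1 Hp) // ltW.
suff : absv (\sum_(i < m) (z ^+ i - 1)) < 1.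
  rewrite sumrB h sub0r (avN Hp) sumr_const card_ord m1 ltxx //.
apply: (av_sum_lt Hp) => // i _; rewrite subrX1 (avM Hp).
apply: le_lt_trans z1; rewrite ler_piMr ?ge0 //; apply: (av_sum_le Hp) => // j _.
exact: (avX_le1 Hp).
Qed.

Lemma unity_red_inj x y n : (0 < n)%N ->
  x ^+ (q ^ n - 1) = 1 -> y ^+ (q ^ n - 1) = 1 -> absv (x - y) < 1 -> x = y.
Proof.
move=> n0 hx hy h.
have m0 : (0 < q ^ n - 1)%N by rewrite subn_gt0 -{1}(exp1n n) ltn_exp2r ?q_gt1.
have vy : absv y = 1 by exact: (av_root_unity Hp m0 hy).
have y0 : y != 0 by rewrite -(av_gt0 Hp) vy.
suff : x / y = 1 by move/(congr1 ( *%R^~ y)); rewrite divfK ?mul1r.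
apply: (unity_close (m := q ^ n - 1)); rewrite ?av_qn1 //.
  by rewrite expr_div_n hx hy divr1.
have -> : x / y - 1 = (x - y) / y by rewrite mulrBl divff.
by rewrite (avM Hp) (avV Hp) vy invr1 mulr1.
Qed.

(** For z congruent to 1, z^q - 1 is z - 1 times a sum of q terms congruent to 1, and that sum has
    absolute value at most M because |q| < 1. Hence each q-th power gains a factor M. *)
Lemma pow_q_limit y (e : R) : absv (y - 1) < 1 -> 0 < e ->
  exists N, forall m, (N <= m)%N -> absv (y ^+ (q ^ m)%N - 1) < e.
Proof.
move=> y1 e0; pose M := Num.max (absv q%:R) (absv (y - 1)).
have M1 : M < 1 by rewrite gt_max av_q_lt1.
have M0 : 0 <= M by rewrite le_max ge0.
have [N hN] := geometric_lt M0 M1 e0; exists N => m hm.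
apply: le_lt_trans (hN m hm).
suff : absv (y ^+ (q ^ m)%N - 1) <= M ^+ m /\ absv (y ^+ (q ^ m)%N - 1) <= M by case.
elim: m {hm} => [|m [IH1 IH2]].
  by rewrite expn0 expr1 expr0 (ltW y1) le_max lexx orbT.
have v1 : absv (y ^+ (q ^ m)%N) <= 1.
  rewrite -[y ^+ _](subrK 1) (avD_le Hp) ?(av1 Hp) //.
  exact: le_trans IH2 (ltW M1).
suff h : absv (y ^+ (q ^ m.+1)%N - 1) <= M * absv (y ^+ (q ^ m)%N - 1).
  split; apply: le_trans h _; first by rewrite exprS ler_wpM2l.
  by rewrite ler_piMr // (le_trans IH2) // ltW.
rewrite expnS mulnC exprM; move: (y ^+ _) v1 IH2 => z z1 zM {IH1}.
rewrite subrX1 (avM Hp) mulrC ler_wpM2r ?ge0 //.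
have -> : \sum_(i < q) z ^+ i = \sum_(i < q) (z ^+ i - 1) + q%:R.
  by rewrite sumrB sumr_const card_ord subrK.
apply: (avD_le Hp); last by rewrite le_max lexx.
apply: (av_sum_le Hp) => // i _; rewrite subrX1 (avM Hp).
apply: le_trans zM; rewrite ler_piMr ?ge0 //; apply: (av_sum_le Hp) => // j _.
exact: (avX_le1 Hp).
Qed.

(** x/z is congruent to 1 and z^(q^n) = z, so z is the limit of the powers x^(q^(n N)), which lie in
    the complete field L. *)
Lemma teichmuller L z x n : is_subfield L -> vcomplete absv L -> (0 < n)%N ->
  z ^+ (q ^ n - 1) = 1 -> L x -> absv (x - z) < 1 -> L z.
Proof.
move=> sL cL n0 hz Lx hx; apply: (complete_closed Hp cL) => e e0.
have m0 : (0 < q ^ n - 1)%N by rewrite subn_gt0 -{1}(exp1n n) ltn_exp2r ?q_gt1.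
have vz : absv z = 1 by exact: (av_root_unity Hp m0 hz).
have z0 : z != 0 by rewrite -(av_gt0 Hp) vz.
have h1 : absv (x / z - 1) < 1.
  have -> : x / z - 1 = (x - z) / z by rewrite mulrBl divff.
  by rewrite (avM Hp) (avV Hp) vz invr1 mulr1.
have [N hN] := pow_q_limit h1 e0.
exists (x ^+ (q ^ (n * N))%N); first exact: (sfX sL).
have zq : z ^+ (q ^ (n * N))%N = z.
  elim: (N) => [|l IH]; first by rewrite muln0 expn0 expr1.
  rewrite mulnS expnD exprM -[(q ^ n)%N](@subnK 1) ?expn_gt0 ?(ltnW q_gt1) //.
  by rewrite exprD hz mul1r expr1.
rewrite (av_distC Hp).
have := hN (n * N)%N; rewrite leq_pmull // => /(_ isT).
have -> : (x / z) ^+ (q ^ (n * N))%N - 1 = (x ^+ (q ^ (n * N))%N - z) / z.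
  by rewrite expr_div_n zq mulrBl divff.
by rewrite (avM Hp) (avV Hp) vz invr1 mulr1.
Qed.

(** Square roots near 1 without Newton iteration: y is the limit of y^(q^N + 1), and these are
    powers of y^2 because q is odd. *)
Lemma sqrt_closed L y : is_subfield L -> vcomplete absv L ->
  L (y ^+ 2) -> absv (y - 1) < 1 -> L y.
Proof.
move=> sL cL Ly hy; apply: (complete_closed Hp cL) => e e0.
have vy : absv y = 1 by rewrite -(av1 Hp); apply: (av_close Hp); rewrite (av1 Hp).
have [N hN] := pow_q_limit hy e0.
exists (y ^+ (q ^ N).+1).
  have -> : (q ^ N).+1 = (2 * (q ^ N).+1./2)%N.
    by rewrite mul2n -[LHS]odd_double_half /= oddX q_odd orbT.
  by rewrite exprM; apply: (sfX sL).
rewrite exprS -{1}[y]mulr1 -mulrBr (avM Hp) vy mul1r (av_distC Hp).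
exact: hN.
Qed.

(* Linear combinations of powers of z: the reduction of a relation has the n
   conjugates of red z among its roots. *)
Lemma powers_orthonormal n z : absv z <= 1 ->
  (forall i j, (i < n)%N -> (j < n)%N ->
     red z ^+ (q ^ i)%N = red z ^+ (q ^ j)%N -> i = j) ->
  v_orthonormal absv F (fun i : 'I_n => z ^+ i).
Proof.
move=> z1 hz; split=> [i|c hc i0]; first exact: (avX_le1 Hp).
rewrite leNgt; apply/negP => lt0.
have [i1 _ imax] : exists2 i1, true & forall i, absv (c i) <= absv (c i1).
  case: (@Order.TotalTheory.arg_maxP _ _ _ i0 xpredT (fun i => absv (c i))) => // i1 _ h.
  by exists i1 => // i; apply: h.
have lt : absv (\sum_l c l * z ^+ l) < absv (c i1) by apply: lt_le_trans lt0 (imax i0).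
have c0 : c i1 != 0 by rewrite -(av_gt0 Hp) (le_lt_trans _ lt) // ge0.
pose d i := c i / c i1.
have d1 i : absv (d i) <= 1.
  by rewrite (avM Hp) (avV Hp) ler_pdivrMr ?mul1r // (av_gt0 Hp).
have Fd i : F (d i) by apply: (sf_div sF).
have dlt : absv (\sum_l d l * z ^+ l) < 1.
  under eq_bigr do rewrite /d mulrAC.
  by rewrite -mulr_suml (avM Hp) (avV Hp) ltr_pdivrMr ?mul1r // (av_gt0 Hp).
pose P : {poly k} := \poly_(l < n) (if insub l is Some i then red (d i) else 0).
have Pval (y : k) : P.[y] = \sum_(l < n) red (d l) * y ^+ l.
  by rewrite horner_poly; apply: eq_bigr => l _; rewrite valK.
have P0 : P.[red z] = 0.
  rewrite Pval; apply/eqP; rewrite -[X in X == 0](_ : red (\sum_l d l * z ^+ l) = _).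
    by rewrite red_eq0 // ltW.
  rewrite red_sum' => [|l _]; last by rewrite (avM_le1 Hp) // (avX_le1 Hp).
  by apply: eq_bigr => l _; rewrite redM ?redX' // (avX_le1 Hp).
have Pq (y : k) : P.[y] ^+ q = P.[y ^+ q].
  rewrite !Pval frob_sum; apply: eq_bigr => l _.
  by rewrite exprMn red_powF // -!exprM mulnC.
have roots i : P.[red z ^+ (q ^ i)%N] = 0.
  elim: i => [|i IH]; first by rewrite expn0 expr1.
  by rewrite expnSr exprM -Pq IH expr0n q_eq0.
have : P = 0.
  apply: (@roots_geq_poly_eq0 _ _ [seq red z ^+ (q ^ i)%N | i <- iota 0 n]).
  - by apply/allP => y /mapP[i _ ->]; rewrite rootE roots.
  - rewrite map_inj_in_uniq ?iota_uniq // => i j; rewrite !mem_iota /= => ? ?.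
    exact: hz.
  - by rewrite size_map size_iota size_poly.
move/(congr1 (fun Q : {poly k} => Q`_i1)).
rewrite coef_poly coef0 ltn_ord valK /d divff // red1 => /eqP.
by rewrite oner_eq0.
Qed.

End Local2.

Lemma ltr_exprz_lt1 (R : realFieldType) (x : R) (m n : int) : 0 < x -> x < 1 ->
  (x ^ m < x ^ n) = (n < m).
Proof.
move=> x0 x1; rewrite -[m]opprK -[n]opprK -!(exprz_inv x).
by rewrite !opprK ltr_eXz2l ?invf_gt1 // ltrN2.
Qed.

Lemma prim_root_exists (R : realType) (p : nat) (Omega : closedFieldType)
  (absv : Omega -> R) m : prime p -> padic_closure absv p -> (0 < m)%N ->
  exists z : Omega, m.-primitive_root z.
Proof.
move=> pp Hp m0.
have [r hr] := closed_field_poly_normal ('X^m - 1 : {poly Omega}).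
have lc : lead_coef ('X^m - 1 : {poly Omega}) = 1.
  by rewrite -[X in _ - X]polyC1 lead_coefXnsubC.
rewrite lc scale1r in hr.
have sr : size r = m.
  have := size_XnsubC (1 : Omega) m0.
  by rewrite polyC1 hr size_prod_XsubC => -[].
have ur : uniq r.
  rewrite -separable_prod_XsubC -hr; apply: separable_Xn_sub_1.
  exact: (nat_neq0 pp Hp).
have : has m.-primitive_root r.
  apply: has_prim_root => //; last by rewrite sr.
  apply/allP => z zr; rewrite unity_rootE.
  have : root ('X^m - 1) z by rewrite hr root_prod_XsubC.
  by rewrite rootE !hornerE subr_eq0.
by case/hasP => z _; exists z.
Qed.

(** * Orthonormal bases and the unramified extension of degree n *)

Section Local3.
Variables (R : realType) (p : nat) (Omega : closedFieldType).
Variable absv : Omega -> R.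
Hypotheses (p_prime : prime p) (Hp : padic_closure absv p).
Variables (k : fieldType) (red : Omega -> k).
Hypotheses (red1 : red 1 = 1)
  (redD : forall x y, absv x <= 1 -> absv y <= 1 -> red (x + y) = red x + red y)
  (redM : forall x y, absv x <= 1 -> absv y <= 1 -> red (x * y) = red x * red y)
  (red_eq0 : forall x, absv x <= 1 -> (red x == 0) = (absv x < 1)).
Implicit Types (x y z : Omega) (L W : set Omega).
Local Notation ge0 := (absv_ge0 Hp).
Variables (F : set Omega) (q : nat) (pi : Omega).
Hypotheses (sF : is_subfield F) (cF : vcomplete absv F)
  (uF : uniformizer absv F pi) (rF : residue_card absv F q).
Hypothesis p_odd : p <> 2%N.

Lemma unif_gt0 : 0 < absv pi.
Proof. by case: uF => _ h _ _; rewrite (av_gt0 Hp). Qed.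

Lemma unif_lt1 : absv pi < 1. Proof. by case: uF. Qed.

Lemma val_pow x : F x -> x != 0 -> exists m : int, absv x = absv pi ^ m.
Proof.
have p0 := unif_gt0; have p1 := unif_lt1.
have [Fpi pi0 _ hpi] := uF.
have main y : F y -> y != 0 -> absv y <= 1 -> exists m : nat, absv y = absv pi ^+ m.
  move=> Fy y0 y1; have vy : 0 < absv y by rewrite (av_gt0 Hp).
  have [N hN] := geometric_lt (ltW p0) p1 vy.
  have exN : exists n, absv pi ^+ n < absv y by exists N; apply: hN.
  case: (ex_minnP exN) => -[|n] h hmin.
    by move: h; rewrite expr0 ltNge y1.
  exists n; apply/eqP; rewrite eq_le; apply/andP; split.
    by rewrite leNgt; apply/negP => /hmin; rewrite ltnn.
  have := hpi (pi ^+ n.+1 / y) (sf_div sF (sfX sF _ Fpi) Fy).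
  rewrite (avM Hp) (avV Hp) (avX Hp) ltr_pdivrMr // mul1r => /(_ h).
  by rewrite ler_pdivrMr // exprS ler_pM2l.
move=> Fx x0; case: (leP (absv x) 1) => [/(main x Fx x0)[m ->]|/ltW x1].
  by exists m.
have vx : 0 < absv x by rewrite (av_gt0 Hp).
have [||m] := main x^-1 (sfV sF Fx); rewrite ?invr_eq0 // (avV Hp).
  by rewrite invf_le1.
move=> h; exists (- m%:Z); rewrite -[LHS]invrK h.
by rewrite exprnN.
Qed.

(** From the last vector subtract a nearest point of the span of the others, then divide by an
    element of F of the same absolute value. The division is where values in |F|, that is
    unramifiedness, is used; minimality of the distance is what makes the result orthonormal to the
    earlier vectors. *)
Lemma gram_schmidt n (b : 'I_n -> Omega) : lin_free F b ->
  (forall x, lin_span F b x -> exists2 y, F y & absv x = absv y) ->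
  exists t : 'I_n -> Omega, (forall i, lin_span F b (t i)) /\ v_orthonormal absv F t.
Proof.
elim: n b => [|n IH] b fb vb.
  by exists b; split=> [[]//|]; split=> [[]//|c hc []].
pose w i := widen_ord (leqnSn n) i.
pose b' i := b (w i).
have sub x : lin_span F b' x -> lin_span F b x.
  move=> [c hc ->]; apply: lin_span_sum => // i; apply: lin_spanZ => //.
  exact: lin_span_mem.
pose ext (c : 'I_n -> Omega) t (l : 'I_n.+1) :=
  if insub (val l) is Some i then c i else t.
have extw c t i : ext c t (w i) = c i by rewrite /ext /= valK.
have extm c t : ext c t ord_max = t by rewrite /ext /= insubF ?ltnn.
have Fext (P : Omega -> Prop) c t : (forall l, P (c l)) -> P t -> forall l, P (ext c t l).
  by move=> hc ht l; rewrite /ext; case: insubP.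
have fb' : lin_free F b'.
  move=> c hc e i; rewrite -(extw c 0); apply: (fb (ext c 0)).
    by apply: Fext => //; apply: (sf0 sF).
  rewrite big_ord_recr /= extm mul0r addr0 -[RHS]e.
  by apply: eq_bigr => j _; rewrite extw.
have [t [tb [t1 ht]]] := IH b' fb' (fun x hx => vb x (sub x hx)).
have clW : vclosed absv (lin_span F b').
  have [C _ hC] := coord_bound Hp sF cF fb'.
  by apply: (complete_closed Hp); apply: (span_complete Hp sF cF hC).
have bmax x : lin_span F b' x -> lin_span F b (b ord_max - x).
  by move=> hx; apply: lin_spanB => //; [apply: lin_span_mem|apply: sub].
have notin x : lin_span F b' x -> b ord_max - x != 0.
  move=> [c hc ex]; apply/eqP => e0.
  have h : ext (fun i => - c i) 1 ord_max = 0.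
    apply: fb; first by apply: (Fext F) => [i|]; [apply: (sfN sF)|apply: (sf1 sF)].
    rewrite big_ord_recr /= extm mul1r -[RHS]e0 ex addrC; congr (_ + _).
    by rewrite -sumrN; apply: eq_bigr => i _; rewrite extw mulNr.
  by move/eqP: h; rewrite extm oner_eq0.
have [x1 hx1 x1min] : exists2 x1, lin_span F b' x1 &
    forall x, lin_span F b' x -> absv (b ord_max - x1) <= absv (b ord_max - x).
  have [d d0 hd] : exists2 d : R, 0 < d &
      forall x, lin_span F b' x -> d <= absv (b ord_max - x).
    apply: contrapT => H.
    have : lin_span F b' (b ord_max).
      apply: clW => e e0; apply: contrapT => H2; apply: H; exists e => // x hx.
      by rewrite leNgt; apply/negP => hlt; apply: H2; exists x.
    by move/notin; rewrite subrr eqxx.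
  have vals x : lin_span F b' x -> exists m : int, absv (b ord_max - x) = absv pi ^ m.
    move=> hx; have [y Fy ey] := vb _ (bmax x hx); rewrite ey; apply: val_pow => //.
    by rewrite -(av_gt0 Hp) -ey (av_gt0 Hp) notin.
  have p0 := unif_gt0; have p1 := unif_lt1.
  have [m0 hm0] := vals 0 (lin_span0 b' sF); rewrite subr0 in hm0.
  (* A nearest point exists because the distances are powers of |pi| bounded below by d: take the
     largest exponent m0 + l that occurs. *)
  pose P (l : nat) := `[< exists2 x, lin_span F b' x & absv (b ord_max - x) = absv pi ^ (m0 + l%:Z) >].
  have exP : exists l, P l.
    by exists 0%N; apply/asboolP; exists 0; rewrite ?subr0 ?addr0 //; apply: lin_span0.
  have [N hN] : exists N : nat, forall l, P l -> (l <= N)%N.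
    have e0 : 0 < d / absv pi ^ m0 by rewrite divr_gt0 // exprz_gt0.
    have [N hN] := geometric_lt (ltW p0) p1 e0; exists N => l /asboolP[x hx ex].
    rewrite leqNgt; apply/negP => /ltnW /hN; rewrite ltr_pdivlMr ?exprz_gt0 //.
    have := hd x hx; rewrite ex expfzDr ?gt_eqF // mulrC => h1 h2.
    by have := le_lt_trans h1 h2; rewrite ltxx.
  case: (ex_maxnP exP hN) => l /asboolP[x1 hx1 ex1] lmax.
  exists x1 => // x hx; rewrite leNgt; apply/negP => lt.
  have [m hm] := vals x hx; move: lt; rewrite ex1 hm ltr_exprz_lt1 // => lt.
  have /lmax : P `|m - m0|%N.
    apply/asboolP; exists x => //; rewrite hm; congr (_ ^ _).
    by move: lt; clear; lia.
  by move: lt; clear; lia.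
have [y Fy ey] := vb _ (bmax _ hx1).
have y0 : y != 0 by rewrite -(av_gt0 Hp) -ey (av_gt0 Hp) notin.
have vy : 0 < absv y by rewrite (av_gt0 Hp).
pose tm := (b ord_max - x1) / y.
have vtm : absv tm = 1 by rewrite (avM Hp) (avV Hp) ey divff // gt_eqF.
exists (ext t tm); split.
  apply: Fext => [i|]; first exact/sub.
  by rewrite /tm mulrC; apply: lin_spanZ => //; [apply: (sfV sF)|apply: bmax].
split=> [|c hc].
  by apply: (Fext (fun x => absv x <= 1)) => //; rewrite vtm.
have eS : \sum_l c l * ext t tm l = \sum_i c (w i) * t i + c ord_max * tm.
  by rewrite big_ord_recr /= extm; congr (_ + _); apply: eq_bigr => i _; rewrite extw.
have spS : lin_span F b' (\sum_i c (w i) * t i).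
  by apply: lin_span_sum => // i; apply: lin_spanZ.
have hmax : absv (c ord_max) <= absv (\sum_l c l * ext t tm l).
  have [->|c0] := eqVneq (c ord_max) 0; first by rewrite (av0 Hp) ge0.
  rewrite eS; set S := \sum_i _ in spS *.
  have -> : S + c ord_max * tm = c ord_max / y * (b ord_max - (x1 - y / c ord_max * S)).
    by rewrite /tm; field; rewrite y0 c0.
  rewrite (avM Hp) (avM Hp) (avV Hp) -mulrA ler_peMr ?ge0 //.
  rewrite mulrC ler_pdivlMr // mul1r -ey; apply: x1min.
  by apply: lin_spanB => //; apply: lin_spanZ => //; apply: (sf_div sF).
move=> l; case: (unliftP ord_max l) => [i ->|-> //].
have -> : lift ord_max i = w i by apply: val_inj; rewrite /= /bump leqNgt ltn_ord.
apply: le_trans (ht (fun i => c (w i)) (fun i => hc _) i) _.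
have -> : \sum_i c (w i) * t i = \sum_l c l * ext t tm l - c ord_max * tm.
  by rewrite eS addrK.
by apply: (avB_le Hp); rewrite // (avM Hp) vtm mulr1.
Qed.

Lemma orthonormal_values n (t : 'I_n -> Omega) : v_orthonormal absv F t ->
  same_values absv F (lin_span F t).
Proof.
move=> [t1 ht] x [c hc ->].
case: n t t1 ht c hc => [|n] t t1 ht c hc.
  by exists 0; [apply: (sf0 sF)|rewrite big_ord0].
have [i1 _ imax] : exists2 i1, true & forall i, absv (c i) <= absv (c i1).
  case: (@Order.TotalTheory.arg_maxP _ _ _ ord0 xpredT (fun i => absv (c i))) => // i1 _ h.
  by exists i1 => // i; apply: h.
exists (c i1) => //; apply/eqP; rewrite eq_le ht // andbT.
apply: (av_sum_le Hp); rewrite ?ge0 // => i _; rewrite (avM Hp).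
by apply: le_trans (imax i); rewrite ler_piMr ?ge0.
Qed.

Section Zeta.
Variables (n : nat) (z : Omega).
Hypotheses (n_gt0 : (0 < n)%N) (z_prim : (q ^ n - 1).-primitive_root z).

Lemma zeta_abs : absv z = 1.
Proof. exact: (av_root_unity Hp (prim_order_gt0 z_prim) (prim_expr_order z_prim)). Qed.

Let z1 : absv z <= 1. Proof. by rewrite zeta_abs. Qed.

Lemma zeta_red_inj i j : (i < n)%N -> (j < n)%N ->
  red z ^+ (q ^ i)%N = red z ^+ (q ^ j)%N -> i = j.
Proof.
have q2 := q_gt2 p_prime Hp red1 redD redM red_eq0 sF rF p_odd.
move=> lti ltj e.
have vz m : absv (z ^+ m) <= 1 by apply: (avX_le1 Hp).
have u m : (z ^+ m) ^+ (q ^ n - 1) = 1.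
  by rewrite exprAC (prim_expr_order z_prim) expr1n.
have /(unity_red_inj Hp red1 redD redM red_eq0 sF rF n_gt0 (u _) (u _)) :
    absv (z ^+ (q ^ i)%N - z ^+ (q ^ j)%N) < 1.
  by rewrite -(red_eq Hp redD red_eq0) // !(redX Hp red1 redM) // e.
move/eqP; rewrite (eq_prim_root_expr z_prim).
(* The case n = 1, l = 0 reads 1 < q - 1; it is here that q > 2 matters. *)
have bound l : (l < n)%N -> (q ^ l < q ^ n - 1)%N.
  move=> ltl; have : (q ^ l.+1 <= q ^ n)%N by rewrite leq_exp2l // ltnW.
  rewrite expnS; have : (0 < q ^ l)%N by rewrite expn_gt0 ltnW // ltnW.
  move: (q ^ l)%N (q ^ n)%N => a d; nia.
rewrite !modn_small ?bound // => /eqP; apply: expnI; exact: ltnW.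
Qed.

Lemma zeta_orthonormal : v_orthonormal absv F (fun i : 'I_n => z ^+ i).
Proof.
apply: (powers_orthonormal Hp red1 redD redM red_eq0 sF rF) => // i j.
exact: zeta_red_inj.
Qed.

Lemma red_zeta_pow : red z ^+ (q ^ n)%N = red z.
Proof.
rewrite -[(q ^ n)%N](@subnK 1); last first.
  by rewrite expn_gt0 ltnW // (q_gt1 Hp sF rF).
rewrite exprD expr1 -(redX Hp red1 redM) //.
by rewrite (prim_expr_order z_prim) red1 mul1r.
Qed.

(** An orthonormal basis of L shows that its residues are all solutions of y^(q^n) = y, so some x in
    L reduces to the residue of z; then z is the Teichmuller limit attached to x. *)
Lemma zeta_mem L : ext_of_degree F L n -> same_values absv F L -> L z.
Proof.
move=> eL vL; have cL := ext_complete Hp sF cF eL.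
have [sL FL [b bb]] := eL; have [bL bs bf] := bb.
have eLb : L = lin_span F b.
  apply/seteqP; split=> [x /bs|x [c hc ->]] //.
  by apply: (sf_sum sL) => i _; apply: (sfM sL) => //; apply: FL.
have [|t [tb ot]] := gram_schmidt bf.
  by move=> x; rewrite -eLb => /vL.
have tt : ext_basis F L t.
  apply: (basis_change sF bb); last exact: (v_orthonormal_free Hp ot).
  by move=> i; rewrite eLb.
have [_ ts _] := tt.
have eLt : L = lin_span F t.
  apply/seteqP; split=> [x /ts|x [c hc ->]] //.
  by apply: (sf_sum sL) => i _; apply: (sfM sL); [apply: FL|case: tt].
have [|_ h] := red_pow Hp redD redM red_eq0 sF rF n_gt0 ot.
  by rewrite -eLt; apply: (sfM sL).
have [x [Lx x1] ex] := h _ red_zeta_pow; rewrite -eLt in Lx.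
apply: (teichmuller Hp red1 redD redM red_eq0 sF rF sL cL n_gt0 _ Lx).
  exact: prim_expr_order.
by rewrite -(red_eq Hp redD red_eq0) // ex.
Qed.

Lemma zeta_basis L : ext_of_degree F L n -> same_values absv F L ->
  ext_basis F L (fun i : 'I_n => z ^+ i).
Proof.
move=> eL vL; have [sL FL [b bb]] := eL.
apply: (basis_change sF bb); last exact: (v_orthonormal_free Hp zeta_orthonormal).
by move=> i; apply: (sfX sL); apply: zeta_mem.
Qed.

(** The q-power Frobenius permutes the factors cyclically, so the coefficients are fixed by it and
    hence are residues of elements of F. *)
Lemma conj_poly_fixed (l : nat) :
  (\prod_(i < n) ('X - (red z ^+ (q ^ i)%N)%:P))`_l ^+ q =
  (\prod_(i < n) ('X - (red z ^+ (q ^ i)%N)%:P))`_l.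
Proof.
have q0 := q_eq0 Hp sF rF.
pose fr (y : k) := y ^+ q.
have frB : zmod_morphism fr.
  have frD := frobD Hp red1 redD redM red_eq0 sF rF.
  move=> x y; apply: (canRL (addrK _)).
  by rewrite /fr -frD subrK.
have frM : monoid_morphism fr.
  by split=> [|x y]; rewrite /fr ?expr1n // exprMn.
pose frob : {rmorphism k -> k} := HB.pack fr
  (GRing.isZmodMorphism.Build _ _ fr frB) (GRing.isMonoidMorphism.Build _ _ fr frM).
rewrite -[LHS]/(frob _) -coef_map; congr (_`_l).
rewrite (map_prod_XsubC frob) /=.
rewrite (eq_bigr (fun i : 'I_n => 'X - (red z ^+ (q ^ i.+1)%N)%:P)); last first.
  by move=> i _; rewrite /fr -exprM -expnSr.
case: n n_gt0 red_zeta_pow => // m _ zq; rewrite big_ord_recr big_ord_recl /=.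
by rewrite zq expn0 expr1 mulrC.
Qed.

(* A root of a lift to F of the minimal polynomial of red z generates an
   unramified extension of degree n. *)
Lemma zeta_ext : exists L, ext_of_degree F L n /\ same_values absv F L.
Proof.
pose chi := \prod_(i < n) ('X - (red z ^+ (q ^ i)%N)%:P).
have schi : size chi = n.+1.
  by rewrite /chi size_prod_XsubC /index_enum; case: index_enum_key; rewrite /= -enumT size_enum_ord.
have mchi : chi`_n = 1.
  have /monicP : chi \is monic by exact: monic_prod_XsubC.
  by rewrite lead_coefE schi.
have /choice[a ha] : forall l, exists x, [/\ F x, absv x <= 1 & red x = chi`_l].
  move=> l; have [x [Fx x1] ex] := red_liftF Hp redD redM red_eq0 sF rF (conj_poly_fixed l).
  by exists x.
pose Phi : {poly Omega} := 'X^n + \poly_(l < n) a l.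
have sPhi : (size (\poly_(l < n) a l : {poly Omega}) < size ('X^n : {poly Omega}))%N.
  by rewrite size_polyXn ltnS size_poly.
have lPhi : lead_coef Phi = 1 by rewrite lead_coefDl // lead_coefXn.
have vPhi : absv Phi.[z] < 1.
  have vz m : absv (z ^+ m) <= 1 by apply: (avX_le1 Hp).
  have va l : absv (a l) <= 1 by case: (ha l).
  have e : Phi.[z] = z ^+ n + \sum_(l < n) a l * z ^+ l.
    by rewrite hornerD hornerXn horner_poly.
  have s1 : absv (\sum_(l < n) a l * z ^+ l) <= 1.
    by apply: (av_sum_le Hp) => // l _; apply: (avM_le1 Hp).
  rewrite -red_eq0 e; last exact: (avD_le Hp).
  rewrite redD // (redX Hp red1 redM) //.
  rewrite (red_sum Hp redD red_eq0) => [|l _]; last exact: (avM_le1 Hp).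
  have : chi.[red z] = 0.
    rewrite horner_prod (bigD1 (Ordinal n_gt0)) //= !hornerE.
    by rewrite expn0 expr1 subrr mul0r.
  rewrite horner_coef schi big_ord_recr /= mchi mul1r => hchi.
  rewrite addrC -[X in _ == X]hchi; apply/eqP; congr (_ + _); apply: eq_bigr => l _.
  by rewrite redM // (redX Hp red1 redM) //; case: (ha l) => _ _ ->.
have [r hr] := closed_field_poly_normal Phi.
rewrite lPhi scale1r in hr.
(* The small number Phi(z) is the product of the differences of z with the roots of Phi, so one of
   these is small. *)
have [t tr tz] : exists2 t, t \in r & absv (z - t) < 1.
  apply: contrapT => H; move: vPhi; rewrite hr horner_prod (av_prod Hp) ltNge => /negP[].
  rewrite big_seq; elim/big_ind: _ => // [x y x1 y1|t tr].
    by rewrite -[1]mulr1 ler_pM.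
  rewrite !hornerE leNgt; apply/negP => lt; apply: H; exists t => //.
have rt : Phi.[t] = 0.
  by apply/eqP; rewrite -rootE hr root_prod_XsubC.
have t1 : absv t <= 1.
  by rewrite -[t](subKr z) (avB_le Hp) // ltW.
have ert : red t = red z by apply/esym/eqP; rewrite (red_eq Hp redD red_eq0).
pose b (i : 'I_n) := t ^+ i.
have ob : v_orthonormal absv F b.
  apply: (powers_orthonormal Hp red1 redD redM red_eq0 sF rF) => // i j ? ?.
  by rewrite ert; apply: zeta_red_inj.
have tn : lin_span F b (t ^+ n).
  exists (fun l => - a l) => [l|]; first by apply: (sfN sF); case: (ha l).
  move/eqP: rt; rewrite hornerD hornerXn horner_poly addr_eq0 => /eqP ->.
  by rewrite -sumrN; apply: eq_bigr => l _; rewrite mulNr.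
have tX m : lin_span F b (t ^+ m).
  elim: m => [|m [c hc e]].
    have := lin_span_mem b (Ordinal n_gt0) sF.
    by rewrite /b /= expr0.
  rewrite exprS e mulr_sumr; apply: lin_span_sum => // l.
  rewrite mulrCA -exprS; apply: lin_spanZ => //.
  have : (l.+1 <= n)%N by [].
  rewrite leq_eqVlt => /orP[/eqP->//|ltl].
  exact: (lin_span_mem b (Ordinal ltl) sF).
have fb := v_orthonormal_free Hp ob.
have FL : F `<=` lin_span F b.
  move=> x Fx; rewrite -[x]mulr1; apply: lin_spanZ => //.
  exact: (tX 0%N).
exists (lin_span F b); split; last exact: orthonormal_values.
split=> //.
  apply: span_subfield => //; first exact: (tX 0%N).
  by move=> i l; rewrite /b -exprD.
exists b; split=> // i; exact: lin_span_mem.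
Qed.

(** [unr] is a union over all candidates; every candidate contains z and is spanned over F by its
    powers, so there is only one. *)
Lemma unr_zeta :
  [/\ ext_of_degree F (unr absv F n) n, same_values absv F (unr absv F n) &
      ext_basis F (unr absv F n) (fun i : 'I_n => z ^+ i)].
Proof.
have [L [eL vL]] := zeta_ext.
suff -> : unr absv F n = L by split=> //; apply: zeta_basis.
apply/seteqP; split=> [x [L' [eL' vL'] L'x]|x Lx]; last by exists L.
have [_ h _] := zeta_basis eL' vL'; have [c hc ->] := h x L'x.
have [sL FL _] := eL.
by apply: (sf_sum sL) => i _; apply: (sfM sL); [apply: FL|apply: (sfX sL); apply: zeta_mem].
Qed.

End Zeta.

Lemma unr0 x : ~ unr absv F 0 x.
Proof.
move=> [L [[sL _ [b [_ h _]]] _] _].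
have [c _ /eqP] := h 1 (sf1 sL).
by rewrite big_ord0 oner_eq0.
Qed.

Lemma zeta_exists n : (0 < n)%N -> exists z : Omega, (q ^ n - 1).-primitive_root z.
Proof.
move=> n0; apply: (prim_root_exists p_prime Hp).
by rewrite subn_gt0 -{1}(exp1n n) ltn_exp2r ?(q_gt1 Hp sF rF).
Qed.

Lemma unr_sub m n : (0 < n)%N -> (m %| n)%N -> unr absv F m `<=` unr absv F n.
Proof.
move=> n0 mn x hx.
have m0 : (0 < m)%N by rewrite lt0n; apply/eqP => m0; move: hx; rewrite m0; apply: unr0.
have [z hz] := zeta_exists m0; have [y hy] := zeta_exists n0.
have [_ _ [_ hm _]] := unr_zeta m0 hz.
have [[sn Fn _] _ [yn _ _]] := unr_zeta n0 hy.
have [y1|n1] := leqP n 1.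
  have n1 : n = 1%N by lia.
  by move: mn hx; rewrite n1 dvdn1 => /eqP->.
have uy : unr absv F n y by have := yn (Ordinal n1).
have dvd : (q ^ m - 1 %| q ^ n - 1)%N.
  have /dvdnP[l ->] := mn; rewrite mulnC expnM.
  by rewrite !subn1 dvdn_pred_predX.
have zq : z ^+ (q ^ n - 1) = 1.
  by have /dvdnP[l ->] := dvd; rewrite mulnC exprM (prim_expr_order hz) expr1n.
have [i ei] := prim_rootP hy zq.
have [c hc ->] := hm x hx.
apply: (sf_sum sn) => l _; apply: (sfM sn); first exact: Fn.
by apply: (sfX sn); rewrite ei; apply: (sfX sn).
Qed.

Lemma unr1 : unr absv F 1 = F.
Proof.
apply/seteqP; split=> [x [L [[sL _ [b [_ bs _]]] _] Lx]|x Fx]; last first.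
  exists F => //; split; last by move=> y Fy; exists y.
  split=> //; exists (fun=> 1); split=> [_|y Fy|c hc]; first exact: (sf1 sF).
    by exists (fun=> y) => //; rewrite big_ord1 mulr1.
  by rewrite big_ord1 mulr1 => h i; rewrite [i]ord1.
have [c hc ->] := bs x Lx; have [d hd e1] := bs 1 (sf1 sL).
rewrite !big_ord1 in e1 *.
have d0 : d 0 != 0.
  by apply: contra_eq_neq e1 => ->; rewrite mul0r oner_neq0.
have -> : b 0 = (d 0)^-1 by apply: (mulfI d0); rewrite -e1 divff.
exact: sf_div.
Qed.

Lemma max_unr_pos x : max_unr absv F x -> exists2 n, (0 < n)%N & unr absv F n x.
Proof. by move=> [[/unr0//|n] hx]; exists n.+1. Qed.

Lemma max_unr_subfield : is_subfield (max_unr absv F).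
Proof.
have join x y : max_unr absv F x -> max_unr absv F y -> exists n,
    [/\ is_subfield (unr absv F n), unr absv F n x & unr absv F n y].
  move=> /max_unr_pos[n n0 hx] /max_unr_pos[m m0 hy]; exists (n * m)%N.
  have nm0 : (0 < n * m)%N by rewrite muln_gt0 n0.
  have [z hz] := zeta_exists nm0; have [[sL _ _] _ _] := unr_zeta nm0 hz.
  have sub1 : unr absv F n `<=` unr absv F (n * m) by apply: unr_sub; rewrite ?dvdn_mulr.
  have sub2 : unr absv F m `<=` unr absv F (n * m) by apply: unr_sub; rewrite ?dvdn_mull.
  by split=> //; [apply: sub1|apply: sub2].
split; first by exists 1%N; rewrite unr1; apply: (sf1 sF).
  by move=> x y hx hy; have [n [? ? ?]] := join x y hx hy; exists n; apply: sfB.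
by move=> x y hx hy; have [n [? ? ?]] := join x y hx hy; exists n; apply: sf_div.
Qed.

Lemma sub_max_unr : F `<=` max_unr absv F.
Proof. by move=> x Fx; exists 1%N; rewrite unr1. Qed.

Lemma zeta_unr n z : (0 < n)%N -> (q ^ n - 1).-primitive_root z -> unr absv F n z.
Proof.
by move=> n0 hz; have [eL vL _] := unr_zeta n0 hz; exact: (zeta_mem n0 hz eL vL).
Qed.

(** The q^n-power map fixes the residue of x. If |x| = 1 then x^(q^n - 1) - 1 is small; it is the
    product of the x - z^i, so one factor is small. *)
Lemma unr_residue n z x : (0 < n)%N -> (q ^ n - 1).-primitive_root z ->
  unr absv F n x -> absv x <= 1 ->
  absv x < 1 \/ exists i : nat, absv (x - z ^+ i) < 1.
Proof.
move=> n0 hz hx x1; have [eL vL bb] := unr_zeta n0 hz.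
have [sL FL _] := eL; have [bL bs _] := bb.
have sp : unr absv F n = lin_span F (fun i : 'I_n => z ^+ i).
  apply/seteqP; split=> [y /bs|y [c hc ->]] //.
  by apply: (sf_sum sL) => i _; apply: (sfM sL) => //; apply: FL.
have [|h _] := red_pow Hp redD redM red_eq0 sF rF n0 (zeta_orthonormal n0 hz).
  by rewrite -sp; apply: (sfM sL).
have q0 : (0 < q ^ n)%N by rewrite expn_gt0 ltnW // (q_gt1 Hp sF rF).
rewrite sp in hx; have /eqP := h x hx x1.
rewrite -(redX Hp red1 redM) // (red_eq Hp redD red_eq0) ?(avX_le1 Hp) //.
have -> : x ^+ (q ^ n)%N - x = (x ^+ (q ^ n - 1) - 1) * x.
  by rewrite mulrBl mul1r -exprSr subn1 prednK.
rewrite (avM Hp).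
have [lt1|ge1] := ltP (absv x) 1; first by left.
have -> : absv x = 1 by apply/eqP; rewrite eq_le x1.
rewrite mulr1 => lt1; right; apply: contrapT => H; move: lt1; rewrite ltNge => /negP[].
have -> : x ^+ (q ^ n - 1) - 1 = ('X^(q ^ n - 1) - 1).[x] by rewrite !hornerE.
rewrite -(factor_Xn_sub_1 hz) horner_prod (av_prod Hp).
elim/big_ind: _ => // [a b a1 b1|i _]; first by rewrite -[1]mulr1 ler_pM.
by rewrite !hornerE leNgt; apply/negP => lt; apply: H; exists i.
Qed.

End Local3.

(** * Automorphisms *)

Section Aut.
Variables (R : realType) (p : nat) (Omega : closedFieldType).
Variable absv : Omega -> R.
Hypotheses (p_prime : prime p) (Hp : padic_closure absv p).
Implicit Types (x y z : Omega) (F L : set Omega) (f g : Omega -> Omega).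
Local Notation ge0 := (absv_ge0 Hp).

(** Let s < 1 be the supremum of the values below 1 and choose x with |x| > s^2. If |y| exceeded |x|
    with |y| < 1, then x/y and y would both have value at most s, forcing |x| <= s^2. *)
Lemma max_uniformizer F : is_subfield F ->
  (exists2 c : R, c < 1 & forall x, F x -> absv x < 1 -> absv x <= c) ->
  exists pi, uniformizer absv F pi.
Proof.
move=> sF [c c1 hc].
pose S := [set absv x | x in [set x | F x /\ absv x < 1]].
have Sp : S (absv p%:R) by exists p%:R => //; split; [apply: sf_nat|apply: (av_p_lt1 p_prime Hp)].
have ubS : ubound S c by move=> _ [x [Fx x1] <-]; apply: hc.
have supS : has_sup S by split; [exists (absv p%:R)|exists c].
have ubs x : F x -> absv x < 1 -> absv x <= sup S.
  by move=> Fx x1; apply: (ub_le_sup supS.2); exists x.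
have s0 : 0 < sup S.
  apply: lt_le_trans (ubs p%:R _ _); first exact: (av_p_gt0 p_prime Hp).
    exact: sf_nat.
  exact: (av_p_lt1 p_prime Hp).
have s1 : sup S < 1 by apply: le_lt_trans c1; apply: ge_sup => //; exists (absv p%:R).
have d0 : 0 < sup S - sup S * sup S by rewrite subr_gt0 gtr_pMr.
have [_ [x [Fx x1] <-]] := sup_adherent d0 supS.
rewrite opprB addrC subrK => hx.
have x0 : 0 < absv x by apply: lt_trans hx; rewrite mulr_gt0.
exists x; split=> //; first by rewrite -(av_gt0 Hp).
move=> y Fy y1; rewrite leNgt; apply/negP => lt.
have y0 : 0 < absv y by apply: lt_trans lt.
have := ubs (x / y) (sf_div sF Fx Fy).
rewrite (avM Hp) (avV Hp) ltr_pdivrMr // mul1r => /(_ lt).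
rewrite ler_pdivrMr // leNgt => /negP[]; apply: le_lt_trans hx.
by rewrite ler_pM2l // ubs.
Qed.

Record field_aut L f : Prop := FieldAut {
  fa_mem : forall x, L x -> L (f x);
  faD : forall x y, L x -> L y -> f (x + y) = f x + f y;
  faM : forall x y, L x -> L y -> f (x * y) = f x * f y;
  fa_abs : forall x, L x -> absv (f x) = absv x }.

Lemma field_aut_comp L f g : field_aut L f -> field_aut L g ->
  field_aut L (fun x => f (g x)).
Proof.
move=> hf hg; split=> [x Lx|x y Lx Ly|x y Lx Ly|x Lx].
- by apply/(fa_mem hf)/(fa_mem hg).
- by rewrite (faD hg) // (faD hf) //; apply: (fa_mem hg).
- by rewrite (faM hg) // (faM hf) //; apply: (fa_mem hg).
- by rewrite (fa_abs hf) ?(fa_abs hg) //; apply: (fa_mem hg).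
Qed.

Lemma field_aut_id L : field_aut L id. Proof. by split. Qed.

Lemma field_aut_iter L f n : field_aut L f -> field_aut L (iter n f).
Proof.
move=> hf; elim: n => [|n IH]; first exact: field_aut_id.
exact: (field_aut_comp hf IH).
Qed.

Section Theory.
Variables (L : set Omega) (f : Omega -> Omega).
Hypotheses (sL : is_subfield L) (hf : field_aut L f).

Lemma fa0 : f 0 = 0.
Proof.
have L0 := sf0 sL.
by apply: (addrI (f 0)); rewrite addr0 -(faD hf) // addr0.
Qed.

Lemma faN x : L x -> f (- x) = - f x.
Proof.
move=> Lx; apply/eqP; rewrite -addr_eq0 -(faD hf) ?addNr ?fa0 //.
exact: sfN.
Qed.

Lemma faB x y : L x -> L y -> f (x - y) = f x - f y.
Proof. by move=> Lx Ly; rewrite (faD hf) ?faN //; apply: sfN. Qed.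

Lemma fa1 : f 1 = 1.
Proof.
have L1 := sf1 sL.
have n0 : f 1 != 0 by rewrite -(av_gt0 Hp) (fa_abs hf) // (av1 Hp) ltr01.
by apply: (mulfI n0); rewrite mulr1 -(faM hf) // mulr1.
Qed.

Lemma faX x n : L x -> f (x ^+ n) = f x ^+ n.
Proof.
move=> Lx; elim: n => [|n IH]; first exact: fa1.
by rewrite !exprS (faM hf) ?IH //; apply: sfX.
Qed.

Lemma fa_eq0 x : L x -> (f x == 0) = (x == 0).
Proof. by move=> Lx; rewrite -(av_eq0 Hp) (fa_abs hf) // (av_eq0 Hp). Qed.

Lemma faV x : L x -> f x^-1 = (f x)^-1.
Proof.
move=> Lx; have [->|x0] := eqVneq x 0; first by rewrite invr0 fa0 invr0.
have fx0 : f x != 0 by rewrite fa_eq0.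
apply: (mulfI fx0); rewrite divff // -(faM hf) ?divff ?fa1 //.
exact: sfV.
Qed.

Lemma fa_div x y : L x -> L y -> f (x / y) = f x / f y.
Proof. by move=> Lx Ly; rewrite (faM hf) ?faV //; apply: sfV. Qed.

Lemma fa_sum (I : Type) (r : seq I) (P : pred I) (F : I -> Omega) :
  (forall i, P i -> L (F i)) ->
  f (\sum_(i <- r | P i) F i) = \sum_(i <- r | P i) f (F i).
Proof.
move=> h; elim: r => [|a r IH]; first by rewrite !big_nil fa0.
rewrite !big_cons; case: ifP => // Pa; rewrite (faD hf) ?IH //; first exact: h.
exact: (sf_sum sL).
Qed.

Lemma fa_prod (I : Type) (r : seq I) (P : pred I) (F : I -> Omega) :
  (forall i, P i -> L (F i)) ->
  f (\prod_(i <- r | P i) F i) = \prod_(i <- r | P i) f (F i).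
Proof.
move=> h; elim: r => [|a r IH]; first by rewrite !big_nil fa1.
rewrite !big_cons; case: ifP => // Pa; rewrite (faM hf) ?IH //; first exact: h.
exact: (sf_prod sL).
Qed.

End Theory.

(* |f x| <= C |x| on L, applied to the powers of x, gives |f x| <= |x|. *)
Lemma isometry_ext F L n f : is_subfield F -> vcomplete absv F ->
  ext_of_degree F L n ->
  (forall x y, L x -> L y -> f (x + y) = f x + f y /\ f (x * y) = f x * f y) ->
  (forall c, F c -> absv (f c) = absv c) ->
  forall x, L x -> absv (f x) = absv x.
Proof.
move=> sF cF [sL FL [b [bL bs bf]]] hf hF.
have f0 : f 0 = 0.
  have L0 := sf0 sL; apply: (addrI (f 0)).
  by rewrite addr0 -(hf 0 0 L0 L0).1 addr0.
have fsum (I : Type) (r : seq I) (G : I -> Omega) : (forall i, L (G i)) ->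
    f (\sum_(i <- r) G i) = \sum_(i <- r) f (G i).
  move=> h; elim: r => [|a r IH]; first by rewrite !big_nil f0.
  by rewrite !big_cons (hf _ _ (h a) _).1 ?IH //; apply: (sf_sum sL).
have [C C0 hC] := coord_bound Hp sF cF bf.
have [D D0 hD] : exists2 D : R, 0 < D & forall x, L x -> absv (f x) <= D * absv x.
  pose B := \sum_i absv (f (b i)).
  have B0 : 0 <= B by apply: sumr_ge0 => i _; apply: ge0.
  exists (C * (1 + B)); first by rewrite mulr_gt0 // ltr_pwDl ?ltr01.
  move=> x /bs[c hc ex]; rewrite {1}ex fsum => [|i]; last first.
    by apply: (sfM sL) => //; apply: FL.
  apply: (av_sum_le Hp) => [|i _].
    by rewrite !mulr_ge0 ?ge0 ?(ltW C0) // addr_ge0.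
  rewrite (hf _ _ (FL _ (hc i)) (bL i)).2 (avM Hp) hF //.
  rewrite mulrAC ler_pM ?ge0 //; first by rewrite ex hC.
  rewrite ler_wpDl ?ler01 // /B (bigD1 i) //= lerDl.
  by apply: sumr_ge0 => l _; apply: ge0.
have fX x m : L x -> f (x ^+ m.+1) = f x ^+ m.+1.
  move=> Lx; elim: m => [//|m IH].
  by rewrite exprS (hf _ _ Lx (sfX sL _ Lx)).2 IH -exprS.
have main x : L x -> absv (f x) <= absv x.
  move=> Lx; rewrite leNgt; apply/negP => lt.
  have v0 : 0 < absv (f x) by apply: le_lt_trans lt; apply: ge0.
  have r1 : absv x / absv (f x) < 1 by rewrite ltr_pdivrMr // mul1r.
  have r0 : 0 <= absv x / absv (f x) by rewrite divr_ge0 ?ge0.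
  have Di : 0 < D^-1 by rewrite invr_gt0.
  have [N hN] := geometric_lt r0 r1 Di.
  have := hN N.+1 (leqnSn N); rewrite expr_div_n ltr_pdivrMr ?exprn_gt0 //.
  rewrite -(avX Hp) -(avX Hp) -fX // mulrC ltr_pdivlMr // ltNge.
  by rewrite mulrC hD //; apply: sfX.
move=> x Lx; apply/eqP; rewrite eq_le main //=.
have [->|x0] := eqVneq x 0; first by rewrite (av0 Hp) ge0.
have := main _ (sfV sL Lx); rewrite (avV Hp).
have e : absv (f x) * absv (f x^-1) = 1.
  rewrite -(avM Hp) -(hf _ _ Lx (sfV sL Lx)).2 divff // hF ?(av1 Hp) //.
  exact: sf1.
have vx : 0 < absv x by rewrite (av_gt0 Hp).
rewrite -(ler_pM2l vx) divff ?gt_eqF // => h.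
have fx0 : 0 < absv (f x^-1).
  rewrite lt_def ge0 andbT; apply/eqP => e0.
  by move: e; rewrite e0 mulr0 => /eqP; rewrite eq_sym oner_eq0.
by rewrite -(ler_pM2r fx0) e.
Qed.

End Aut.

(** The arithmetic of E over K, collected once so that the geometry below can ignore its proof.
    Besides Pi with tau Pi = - Pi, the essential items are the even valuations of K, the trivial
    action of tau on residues, and square roots near 1. *)
Record ramified_setup (R : realType) (p : nat) (Omega : closedFieldType)
    (absv : Omega -> R) (K E : set Omega) (q : nat) (tau sigma : Omega -> Omega)
    (Pi : Omega) : Prop := RamifiedSetup {
  su_prime : prime p;
  su_Hp : padic_closure absv p;
  su_two : absv 2%:R = 1;
  su_K : is_subfield K;
  su_E : is_subfield E;
  su_KE : K `<=` E;
  su_sqrt : forall y, K (y ^+ 2) -> absv (y - 1) < 1 -> K y;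
  su_Ec : vcomplete absv E;
  su_unif : uniformizer absv E Pi;
  su_card : residue_card absv E q;
  su_q : (2 < q)%N;
  su_ur : is_subfield (max_unr absv E);
  su_Eur : E `<=` max_unr absv E;
  su_tau : field_aut absv (max_unr absv E) tau;
  su_sigma : field_aut absv (max_unr absv E) sigma;
  su_tauE : forall x, E x -> E (tau x);
  su_sigmaE : forall x, E x -> sigma x = x;
  su_tauPi : tau Pi = - Pi;
  su_tauK : forall x, K x -> tau x = x;
  su_fix : forall x, E x -> tau x = x -> K x;
  su_tautau : forall x, max_unr absv E x -> tau (tau x) = x;
  su_comm : forall x, max_unr absv E x -> tau (sigma x) = sigma (tau x);
  su_valK : forall x, K x -> x != 0 ->
    exists m : int, absv x = absv Pi ^ (m * 2);
  su_close : forall x, max_unr absv E x -> absv x <= 1 -> absv (tau x - x) < 1;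
  su_zeta : forall n z, (0 < n)%N -> (q ^ n - 1).-primitive_root z ->
    [/\ ext_of_degree E (unr absv E n) n,
        ext_basis E (unr absv E n) (fun i : 'I_n => z ^+ i),
        same_values absv E (unr absv E n), unr absv E n z &
        tau z = z /\ sigma z = z ^+ q];
  su_unity : forall n x y, (0 < n)%N -> x ^+ (q ^ n - 1) = 1 ->
    y ^+ (q ^ n - 1) = 1 -> absv (x - y) < 1 -> x = y;
  su_powers : forall n m y, (0 < n)%N -> y ^+ (q ^ n - 1) = 1 ->
    (forall i j, (i < m)%N -> (j < m)%N -> y ^+ (q ^ i)%N = y ^+ (q ^ j)%N -> i = j) ->
    v_orthonormal absv E (fun i : 'I_m => y ^+ i);
  su_zeta_exists : forall n, (0 < n)%N ->
    exists z : Omega, (q ^ n - 1).-primitive_root z }.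

(** * The ramified quadratic extension: a uniformizer negated by tau *)

Section Base.
Variables (R : realType) (p : nat) (Omega : closedFieldType).
Variable absv : Omega -> R.
Hypotheses (p_prime : prime p) (p_odd : p <> 2%N) (Hp : padic_closure absv p).
Implicit Types (x y z : Omega) (L : set Omega).
Local Notation ge0 := (absv_ge0 Hp).
Variables (K E : set Omega).
Hypotheses (K_finite : exists d, ext_of_degree (Qp absv) K d)
  (E_quadratic : ext_of_degree K E 2)
  (E_ramified : ~ same_values absv K E).
Variable q : nat.
Hypothesis K_residue : residue_card absv K q.
Variables tau sigma : Omega -> Omega.
Hypotheses (tau_gal : gal_aut (max_unr absv E) (max_unr absv K) tau)
  (tau_nontriv : exists2 x, E x & tau x <> x)
  (sigma_gal : gal_aut (max_unr absv E) E sigma)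
  (sigma_Frob : forall x, max_unr absv K x -> absv x <= 1 ->
     absv (sigma x - x ^+ q) < 1)
  (K_gap : exists2 c : R, c < 1 & forall x, K x -> absv x < 1 -> absv x <= c).

Let sK : is_subfield K. Proof. by case: K_finite => d []. Qed.
Let cK : vcomplete absv K.
Proof.
case: K_finite => d h; apply: (ext_complete Hp) h; first exact: (Qp_subfield p_prime Hp).
exact: (Qp_vcomplete p_prime Hp).
Qed.
Let sE : is_subfield E. Proof. by case: E_quadratic. Qed.
Let KE : K `<=` E. Proof. by case: E_quadratic. Qed.
Let cE : vcomplete absv E. Proof. exact: (ext_complete Hp sK cK E_quadratic). Qed.
Let two1 : absv 2%:R = 1. Proof. exact: (av_odd2 p_prime Hp p_odd). Qed.
Let two0 : 2%:R != 0 :> Omega. Proof. by rewrite -(av_gt0 Hp) two1 ltr01. Qed.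

(** Take x with |x| outside |K| and write x^2 = a + c x. The two terms on the right have different
    values, which gives |c| < |x|; so completing the square to x - c/2 does not change the value. *)
Lemma ramified_generator : exists d, [/\ E d, K (d ^+ 2),
  forall y, K y -> absv d != absv y &
  forall x, E x -> exists a b, [/\ K a, K b & x = a + b * d]].
Proof.
have [x Ex hx] : exists2 x, E x & forall y, K y -> absv x != absv y.
  apply: contrapT => H; apply: E_ramified => x Ex; apply: contrapT => H2.
  by apply: H; exists x => // y Ky; apply/eqP => e; apply: H2; exists y.
have x0 : x != 0 by apply: contraNneq (hx 0 (sf0 sK)) => ->.
have indep a b : K a -> K b -> a + b * x = 0 -> a = 0 /\ b = 0.
  move=> Ka Kb e; have b0 : b = 0.
    apply/eqP/negPn/negP => b0; have /negP := hx (- a / b) (sf_div sK (sfN sK Ka) Kb).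
    apply; rewrite (_ : x = - a / b) //; apply: (mulfI b0).
    by rewrite mulrCA divff // mulr1; apply/eqP; rewrite -addr_eq0 addrC e.
  by split=> //; move: e; rewrite b0 mul0r addr0.
pose t (i : 'I_2) : Omega := if i == 0 then 1 else x.
have ft : lin_free K t.
  move=> c hc; rewrite big_ord_recl big_ord1 /t /= mulr1 => e.
  have [c0 c1] := indep _ _ (hc _) (hc _) e.
  move=> i; case: (unliftP 0 i) => [j ->|->] //.
  by rewrite [j]ord1.
have [_ _ [b bb]] := E_quadratic.
have [_ ts _] : ext_basis K E t.
  apply: basis_change sK bb _ ft => i; rewrite /t; case: ifP => _ //.
  exact: (sf1 sE).
have gen y : E y -> exists a b, [/\ K a, K b & y = a + b * x].
  move=> /ts[c hc ->]; exists (c 0), (c (lift 0 0)); split=> //.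
  by rewrite big_ord_recl big_ord1 /t /= mulr1.
have [a [c [Ka Kc ex2]]] := gen (x ^+ 2) (sfX sE 2 Ex).
have vax : absv a != absv (c * x).
  have [c0|c0] := eqVneq c 0; last first.
    rewrite (avM Hp) eq_sym; apply: contraNneq (hx (a / c) (sf_div sK Ka Kc)) => e.
    by rewrite (avM Hp) (avV Hp) -e mulrAC divff ?mul1r // (av_eq0 Hp).
  rewrite c0 mul0r (av0 Hp) (av_eq0 Hp); apply: contraTneq x0 => a0.
  by rewrite negbK -sqrf_eq0 ex2 a0 c0 mul0r addr0.
have ltc : absv c < absv x.
  have [c0|c0] := eqVneq c 0; first by rewrite c0 (av0 Hp) (av_gt0 Hp).
  rewrite ltNge le_eqVlt; apply/negP => /orP[/eqP e|lt].
    by have /eqP := hx c Kc; rewrite e.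
  have v2 : absv (x ^+ 2) < absv (c * x).
    by rewrite expr2 !(avM Hp) ltr_pM2r // (av_gt0 Hp).
  have e : absv a = absv (c * x).
    have -> : a = x ^+ 2 + - (c * x) by rewrite ex2 addrK.
    by rewrite (avD_eqr Hp) (avN Hp).
  by rewrite e eqxx in vax.
exists (x - c / 2%:R); split.
- by apply: sfB => //; apply: KE; apply: sf_div => //; apply: sf_nat.
- have -> : (x - c / 2%:R) ^+ 2 = a + (c / 2%:R) ^+ 2.
    by rewrite sqrrB ex2; field.
  by apply: sfD => //; apply: sfX => //; apply: sf_div => //; apply: sf_nat.
- have -> : absv (x - c / 2%:R) = absv x.
    apply: (av_close Hp); rewrite addrAC subrr add0r (avN Hp) (avM Hp) (avV Hp).
    by rewrite two1 invr1 mulr1.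
  exact: hx.
- move=> y /gen[a' [b' [Ka' Kb' ->]]]; exists (a' + b' * (c / 2%:R)), b'; split=> //.
    by apply: sfD => //; apply: sfM => //; apply: sf_div => //; apply: sf_nat.
  by field.
Qed.

Let EE : E `<=` max_unr absv E. Proof. exact: sub_max_unr. Qed.
Let KK : K `<=` max_unr absv K. Proof. exact: sub_max_unr. Qed.

(** With d^2 in K and tau nontrivial, tau d = - d. The exponent of |d^2| is odd, as otherwise |d|
    would be a value of K; dividing d by a power of the uniformizer pK of K leaves Pi with |Pi|^2 =
    |pK|. *)
Lemma twisted_uniformizer : exists Pi, [/\ uniformizer absv E Pi, tau Pi = - Pi,
  forall x, E x -> exists a b, [/\ K a, K b & x = a + b * Pi],
  forall a b, K a -> K b -> absv (a + b * Pi) = Num.max (absv a) (absv (b * Pi)) &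
  forall x, K x -> x != 0 -> exists m : int, absv x = absv Pi ^ (m * 2)].
Proof.
have [tK thom tmem _] := tau_gal.
have [d [Ed Kd2 hd gend]] := ramified_generator.
have d0 : d != 0 by apply: contraNneq (hd 0 (sf0 sK)) => ->.
have [pK uK] := max_uniformizer p_prime Hp sK K_gap.
have [KpK pK0 pK1 pKmax] := uK.
have td : tau d = - d.
  have : tau d ^+ 2 = d ^+ 2.
    by rewrite expr2 -(thom _ _ (EE Ed) (EE Ed)).2 -expr2 tK //; apply: KK.
  move/eqP; rewrite eqf_sqr => /orP[/eqP e|/eqP //].
  case: tau_nontriv => x /gend[a [b [Ka Kb ->]]] [].
  have Ebd : E (b * d) by apply: sfM => //; apply: KE.
  rewrite (thom _ _ (EE (KE Ka)) (EE Ebd)).1 (thom _ _ (EE (KE Kb)) (EE Ed)).2.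
  by rewrite e !tK //; apply: KK.
have vp0 : 0 < absv pK by rewrite (av_gt0 Hp).
have [m hm] : exists m : int, absv (d ^+ 2) = absv pK ^ (m * 2 + 1).
  have [|k hk] := val_pow Hp sK uK Kd2; first by rewrite expf_eq0.
  have [m em] : exists m : int, k = m * 2 \/ k = m * 2 + 1.
    exists (k %/ 2)%Z; have := divz_eq k 2; have := ltz_pmod k (isT : 0 < 2 :> int).
    have := modz_ge0 k (isT : 2 != 0 :> int); lia.
  case: em => em; last by exists m; rewrite hk em.
  have /eqP[] := hd (pK ^ m) (sfXz sK m KpK).
  have : absv d ^+ 2 = absv (pK ^ m) ^+ 2.
    by rewrite -(avX Hp) hk em -exprz_exp (avXz Hp).
  by move/eqP; rewrite eqrXn2 ?ge0 // => /eqP.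
pose Pi := d / pK ^ m.
have pm0 : pK ^ m != 0 by rewrite expfz_neq0.
have Kpm : K (pK ^ m) by apply: sfXz.
have Pi0 : Pi != 0 by rewrite mulf_neq0 // invr_eq0.
have vPi2 : absv Pi ^+ 2 = absv pK.
  rewrite -(avX Hp) expr_div_n (avM Hp) hm (avV Hp) (avX Hp) (avXz Hp).
  by rewrite -[_ ^+ 2]/(_ ^ 2%:Z) exprz_exp expfzDr ?gt_eqF // expr1z mulrAC divff ?mul1r // expfz_neq0 // gt_eqF.
have EPi : E Pi by apply: sf_div => //; apply: KE.
have genPi x : E x -> exists a b, [/\ K a, K b & x = a + b * Pi].
  move=> /gend[a [b [Ka Kb ->]]]; exists a, (b * pK ^ m); split=> //.
    exact: sfM.
  by rewrite /Pi; field; rewrite pm0.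
have notK y : K y -> absv Pi != absv y.
  move=> Ky; have := hd (y * pK ^ m) (sfM sK Ky Kpm); apply: contraNneq => e.
  by rewrite (avM Hp) -e /Pi (avM Hp) (avV Hp) divfK // (av_eq0 Hp).
have vmax a b : K a -> K b -> absv (a + b * Pi) = Num.max (absv a) (absv (b * Pi)).
  move=> Ka Kb; have [ab|ab|ab] := ltgtP (absv a) (absv (b * Pi)).
  - by rewrite (avD_eqr Hp).
  - by rewrite addrC (avD_eqr Hp).
  have [b0|b0] := eqVneq b 0; first by rewrite b0 mul0r addr0.
  have /eqP[] := notK (a / b) (sf_div sK Ka Kb).
  by rewrite (avM Hp) (avV Hp) ab (avM Hp) mulrAC divff ?mul1r // (av_eq0 Hp).
have v2 : absv Pi * absv Pi = absv pK by rewrite -expr2.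
have aux (a b : R) : 0 <= a -> a * a = b -> b < 1 -> a < 1 /\ b <= a by move=> *; nra.
have [Pi1 lePi] := aux _ _ (ge0 Pi) v2 pK1.
exists Pi; split=> //.
- split=> // y /genPi[a [b [Ka Kb ->]]]; rewrite vmax // gt_max => /andP[a1 b1].
  rewrite ge_max; apply/andP; split; first exact: le_trans (pKmax _ Ka a1) _.
  have [->|b0] := eqVneq b 0; first by rewrite mul0r (av0 Hp) ge0.
  have vb : 0 < absv b by rewrite (av_gt0 Hp).
  rewrite (avM Hp) ler_piMl ?ge0 // leNgt; apply/negP => b2.
  have := pKmax b^-1 (sfV sK Kb); rewrite (avV Hp) invf_lt1 // => /(_ b2) h.
  move: b1; rewrite ltNge => /negP[].
  have h2 : 1 <= absv b * absv pK by rewrite -ler_pdivrMl // mulr1.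
  by apply: le_trans h2 _; rewrite (avM Hp) ler_pM2l.
- have [tK' _ _ _] := tau_gal.
  rewrite /Pi (thom _ _ (EE Ed) (EE (KE (sfV sK Kpm)))).2 td mulNr.
  by rewrite tK //; apply: KK; apply: sfV.
- move=> x Kx x0; have [m' ->] := val_pow Hp sK uK Kx x0.
  by exists m'; rewrite mulrC -exprz_exp -vPi2.
Qed.

Section Residue.
Variables (k : fieldType) (red : Omega -> k).
Hypotheses (red1 : red 1 = 1)
  (redD : forall x y, absv x <= 1 -> absv y <= 1 -> red (x + y) = red x + red y)
  (redM : forall x y, absv x <= 1 -> absv y <= 1 -> red (x * y) = red x * red y)
  (red_eq0 : forall x, absv x <= 1 -> (red x == 0) = (absv x < 1)).

Lemma setup_of_red : exists Pi, ramified_setup p absv K E q tau sigma Pi.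
Proof.
have [tK thom tmem tsurj] := tau_gal.
have [sfix shom smem ssurj] := sigma_gal.
have [Pi [uE tPi genPi vmax valK]] := twisted_uniformizer.
have [EPi Pi0 Pi1 Pimax] := uE.
have vPi : 0 < absv Pi by rewrite (av_gt0 Hp).
have vPi1 b : K b -> absv (b * Pi) != 1.
  move=> Kb; have [->|b0] := eqVneq b 0; first by rewrite mul0r (av0 Hp) eq_sym oner_neq0.
  have [m hm] := valK b Kb b0; rewrite (avM Hp) hm.
  have vn0 : absv Pi != 0 by rewrite (av_eq0 Hp).
  have -> : absv Pi ^ (m * 2) * absv Pi = absv Pi ^ (m * 2 + 1) by rewrite expfzDr.
  apply/negP; rewrite pexprz_eq1 ?(ltW vPi) // (lt_eqF Pi1) orbF => /eqP; lia.
have [pK uK] := max_uniformizer p_prime Hp sK K_gap.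
(* E has the residues of K: b Pi never has absolute value 1, so an integral a + b Pi is congruent to
   a. *)
have rE : residue_card absv E q.
  have [r r1 hr] := K_residue; exists r => [i|x Ex x1].
    by have [Kr ?] := r1 i; split=> //; apply: KE.
  have [a [b [Ka Kb ex]]] := genPi x Ex.
  have := x1; rewrite ex vmax // ge_max => /andP[a1 b1].
  have b2 : absv (b * Pi) < 1 by rewrite lt_neqAle vPi1.
  have e i : (absv (a + b * Pi - r i) < 1) = (absv (a - r i) < 1).
    rewrite addrAC; apply/idP/idP => h; last exact: (avD_lt Hp).
    by rewrite -[a - _](addrK (b * Pi)) (avB_lt Hp).
  have [i [h1 h2]] := hr a Ka a1; exists i; split; first by rewrite e.
  by move=> i'; rewrite e; apply: h2.
pose zE := unr_zeta p_prime Hp red1 redD redM red_eq0 sE cE uE rE p_odd.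
pose zK := zeta_unr p_prime Hp red1 redD redM red_eq0 sK cK uK K_residue p_odd.
have sur : is_subfield (max_unr absv E).
  exact: (max_unr_subfield p_prime Hp red1 redD redM red_eq0 sE cE uE rE p_odd).
have ex_z n : (0 < n)%N -> exists z : Omega, (q ^ n - 1).-primitive_root z.
  exact: (zeta_exists p_prime Hp sE rE).
have tgen a b : K a -> K b -> tau (a + b * Pi) = a - b * Pi.
  move=> Ka Kb; have Ebd : E (b * Pi) by apply: sfM => //; apply: KE.
  rewrite (thom _ _ (EE (KE Ka)) (EE Ebd)).1 (thom _ _ (EE (KE Kb)) (EE EPi)).2.
  by rewrite tPi !tK ?mulrN //; apply: KK.
have tE x : E x -> E (tau x).
  move=> /genPi[a [b [Ka Kb ->]]]; rewrite tgen //.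
  by apply: (sfB sE); [apply: KE|apply: (sfM sE) => //; apply: KE].
have absE x : E x -> absv (tau x) = absv x.
  apply: (isometry_ext Hp sK cK E_quadratic) => [y y' Ey Ey'|c Kc].
    by apply: thom; apply: EE.
  by rewrite tK //; apply: KK.
have unr_stable f : (forall x y, max_unr absv E x -> max_unr absv E y ->
       f (x + y) = f x + f y /\ f (x * y) = f x * f y) ->
    (forall c, E c -> absv (f c) = absv c) ->
    forall x, max_unr absv E x -> absv (f x) = absv x.
  move=> fhom fE x /max_unr_pos[n n0 hx]; have [z hz] := ex_z n n0.
  have [eL _ _] := zE n z n0 hz.
  apply: (isometry_ext Hp sE cE eL _ fE hx) => y y' hy hy'.
  by apply: fhom; exists n.
have ht : field_aut absv (max_unr absv E) tau.
  split=> // [x y hx hy|x y hx hy|]; [exact: (thom x y hx hy).1|exact: (thom x y hx hy).2|].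
  exact: unr_stable.
have hs : field_aut absv (max_unr absv E) sigma.
  split=> // [x y hx hy|x y hx hy|]; [exact: (shom x y hx hy).1|exact: (shom x y hx hy).2|].
  by apply: unr_stable => // c Ec; rewrite sfix.
have uri := unity_red_inj Hp red1 redD redM red_eq0 sE rE.
have zur n z : (0 < n)%N -> (q ^ n - 1).-primitive_root z -> unr absv E n z.
  exact: (zeta_unr p_prime Hp red1 redD redM red_eq0 sE cE uE rE p_odd).
have tz n z : (0 < n)%N -> (q ^ n - 1).-primitive_root z -> tau z = z.
  by move=> n0 hz; apply: tK; exists n; apply: zK.
have vz n z : (q ^ n - 1).-primitive_root z -> absv z = 1.
  by move=> hz; apply: (zeta_abs Hp hz).
(* Both sides are roots of unity of order dividing q^n - 1 with the same residue, hence equal. *)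
have sz n z : (0 < n)%N -> (q ^ n - 1).-primitive_root z -> sigma z = z ^+ q.
  move=> n0 hz; have zz : max_unr absv E z by exists n; apply: zur.
  apply: (uri _ _ n n0).
  - by rewrite -(faX Hp sur hs) // (prim_expr_order hz) (fa1 Hp sur hs).
  - by rewrite exprAC (prim_expr_order hz) expr1n.
  - by apply: sigma_Frob; rewrite ?(vz _ _ hz) //; exists n; apply: zK.
have fa_ext f g : field_aut absv (max_unr absv E) f -> field_aut absv (max_unr absv E) g ->
    (forall c, E c -> f c = g c) ->
    (forall n z, (0 < n)%N -> (q ^ n - 1).-primitive_root z -> f z = g z) ->
    forall x, max_unr absv E x -> f x = g x.
  move=> hf hg eE ez x /max_unr_pos[n n0 hx]; have [z hz] := ex_z n n0.
  have [_ _ [_ hb _]] := zE n z n0 hz; have [c hc ->] := hb x hx.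
  have zz : max_unr absv E z by exists n; apply: zur.
  have mc (i : 'I_n) : max_unr absv E (c i) by apply: EE.
  have mz (i : nat) : max_unr absv E (z ^+ i) by apply: sfX.
  have mcz (i : 'I_n) : max_unr absv E (c i * z ^+ i) by apply: sfM.
  rewrite (fa_sum sur hf) // (fa_sum sur hg) //; apply: eq_bigr => i _.
  rewrite (faM hf) // (faM hg) // (faX Hp sur hf) // (faX Hp sur hg) //.
  by rewrite eE // (ez n).
exists Pi; split=> //.
- move=> y; apply: (sqrt_closed p_prime Hp red1 redD redM red_eq0 sE rE p_odd sK cK).
- exact: (q_gt2 p_prime Hp red1 redD redM red_eq0 sE rE p_odd).
- by move=> x Kx; apply: tK; apply: KK.
- move=> x /genPi[a [b [Ka Kb ->]]].
  rewrite tgen // => /addrI/eqP; rewrite eq_sym -subr_eq0 opprK.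
  rewrite -mulr2n -mulr_natl mulf_eq0 (negPf two0) /= => /eqP ->.
  by rewrite addr0.
- apply: fa_ext => [||c Ec|n z n0 hz].
  + exact: (field_aut_comp ht ht).
  + exact: field_aut_id.
  + have [a [b [Ka Kb ->]]] := genPi c Ec.
    by rewrite tgen // -mulNr tgen ?mulNr ?opprK //; apply: sfN.
  + by rewrite /= !(tz n).
- apply: fa_ext => [||c Ec|n z n0 hz].
  + exact: (field_aut_comp ht hs).
  + exact: (field_aut_comp hs ht).
  + by rewrite !sfix //; apply: tE.
  + have zz : max_unr absv E z by exists n; apply: zur.
    by rewrite !(sz n) ?(faX Hp sur ht) ?(tz n) // (sz n).
(* The field [su_close]: x is small or congruent to a power of z, and tau fixes z and preserves
   absolute values. *)
- move=> x /max_unr_pos[n n0 hx] x1; have [z hz] := ex_z n n0.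
  have zz : max_unr absv E z by exists n; apply: zur.
  have xx : max_unr absv E x by exists n.
  have := unr_residue p_prime Hp red1 redD redM red_eq0 sE cE uE rE p_odd n0 hz hx x1.
  case=> [lt|[i hi]]; first by apply: (avB_lt Hp) => //; rewrite (fa_abs ht).
  have zi' : max_unr absv E (z ^+ i) by apply: sfX.
  have tzi : tau (z ^+ i) = z ^+ i by rewrite (faX Hp sur ht) // (tz n).
  have -> : tau x - x = tau (x - z ^+ i) - (x - z ^+ i).
    by rewrite (faB sur ht) // tzi opprB addrA subrK.
  have zi : max_unr absv E (x - z ^+ i) by apply: sfB => //; apply: sfX.
  by apply: (avB_lt Hp) => //; rewrite (fa_abs ht).
- move=> n z n0 hz; have [eL vL bb] := zE n z n0 hz.
  by split=> //; [apply: zur|split; [apply: (tz n)|apply: (sz n)]].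
- by move=> n x y n0; apply: uri.
- move=> n m y n0 hy hinj.
  have v1 := av_root_unity Hp (prim_order_gt0 (projT2 (cid (ex_z n n0)))) hy.
  apply: (powers_orthonormal Hp red1 redD redM red_eq0 sE rE); first by rewrite v1.
  move=> i l lti ltl e; apply: hinj => //; apply: (uri _ _ n n0).
  - by rewrite exprAC hy expr1n.
  - by rewrite exprAC hy expr1n.
  - rewrite -(red_eq Hp redD red_eq0) ?(avX_le1 Hp) ?v1 //.
    by rewrite !(redX Hp red1 redM) ?v1 // e.
Qed.
End Residue.

Lemma setup_exists : exists Pi, ramified_setup p absv K E q tau sigma Pi.
Proof.
have [k [red [red1 redD redM red_eq0]]] := residue_field Hp.
exact: setup_of_red red1 redD redM red_eq0.
Qed.
End Base.

(** * The Hermitian form on one piece *)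

(** q has order 2r modulo q^r + 1: since q^r is congruent to -1, q^(e + r) - 1 is congruent to -(q^e
    + 1), which is too small to be divisible when 0 < e < r. This will give the norm-one element
    [xi] its full set of s conjugates. *)
Lemma pow_q_inj_mod q r i j : (2 < q)%N -> (0 < r)%N -> (i < r.*2)%N -> (j < r.*2)%N ->
  q ^ i = q ^ j %[mod (q ^ r).+1] -> i = j.
Proof.
move=> q2 r0; wlog le_ij : i j / (i <= j)%N.
  by move=> H hi hj e; case/orP: (leq_total i j) => h; [apply: H|apply/esym/H].
move=> hi hj /esym/eqP; have q1 : (1 < q)%N by apply: ltn_trans q2.
have q0 : (0 < q)%N by apply: ltn_trans q1.
rewrite eqn_mod_dvd; last by rewrite leq_exp2l.
rewrite -(subnK le_ij) expnD -[X in (_ - X)%N]mul1n -mulnBl Gauss_dvdl; last first.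
  by apply/coprimeXr/(coprime_dvdr _ (coprimeSn _))/dvdn_exp.
have : (j - i < r.*2)%N by apply: leq_ltn_trans hj; apply: leq_subr.
move: (j - i)%N => d hd; case: (posnP d) => [->//|d0] dvd; exfalso.
have small m : (0 < m)%N -> (m <= q ^ r)%N -> ((q ^ r).+1 %| m)%N = false.
  by move=> m0 mr; apply/negP => /dvdn_leq => /(_ m0); rewrite ltnNge mr.
have pos m : (0 < m)%N -> (1 < q ^ m)%N by move=> m0; rewrite -{1}(exp1n m) ltn_exp2r.
have [dr|rd] := leqP d r.
  move: dvd; rewrite small // ?subn_gt0 ?pos //.
  by apply: leq_trans (leq_subr _ _) _; rewrite leq_exp2l.
have [e ed] : exists e, d = (e + r)%N by exists (d - r)%N; rewrite subnK // ltnW.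
have e0 : (0 < e)%N by move: rd; rewrite ed -{1}[r]add0n ltn_add2r.
have er : (e < r)%N by move: hd; rewrite ed -addnn ltn_add2r.
have qe : (0 < q ^ e)%N by rewrite expn_gt0 q0.
have : ((q ^ r).+1 %| q ^ e * (q ^ r).+1 - (q ^ d - 1))%N by rewrite dvdn_sub // dvdn_mull.
have -> : (q ^ e * (q ^ r).+1 - (q ^ d - 1) = q ^ e + 1)%N.
  rewrite ed expnD mulnS; have : (0 < q ^ e * q ^ r)%N by rewrite muln_gt0 qe expn_gt0 q0.
  move: (q ^ e * q ^ r)%N (q ^ e)%N qe => a c; clear; lia.
by rewrite small ?addn1 // ltn_exp2l.
Qed.

Section Pieces.
Variables (R : realType) (p : nat) (Omega : closedFieldType).
Variable absv : Omega -> R.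
Variables (K E : set Omega) (q : nat) (tau sigma : Omega -> Omega) (Pi : Omega).
Hypothesis S : ramified_setup p absv K E q tau sigma Pi.
Implicit Types (x y z : Omega).
Let Hp := su_Hp S.
Let sE := su_E S.
Let sur := su_ur S.
Let EE := su_Eur S.
Let ht := su_tau S.
Let hs := su_sigma S.
Local Notation ge0 := (absv_ge0 Hp).
Local Notation Eur := (max_unr absv E).
Local Notation Un n := (unr absv E n).
Local Notation sg := (fun m => iter m sigma).

Lemma hsg m : field_aut absv Eur (iter m sigma). Proof. exact: field_aut_iter. Qed.

Lemma heta s : field_aut absv Eur (Defs.eta tau sigma s).
Proof. exact: (field_aut_comp ht (hsg _)). Qed.

Lemma sgE m x : E x -> iter m sigma x = x.
Proof. by move=> Ex; elim: m => //= m ->; apply: (su_sigmaE S). Qed.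

Lemma tau_sg m x : Eur x -> tau (iter m sigma x) = iter m sigma (tau x).
Proof.
move=> hx; elim: m => //= m IH; rewrite (su_comm S) ?IH //.
exact: (fa_mem (hsg m)).
Qed.

Lemma unr_ur n : Un n `<=` Eur. Proof. by move=> x hx; exists n. Qed.

Lemma Pi_gt0 : 0 < absv Pi.
Proof. by case: (su_unif S) => _ h _ _; rewrite (av_gt0 Hp). Qed.
Lemma Pi_lt1 : absv Pi < 1. Proof. by case: (su_unif S). Qed.
Lemma E_Pi : E Pi. Proof. by case: (su_unif S). Qed.

Lemma tau_PiX (m : int) : tau (Pi ^ m) = (-1) ^ m * Pi ^ m.
Proof.
have EP := EE E_Pi; have tX (l : nat) : tau (Pi ^+ l) = (-1) ^+ l * Pi ^+ l.
  by rewrite (faX Hp sur ht) // (su_tauPi S) -[- Pi]mulN1r exprMn.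
case: m => m; first exact: tX.
rewrite NegzE -!exprnN (faV Hp sur ht) ?tX; last exact: sfX.
by rewrite invfM -exprVn invrN1.
Qed.

Section Degree.
Variables (n : nat) (n_gt0 : (0 < n)%N) (z : Omega).
Hypothesis hz : (q ^ n - 1).-primitive_root z.

Let Z := su_zeta S n_gt0 hz.

Lemma unr_subfield : is_subfield (Un n). Proof. by case: Z => [[]]. Qed.
Lemma unr_base : E `<=` Un n. Proof. by case: Z => [[]]. Qed.

Lemma zeta_in : Un n z. Proof. by case: Z. Qed.
Lemma zeta_tau : tau z = z. Proof. by case: Z => _ _ _ _ []. Qed.
Lemma zeta_v : absv z = 1. Proof. exact: (zeta_abs Hp hz). Qed.
Lemma zeta_ur : Eur z. Proof. exact: (unr_ur zeta_in). Qed.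
Lemma zX_ur i : Eur (z ^+ i). Proof. exact: (sfX sur _ zeta_ur). Qed.
Lemma zX_unity i : (z ^+ i) ^+ (q ^ n - 1) = 1.
Proof. by rewrite exprAC (prim_expr_order hz) expr1n. Qed.

Lemma zeta_sg m : iter m sigma z = z ^+ (q ^ m)%N.
Proof.
elim: m => [|m IH] /=; first by rewrite expn0 expr1.
by rewrite IH (faX Hp sur hs _ zeta_ur); case: Z => _ _ _ _ [_ ->]; rewrite -exprM expnS.
Qed.

Lemma zeta_gen x : Un n x -> exists2 c : 'I_n -> Omega, (forall i, E (c i)) &
  x = \sum_i c i * z ^+ i.
Proof. by case: Z => _ [_ h _] _ _ _ /h. Qed.

Lemma zeta_sum_sg m (c : 'I_n -> Omega) : (forall i, E (c i)) ->
  iter m sigma (\sum_i c i * z ^+ i) = \sum_i c i * (z ^+ i) ^+ (q ^ m)%N.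
Proof.
move=> hc; have h i : Eur (c i) by apply: EE.
have h2 (i : 'I_n) : Eur (z ^+ i) by apply: zX_ur.
rewrite (fa_sum sur (hsg m)) => [|i _]; last exact: sfM.
apply: eq_bigr => i _; rewrite (faM (hsg m)) // sgE //.
by rewrite (faX Hp sur (hsg m) _ zeta_ur) zeta_sg exprAC.
Qed.

Lemma sg_unr m x : Un n x -> Un n (iter m sigma x).
Proof.
move=> /zeta_gen[c hc ->]; rewrite zeta_sum_sg //.
have sL := unr_subfield; apply: (sf_sum sL) => i _; apply: (sfM sL).
  exact: unr_base.
by do 2!apply: (sfX sL); exact: zeta_in.
Qed.

Lemma sg_period x : Un n x -> iter n sigma x = x.
Proof.
move=> /zeta_gen[c hc ->]; rewrite zeta_sum_sg //; apply: eq_bigr => i _.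
congr (_ * _); have q0 : (0 < q ^ n)%N by rewrite expn_gt0 (ltn_trans _ (su_q S)).
rewrite -[(q ^ n)%N](subnK q0) exprD expr1 zX_unity mul1r //.
Qed.

Lemma tau_unr x : Un n x -> Un n (tau x).
Proof.
move=> /zeta_gen[c hc ->].
have h i : Eur (c i) by apply: EE.
have h2 (i : 'I_n) : Eur (z ^+ i) by apply: zX_ur.
rewrite (fa_sum sur ht) => [|i _]; last exact: sfM.
have sL := unr_subfield; apply: (sf_sum sL) => i _.
rewrite (faM ht) // (faX Hp sur ht _ zeta_ur) zeta_tau; apply: (sfM sL).
  by apply: unr_base; apply: (su_tauE S).
by apply: (sfX sL); exact: zeta_in.
Qed.

Lemma eta_unr s x : Un n x -> Un n (Defs.eta tau sigma s x).
Proof. by move=> hx; apply: tau_unr; apply: sg_unr. Qed.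

Lemma unr_values x : Un n x -> x != 0 -> exists m : int, absv x = absv Pi ^ m.
Proof.
move=> hx x0; have [_ _ vL _ _] := Z; have [y Ey ey] := vL x hx.
rewrite ey; apply: (val_pow Hp sE (su_unif S)) => //.
by rewrite -(av_gt0 Hp) -ey (av_gt0 Hp).
Qed.

Lemma zeta_pow_inj i j : (i < n)%N -> (j < n)%N ->
  z ^+ (q ^ i)%N = z ^+ (q ^ j)%N -> i = j.
Proof.
have q2 := su_q S; have q1 : (1 < q)%N by apply: ltn_trans q2.
move=> lti ltj /eqP; rewrite (eq_prim_root_expr hz).
have bound l : (l < n)%N -> (q ^ l < q ^ n - 1)%N.
  move=> ltl; have : (q ^ l.+1 <= q ^ n)%N by rewrite leq_exp2l.
  rewrite expnS; have : (0 < q ^ l)%N by rewrite expn_gt0 (ltnW q1).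
  move: (q ^ l)%N (q ^ n)%N q2 => a d; clear; nia.
by rewrite !modn_small ?bound // => /eqP; apply: expnI.
Qed.

Lemma zeta_ortho : v_orthonormal absv E (fun i : 'I_n => z ^+ i).
Proof.
apply: (su_powers S n_gt0); first by have := zX_unity 1; rewrite expr1.
exact: zeta_pow_inj.
Qed.

(* The matrix of the embeddings sigma^m in the basis of powers of z. *)
Definition zeta_mx : 'M[Omega]_n := \matrix_(m, i) (z ^+ i) ^+ (q ^ m)%N.

(** The matrix is a Vandermonde matrix in the conjugates of z; distinct roots of unity of order
    dividing q^n - 1 differ by units. *)
Lemma zeta_mx_det : absv (\det zeta_mx) = 1.
Proof.
have -> : zeta_mx = (Vandermonde n (\row_m z ^+ (q ^ m)%N))^T.
  by apply/matrixP => m i; rewrite !mxE exprAC.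
rewrite det_tr det_Vandermonde (av_prod Hp) big1 // => i _.
rewrite (av_prod Hp) big1 // => j ij; rewrite !mxE.
apply/eqP; rewrite eq_le (avB_le Hp) ?(avX Hp) ?zeta_v ?expr1n //=.
rewrite leNgt; apply/negP => lt.
have e := su_unity S n_gt0 (zX_unity _) (zX_unity _) lt.
have := zeta_pow_inj (ltn_ord j) (ltn_ord i) e; move=> h.
by rewrite h ltnn in ij.
Qed.

Lemma zeta_mx_unit : zeta_mx \in unitmx.
Proof. by rewrite unitmxE unitfE -(av_gt0 Hp) zeta_mx_det ltr01. Qed.

Lemma zeta_mx_inv_int i m : absv (invmx zeta_mx i m) <= 1.
Proof.
rewrite /invmx zeta_mx_unit mxE (avM Hp) (avV Hp) zeta_mx_det invr1 mul1r mxE.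
rewrite /cofactor (avM Hp) (avX Hp) (avN Hp) (av1 Hp) expr1n mul1r.
apply: (av_sum_le Hp) => // s _; rewrite (avM Hp) (avX Hp) (avN Hp) (av1 Hp).
rewrite expr1n mul1r (av_prod Hp); apply: prodr_ile1 => l _.
by rewrite ge0 !mxE -!exprM (avX Hp) zeta_v expr1n /=.
Qed.

(** For x fixed by sigma, [zeta_mx] sends both the coordinates of x and the column (x, 0, ..., 0) to
    the constant column x. Hence they agree, and x is its first coordinate, an element of E. *)
Lemma sg_fixed x : Un n x -> sigma x = x -> E x.
Proof.
move=> hx sx; have [c hc ex] := zeta_gen hx.
have sX m : iter m sigma x = x by elim: m => //= m ->.
have e : zeta_mx *m (\col_i c i) = zeta_mx *m (\col_i (if i == Ordinal n_gt0 then x else 0)).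
  apply/matrixP => m l; rewrite !mxE.
  transitivity x.
    rewrite -[RHS](sX m) [in RHS]ex zeta_sum_sg //; apply: eq_bigr => i _.
    by rewrite !mxE mulrC.
  rewrite (bigD1 (Ordinal n_gt0)) //= !mxE eqxx expr0 expr1n mul1r.
  by rewrite big1 ?addr0 // => i /negPf ni; rewrite !mxE ni mulr0.
have /matrixP/(_ (Ordinal n_gt0) 0) := can_inj (mulKmx zeta_mx_unit) e.
by rewrite !mxE eqxx => <-.
Qed.

Local Notation tr := (trace sigma n).

Lemma sg_ur m x : Eur x -> Eur (iter m sigma x).
Proof. exact: (fa_mem (hsg m)). Qed.

Lemma trace_E x : Un n x -> E (tr x).
Proof.
move=> hx; have sL := unr_subfield; apply: sg_fixed.
  by apply: (sf_sum sL) => i _; apply: sg_unr.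
have hu (i : nat) : Eur (iter i sigma x) by apply: sg_ur; apply: unr_ur hx.
rewrite /trace (fa_sum sur hs) //.
case: (n) n_gt0 (sg_period hx) => // l _ hp.
by rewrite big_ord_recr big_ord_recl /= addrC; congr (_ + _).
Qed.

Lemma trace_le x : Un n x -> absv (tr x) <= absv x.
Proof.
move=> hx; apply: (av_sum_le Hp) => [|i _]; first exact: ge0.
by rewrite (fa_abs (hsg i)) //; apply: unr_ur hx.
Qed.

(** If all traces of powers of z were small, the row (1, ..., 1) times [zeta_mx] would be small;
    multiplying by the integral inverse of [zeta_mx] would make 1 small. *)
Lemma trace_unit : exists2 x, Un n x & absv x = 1 /\ absv (tr x) = 1.
Proof.
have sL := unr_subfield.
apply: contrapT => H.
have small i : absv (tr (z ^+ i)) < 1.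
  have zi : Un n (z ^+ i) by apply: (sfX sL); exact: zeta_in.
  have v1 : absv (z ^+ i) = 1 by rewrite (avX Hp) zeta_v expr1n.
  rewrite lt_neqAle -{2}v1 trace_le // andbT; apply/eqP => e.
  by apply: H; exists (z ^+ i).
have e : \sum_i (const_mx 1 *m zeta_mx : 'rV_n) 0 i * invmx zeta_mx i (Ordinal n_gt0) = 1.
  have := mulmxK zeta_mx_unit (const_mx 1 : 'rV[Omega]_n).
  by move/matrixP/(_ 0 (Ordinal n_gt0)); rewrite mxE [RHS]mxE.
suff : absv (1 : Omega) < 1 by rewrite (av1 Hp) ltxx.
rewrite -e; apply: (av_sum_lt Hp) => // i _.
have -> : (const_mx 1 *m zeta_mx : 'rV_n) 0 i = tr (z ^+ i).
  rewrite mxE; apply: eq_bigr => m _; rewrite !mxE mul1r.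
  by rewrite (faX Hp sur (hsg m) _ zeta_ur) zeta_sg exprAC.
rewrite (avM Hp); apply: le_lt_trans (small i).
by rewrite ler_piMr ?ge0 ?zeta_mx_inv_int.
Qed.

End Degree.

Section Piece.
Variables (s : nat) (z : Omega).
Hypotheses (s_cond : ((0 < s)%N /\ ~~ odd s) \/ s = 1%N)
  (hz : (q ^ s - 1).-primitive_root z).
Variables (w kappa : Omega).
Hypotheses (w_unif : uniformizer absv (Lfield absv K E tau sigma s) w)
  (kappa_L : Lfield absv K E tau sigma s kappa /\ kappa <> 0).
Local Notation et := (Defs.eta tau sigma s).
Local Notation ph := (Defs.phi tau sigma s w kappa).

Let s_gt0 : (0 < s)%N. Proof. by case: s_cond => [[]|->]. Qed.
Let sL := unr_subfield s_gt0 hz.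
Let u := kappa / w.

Lemma Lfield_eta x : Lfield absv K E tau sigma s x -> Un s x /\ et x = x.
Proof.
rewrite /Lfield; case: eqP => [s1 Kx|_ //]; split.
  by apply: (unr_base s_gt0 hz); apply: (su_KE S).
by rewrite /Defs.eta s1 /= (su_tauK S).
Qed.

Lemma ratio_unr : Un s u.
Proof.
have [wL _ _ _] := w_unif.
by apply: (sf_div sL); [case: (Lfield_eta kappa_L.1)|case: (Lfield_eta wL)].
Qed.

Lemma ratio_neq0 : u != 0.
Proof.
have [_ w0 _ _] := w_unif; case: kappa_L => _ /eqP k0.
by rewrite mulf_neq0 // invr_eq0.
Qed.

Lemma ratio_eta : et u = u.
Proof.
have [wL _ _ _] := w_unif.
have [kU ke] := Lfield_eta kappa_L.1; have [wU we] := Lfield_eta wL.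
by rewrite (fa_div Hp sur (heta s)) ?ke ?we //; apply: unr_ur; eassumption.
Qed.

Lemma eta_abs x : Un s x -> absv (et x) = absv x.
Proof. by move=> hx; rewrite (fa_abs (heta s)) //; apply: unr_ur hx. Qed.

Lemma eta_eta x : Un s x -> et (et x) = x.
Proof.
move=> hx; have ux : Eur x := unr_ur hx.
rewrite /Defs.eta -tau_sg; last exact: sg_ur.
rewrite (su_tautau S); last by do 2!apply: sg_ur.
rewrite -iterD addnn; case: s_cond => [[_ ev]|s1].
  by rewrite even_halfK // (sg_period s_gt0 hz).
by rewrite s1.
Qed.

Lemma phi_ratio x y : ph x y = trace sigma s (u * x * et y). Proof. by []. Qed.

Lemma phi_arg_unr x y : Un s x -> Un s y -> Un s (u * x * et y).
Proof.
move=> hx hy; apply: (sfM sL); last exact: (eta_unr s_gt0 hz).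
by apply: (sfM sL) => //; apply: ratio_unr.
Qed.

Lemma phi_E x y : Un s x -> Un s y -> E (ph x y).
Proof. by move=> hx hy; apply: (trace_E s_gt0 hz); apply: phi_arg_unr. Qed.

Lemma phi_le x y : Un s x -> Un s y -> absv (ph x y) <= absv u * absv x * absv y.
Proof.
move=> hx hy; apply: le_trans (trace_le (phi_arg_unr hx hy)) _.
by rewrite !(avM Hp) eta_abs.
Qed.

(** The bound [phi_le] is sharp, so the dual of the norm |x| on the piece is |u| |x|. The witness is
    chosen to turn the argument of the trace into an element of unit trace. *)
Lemma phi_attained y : Un s y -> y != 0 -> exists x,
  [/\ Un s x, x != 0 & absv (ph x y) = absv u * absv x * absv y].
Proof.
move=> hy y0; have [x hx [x1 t1]] := trace_unit s_gt0 hz.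
have u0 := ratio_neq0; have he := eta_unr s_gt0 hz s hy.
have ey0 : et y != 0 by rewrite -(av_gt0 Hp) eta_abs // (av_gt0 Hp).
exists (x / (u * et y)); split.
- by apply: (sf_div sL) => //; apply: (sfM sL) => //; apply: ratio_unr.
- have x0 : x != 0 by rewrite -(av_gt0 Hp) x1 ltr01.
  by rewrite mulf_neq0 // invr_eq0 mulf_neq0.
have e : u * (x / (u * et y)) * et y = x by field; rewrite u0 ey0.
rewrite phi_ratio e t1 -(eta_abs hy).
by move/(congr1 absv): e; rewrite x1 !(avM Hp) => ->.
Qed.

Lemma trace_sg m x : Un s x -> trace sigma s (iter m sigma x) = trace sigma s x.
Proof.
move=> hx; elim: m => //= m <-; move: (iter m sigma x) (sg_unr s_gt0 hz m hx) => y hy.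
have hu (i : nat) : Eur (iter i sigma y) by apply: sg_ur; apply: unr_ur hy.
transitivity (sigma (trace sigma s y)).
  by rewrite /trace (fa_sum sur hs) //; apply: eq_bigr => i _; rewrite -iterS iterSr.
by apply: (su_sigmaE S); apply: (trace_E s_gt0 hz).
Qed.

(** eta fixes u and is an involution, so it exchanges the arguments for x, y and y, x; the trace
    absorbs the factor sigma^(s/2) of eta and leaves tau. *)
Lemma phi_herm x y : Un s x -> Un s y -> ph y x = tau (ph x y).
Proof.
move=> hx hy; have ua := phi_arg_unr hx hy; have uu := unr_ur ua.
rewrite !phi_ratio {2}/trace (fa_sum sur ht) => [|i _]; last exact: sg_ur.
transitivity (trace sigma s (tau (u * x * et y))); last first.
  by apply: eq_bigr => i _; rewrite tau_sg.
rewrite -[RHS](trace_sg s./2 (tau_unr s_gt0 hz ua)) -tau_sg //.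
rewrite -[tau (iter _ _ _)]/(et (u * x * et y)).
have h := heta s; have ur := unr_ur ratio_unr; have xr := unr_ur hx.
have yr : Eur (et y) by apply: (fa_mem h); apply: unr_ur hy.
by rewrite (faM h (sfM sur ur xr) yr) (faM h ur xr) ratio_eta eta_eta // mulrAC.
Qed.

(** y = u v eta(v) is fixed by eta, so for s = 2 its trace is y + tau y. Its valuation is even, so
    some even power c of Pi, which tau fixes, makes y/c a unit; tau (y/c) is congruent to y/c, and
    the trace is c times something congruent to the unit 2 y/c. *)
Lemma phi_anisotropic v (m : int) : (s <= 2)%N -> absv u = absv Pi ^ (m * 2) ->
  Un s v -> absv (ph v v) = absv u * absv v ^+ 2.
Proof.
move=> s2 um hv; have vu := unr_ur hv.
have [->|v0] := eqVneq v 0.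
  by rewrite (av0 Hp) expr0n mulr0; apply/eqP; rewrite eq_le ge0 andbT
   (le_trans (phi_le _ _)) ?(av0 Hp) ?mulr0 //; apply: (sf0 sL).
have [l hl] := unr_values s_gt0 hz hv v0.
pose y := u * v * et v.
have hy : Un s y by apply: phi_arg_unr.
have ey : et y = y.
  have h := heta s; have ur := unr_ur ratio_unr.
  have er : Eur (et v) by apply: (fa_mem h).
  by rewrite /y (faM h (sfM sur ur vu) er) (faM h ur vu) ratio_eta eta_eta // mulrAC.
have vyE : absv y = absv u * absv v * absv v.
  by rewrite /y (avM Hp) (avM Hp) eta_abs.
have vy : absv y = absv Pi ^ ((m + l) * 2).
  rewrite vyE um hl mulrDl expfzDr ?gt_eqF ?Pi_gt0 // -mulrA.
  by congr (_ * _); rewrite -exprz_exp.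
have -> : absv u * absv v ^+ 2 = absv y by rewrite vyE mulrA.
rewrite phi_ratio -/y; have [s1|s2'] : s = 1%N \/ s = 2%N by lia.
  by rewrite /trace s1 big_ord1.
have yr := unr_ur hy.
have sy : sigma y = tau y.
  rewrite -[in RHS]ey /Defs.eta s2' /= (su_tautau S) //; exact: (fa_mem hs).
have -> : trace sigma s y = y + tau y.
  by rewrite /trace s2' big_ord_recl big_ord1 /= sy.
pose c := Pi ^ ((m + l) * 2).
have Ec : E c by apply: (sfXz sE); exact: E_Pi.
have vc : absv c = absv y by rewrite vy (avXz Hp).
have c0 : c != 0 by rewrite -(av_gt0 Hp) vc vy exprz_gt0 // Pi_gt0.
have tc : tau c = c.
  have e1 (l' : int) : (-1) ^ (l' * 2) = 1 :> Omega.
    by rewrite [l' * 2]mulrC -exprz_exp -[X in X ^ l']/((-1) ^+ 2) sqrrN expr1n exp1rz.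
  by rewrite tau_PiX e1 mul1r.
have cr : Eur c by apply: EE.
have y0r : Eur (y / c) by apply: (sf_div sur).
have v1 : absv (y / c) = 1.
  by rewrite (avM Hp) (avV Hp) vc divff // -vc (av_eq0 Hp).
have -> : y + tau y = c * ((tau (y / c) - y / c) + 2%:R * (y / c)).
  by rewrite (fa_div Hp sur ht) // tc; field.
have v2 : absv (2%:R * (y / c)) = 1 by rewrite (avM Hp) (su_two S) v1 mulr1.
rewrite (avM Hp) (avD_eqr Hp) v2 ?mulr1 ?vc //.
by apply: (su_close S) => //; rewrite v1.
Qed.

Lemma zeta_eta : et z = z ^+ (q ^ s./2)%N.
Proof.
by rewrite /Defs.eta (zeta_sg s_gt0 hz) (faX Hp sur ht _ (zeta_ur s_gt0 hz)) (zeta_tau s_gt0 hz).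
Qed.

(** * The norm-one element xi on a piece of even degree *)

Section Even.
Hypothesis s_even : ~~ odd s.

Let r_gt0 : (0 < s./2)%N.
Proof. by have := s_gt0; have := even_halfK s_even; case: (s./2) => // <-. Qed.

Let q0 : (0 < q)%N. Proof. exact: ltn_trans (su_q S). Qed.

Definition xi := et z / z.

Lemma xi_pow : xi = z ^+ (q ^ s./2 - 1).
Proof.
have z0 : z != 0 by rewrite -(av_gt0 Hp) (zeta_v hz) ltr01.
have qs0 : (0 < q ^ s./2)%N by rewrite expn_gt0 q0.
by rewrite /xi zeta_eta -{1}(subnK qs0) exprD expr1 mulfK.
Qed.

Lemma xi_prim : ((q ^ s./2).+1).-primitive_root xi.
Proof.
have qs1 : (1 < q ^ s./2)%N.
  by rewrite -{1}(exp1n s./2) ltn_exp2r // (ltn_trans _ (su_q S)).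
have e : (q ^ s - 1 = (q ^ s./2).+1 * (q ^ s./2 - 1))%N.
  rewrite -{1}(even_halfK s_even) -addnn expnD.
  move: (q ^ s./2)%N qs1 => a; clear; nia.
have d : ((q ^ s./2).+1 %| q ^ s - 1)%N by rewrite e dvdn_mulr.
by have := dvdn_prim_root hz d; rewrite e mulKn // -xi_pow.
Qed.

Lemma xi_unr : Un s xi.
Proof.
by apply: (sf_div sL); [apply: (eta_unr s_gt0 hz)|]; exact: (zeta_in s_gt0 hz).
Qed.

Lemma xi_norm : xi * et xi = 1.
Proof.
have zr := zeta_ur s_gt0 hz; have h := heta s.
have z0 : z != 0 by rewrite -(av_gt0 Hp) (zeta_v hz) ltr01.
have ez0 : et z != 0 by rewrite (fa_eq0 Hp h).
rewrite /xi (fa_div Hp sur h) //; last exact: (fa_mem h).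
rewrite eta_eta; last exact: (zeta_in s_gt0 hz).
by field; rewrite z0 ez0.
Qed.

Lemma xi_unity : xi ^+ (q ^ s - 1) = 1.
Proof. by rewrite xi_pow (zX_unity hz). Qed.

Lemma xi_sub1 : absv (xi - 1) = 1.
Proof.
apply/eqP; rewrite eq_le; apply/andP; split.
  by rewrite (avB_le Hp) ?(av1 Hp) // (av_root_unity Hp (prim_order_gt0 hz) xi_unity).
rewrite leNgt; apply/negP => lt.
have e := su_unity S s_gt0 xi_unity (expr1n _ _) lt.
have := eq_prim_root_expr xi_prim 1 0; rewrite e expr1n eqxx.
by rewrite mod0n modn_small // ltnS expn_gt0 q0.
Qed.

Lemma xi_ortho : v_orthonormal absv E (fun i : 'I_s => xi ^+ i).
Proof.
apply: (su_powers S s_gt0 xi_unity) => i j hi hj /eqP.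
rewrite (eq_prim_root_expr xi_prim) => /eqP.
by apply: (pow_q_inj_mod (su_q S) r_gt0); rewrite even_halfK.
Qed.

Lemma xi_gen x : Un s x -> exists2 c : 'I_s -> Omega, (forall i, E (c i)) &
  x = \sum_i c i * xi ^+ i /\ forall i, absv (c i) <= absv x.
Proof.
move=> hx; have [_ bb _ _ _] := su_zeta S s_gt0 hz.
have xX i : Un s (xi ^+ i) by apply: (sfX sL); exact: xi_unr.
have [_ h _] := basis_change sE bb xX (v_orthonormal_free Hp xi_ortho).
have [c hc ex] := h x hx; exists c => //; split=> // i.
by rewrite ex; apply: (xi_ortho.2 c hc).
Qed.

End Even.
End Piece.
End Pieces.

(** * Split norms *)

Section SplitNorm.
Variables (R : realType) (p : nat) (Omega : closedFieldType) (absv : Omega -> R).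
Hypothesis Hp : padic_closure absv p.
Variable n : nat.
Implicit Types (x y : 'cV[Omega]_n) (P : 'M[Omega]_n) (c : 'I_n -> R).
Local Notation ge0 := (absv_ge0 Hp).

Lemma split_norm_ge P c x k : c k * absv ((invmx P *m x) k 0) <= split_norm absv P c x.
Proof. by rewrite /split_norm; apply: (le_bigmax_cond _ (fun k => c k * absv ((invmx P *m x) k 0))). Qed.

Lemma split_norm_le P c x (C : R) : 0 <= C ->
  (forall k, c k * absv ((invmx P *m x) k 0) <= C) -> split_norm absv P c x <= C.
Proof. by move=> C0 h; apply: bigmax_le. Qed.

Variables (P : 'M[Omega]_n) (c : 'I_n -> R).
Hypotheses (P_unit : P \in unitmx) (c_gt0 : forall k, 0 < c k).
Local Notation al := (split_norm absv P c).

Lemma split_norm_ge0 x : 0 <= al x.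
Proof. by rewrite /split_norm; elim/big_rec: _ => // k y _; rewrite le_max => ->; rewrite orbT. Qed.

Lemma split_normZ a x : al (a *: x) = absv a * al x.
Proof.
apply/eqP; rewrite eq_le; apply/andP; split.
  apply: split_norm_le => [|k]; first by rewrite mulr_ge0 ?ge0 ?split_norm_ge0.
  by rewrite -scalemxAr mxE (avM Hp) mulrCA ler_wpM2l ?ge0 // split_norm_ge.
have [->|a0] := eqVneq a 0; first by rewrite (av0 Hp) mul0r split_norm_ge0.
rewrite mulrC -ler_pdivlMr ?(av_gt0 Hp) //.
apply: split_norm_le => [|k]; first by rewrite divr_ge0 ?ge0 ?split_norm_ge0.
rewrite ler_pdivlMr ?(av_gt0 Hp) // -mulrA -(avM Hp) mulrC.
have -> : (invmx P *m x) k 0 * a = (invmx P *m (a *: x)) k 0.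
  by rewrite -scalemxAr [RHS]mxE mulrC.
by rewrite mulrC split_norm_ge.
Qed.

Lemma split_normD_le x y (C : R) : al x <= C -> al y <= C -> al (x + y) <= C.
Proof.
move=> hx hy; apply: split_norm_le => [|k].
  exact: le_trans (split_norm_ge0 x) hx.
rewrite mulmxDr mxE -ler_pdivlMl //; apply: (avD_le Hp); rewrite ler_pdivlMl //.
  exact: le_trans (split_norm_ge _ _ _ _) hx.
exact: le_trans (split_norm_ge _ _ _ _) hy.
Qed.

Lemma split_norm0 : al 0 = 0.
Proof. by rewrite -(scale0r 0) split_normZ (av0 Hp) mul0r. Qed.

Lemma split_norm_sum_le (I : Type) (r : seq I) (Q : pred I) (F : I -> 'cV_n) (C : R) :
  0 <= C -> (forall i, Q i -> al (F i) <= C) -> al (\sum_(i <- r | Q i) F i) <= C.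
Proof.
move=> C0 h; elim/big_ind: _ => //; first by rewrite split_norm0.
by move=> x y; apply: split_normD_le.
Qed.

Lemma split_norm_eq0 x : (al x == 0) = (x == 0).
Proof.
apply/eqP/eqP => [e|->]; last exact: split_norm0.
rewrite -[x](mulKVmx P_unit); apply/eqP; rewrite -(mulmx0 _ P); apply/eqP; congr (_ *m _).
apply/colP => k; rewrite [RHS]mxE; apply/eqP; rewrite -(av_eq0 Hp) eq_le ge0 andbT.
by rewrite -(ler_pM2l (c_gt0 k)) mulr0 -e split_norm_ge.
Qed.

Lemma split_norm_gt0 x : (0 < al x) = (x != 0).
Proof. by rewrite lt_def split_norm_ge0 andbT split_norm_eq0. Qed.

Lemma split_norm_col k : al (col k P) = c k.
Proof.
have e : invmx P *m col k P = delta_mx k 0.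
  by rewrite colE mulKmx.
apply/eqP; rewrite eq_le; apply/andP; split.
  apply: split_norm_le => [|l]; first exact: ltW.
  rewrite e mxE eqxx andbT; case: eqP => [->|_]; rewrite ?(av1 Hp) ?mulr1 //.
  by rewrite (av0 Hp) mulr0 ltW.
have := split_norm_ge P c (col k P) k.
by rewrite e mxE !eqxx (av1 Hp) mulr1.
Qed.

Lemma mul_col_sum (y : 'cV_n) : P *m y = \sum_k y k 0 *: col k P.
Proof.
apply/colP => i; rewrite mxE summxE; apply: eq_bigr => k _.
by rewrite !mxE mulrC.
Qed.

(** A split norm is the largest norm with given bounds on the columns of P. Comparisons of norms
    thereby reduce to finitely many vectors. *)
Lemma split_norm_max (be : 'cV[Omega]_n -> R) x : (forall a y, be (a *: y) = absv a * be y) ->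
  (forall (F : 'I_n -> 'cV_n) (C : R), 0 <= C -> (forall k, be (F k) <= C) -> be (\sum_k F k) <= C) ->
  (forall k, be (col k P) <= c k) -> be x <= al x.
Proof.
move=> beZ beS bec; rewrite -{1}[x](mulKVmx P_unit) mul_col_sum.
apply: beS => [|k]; first exact: split_norm_ge0.
rewrite beZ; apply: le_trans (split_norm_ge P c x k); rewrite mulrC.
by rewrite ler_wpM2r ?ge0.
Qed.

Lemma split_norm_bound : exists2 C : R, 0 < C & forall x k, absv (x k 0) <= C * al x.
Proof.
pose B := \sum_i \sum_k absv (P i k) / c k.
have t0 i k : 0 <= absv (P i k) / c k by rewrite divr_ge0 ?ge0 // ltW.
have B0 i k : absv (P i k) / c k <= B.
  rewrite /B (bigD1 i) //= (bigD1 k) //= -addrA lerDl addr_ge0 ?sumr_ge0 // => l _.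
  exact: sumr_ge0.
exists (B + 1).
  by rewrite ltr_wpDl ?ltr01 //; apply: sumr_ge0 => l _; apply: sumr_ge0.
move=> x i; rewrite -{1}[x](mulKVmx P_unit) mxE.
have b0 : 0 <= B by apply: sumr_ge0 => l _; apply: sumr_ge0.
apply: (av_sum_le Hp) => [|k _].
  by rewrite mulr_ge0 ?split_norm_ge0 // addr_ge0.
rewrite (avM Hp).
have -> : forall t, absv (P i k) * t = (absv (P i k) / c k) * (c k * t).
  by move=> t; rewrite mulrA divfK // gt_eqF.
apply: ler_pM; [exact: t0|by rewrite mulr_ge0 ?ge0 ?ltW| |exact: split_norm_ge].
by apply: le_trans (B0 i k) _; rewrite lerDl ler01.
Qed.

Lemma fixes_bounded : exists C : R, forall A : 'M[Omega]_n, fixes A al ->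
  forall k l, absv (A k l) <= C.
Proof.
have [C C0 hC] := split_norm_bound.
exists (C * \sum_l al (delta_mx l 0)) => A hA k l.
have := hC (A *m delta_mx l 0) k; rewrite -colE [in absv _]mxE => h.
apply: le_trans h _; rewrite ler_pM2l // colE hA.
rewrite (bigD1 l) //= lerDl; apply: sumr_ge0 => l' _.
exact: split_norm_ge0.
Qed.

Lemma split_norm_attained x : x != 0 -> exists k,
  (invmx P *m x) k 0 != 0 /\ al x = c k * absv ((invmx P *m x) k 0).
Proof.
move=> x0; have [k0 hk0] : exists k, (invmx P *m x) k 0 != 0.
  apply: contrapT => nk; case/eqP: x0; rewrite -[x](mulKVmx P_unit).
  suff -> : invmx P *m x = 0 by rewrite mulmx0.
  apply/colP => k; rewrite [RHS]mxE; apply/eqP/negPn/negP => hk; apply: nk; by exists k.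
pose F k := c k * absv ((invmx P *m x) k 0).
case: (@arg_maxP _ _ _ k0 xpredT F isT) => k _ hk.
have e : al x = F k.
  apply/eqP; rewrite eq_le split_norm_ge andbT; apply: split_norm_le => [|l].
    by rewrite mulr_ge0 ?ge0 // ltW.
  exact: hk.
exists k; split=> //; have := hk k0 isT; rewrite /F; apply: contraTneq => ->.
by rewrite (av0 Hp) mulr0 -ltNge mulr_gt0 // (av_gt0 Hp).
Qed.

Lemma split_norm_bounded x (C : R) : exists B : R,
  forall A : 'M[Omega]_n, (forall k l, absv (A k l) <= C) -> al (A *m x) <= B.
Proof.
pose D k := C * \sum_l absv (x l 0) * al (delta_mx k 0).
have [C0|Cn] := leP 0 C; last first.
  exists 0 => A hA; have -> : A *m x = 0; last by rewrite split_norm0.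
  apply/colP => k; have := le_lt_trans (hA k k) Cn; rewrite ltNge ge0 //.
have D0 k : 0 <= D k.
  by rewrite mulr_ge0 // sumr_ge0 // => l _; rewrite mulr_ge0 ?ge0 ?split_norm_ge0.
exists (\sum_k D k) => A hA.
have -> : A *m x = \sum_k (A *m x) k 0 *: delta_mx k 0.
  by rewrite {1}[A *m x]matrix_sum_delta; apply: eq_bigr => k _; rewrite big_ord1.
apply: split_norm_sum_le => [|k _]; first exact: sumr_ge0.
apply: (@le_trans _ _ (D k)); last by rewrite (bigD1 k) //= lerDl sumr_ge0.
rewrite split_normZ /D -mulr_suml mulrA ler_wpM2r ?split_norm_ge0 //.
rewrite mxE; apply: (av_sum_le Hp) => [|l _].
  by rewrite mulr_ge0 // sumr_ge0 // => l _; exact: ge0.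
rewrite (avM Hp) ler_pM ?ge0 // (bigD1 l) //= lerDl sumr_ge0 // => l' _.
exact: ge0.
Qed.

Lemma split_norm_small x (e : R) : 0 < e -> exists2 d : R, 0 < d &
  forall A : 'M[Omega]_n, (forall k l, absv (A k l) <= d) -> al (A *m x) <= e.
Proof.
move=> e0; pose X := \sum_l absv (x l 0); pose D := \sum_k al (delta_mx k 0).
have X0 : 0 <= X by apply: sumr_ge0 => l _; exact: ge0.
have D0 : 0 <= D by apply: sumr_ge0 => l _; exact: split_norm_ge0.
have X1 : 0 < X + 1 by rewrite ltr_wpDl ?ltr01.
have D1 : 0 < D + 1 by rewrite ltr_wpDl ?ltr01.
have d0 : 0 < e / ((X + 1) * (D + 1)) by rewrite divr_gt0 ?mulr_gt0.
exists (e / ((X + 1) * (D + 1))) => // A hA.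
have -> : A *m x = \sum_k (A *m x) k 0 *: delta_mx k 0.
  by rewrite {1}[A *m x]matrix_sum_delta; apply: eq_bigr => k _; rewrite big_ord1.
apply: split_norm_sum_le; first exact: ltW.
move=> k _; rewrite split_normZ.
have -> : e = e / ((X + 1) * (D + 1)) * (X + 1) * (D + 1).
  by field; rewrite !gt_eqF.
apply: ler_pM; [exact: ge0|exact: split_norm_ge0| |]; last first.
  rewrite /D (bigD1 k) //= -addrA lerDl addr_ge0 ?ler01 // sumr_ge0 // => l _.
  exact: split_norm_ge0.
rewrite mxE; apply: (av_sum_le Hp) => [|l _]; first by rewrite mulr_ge0 ?ltW.
rewrite (avM Hp) ler_pM ?ge0 // /X (bigD1 l) //= -addrA lerDl.
by rewrite addr_ge0 ?ler01 // sumr_ge0 // => l' _; exact: ge0.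
Qed.

End SplitNorm.

(** The columns of P and P' lie in E^n, and each norm is maximal for its own columns; so equality on
    E^n gives both inequalities on Omega^n. *)
Lemma split_norm_agree (R : realType) (p : nat) (Omega : closedFieldType) (absv : Omega -> R)
    (Hp : padic_closure absv p) (E : set Omega) n (P P' : 'M[Omega]_n) c c' :
  P \in unitmx -> P' \in unitmx -> mx_over E P -> mx_over E P' ->
  (forall k, 0 < c k) -> (forall k, 0 < c' k) ->
  (forall x, mx_over E x -> split_norm absv P c x = split_norm absv P' c' x) ->
  split_norm absv P c = split_norm absv P' c'.
Proof.
move=> uP uP' EP EP' c0 c0' h; apply/funext => x; apply/eqP; rewrite eq_le.
apply/andP; split; apply: (split_norm_max Hp) => //.
- by move=> a y; apply: (split_normZ Hp).
- by move=> F C C0 hF; apply: (split_norm_sum_le Hp).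
- move=> k; rewrite h; first by rewrite (split_norm_col Hp).
  by move=> i l; rewrite mxE.
- by move=> a y; apply: (split_normZ Hp).
- by move=> F C C0 hF; apply: (split_norm_sum_le Hp).
- move=> k; rewrite -h; first by rewrite (split_norm_col Hp).
  by move=> i l; rewrite mxE.
Qed.

(** * Hermitian spaces: Witt bases and affine roots *)

Lemma invmx_mul_unit (F : fieldType) n (A B : 'M[F]_n) : A \in unitmx -> B \in unitmx ->
  invmx (A *m B) = invmx B *m invmx A.
Proof.
move=> uA uB; have uAB : A *m B \in unitmx by rewrite unitmx_mul uA.
by apply: (can_inj (mulKmx uAB)); rewrite mulmxV // -mulmxA mulKVmx // mulmxV.
Qed.

Lemma sup_max (R : realType) (A : set R) M : A M -> (forall x, A x -> x <= M) -> sup A = M.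
Proof.
move=> AM ub; apply/eqP; rewrite eq_le; apply/andP; split.
  by apply: ge_sup; [exists M|exact: ub].
by apply: ub_le_sup => //; exists M; apply: ub.
Qed.

Lemma int_parity (m : int) : (exists a, m = a * 2) \/ (exists a, m = a * 2 + 1).
Proof.
have := divz_eq m 2; have := ltz_pmod m (isT : 0 < 2 :> int).
have := modz_ge0 m (isT : 2 != 0 :> int); case: (m %% 2)%Z => // -[|[|r]] // _ _ e.
  by left; exists (m %/ 2)%Z; rewrite {1}e addr0.
by right; exists (m %/ 2)%Z.
Qed.

Section Hermitian.
Variables (R : realType) (p : nat) (Omega : closedFieldType).
Variable absv : Omega -> R.
Variables (K E : set Omega) (q : nat) (tau sigma : Omega -> Omega) (Pi : Omega).
Hypothesis S : ramified_setup p absv K E q tau sigma Pi.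

Let Hp := su_Hp S.
Let sE := su_E S.
Let sur := su_ur S.
Let EE := su_Eur S.
Let ht := su_tau S.
Local Notation ge0 := (absv_ge0 Hp).
Local Notation Eur := (max_unr absv E).

Variable n : nat.
Implicit Types (x y w : 'cV[Omega]_n).

Lemma map_tau_delta (l : 'I_n) :
  map_mx tau (delta_mx l 0 : 'cV[Omega]_n) = (delta_mx l 0 : 'cV[Omega]_n).
Proof.
apply/colP => i; rewrite !mxE; case: (_ && _); last exact: (fa0 sur ht).
exact: (fa1 Hp sur ht).
Qed.

Lemma entry_delta (M : 'M[Omega]_n) (k l : 'I_n) :
  ((delta_mx k 0 : 'cV_n)^T *m M *m (delta_mx l 0 : 'cV_n)) 0 0 = M k l.
Proof. by rewrite trmx_delta -rowE -colE !mxE. Qed.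

Lemma map_tau_mul m l (A : 'M[Omega]_(m, n)) (B : 'M[Omega]_(n, l)) :
  mx_over Eur A -> mx_over Eur B -> map_mx tau (A *m B) = map_mx tau A *m map_mx tau B.
Proof.
move=> EA EB; apply/matrixP => i k; rewrite !mxE (fa_sum sur ht) => [|t _]; last exact: (sfM sur).
by apply: eq_bigr => t _; rewrite !mxE (faM ht).
Qed.

Variable H : 'M[Omega]_n.
Local Notation h := (herm_form tau H).

Lemma herm_delta k l : h (delta_mx k 0) (delta_mx l 0) = H k l.
Proof. by rewrite /herm_form map_tau_delta entry_delta. Qed.

Lemma unitary_isometry (F : set Omega) A : F `<=` Eur -> mx_over F A -> A \in unitmx ->
  (forall k l, h (A *m delta_mx k 0) (A *m delta_mx l 0) = h (delta_mx k 0) (delta_mx l 0)) ->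
  unitary tau H F A.
Proof.
move=> FE EA uA hA; split=> //; apply/matrixP => k l.
rewrite -[RHS]herm_delta -hA /herm_form trmx_mul map_tau_mul.
- by rewrite map_tau_delta -[LHS]entry_delta !mulmxA.
- by move=> i i'; apply: FE.
- exact: (mxo_delta sur).
Qed.

Lemma unitary_herm A x y : unitary tau H E A -> mx_over E y -> h (A *m x) (A *m y) = h x y.
Proof.
move=> [EA _ hA] Ey; rewrite /herm_form trmx_mul map_tau_mul; last 2 first.
- by move=> i k; apply: EE.
- by move=> i k; apply: EE.
by rewrite -{2}hA !mulmxA.
Qed.

Lemma herm_formE x y : h x y = \sum_k \sum_l x k 0 * H k l * tau (y l 0).
Proof.
rewrite /herm_form mxE exchange_big /=; apply: eq_bigr => l _.
by rewrite !mxE mulr_suml; apply: eq_bigr => k _; rewrite mxE.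
Qed.

Lemma herm_Dl x y w : h (x + y) w = h x w + h y w.
Proof. by rewrite /herm_form linearD /= !mulmxDl mxE. Qed.

Lemma herm_Zl a x w : h (a *: x) w = a * h x w.
Proof. by rewrite /herm_form linearZ /= -!scalemxAl mxE. Qed.

Lemma herm_0l w : h 0 w = 0.
Proof. by rewrite -(scale0r 0) herm_Zl mul0r. Qed.

Lemma herm_suml (I : Type) (r : seq I) (Q : pred I) (F : I -> 'cV_n) w :
  h (\sum_(i <- r | Q i) F i) w = \sum_(i <- r | Q i) h (F i) w.
Proof. by apply: (big_morph (h^~ w)) => [x y|]; rewrite ?herm_Dl ?herm_0l. Qed.

Lemma herm_Bl x y w : h (x - y) w = h x w - h y w.
Proof. by rewrite herm_Dl -scaleN1r herm_Zl mulN1r. Qed.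

Hypotheses (HE : mx_over E H) (Hsym : forall k l, H l k = tau (H k l)).

Lemma herm_E x y : mx_over E x -> mx_over E y -> E (h x y).
Proof.
move=> Ex Ey; rewrite herm_formE; apply: (sf_sum sE) => k _; apply: (sf_sum sE) => l _.
by apply: (sfM sE); [apply: (sfM sE)|apply: (su_tauE S)].
Qed.

Lemma herm_sym x y : mx_over E x -> mx_over E y -> h y x = tau (h x y).
Proof.
move=> Ex Ey; have tE a : E a -> Eur (tau a) by move=> Ea; apply: EE; apply: (su_tauE S).
rewrite !herm_formE (fa_sum sur ht) => [|k _]; last first.
  by apply: (sf_sum sur) => l _; do 2?apply: (sfM sur); [exact: EE|exact: EE|exact: tE].
rewrite exchange_big /=; apply: eq_bigr => k _.
rewrite (fa_sum sur ht) => [|l _]; last first.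
  by do 2?apply: (sfM sur); [exact: EE|exact: EE|exact: tE].
apply: eq_bigr => l _; rewrite (faM ht (sfM sur (EE (Ex _ _)) (EE (HE _ _))) (tE _ (Ey _ _))).
rewrite (faM ht (EE (Ex _ _)) (EE (HE _ _))) -Hsym (su_tautau S (EE (Ey _ _))).
ring.
Qed.

Lemma tauE_abs a : E a -> absv (tau a) = absv a.
Proof. by move=> Ea; apply: (fa_abs ht); apply: EE. Qed.

Lemma herm_Zr a x w : E a -> mx_over E x -> mx_over E w -> h w (a *: x) = tau a * h w x.
Proof.
move=> Ea Ex Ew; rewrite herm_sym //; last exact: (mxoZ sE).
rewrite herm_Zl (faM ht (EE Ea)) -?herm_sym //; apply: EE; exact: herm_E.
Qed.

Lemma herm_Dr x y w : mx_over E x -> mx_over E y -> mx_over E w ->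
  h w (x + y) = h w x + h w y.
Proof.
move=> Ex Ey Ew; rewrite herm_sym //; last exact: (mxoD sE).
by rewrite herm_Dl (faD ht) -?herm_sym //; apply: EE; apply: herm_E.
Qed.

Lemma herm_0r w : h w 0 = 0.
Proof.
rewrite /herm_form (_ : map_mx tau 0 = 0) ?mulmx0 ?mxE //.
by apply/colP => k; rewrite !mxE (fa0 sur ht).
Qed.

Lemma herm_abs_sym x y : mx_over E x -> mx_over E y -> absv (h y x) = absv (h x y).
Proof. by move=> Ex Ey; rewrite herm_sym // tauE_abs //; apply: herm_E. Qed.

Lemma herm_diag_K x : mx_over E x -> K (h x x).
Proof. by move=> Ex; apply: (su_fix S); [apply: herm_E|rewrite -herm_sym]. Qed.

(** Invertibility is automatic: a kernel vector over E would be orthogonal to everything. *)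
Lemma isometry_unitary A : (forall y, mx_over E y -> y != 0 -> exists2 x, mx_over E x & h x y != 0) ->
  mx_over E A -> (forall x y, mx_over E x -> mx_over E y -> h (A *m x) (A *m y) = h x y) ->
  unitary tau H E A.
Proof.
move=> nd EA hA; apply: unitary_isometry => //; last first.
  by move=> k l; apply: hA; apply: (mxo_delta sE).
rewrite -unitmx_tr unitmxE unitfE; apply/eqP => /(det0_over sE (mxo_tr EA)).
move=> [v [v0 Ev vA]].
have Av : A *m v^T = 0 by rewrite -[A]trmxK -trmx_mul vA trmx0.
have Ev' : mx_over E v^T by apply: mxo_tr.
have [|x Ex] := nd v^T Ev'; first by rewrite trmx_eq0.
by rewrite -hA // Av herm_0r ?eqxx //; apply: (mxo_mul sE).
Qed.

(** * Hermitian spaces with a self-dual norm whose duality is attained *)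

Variables (Q0 : 'M[Omega]_n) (c0 : 'I_n -> R).
Hypotheses (Q0_E : mx_over E Q0) (Q0_unit : Q0 \in unitmx) (c0_gt0 : forall k, 0 < c0 k).
Local Notation al := (split_norm absv Q0 c0).
Hypotheses (h_le : forall x y, mx_over E x -> mx_over E y -> absv (h x y) <= al x * al y)
  (h_attained : forall y, mx_over E y -> y != 0 ->
     exists x, [/\ mx_over E x, x != 0 & absv (h x y) = al x * al y]).

Let al_ge0 x : 0 <= al x. Proof. exact: split_norm_ge0. Qed.
Let al_gt0 x : (0 < al x) = (x != 0). Proof. exact: (split_norm_gt0 Hp). Qed.
Let alZ a x : al (a *: x) = absv a * al x. Proof. exact: (split_normZ Hp). Qed.
Let alD x y (C : R) : al x <= C -> al y <= C -> al (x + y) <= C.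
Proof. exact: (split_normD_le Hp). Qed.

Lemma herm_nondeg y : mx_over E y -> y != 0 -> exists2 x, mx_over E x & h x y != 0.
Proof.
move=> Ey y0; have [x [Ex x0 e]] := h_attained Ey y0; exists x => //.
by rewrite -(av_gt0 Hp) e mulr_gt0 ?al_gt0.
Qed.

(** A contracting isometry preserves the norm: if x attains duality for y, then al x al y = |h(Ax,
    Ay)| <= al x al(Ay). Later arguments therefore need only one inequality. *)
Lemma isometry_fixes A : unitary tau H E A ->
  (forall x, mx_over E x -> al (A *m x) <= al x) -> fixes A al.
Proof.
move=> uA hA; have [EA unA _] := uA.
have EAx x : mx_over E x -> mx_over E (A *m x) by move=> Ex; apply: (mxo_mul sE).
have e x : al (A *m x) = split_norm absv (invmx A *m Q0) c0 x.
  by rewrite /split_norm invmx_mul_unit ?unitmx_inv // invmxK; apply: eq_bigr => k _; rewrite mulmxA.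
suff ee : split_norm absv (invmx A *m Q0) c0 = al by move=> x; rewrite e ee.
apply: (@split_norm_agree _ _ _ _ Hp E) => //.
- by rewrite unitmx_mul unitmx_inv unA.
- by apply: (mxo_mul sE) => //; apply: (mxo_inv sE).
move=> y Ey; rewrite -e; apply/eqP; rewrite eq_le hA //=.
have [->|y0] := eqVneq y 0; first by rewrite (split_norm0 Hp).
have [x [Ex x0 ex]] := h_attained Ey y0.
have ax : 0 < al x by rewrite al_gt0.
rewrite -(ler_pM2l ax) -ex -(unitary_herm x uA Ey).
apply: le_trans (h_le (EAx _ Ex) (EAx _ Ey)) _.
by rewrite ler_wpM2r ?hA.
Qed.

(** * Siegel transformations attached to an isotropic vector *)

Section Siegel.
Variables (e v : 'cV[Omega]_n) (t : Omega).
Hypotheses (Ee : mx_over E e) (Ev : mx_over E v) (Et : E t) (tau_t : tau t = - t)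
  (he0 : h e e = 0) (hev : h e v = 0).
Let w := t - h v v / 2%:R.

(** The unipotent isometry sending x to x + h(x,e) v + (w h(x,e) - h(x,v)) e. The isometry condition
    is w + tau w = - h(v,v); the solutions w differ by elements t of trace zero. *)
Definition siegel : 'M[Omega]_n :=
  1%:M + v *m (H *m map_mx tau e)^T - e *m (H *m map_mx tau v)^T
    + w *: (e *m (H *m map_mx tau e)^T).

Lemma rank_one_mul (a b x : 'cV[Omega]_n) : a *m (H *m map_mx tau b)^T *m x = h x b *: a.
Proof.
rewrite -mulmxA.
have -> : (H *m map_mx tau b)^T *m x = (x^T *m (H *m map_mx tau b))^T.
  by rewrite [RHS]trmx_mul trmxK.
apply/colP => k; rewrite [LHS]mxE big_ord1 [X in _ * X]mxE mulrC [RHS]mxE.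
by rewrite /herm_form -mulmxA.
Qed.

Lemma siegel_mul x : siegel *m x = x + h x e *: v + (w * h x e - h x v) *: e.
Proof.
rewrite /siegel !mulmxDl mul1mx mulNmx -scalemxAl !rank_one_mul [(w * _ - _) *: e]scalerBl -[(w * _) *: e]scalerA.
by rewrite -!addrA; congr (_ + (_ + _)); rewrite addrC.
Qed.

Let Ew : E w.
Proof.
apply: (sfB sE) => //; apply: (sf_div sE); first exact: herm_E.
exact: (sf_nat sE).
Qed.

Lemma siegel_E : mx_over E siegel.
Proof.
have r a b : mx_over E a -> mx_over E b -> mx_over E (a *m (H *m map_mx tau b)^T).
  move=> Ea Eb; apply: (mxo_mul sE) => //; apply: mxo_tr; apply: (mxo_mul sE) => //.
  by move=> i k; rewrite mxE; apply: (su_tauE S).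
apply: (mxoD sE); last by apply: (mxoZ sE) => //; apply: r.
apply: (mxoB sE); last exact: r.
by apply: (mxoD sE); [apply: (mxo_scalar sE); apply: (sf1 sE)|apply: r].
Qed.

Lemma siegel_unitary : unitary tau H E siegel.
Proof.
apply: isometry_unitary => [||x y Ex Ey]; [exact: herm_nondeg|exact: siegel_E|].
have hve : h v e = 0 by rewrite herm_sym // hev (fa0 sur ht).
have EZ a x' : E a -> mx_over E x' -> mx_over E (a *: x') by apply: (mxoZ sE).
have hE := herm_E; have Ec x' : mx_over E x' -> E (w * h x' e - h x' v).
  by move=> Ex'; apply: (sfB sE); [apply: (sfM sE)|]; auto.
have Ey1 : mx_over E (y + h y e *: v) by apply: (mxoD sE) => //; auto.
have tw : tau w + h v v + w = 0.
  have tvv := herm_sym Ev Ev.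
  rewrite /w (faD ht (EE Et)); last first.
    by apply: (sfN sur); apply: EE; apply: (sf_div sE); [auto|exact: (sf_nat sE)].
  rewrite tau_t (faN sur ht); last first.
    by apply: EE; apply: (sf_div sE); [auto|exact: (sf_nat sE)].
  have tau2 : tau 2%:R = 2%:R.
    by rewrite -natr1 (faD ht (sf1 sur) (sf1 sur)) (fa1 Hp sur ht).
  rewrite (fa_div Hp sur ht) //; last 2 first.
  - by apply: EE; apply: hE.
  - exact: (sf_nat sur).
  rewrite tau2 -tvv; field; rewrite -(av_gt0 Hp) (su_two S); exact: ltr01.
rewrite !siegel_mul !herm_Dl !herm_Zl !(herm_Dr Ey1) ?(herm_Dr Ey) ?herm_Zr //; auto.
have ue a b : mx_over E a -> mx_over E b -> Eur (h a b) by move=> Ea Eb; apply: EE; apply: hE.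
have uw : Eur w by apply: EE.
rewrite hev hve he0 (faB sur ht) ?(faM ht) //; [|by apply: ue..|by apply: (sfM sur) => //; apply: ue|by apply: ue].
have -> : tau w = - h v v - w.
  by apply/eqP; rewrite -subr_eq0 -(eqP (introT eqP tw)); apply/eqP; ring.
rewrite -!herm_sym //; ring.
Qed.
End Siegel.

(** * Witt bases that split the given norm *)

Section Witt.

Definition pairing a k := if (k < a.*2)%N then (if odd k then k.-1 else k.+1) else k.

Lemma pairing_lt a m k : (a.*2 <= m)%N -> (k < m)%N -> (pairing a k < m)%N.
Proof.
rewrite /pairing => am km; case: ifP => // ka; case: ifP => ok.
  by apply: leq_ltn_trans km; apply: leq_pred.
by apply: leq_trans am; rewrite ltn_neqAle ka andbT; apply/eqP => e; move: (odd_double a); rewrite -e /= ok.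
Qed.

Lemma pairingK a : involutive (pairing a).
Proof.
move=> k; rewrite /pairing; case: (ltnP k a.*2) => ka; last by rewrite ltnNge ka.
have := pairing_lt (leqnn a.*2) ka; rewrite /pairing ka; case: ifP => ok h; rewrite h.
  by case: k ok {ka h} => //= k /negPf->.
by rewrite /= ok /=.
Qed.

(* Vectors 2i and 2i + 1, for i < a, form hyperbolic pairs; the others are
   anisotropic and pairwise orthogonal. *)
Record frame a m (e : nat -> 'cV[Omega]_n) : Prop := Frame {
  fr_le : (a.*2 <= m)%N;
  fr_E : forall k, mx_over E (e k);
  fr_orth : forall k l, (k < m)%N -> (l < m)%N -> l != pairing a k -> h (e k) (e l) = 0;
  fr_pair : forall k, (k < a.*2)%N -> h (e k) (e (pairing a k)) = 1;
  fr_al : forall k, (k < m)%N ->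
    absv (h (e k) (e (pairing a k))) = al (e k) * al (e (pairing a k));
  fr_nz : forall k, (k < m)%N -> e k != 0 }.

Definition perp m (e : nat -> 'cV[Omega]_n) x := forall k, (k < m)%N -> h x (e k) = 0.

Section Frame.
Variables (a m : nat) (e : nat -> 'cV[Omega]_n).
Hypothesis fr : frame a m e.
Local Notation nu := (pairing a).

Let nu_lt k : (k < m)%N -> (nu k < m)%N. Proof. by apply: pairing_lt; case: fr. Qed.
Let Ee k : mx_over E (e k). Proof. by case: fr. Qed.

(** The coefficient along e k is read off by pairing with its partner, the only frame vector not
    orthogonal to it. *)
Definition fcoef k y := h y (e (nu k)) / h (e k) (e (nu k)).
Definition fspan y := \sum_(k < m) fcoef k y *: e k.

Let d_gt0 k : (k < m)%N -> 0 < absv (h (e k) (e (nu k))).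
Proof. by move=> km; rewrite (fr_al fr km) mulr_gt0 ?al_gt0 ?(fr_nz fr) // nu_lt. Qed.
Let d_neq0 k : (k < m)%N -> h (e k) (e (nu k)) != 0.
Proof. by move=> km; rewrite -(av_gt0 Hp) d_gt0. Qed.

Lemma fcoef_E k y : mx_over E y -> E (fcoef k y).
Proof. by move=> Ey; apply: (sf_div sE); apply: herm_E. Qed.

Lemma fspan_E y : mx_over E y -> mx_over E (fspan y).
Proof. by move=> Ey; apply: (mxo_sum sE) => k _; apply: (mxoZ sE) => //; apply: fcoef_E. Qed.

(** Partners pair as strongly as al permits, by [fr_al]; this cancels the norms of the frame
    vectors, so projecting to a frame vector does not increase al. *)
Lemma fcoef_le k y : (k < m)%N -> mx_over E y -> al (fcoef k y *: e k) <= al y.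
Proof.
move=> km Ey; rewrite alZ /fcoef (avM Hp) (avV Hp) (fr_al fr km).
have e1 : 0 < al (e k) by rewrite al_gt0 (fr_nz fr).
have e2 : 0 < al (e (nu k)) by rewrite al_gt0 (fr_nz fr) ?nu_lt.
have -> : absv (h y (e (nu k))) / (al (e k) * al (e (nu k))) * al (e k) =
    absv (h y (e (nu k))) / al (e (nu k)) by field; rewrite !gt_eqF.
by rewrite ler_pdivrMr // h_le.
Qed.

Lemma fspan_le y : mx_over E y -> al (fspan y) <= al y.
Proof.
by move=> Ey; apply: (split_norm_sum_le Hp) => // k _; apply: fcoef_le.
Qed.

Lemma herm_comb (c : 'I_m -> Omega) (l : 'I_m) :
  h (\sum_k c k *: e k) (e (nu l)) = c l * h (e l) (e (nu l)).
Proof.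
rewrite herm_suml (bigD1 l) //= herm_Zl big1 ?addr0 // => k kl.
rewrite herm_Zl (fr_orth fr) ?mulr0 ?nu_lt //.
by rewrite (inj_eq (inv_inj (pairingK a))) eq_sym.
Qed.

Lemma perp_proj y : perp m e (y - fspan y).
Proof.
move=> k km; rewrite herm_Bl -[k](pairingK a) (herm_comb _ (Ordinal (nu_lt km))) /=.
by rewrite divfK ?subrr // d_neq0 // nu_lt.
Qed.

Lemma proj_E y : mx_over E y -> mx_over E (y - fspan y).
Proof. by move=> Ey; apply: (mxoB sE) => //; apply: fspan_E. Qed.

Lemma proj_le y : mx_over E y -> al (y - fspan y) <= al y.
Proof.
by move=> Ey; apply: alD => //; rewrite -scaleN1r alZ (avN Hp) (av1 Hp) mul1r fspan_le.
Qed.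

Lemma herm_proj y x : mx_over E x -> mx_over E y -> perp m e x -> h (y - fspan y) x = h y x.
Proof.
move=> Ex Ey px; rewrite herm_Bl herm_suml big1 ?subr0 // => k _.
by rewrite herm_Zl herm_sym // px // (fa0 sur ht) mulr0.
Qed.

(** The orthogonal complement of a frame is again self-dual: projecting a vector that attains
    duality keeps its pairing with y and does not increase its norm, so it still attains duality. *)
Lemma perp_attained y : mx_over E y -> y != 0 -> perp m e y ->
  exists x, [/\ mx_over E x, x != 0, perp m e x & absv (h x y) = al x * al y].
Proof.
move=> Ey y0 py; have [x [Ex x0 ex]] := h_attained Ey y0.
have ay : 0 < al y by rewrite al_gt0.
have ee := herm_proj Ey Ex py.
have ge : al x <= al (x - fspan x).
  rewrite -(ler_pM2r ay) -ex -ee; apply: h_le => //; exact: proj_E.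
have eq : al (x - fspan x) = al x by apply/eqP; rewrite eq_le ge proj_le.
exists (x - fspan x); split; [exact: proj_E| |exact: perp_proj|by rewrite ee ex eq].
by rewrite -al_gt0 eq al_gt0.
Qed.

Lemma frame_size : (m <= n)%N.
Proof.
pose P : 'M[Omega]_(n, m) := \matrix_(i, k) e k i 0.
pose Q : 'M[Omega]_(m, n) := \matrix_(k, i) fcoef k (delta_mx i 0).
have QP : Q *m P = 1%:M.
  apply/matrixP => k l; rewrite !mxE.
  transitivity (fcoef k (e l)).
    rewrite /fcoef [e l in RHS]matrix_sum_delta.
    rewrite herm_suml mulr_suml; apply: eq_bigr => i _.
    by rewrite big_ord1 herm_Zl !mxE mulrC mulrA.
  have [->|kl] := eqVneq k l; first by rewrite /fcoef divff // d_neq0.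
  rewrite /fcoef (fr_orth fr) ?mul0r ?nu_lt //.
  by rewrite (inj_eq (inv_inj (pairingK a))).
exact: mulmx1_min QP.
Qed.
End Frame.

Let tau1 : tau 1 = 1. Proof. exact: (fa1 Hp sur ht). Qed.
Let two0 : 2%:R != 0 :> Omega. Proof. by rewrite -(av_gt0 Hp) (su_two S) ltr01. Qed.
Lemma perp_comb a m e x y c d : frame a m e -> mx_over E x -> mx_over E y ->
  perp m e x -> perp m e y -> perp m e (c *: x + d *: y).
Proof.
by move=> fr Ex Ey px py k km; rewrite herm_Dl !herm_Zl px // py // !mulr0 addr0.
Qed.

Lemma perp_dual a m e y : frame a m e -> mx_over E y -> y != 0 -> perp m e y ->
  exists x, [/\ mx_over E x, perp m e x, h x y = 1, h y x = 1 & al x * al y = 1].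
Proof.
move=> fr Ey y0 py; have [z [Ez z0 pz e1]] := perp_attained fr Ey y0 py.
have d0 : h z y != 0 by rewrite -(av_gt0 Hp) e1 mulr_gt0 ?al_gt0.
have hc : h ((h z y)^-1 *: z) y = 1 by rewrite herm_Zl mulVf.
have Ex : mx_over E ((h z y)^-1 *: z).
  by apply: (mxoZ sE) => //; apply: (sfV sE); apply: herm_E.
exists ((h z y)^-1 *: z); split=> //.
- by move=> k km; rewrite herm_Zl pz // mulr0.
- by rewrite herm_sym // hc.
- by rewrite alZ -mulrA -e1 (avV Hp) mulVf // (av_eq0 Hp).
Qed.

(** Subtract h(z,z)/2 times x from the dual vector z. As al x al z = 1 and 2 is a unit, the
    correction is not longer than z. *)
Lemma isotropic_dual a m e x : frame a m e -> mx_over E x -> x != 0 -> perp m e x ->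
  h x x = 0 -> exists z, [/\ mx_over E z, perp m e z, h z z = 0, h x z = 1 & al x * al z = 1].
Proof.
move=> fr Ex x0 px hxx; have [z [Ez pz hzx hxz az]] := perp_dual fr Ex x0 px.
set c := h z z / 2%:R.
have Kc : K c by apply: (sf_div (su_K S)); [apply: herm_diag_K|apply: (sf_nat (su_K S))].
have Ec : E c by apply: (su_KE S).
have Ecx : mx_over E (- c *: x) by apply: (mxoZ sE) => //; apply: (sfN sE).
have tc : tau (- c) = - c by rewrite (faN sur ht) ?(su_tauK S) //; apply: EE.
have Ez' : mx_over E (z + - c *: x) by apply: (mxoD sE).
have hxz' : h x (z + - c *: x) = 1.
  by rewrite herm_Dr // herm_Zr //; [rewrite hxx mulr0 addr0|apply: (sfN sE)].
have ax : 0 < al x by rewrite al_gt0.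
have az0 : 0 < al z by rewrite -(pmulr_lgt0 _ ax) az ltr01.
exists (z + - c *: x); split=> //.
- by have := perp_comb 1 (- c) fr Ez Ex pz px; rewrite scale1r.
- rewrite herm_Dl herm_Zl hxz' mulr1 herm_Dr // herm_Zr //; last exact: (sfN sE).
  by rewrite tc hzx mulr1 /c; field.
- apply/eqP; rewrite eq_le; apply/andP; split; last first.
    by rewrite -(av1 Hp) -hxz' h_le.
  rewrite -az mulrC ler_wpM2r ?(ltW ax) //; apply: alD => //.
  rewrite alZ (avN Hp) /c (avM Hp) (avV Hp) (su_two S) invr1 mulr1.
  apply: (@le_trans _ _ (al z * al z * al x)); first by rewrite ler_wpM2r ?h_le.
  by rewrite -mulrA az mulr1.
Qed.

Lemma pairingS a k : (k < a.*2)%N -> pairing a.+1 k = pairing a k.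
Proof. by move=> ka; rewrite /pairing ka doubleS ltnW // ltnW. Qed.

Lemma pairing_new a : pairing a.+1 a.*2 = a.*2.+1 /\ pairing a.+1 a.*2.+1 = a.*2.
Proof. by rewrite /pairing doubleS ltnSn ltnW //= odd_double. Qed.

Lemma extend_pair a e x : frame a a.*2 e -> mx_over E x -> x != 0 -> perp a.*2 e x ->
  h x x = 0 -> exists e', frame a.+1 a.+1.*2 e'.
Proof.
move=> fr Ex x0 px hxx; have [z [Ez pz hzz hxz axz]] := isotropic_dual fr Ex x0 px hxx.
pose e' k := if (k < a.*2)%N then e k else if k == a.*2 then x else z.
have e1 k : (k < a.*2)%N -> e' k = e k by rewrite /e' => ->.
have e2 : e' a.*2 = x by rewrite /e' ltnn eqxx.
have e3 : e' a.*2.+1 = z by rewrite /e' ltnNge leqnSn /= gtn_eqF.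
have [n2 n3] := pairing_new a.
have hzx : h z x = 1 by rewrite herm_sym // hxz.
have cases k : (k < a.+1.*2)%N -> [\/ (k < a.*2)%N, k = a.*2 | k = a.*2.+1].
  rewrite doubleS !ltnS leq_eqVlt => /orP[/eqP|]; first by constructor 3.
  rewrite ltnS leq_eqVlt => /orP[/eqP|]; first by constructor 2.
  by constructor 1.
have az : al z != 0 by apply/eqP => az; move: axz; rewrite az mulr0 => /eqP; rewrite eq_sym oner_eq0.
have nlt k : (k < a.*2)%N -> (pairing a k < a.*2)%N by apply: pairing_lt.
have hs k y : mx_over E y -> perp a.*2 e y -> (k < a.*2)%N -> h (e k) y = 0.
  by move=> Ey py ka; rewrite herm_sym ?py ?(fa0 sur ht) //; apply: (fr_E fr).
exists e'; split=> //.
- by move=> k; rewrite /e'; do 2?case: ifP => _ //; apply: (fr_E fr).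
- move=> k l /cases[ka|->|->] /cases[la|->|->]; rewrite ?n2 ?n3 ?eqxx // ?e2 ?e3 ?e1 //; auto.
  by rewrite pairingS //; apply: (fr_orth fr).
- move=> k /cases[ka|->|->]; rewrite ?n2 ?n3 ?e2 ?e3 //.
  by rewrite pairingS // !e1 ?nlt //; apply: (fr_pair fr).
- move=> k /cases[ka|->|->]; rewrite ?n2 ?n3 ?e2 ?e3.
  + by rewrite pairingS // !e1 ?nlt //; apply: (fr_al fr).
  + by rewrite hxz (av1 Hp).
  + by rewrite hzx (av1 Hp) mulrC.
- move=> k /cases[ka|->|->]; rewrite ?e2 ?e3 // ?e1 //; first exact: (fr_nz fr).
  by rewrite -al_gt0 lt_def al_ge0 az.
Qed.

(** Only the complement of the hyperbolic part is meant, so the property survives when single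
    vectors are added to the frame. *)
Definition anisotropic a (e : nat -> 'cV[Omega]_n) := forall x, mx_over E x -> x != 0 ->
  perp a.*2 e x -> h x x != 0.

(** Were both x and its dual y shorter under h than al allows, the plane they span would be
    hyperbolic modulo smaller terms, and its isotropic line would lift to K, against anisotropy. *)
Lemma diag_attained a m e y : frame a m e -> anisotropic a e -> mx_over E y -> y != 0 ->
  perp m e y -> exists x, [/\ mx_over E x, perp m e x, x != 0 & absv (h x x) = al x * al x].
Proof.
move=> fr an Ey y0 py; have [x [Ex px hxy hyx ax]] := perp_dual fr Ey y0 py.
have y1 : 0 < al y by rewrite al_gt0.
have x1 : 0 < al x by rewrite -(pmulr_lgt0 _ y1) ax ltr01.
have x0 : x != 0 by rewrite -al_gt0.
have [ey|ny] := eqVneq (absv (h y y)) (al y * al y); first by exists y.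
have [ex|nx] := eqVneq (absv (h x x)) (al x * al x); first by exists x.
have ly : absv (h y y) < al y * al y by rewrite lt_neqAle ny h_le.
have lx : absv (h x x) < al x * al x by rewrite lt_neqAle nx h_le.
exfalso; set A := h x x in lx; set B := h y y in ly.
have KA : K A by apply: herm_diag_K.
have KB : K B by apply: herm_diag_K.
have AB : absv (A * B) < 1.
  have -> : 1 = (al x * al x) * (al y * al y) by rewrite mulrACA ax mulr1.
  by rewrite (avM Hp) ltr_pM ?ge0.
(* A root of A + 2 c + B c^2 makes x + c y isotropic. *)
have [s hs] : exists s, s ^+ 2 = 1 - A * B.
  have [s] := @solve_monicpoly Omega 2 (fun i => if i == 0%N then 1 - A * B else 0) isT.
  by rewrite !big_ord_recl big_ord0 /= expr0 mulr1 mul0r !addr0; exists s.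
(* (s - 1)(s + 1) = - A B is small, so one factor is; replacing s by - s makes it the first. *)
wlog s1 : s hs / absv (s - 1) < 1.
  move=> W; have pr : absv (s - 1) * absv (s + 1) < 1.
    rewrite -(avM Hp) (_ : _ * _ = s ^+ 2 - 1); last by ring.
    by rewrite hs addrAC subrr add0r (avN Hp).
  have [l|g] := ltP (absv (s - 1)) 1; first exact: W s hs l.
  have [l|g'] := ltP (absv (s + 1)) 1.
    by apply: (W (- s)); rewrite ?sqrrN // -opprD (avN Hp).
  by have := mulr_ege1 g g'; rewrite leNgt pr.
have Ks : K s.
  apply: (su_sqrt S) => //; rewrite hs; apply: (sfB (su_K S)); first exact: (sf1 (su_K S)).
  exact: (sfM (su_K S)).
have vs : absv (1 + s) = 1.
  rewrite (_ : 1 + s = (s - 1) + 2%:R); last by ring.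
  by rewrite (avD_eqr Hp) (su_two S).
have s0 : 1 + s != 0 by rewrite -(av_gt0 Hp) vs ltr01.
set c := - A / (1 + s).
have Kc : K c.
  apply: (sf_div (su_K S)); first exact: (sfN (su_K S)).
  by apply: (sfD (su_K S)) => //; apply: (sf1 (su_K S)).
have Ec := su_KE S Kc; have Ecy : mx_over E (c *: y) by apply: (mxoZ sE).
have Exc : mx_over E (x + c *: y) by apply: (mxoD sE).
have vc : al (c *: y) < al x.
  rewrite alZ /c (avM Hp) (avN Hp) (avV Hp) vs invr1 mulr1.
  by rewrite -(ltr_pM2r x1) -mulrA [al y * _]mulrC ax mulr1.
have n0 : x + c *: y != 0.
  apply/eqP => /eqP; rewrite addr_eq0 => /eqP e0.
  by move: vc; rewrite -[c *: y]opprK -e0 -scaleN1r alZ (avN Hp) (av1 Hp) mul1r ltxx.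
have [am _ _ _ _ _] := fr.
have pxc : perp m e (x + c *: y) by have := perp_comb 1 c fr Ex Ey px py; rewrite scale1r.
have /eqP[] := an _ Exc n0 (fun k ka => pxc k (leq_trans ka am)).
rewrite herm_Dl !herm_Dr // herm_Zl !herm_Zl !herm_Zr // (su_tauK S Kc) hxy hyx -/A -/B.
have -> : A + c * 1 + (c * 1 + c * (c * B)) = A / (1 + s) ^+ 2 * (s ^+ 2 - (1 - A * B)).
  by rewrite /c; field.
by rewrite hs subrr mulr0.
Qed.

Lemma extend_single a m e y : frame a m e -> anisotropic a e -> mx_over E y -> y != 0 ->
  perp m e y -> exists e', frame a m.+1 e' /\ anisotropic a e'.
Proof.
move=> fr an Ey y0 py; have [x [Ex px x0 ax]] := diag_attained fr an Ey y0 py.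
have [am _ _ _ _ _] := fr.
pose e' k := if (k < m)%N then e k else x.
have e1 k : (k < m)%N -> e' k = e k by rewrite /e' => ->.
have e2 : e' m = x by rewrite /e' ltnn.
have nm : pairing a m = m by rewrite /pairing ltnNge am.
have nlt k : (k < m)%N -> (pairing a k < m)%N by apply: pairing_lt.
have hs k : (k < m)%N -> h (e k) x = 0.
  by move=> ka; rewrite herm_sym ?px ?(fa0 sur ht) //; apply: (fr_E fr).
have cases k : (k < m.+1)%N -> (k < m)%N \/ k = m.
  by rewrite ltnS leq_eqVlt => /orP[/eqP|]; [right|left].
have lm k : (k < a.*2)%N -> (k < m)%N by move=> ka; apply: leq_trans am.
exists e'; split; last first.
  move=> w Ew w0 pw; apply: an => // k ka; rewrite -(pw k ka) e1 //; exact: lm.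
split.
- exact: leqW.
- by move=> k; rewrite /e'; case: ifP => _ //; apply: (fr_E fr).
- move=> k l /cases[ka|->] /cases[la|->]; rewrite ?nm ?eqxx // ?e2 ?e1 //; auto.
  exact: (fr_orth fr).
- move=> k ka; have km := lm k ka; rewrite !e1 ?nlt //; exact: (fr_pair fr).
- move=> k /cases[ka|->]; rewrite ?nm ?e2 //.
  by rewrite !e1 ?nlt //; apply: (fr_al fr).
- by move=> k /cases[ka|->]; rewrite ?e2 ?e1 //; apply: (fr_nz fr).
Qed.

Lemma frame_full a m e : frame a m e ->
  (forall y, mx_over E y -> perp m e y -> y = 0) -> (n <= m)%N /\
  forall y, mx_over E y -> y = fspan a m e y.
Proof.
move=> fr h0; have sp y : mx_over E y -> y = fspan a m e y.
  move=> Ey; apply/eqP; rewrite -subr_eq0; apply/eqP/h0; first exact: (proj_E fr).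
  exact: (perp_proj fr).
split=> //.
pose P : 'M[Omega]_(n, m) := \matrix_(i, k) e k i 0.
pose Q : 'M[Omega]_(m, n) := \matrix_(k, i) fcoef a e k (delta_mx i 0).
suff : P *m Q = 1%:M by apply: mulmx1_min.
apply/matrixP => i l; rewrite mxE.
have Ed : mx_over E (delta_mx l 0 : 'cV[Omega]_n) by apply: (mxo_delta sE).
have /colP/(_ i) := sp _ Ed; rewrite !mxE eqxx andbT => ->.
by rewrite summxE; apply: eq_bigr => k _; rewrite !mxE mulrC.
Qed.

Lemma hyperbolic_frame : exists a e, frame a a.*2 e /\ anisotropic a e.
Proof.
suff W d a e : frame a a.*2 e -> (n <= a.*2 + d)%N ->
    exists a e, frame a a.*2 e /\ anisotropic a e.
  apply: (W n 0%N (fun=> 0)) => //; split=> // k; exact: (mxo0 sE).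
elim: d a e => [|d IH] a e fr hd.
all: have [an|na] := pselect (anisotropic a e); first by exists a, e.
all: have [x [Ex [x0 [px hx]]]] : exists x, mx_over E x /\ (x != 0 /\ (perp a.*2 e x /\ h x x = 0)).
- by apply: contrapT => H0; apply: na => x Ex x0 px; apply/eqP => hx; apply: H0; exists x.
- have [e' fr'] := extend_pair fr Ex x0 px hx; have := leq_trans (frame_size fr') hd.
  by rewrite addn0 doubleS ltnNge leqnSn.
- by apply: contrapT => H0; apply: na => x Ex x0 px; apply/eqP => hx; apply: H0; exists x.
- have [e' fr'] := extend_pair fr Ex x0 px hx; apply: (IH _ _ fr').
  by apply: leq_trans hd _; rewrite doubleS !addSn addnS leqW.
Qed.

Lemma full_frame : exists a e, [/\ frame a n e, anisotropic a e &
  forall y, mx_over E y -> y = fspan a n e y].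
Proof.
have [a [e [fr an]]] := hyperbolic_frame.
suff W d m e0 : frame a m e0 -> anisotropic a e0 -> (n <= m + d)%N ->
    exists e, [/\ frame a n e, anisotropic a e & forall y, mx_over E y -> y = fspan a n e y].
  by have [e' h'] := W n a.*2 e fr an (leq_addl _ _); exists a, e'.
elim: d m e0 => [|d IH] m e0 fr0 an0 hd.
all: have [h0|nh] := pselect (forall y, mx_over E y -> perp m e0 y -> y = 0).
- have [nm sp] := frame_full fr0 h0.
  have e_m : m = n by apply/eqP; rewrite eqn_leq nm (frame_size fr0).
  by rewrite e_m in fr0 sp; exists e0.
- have [y [Ey [y0 py]]] : exists y, mx_over E y /\ (y != 0 /\ perp m e0 y).
    apply: contrapT => H0; apply: nh => y Ey py; apply/eqP; apply/negPn/negP => y0.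
    by apply: H0; exists y.
  have [e' [fr' _]] := extend_single fr0 an0 Ey y0 py.
  by have := leq_trans (frame_size fr') hd; rewrite addn0 ltnn.
- have [nm sp] := frame_full fr0 h0.
  have e_m : m = n by apply/eqP; rewrite eqn_leq nm (frame_size fr0).
  by rewrite e_m in fr0 sp; exists e0.
- have [y [Ey [y0 py]]] : exists y, mx_over E y /\ (y != 0 /\ perp m e0 y).
    apply: contrapT => H0; apply: nh => y Ey py; apply/eqP; apply/negPn/negP => y0.
    by apply: H0; exists y.
  have [e' [fr' an']] := extend_single fr0 an0 Ey y0 py.
  by apply: (IH _ _ fr' an'); rewrite addSnnS.
Qed.

(** The frame splits al because [fcoef_le] bounds each component of a vector by al of that vector;
    the converse bound is the ultrametric inequality. *)
Lemma witt_exists : exists P nu, witt_basis E tau H P nu /\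
  exists2 c : 'I_n -> R, (forall k, 0 < c k) & al = split_norm absv P c.
Proof.
have [a [e [fr an sp]]] := full_frame.
pose P : 'M[Omega]_n := \matrix_(i, k) e k i 0.
pose Q : 'M[Omega]_n := \matrix_(k, i) fcoef a e k (delta_mx i 0).
pose nu (k : 'I_n) : 'I_n := Ordinal (pairing_lt (fr_le fr) (ltn_ord k)).
have colP_e k : col k P = e k by apply/colP => i; rewrite !mxE.
have PE : mx_over E P by move=> i k; rewrite mxE; apply: (fr_E fr).
have PQ : P *m Q = 1%:M.
  apply/matrixP => i l; rewrite mxE.
  have Ed : mx_over E (delta_mx l 0 : 'cV[Omega]_n) by apply: (mxo_delta sE).
  have /colP/(_ i) := sp _ Ed; rewrite !mxE eqxx andbT => ->.
  by rewrite summxE; apply: eq_bigr => k _; rewrite !mxE mulrC.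
have uP : P \in unitmx by have [] := mulmx1_unit PQ.
have Pcomb x : P *m x = \sum_k x k 0 *: e k.
  by rewrite mul_col_sum; apply: eq_bigr => k _; rewrite colP_e.
have h_P x (k : 'I_n) : h (P *m x) (e (pairing a k)) = x k 0 * h (e k) (e (pairing a k)).
  by rewrite Pcomb (herm_comb fr).
exists P, nu; split; last first.
  have cp k : 0 < al (e (k : 'I_n)) by rewrite al_gt0 (fr_nz fr).
  exists (fun k => al (e k)) => //.
  apply: (@split_norm_agree _ _ _ _ Hp E) => // x Ex; apply/eqP; rewrite eq_le.
  have ex : x = P *m (invmx P *m x) by rewrite mulKVmx.
  apply/andP; split; last first.
    apply: split_norm_le => // k.
    have := fcoef_le fr (ltn_ord k) Ex; rewrite alZ mulrC /fcoef.
    rewrite {1}ex h_P mulfK // -(av_gt0 Hp) (fr_al fr) // mulr_gt0 ?al_gt0 //.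
      exact: (fr_nz fr).
    by apply: (fr_nz fr); apply: (pairing_lt (fr_le fr)).
  rewrite {1}ex Pcomb; apply: (split_norm_sum_le Hp) => // [|k _].
    exact: split_norm_ge0.
  rewrite alZ mulrC; exact: (split_norm_ge _ P (fun k => al (e k)) x k).
split=> //.
- by move=> k; apply: val_inj; rewrite /= pairingK.
- by move=> k l lk; rewrite !colP_e; apply: (fr_orth fr).
- move=> k nk; rewrite !colP_e; apply: (fr_pair fr).
  by rewrite ltnNge; apply: contraNN nk => ak; apply/eqP/val_inj; rewrite /= /pairing ltnNge ak.
- move=> x Ex x0 hx; have EPx : mx_over E (P *m x) by apply: (mxo_mul sE).
  apply: an => //.
    apply: contraNneq x0 => e0; apply/eqP; apply: (can_inj (mulKmx uP)).
    by rewrite e0 mulmx0.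
  move=> k ka; have kn : (k < n)%N by apply: leq_trans (fr_le fr).
  have := h_P x (nu (Ordinal kn)); rewrite /= pairingK => ->.
  rewrite hx ?mul0r //; apply/eqP => /(congr1 val) /=; rewrite pairingK => e1.
  move: e1; rewrite /pairing ka; case: ifP => ok /eqP; last by rewrite ltn_eqF.
  by case: k ok {ka kn} => //= k _; rewrite gtn_eqF.
Qed.

End Witt.
Lemma self_dual_split : self_dual absv E tau H al.
Proof.
move=> y Ey; have [->|y0] := eqVneq y 0.
  rewrite (split_norm0 Hp).
  (* Without nonzero vectors the set is empty, and the default value 0 of [sup] is the correct
     one. *)
  have [[x [Ex x0]]|nx] := pselect (exists x, mx_over E x /\ x != 0); last first.
    rewrite (_ : [set _ | _ in _] = set0) ?sup0 //.
    by apply/seteqP; split=> [r [x [Ex x0] _]|//]; case: nx; exists x.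
  apply/esym; apply: sup_max => [|_ [x' [Ex' _] <-]]; last by rewrite herm_0r // (av0 Hp) mul0r.
  by exists x => //; rewrite herm_0r // (av0 Hp) mul0r.
have [x [Ex x0 ex]] := h_attained Ey y0.
apply/esym; apply: sup_max => [|_ [x' [Ex' x0'] <-]].
  by exists x => //; rewrite ex mulrAC divff ?mul1r // gt_eqF // al_gt0.
by rewrite ler_pdivrMr ?al_gt0 // mulrC h_le.
Qed.

(** * Root groups fixing a norm determine it *)

Section Facet.
Variables (P : 'M[Omega]_n) (nu : 'I_n -> 'I_n).
Hypothesis wb : witt_basis E tau H P nu.
Local Notation ec k := (col k P).

Let PE : mx_over E P. Proof. by case: wb => -[]. Qed.
Let uP : P \in unitmx. Proof. by case: wb => -[]. Qed.
Let nuK : involutive nu. Proof. by case: wb. Qed.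
Let Ec k : mx_over E (ec k). Proof. by move=> i l; rewrite mxE. Qed.
Let h_ne k l : l != nu k -> h (ec k) (ec l) = 0. Proof. by case: wb => _ _ + _ _; apply. Qed.
Let h_nu k : nu k != k -> h (ec k) (ec (nu k)) = 1. Proof. by case: wb => _ _ _ + _; apply. Qed.

Lemma coord_col l : invmx P *m ec l = delta_mx l 0.
Proof. by rewrite colE mulKmx. Qed.

Lemma herm_coord x k : h x (ec k) = (invmx P *m x) (nu k) 0 * h (ec (nu k)) (ec k).
Proof.
rewrite -{1}[x](mulKVmx uP) mul_col_sum herm_suml (bigD1 (nu k)) //= herm_Zl big1 ?addr0 // => l nl.
rewrite herm_Zl h_ne ?mulr0 //; apply/eqP => e; case/eqP: nl; by rewrite e nuK.
Qed.

Lemma herm_pair_neq0 k : h (ec k) (ec (nu k)) != 0.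
Proof.
have [e|] := eqVneq (nu k) k; last by move/h_nu->; rewrite oner_eq0.
have [_ _ _ _ an] := wb; have Ed : mx_over E (delta_mx k 0 : 'cV[Omega]_n) by apply: (mxo_delta sE).
have := an _ Ed; rewrite -colE e; apply.
  by apply/eqP => /colP/(_ k)/eqP; rewrite !mxE !eqxx oner_eq0.
by move=> l; rewrite mxE andbT; have [->|//] := eqVneq l k; rewrite e eqxx.
Qed.

(** In a Witt basis the dual norm has coefficient |h(e_k, e_(nu k))| / c_(nu k) at k, so
    self-duality prescribes the product over each pair and leaves one free parameter. *)
Lemma self_dual_pair c : (forall k, 0 < c k) -> self_dual absv E tau H (split_norm absv P c) ->
  forall k, c k * c (nu k) = absv (h (ec k) (ec (nu k))).
Proof.
move=> cp sd k; have cn0 := lt0r_neq0 (cp (nu k)).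
have d0 : 0 < absv (h (ec k) (ec (nu k))) by rewrite (av_gt0 Hp) herm_pair_neq0.
have := sd _ (Ec k); rewrite (split_norm_col Hp) // => ->.
rewrite (_ : sup _ = absv (h (ec k) (ec (nu k))) / c (nu k)) ?divfK //.
apply: sup_max => [|_ [x [Ex x0] <-]].
  exists (ec (nu k)); last by rewrite herm_abs_sym // (split_norm_col Hp).
  split=> //; rewrite -(split_norm_gt0 Hp uP cp) (split_norm_col Hp) //.
have sx : 0 < split_norm absv P c x by rewrite (split_norm_gt0 Hp).
rewrite herm_coord (avM Hp) -herm_abs_sym // ler_pdivrMr // [X in X <= _]mulrC -mulrA ler_wpM2l ?(ltW d0) //.
by rewrite ler_pdivlMl // split_norm_ge.
Qed.

Variables c c' : 'I_n -> R.
Hypotheses (c_gt0 : forall k, 0 < c k) (c'_gt0 : forall k, 0 < c' k)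
  (al_c : al = split_norm absv P c)
  (c'_dual : self_dual absv E tau H (split_norm absv P c'))
  (roots : forall k l u, is_root nu k l -> root_group E tau H P nu k l u ->
     fixes u al -> fixes u (split_norm absv P c')).
Local Notation be := (split_norm absv P c').

Let c_dual : forall k, c k * c (nu k) = absv (h (ec k) (ec (nu k))).
Proof. by apply: self_dual_pair => //; rewrite -al_c; exact: self_dual_split. Qed.

Let c'_pair := self_dual_pair c'_gt0 c'_dual.

Lemma fixes_columns A : unitary tau H E A -> (forall k, al (A *m ec k) <= c k) -> fixes A al.
Proof.
move=> uA hA; apply: isometry_fixes => // x Ex.
rewrite [in X in _ <= X]al_c; apply: (split_norm_max Hp uP (be := fun x => al (A *m x))) => //.
- by move=> a y; rewrite -scalemxAr alZ.
- by move=> F C C0 hF; rewrite mulmx_sumr; apply: (split_norm_sum_le Hp).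
Qed.

Lemma hyperbolic_root k : nu k != k -> exists2 lam, cochar nu lam & lam k = 1 /\
  forall l, l != k -> l != nu k -> lam l = 0.
Proof.
move=> nk; exists (fun l => if l == k then 1 else if l == nu k then -1 else 0).
  move=> l; have [->|lk] := eqVneq l k; first by rewrite (negPf nk) eqxx.
  have [->|lnk] := eqVneq l (nu k); first by rewrite nuK eqxx opprK.
  rewrite -[k in nu l == k]nuK (inj_eq (inv_inj nuK)) (negPf lnk).
  by rewrite (inj_eq (inv_inj nuK)) (negPf lk) oppr0.
by rewrite eqxx; split=> // l /negPf-> /negPf->.
Qed.

Let h_dual k l : nu k != k -> h (ec l) (ec k) = (l == nu k)%:R.
Proof.
move=> nk; have [->|nl] := eqVneq l (nu k); last first.
  by rewrite h_ne //; apply/eqP => e; case/eqP: nl; rewrite e nuK.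
by have := @h_nu (nu k); rewrite nuK [k == _]eq_sym => ->.

Qed.

Let conj_entry u k1 l1 : (invmx P *m u *m P - 1%:M) k1 l1 =
  (invmx P *m (u *m ec l1)) k1 0 - (k1 == l1)%:R.
Proof.
rewrite [LHS]mxE [X in _ + X]mxE [X in - X]mxE; congr (_ - _).
by rewrite colE !mulmxA -colE [RHS]mxE.
Qed.

(** The transvection adding t h(x, e_k) e_k fixes a self-dual split norm precisely when |t| c_k^2 <=
    1; the inclusion of fixers therefore transfers this inequality from c to c'. *)
Lemma long_root k t : nu k != k -> E t -> tau t = - t -> absv t * (c k * c k) <= 1 ->
  absv t * (c' k * c' k) <= 1.
Proof.
move=> nk Et tt hc.
have E0 : mx_over E (0 : 'cV[Omega]_n) by apply: (mxo0 sE).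
have hee : h (ec k) (ec k) = 0 by rewrite h_ne // eq_sym.
have he0 : h (ec k) 0 = 0 by rewrite herm_0r.
pose u := siegel (ec k) 0 t.
have uu : unitary tau H E u by apply: siegel_unitary.
have uE l : u *m ec l = ec l + (t * (l == nu k)%:R) *: ec k.
  by rewrite siegel_mul scaler0 addr0 !herm_0r mul0r !subr0 h_dual.
have p1 : c k * c (nu k) = 1 by rewrite c_dual h_nu // (av1 Hp).
have p1' : c' k * c' (nu k) = 1 by rewrite c'_pair h_nu // (av1 Hp).
have fu : fixes u al.
  apply: fixes_columns => // l; rewrite uE; apply: alD.
    by rewrite al_c (split_norm_col Hp).
  rewrite alZ al_c (split_norm_col Hp uP) //; case: eqP => [->|_]; last first.
    by rewrite mulr0 (av0 Hp) mul0r ltW.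
  by rewrite mulr1 -(ler_pM2l (c_gt0 k)) p1 mulrCA.
have fb : fixes u be.
  apply: (@roots k (nu k)) => //.
    have [lam cl [l1 _]] := hyperbolic_root nk; exists lam => //.
    by rewrite cl l1.
  split=> // k1 l1; rewrite conj_entry uE mulmxDr -scalemxAr !coord_col !mxE.
  rewrite !andbT addrAC subrr add0r mulf_eq0 negb_or mulf_eq0 negb_or.
  case/andP=> /andP[_ e1] e2; exists 1%N => // lam _; rewrite mulr1n.
  move: e1 e2; have [->|_] := eqVneq l1 (nu k); last by rewrite eqxx.
  by have [->|_] := eqVneq k1 k => //; rewrite eqxx.
have := fb (ec (nu k)); rewrite uE eqxx mulr1 (split_norm_col Hp uP) // => e1.
have := split_norm_ge absv P c' (ec (nu k) + t *: ec k) k.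
rewrite e1 mulmxDr -scalemxAr !coord_col !mxE !eqxx eq_sym (negPf nk) /= add0r mulr1 => le.
by rewrite -p1' mulrCA ler_wpM2l ?(ltW (c'_gt0 k)) // mulrC.
Qed.

(** The Siegel transformation with v = t e_(nu l) fixes the norm as soon as |t| c_(nu l) c_k <= 1,
    and reading the coefficient of e_(nu l) in the image of e_(nu k) gives the bound back for c'. *)
Lemma short_root k l t : nu k != k -> l != k -> l != nu k -> E t ->
  absv t * (c (nu l) * c k) <= 1 -> absv t * (c' (nu l) * c' k) <= 1.
Proof.
move=> nk lk lnk Et hc.
have E0 : E 0 by apply: (sf0 sE).
have nlk : nu l != k by apply/eqP => e; case/eqP: lnk; rewrite -e nuK.
have nlnk : nu l != nu k by rewrite (inj_eq (inv_inj nuK)).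
pose v := t *: ec (nu l).
have Ev : mx_over E v by apply: (mxoZ sE).
have hee : h (ec k) (ec k) = 0 by rewrite h_ne // eq_sym.
have hev : h (ec k) v = 0 by rewrite herm_Zr // h_ne ?mulr0 // (inj_eq (inv_inj nuK)).
have tau0 : tau 0 = - 0 by rewrite oppr0 (fa0 sur ht).
pose u := siegel (ec k) v 0.
have uu : unitary tau H E u by apply: siegel_unitary.
have uE l1 : u *m ec l1 = ec l1 + ((l1 == nu k)%:R * t) *: ec (nu l) +
    (- (h v v / 2%:R) * (l1 == nu k)%:R - tau t * h (ec l1) (ec (nu l))) *: ec k.
  by rewrite siegel_mul h_dual // [h (ec l1) v]herm_Zr // scalerA sub0r.
have p1 : c k * c (nu k) = 1 by rewrite c_dual h_nu // (av1 Hp).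
have p1' : c' k * c' (nu k) = 1 by rewrite c'_pair h_nu // (av1 Hp).
have vl : absv t * c (nu l) <= c (nu k).
  by rewrite -(ler_pM2l (c_gt0 k)) p1 mulrC -mulrA.
have av : al v <= c (nu k) by rewrite /v alZ al_c (split_norm_col Hp uP).
have h_other l1 : l1 != l -> h (ec l1) (ec (nu l)) = 0.
  by move=> ne; rewrite h_ne // (inj_eq (inv_inj nuK)) eq_sym.
have fu : fixes u al.
  apply: fixes_columns => // l1; rewrite uE.
  apply: alD; first apply: alD.
  - by rewrite al_c (split_norm_col Hp).
  - rewrite alZ al_c (split_norm_col Hp uP) // (avM Hp); case: eqP => [->|_].
      by rewrite (av1 Hp) mul1r.
    by rewrite (av0 Hp) !mul0r ltW.
  rewrite alZ al_c (split_norm_col Hp uP) //; have [->|n1] := eqVneq l1 (nu k).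
    rewrite h_other ?mulr0 ?subr0 ?mulr1; last by rewrite eq_sym.
    rewrite (avN Hp) (avM Hp) (avV Hp) (su_two S) invr1 mulr1.
    apply: (@le_trans _ _ (c (nu k) * c (nu k) * c k)).
      rewrite ler_wpM2r ?(ltW (c_gt0 k)) //; apply: le_trans (h_le Ev Ev) _.
      by apply: ler_pM.
    by rewrite -mulrA [c (nu k) * c k]mulrC p1 mulr1.
  rewrite mulr0 sub0r (avN Hp) (avM Hp) tauE_abs //; have [->|n2] := eqVneq l1 l; last first.
    by rewrite h_other // (av0 Hp) mulr0 mul0r ltW.
  have -> : absv t * absv (h (ec l) (ec (nu l))) * c k = c l * (absv t * (c (nu l) * c k)).
    by rewrite -c_dual; ring.
  by rewrite ler_piMr ?(ltW (c_gt0 l)).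
have fb : fixes u be.
  apply: (@roots k l) => //.
    have [lam cl [l1 l2]] := hyperbolic_root nk; exists lam => //.
    by rewrite l1 l2.
  split=> // k1 l1; rewrite conj_entry uE !mulmxDr -!scalemxAr !coord_col !mxE.
  rewrite !andbT [X in X != 0](_ : _ = (l1 == nu k)%:R * t * (k1 == nu l)%:R +
    (- (h v v / 2%:R) * (l1 == nu k)%:R - tau t * h (ec l1) (ec (nu l))) * (k1 == k)%:R);
    last by ring.
  have [->|n1] := eqVneq l1 (nu k).
    rewrite h_other; last by rewrite eq_sym.
    rewrite mulr0 subr0 mul1r mulr1; have [->|n2] := eqVneq k1 (nu l).
      by move=> _; exists 1%N => // lam cl; rewrite !cl mulr1n opprK addrC.
    rewrite mulr0 add0r; have [->|_] := eqVneq k1 k; last by rewrite mulr0 eqxx.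
    rewrite mulr1 oppr_eq0 mulf_eq0 negb_or => /andP[hvv _].
    have e3 : nu l = l.
      apply/eqP; apply: contraNT hvv => nl; rewrite /v herm_Zl herm_Zr // h_ne ?mulr0 //.
      by rewrite nuK.
    (* If l is its own partner, the term h(v,v) lies in the weight space of twice the root, since
       every cocharacter vanishes at l. *)
    exists 2%N => // lam cl; have l0 : lam l = 0.
      by apply/eqP; have := cl l; rewrite e3 => /eqP; rewrite -addr_eq0 -mulr2n mulrn_eq0.
    by rewrite cl l0 subr0 opprK mulr2n.
  rewrite mul0r mul0r add0r mulr0 sub0r; have [->|_] := eqVneq k1 k; last by rewrite mulr0 eqxx.
  have [-> _|n2] := eqVneq l1 l; last by rewrite h_other // mulr0 oppr0 mul0r eqxx.
  by exists 1%N => // lam _; rewrite mulr1n.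
have := fb (ec (nu k)); rewrite uE eqxx mul1r h_other; last by rewrite eq_sym.
rewrite mulr0 subr0 mulr1 (split_norm_col Hp uP) // => e1.
have := split_norm_ge absv P c' (ec (nu k) + t *: ec (nu l) + (- (h v v / 2%:R)) *: ec k) (nu l).
rewrite e1 !mulmxDr -!scalemxAr !coord_col !mxE !eqxx (negPf nlk) (negPf nlnk) /= !mulr0 add0r addr0 mulr1 => le.
have -> : absv t * (c' (nu l) * c' k) = c' k * (c' (nu l) * absv t) by ring.
by rewrite -p1' ler_wpM2l ?(ltW (c'_gt0 k)).
Qed.

Hypotheses (c_class : forall k, exists m : int, c k ^+ 2 = absv Pi ^ m)
  (even_partner : forall k (a : int), nu k != k -> c k = absv Pi ^ a ->
     exists l, [/\ l != k, l != nu k & exists b : int, c l = absv Pi ^ b]).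

Let Pi0 : 0 < absv Pi. Proof. exact: (Pi_gt0 S). Qed.
Let EPi m : E (Pi ^ m). Proof. by apply: (sfXz sE); apply: (E_Pi S). Qed.

Let le_eq (x x' y y' : R) : 0 < x -> 0 < y -> x <= x' -> y <= y' -> x' * y' = x * y -> x = x'.
Proof.
move=> x0 y0 lx ly e; apply/eqP; rewrite eq_le lx /=.
have y0' : 0 < y' by apply: lt_le_trans ly.
by rewrite -(ler_pM2r y0') e ler_wpM2l // ltW.
Qed.

(** The limiting parameter t = Pi^-(2m+1) has trace zero because the exponent is odd, and |t| c_k^2
    = 1 leaves no loss. *)
Let odd_le k (m : int) : nu k != k -> c k ^+ 2 = absv Pi ^ (m * 2 + 1) -> c' k <= c k.
Proof.
move=> nk ck; have t : tau (Pi ^ (- (m * 2 + 1))) = - Pi ^ (- (m * 2 + 1)).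
  rewrite (tau_PiX S); suff -> : (-1) ^ (- (m * 2 + 1)) = -1 :> Omega by rewrite mulN1r.
  rewrite -invr_expz expfzDr ?oppr_eq0 ?oner_eq0 // [m * 2]mulrC -exprz_exp.
  by rewrite -[X in X ^ m]/((-1) ^+ 2) sqrrN expr1n exp1rz mul1r expr1z invrN1.
have := @long_root k _ nk (EPi _) t; rewrite (avXz Hp) -!expr2 ck.
rewrite -expfzDr ?gt_eqF // addNr expr0z => /(_ (lexx _)).
rewrite -invr_expz -ck ler_pdivrMl ?exprn_gt0 // mulr1.
by rewrite ler_pXn2r // nnegrE ltW.
Qed.

Let even_le k l (a b : int) : nu k != k -> l != k -> l != nu k ->
  c k = absv Pi ^ a -> c (nu l) = absv Pi ^ b -> c' (nu l) * c' k <= c (nu l) * c k.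
Proof.
move=> nk lk lnk ck cl; have := @short_root k l _ nk lk lnk (EPi (- (b + a))).
rewrite (avXz Hp) ck cl -!expfzDr ?gt_eqF // addNr expr0z => /(_ (lexx _)).
by rewrite -invr_expz ler_pdivrMl ?exprz_gt0 // mulr1.
Qed.

(** In the odd case both c'_k <= c_k and c'_(nu k) <= c_(nu k) hold while the products are equal. In
    the even case the four bounds for k, nu k against l, nu l pair up in the same way, so c_k c_l
    and c_k c_(nu l) are determined; their product is c_k^2 times the known c_l c_(nu l). *)
Lemma facet_norm_unique : be = al.
Proof.
rewrite al_c; congr split_norm; apply/funext => k.
have [e|nk] := eqVneq (nu k) k.
  have := c_dual k; rewrite -c'_pair e -!expr2 => /eqP.
  by rewrite eqrXn2 ?(ltW (c_gt0 k)) ?(ltW (c'_gt0 k)) // => /eqP.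
have nnk : nu (nu k) != nu k by rewrite nuK eq_sym.
have p1 : c k * c (nu k) = 1 by rewrite c_dual h_nu // (av1 Hp).
have p1' : c' k * c' (nu k) = 1 by rewrite c'_pair h_nu // (av1 Hp).
have cn : c (nu k) = (c k)^-1 by rewrite -[RHS]mulr1 -p1 mulKf ?gt_eqF.
have [m hm] := c_class k.
have [[a ha]|[a ha]] : (exists a, m = a * 2) \/ (exists a, m = a * 2 + 1).
  exact: int_parity.
- have ck : c k = absv Pi ^ a.
    apply/eqP; rewrite -(@eqrXn2 _ 2) ?(ltW (c_gt0 k)) ?exprz_ge0 ?ltW // hm ha.
    by rewrite -exprz_exp.
  have cnk : c (nu k) = absv Pi ^ (- a) by rewrite cn ck -invr_expz.
  have [l [lk lnk [b hb]]] := even_partner nk ck.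
  have nlk : nu l != k by apply/eqP => e; case/eqP: lnk; rewrite -e nuK.
  have nlnk : nu l != nu k by rewrite (inj_eq (inv_inj nuK)).
  have [b' hb'] : exists b' : int, c (nu l) = absv Pi ^ b'.
    have [->|nl] := eqVneq (nu l) l; first by exists b.
    exists (- b); have pl : c l * c (nu l) = 1 by rewrite c_dual h_nu // (av1 Hp).
    by rewrite -invr_expz -hb -[RHS]mulr1 -pl mulKf ?gt_eqF.
  have hl : c (nu (nu l)) = absv Pi ^ b by rewrite nuK.
  have i1 := even_le nk lk lnk ck hb'.
  have i2 := even_le nk nlk nlnk ck hl.
  have i3 : c' (nu l) * c' (nu k) <= c (nu l) * c (nu k).
    by apply: (even_le nnk _ _ cnk hb'); rewrite ?nuK.
  have i4 : c' (nu (nu l)) * c' (nu k) <= c (nu (nu l)) * c (nu k).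
    by apply: (even_le nnk _ _ cnk hl); rewrite ?nuK // (inj_eq (inv_inj nuK)).
  rewrite nuK in i2 i4.
  have e1 : c' (nu l) * c' k = c (nu l) * c k.
    apply: (le_eq _ _ i1 i4); rewrite ?mulr_gt0 //.
    transitivity ((c l * c (nu l)) * (c k * c (nu k))); first by ring.
    by rewrite p1 -p1' c_dual -c'_pair; ring.
  have e2 : c' l * c' k = c l * c k.
    apply: (le_eq _ _ i2 i3); rewrite ?mulr_gt0 //.
    transitivity ((c l * c (nu l)) * (c k * c (nu k))); first by ring.
    by rewrite p1 -p1' c_dual -c'_pair; ring.
  have d0 : 0 < c l * c (nu l) by rewrite mulr_gt0.
  have : c l * c (nu l) * c' k ^+ 2 = c l * c (nu l) * c k ^+ 2.
    transitivity ((c l * c k) * (c (nu l) * c k)); last by ring.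
    by rewrite -e1 -e2 c_dual -c'_pair; ring.
  move/(mulfI (lt0r_neq0 d0))/eqP.
  by rewrite eqrXn2 ?(ltW (c_gt0 k)) ?(ltW (c'_gt0 k)) // => /eqP.
apply: (le_eq (c'_gt0 k) (c'_gt0 (nu k)) (odd_le nk _) (odd_le nnk _)); last by rewrite p1 p1'.
  by rewrite hm ha.
rewrite cn exprVn hm ha invr_expz; congr (_ ^ _).
(* - (2a + 1) = 2 (- a - 1) + 1, so the partner has odd class too. *)
by instantiate (1 := - a - 1); ring.
Qed.
End Facet.
End Hermitian.

(** * Compact subgroups *)

Section Compact.
Variables (R : realType) (p : nat) (Omega : closedFieldType).
Variable absv : Omega -> R.
Variables (K E : set Omega) (q : nat) (tau sigma : Omega -> Omega) (Pi : Omega).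
Hypothesis S : ramified_setup p absv K E q tau sigma Pi.

Let Hp := su_Hp S.
Let sE := su_E S.
Local Notation ge0 := (absv_ge0 Hp).
Let Pi0 : 0 < absv Pi. Proof. exact: (Pi_gt0 S). Qed.

Lemma residue_step x : E x -> forall c, E c -> c != 0 -> absv x <= absv c ->
  forall r : 'I_q -> Omega, (forall k, E (r k) /\ absv (r k) <= 1) ->
  (forall x, E x -> absv x <= 1 -> exists! k, absv (x - r k) < 1) ->
  exists k, absv (x - c * r k) <= absv (c * Pi).
Proof.
move=> Ex c Ec c0 xc r hr ur.
have Ey : E (x / c) by apply: (sf_div sE).
have vy : absv (x / c) <= 1.
  by rewrite (avM Hp) (avV Hp) ler_pdivrMr ?mul1r // (av_gt0 Hp).
have [k [hk _]] := ur _ Ey vy; exists k.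
have [_ _ _ hPi] := su_unif S.
have : absv (x / c - r k) <= absv Pi by apply: hPi => //; apply: (sfB sE) => //; case: (hr k).
rewrite -(ler_pM2l (_ : 0 < absv c)) ?(av_gt0 Hp) // -!(avM Hp).
by rewrite mulrBr mulrCA divff // mulr1.
Qed.

Variable n : nat.
Implicit Types (g h : 'M[Omega]_n) (Q : set 'M[Omega]_n).

(** A ball of matrices over E is a union of q^(n^2) balls of the next radius, one for each choice of
    residues of the entries. If no finite subcover exists, some nested sequence of balls never has
    one; its centres converge to a point of Q, and a member of the cover around that point contains
    a late ball. *)
Lemma closed_bounded_compact Q (C : R) : (forall g, Q g -> mx_over E g) ->
  (forall g, Q g -> forall i k, absv (g i k) <= C) ->
  (forall g, mx_over E g -> (forall e : R, 0 < e ->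
     exists2 h, Q h & forall i k, absv (g i k - h i k) < e) -> Q g) ->
  mx_compact absv Q.
Proof.
move=> QE QC Qcl I f fo Qf; apply: contrapT => nc.
pose covered (A : set 'M[Omega]_n) := exists s : seq I, forall g, A g -> exists2 i, i \in s & f i g.
have [r hr ur] := su_card S.
have Pi1 : absv Pi < 1 := Pi_lt1 S.
have EPi : E Pi := E_Pi S.
have C1 : 0 < `|C| + 1 by rewrite ltr_wpDl ?ltr01.
have [N hN] : exists N, absv Pi ^+ N < (`|C| + 1)^-1.
  have hp : 0 < (`|C| + 1)^-1 by rewrite invr_gt0.
  by have [N hN] := geometric_lt (ltW Pi0) Pi1 hp; exists N; apply: hN.
(* The radii are |Pi|^(k - N), with N such that the first ball around 0 contains all of Q. *)
pose c k := (Pi ^+ N)^-1 * Pi ^+ k.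
have Ec k : E (c k) by apply: (sfM sE); [apply: (sfV sE)|]; apply: (sfX sE).
have vPi k : 0 < absv Pi ^+ k by rewrite exprn_gt0.
have vc k : absv (c k) = (absv Pi ^+ N)^-1 * absv Pi ^+ k.
  by rewrite /c (avM Hp) (avV Hp) !(avX Hp).
have c0 k : c k != 0 by rewrite -(av_gt0 Hp) vc mulr_gt0 // invr_gt0.
have cS k : absv (c k * Pi) = absv (c k.+1) by rewrite (avM Hp) !vc exprSr mulrA.
have c_le k l : (k <= l)%N -> absv (c l) <= absv (c k).
  move=> kl; rewrite !vc ler_wpM2l ?invr_ge0 ?(ltW (vPi _)) //.
  by rewrite ler_wiXn2l // ltW.
have c_small e : 0 < e -> exists k, absv (c k) < e.
  move=> e0; have [M hM] := geometric_lt (ltW Pi0) Pi1 (mulr_gt0 (vPi N) e0).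
  by exists M; rewrite vc ltr_pdivrMl // hM.
pose ball k g := [set h | Q h /\ forall i l, absv (h i l - g i l) <= absv (c k)].
pose bad k g := mx_over E g /\ ~ covered (ball k g).
have bad0 : bad 0%N 0.
  split; first exact: (mxo0 sE).
  move=> [s hs]; apply: nc; exists [fset x in s]%fset => [i _|g Qg]; first by rewrite inE.
  have [|i si fi] := hs g; last by exists i => //=; rewrite inE.
  split=> // i l; rewrite mxE subr0; apply: le_trans (QC g Qg i l) _.
  apply: le_trans (ler_norm _) _; rewrite vc expr0 mulr1.
  apply: (@le_trans _ _ (`|C| + 1)); first by rewrite lerDl ler01.
  by rewrite -[X in X <= _]invrK lef_pV2 ?posrE ?invr_gt0 // ltW.
have step (t : nat * 'M[Omega]_n) : exists g', bad t.1 t.2 ->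
    bad t.1.+1 g' /\ forall i l, absv (g' i l - t.2 i l) <= absv (c t.1).
  case: t => k g /=; have [[Eg nb]|] := pselect (bad k g); last by exists 0.
  pose ch (F : {ffun 'I_n * 'I_n -> 'I_q}) := g + \matrix_(i, l) (c k * r (F (i, l))).
  have Ech F : mx_over E (ch F).
    apply: (mxoD sE) => // i l; rewrite mxE; apply: (sfM sE) => //; exact: (hr _).1.
  have [[F hF]|nF] := pselect (exists F, ~ covered (ball k.+1 (ch F))).
    exists (ch F) => _; split=> // i l; rewrite !mxE addrAC subrr add0r (avM Hp).
    by rewrite ler_piMr ?ge0 // (hr _).2.
  exfalso; apply: nb.
  have hF F : exists s : seq I, forall g, ball k.+1 (ch F) g -> exists2 i, i \in s & f i g.
    by apply: contrapT => H; apply: nF; exists F.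
  have [s hs] := choice hF.
  exists (flatten [seq s F | F <- enum {: {ffun 'I_n * 'I_n -> 'I_q}}]) => h [Qh hb].
  have ex (t : 'I_n * 'I_n) : exists x : 'I_q,
      absv (h t.1 t.2 - g t.1 t.2 - c k * r x) <= absv (c k * Pi).
    apply: (residue_step _ (Ec k)) => //.
    by apply: (sfB sE) => //; apply: QE.
  have [F0 hF0] := choice ex.
  have [|i si fi] := hs (finfun F0) h.
    split=> // i l; rewrite !mxE ffunE opprD addrA -cS; exact: (hF0 (i, l)).
  exists i => //; apply/flattenP; exists (s (finfun F0)) => //.
  by apply: map_f; rewrite mem_enum.
have [nx hnx] := choice step.
pose fix u k := if k is k'.+1 then nx (k', u k') else 0.
have ub k : bad k (u k) by elim: k => //= k IH; apply: (hnx (k, u k) IH).1.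
have ud k i l : absv (u k.+1 i l - u k i l) <= absv (c k).
  exact: (hnx (k, u k) (ub k)).2.
have ul k m i l : (k <= m)%N -> absv (u m i l - u k i l) <= absv (c k).
  elim: m => [|m IH]; first by rewrite leqn0 => /eqP->; rewrite subrr (av0 Hp) ge0.
  rewrite leq_eqVlt => /orP[/eqP->|]; first by rewrite subrr (av0 Hp) ge0.
  rewrite ltnS => km; rewrite -(subrKA (u m i l)); apply: (avD_le Hp); last exact: IH.
  by apply: le_trans (ud m i l) _; apply: c_le.
have lim i l : exists x, E x /\ converges absv (fun k => u k i l) x.
  have [||x Ex hx] := su_Ec S (u := fun k => u k i l); last by exists x.
    by move=> k; case: (ub k) => h _; apply: h.
  move=> e e0; have [k hk] := c_small e e0; exists k => m m' km km'.
  rewrite -(subrKA (u k i l)); apply: (avD_lt Hp); first by apply: le_lt_trans hk; apply: ul.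
  by rewrite (av_distC Hp); apply: le_lt_trans hk; apply: ul.
pose G : 'M[Omega]_n := \matrix_(i, l) projT1 (cid (lim i l)).
have EG : mx_over E G by move=> i l; rewrite mxE; case: (cid _) => x [].
have hG k i l : absv (G i l - u k i l) <= absv (c k).
  rewrite mxE; case: (cid _) => x [Ex cx] /=.
  have [M hM] : exists M, forall m, (M <= m)%N -> absv (x - u m i l) < absv (c k).
    by apply: cx; rewrite (av_gt0 Hp).
  rewrite -(subrKA (u (maxn M k) i l)); apply: (avD_le Hp).
    by apply: ltW; apply: hM; rewrite leq_maxl.
  by apply: ul; rewrite leq_maxr.
have QG : Q G.
  apply: Qcl => // e e0; have [k hk] := c_small e e0.
  have [h [Qh hb]] : exists h, ball k (u k) h.
    apply: contrapT => H; case: (ub k) => _; apply; exists [::] => h hb.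
    by case: H; exists h.
  exists h => // i l; rewrite -(subrKA (u k i l)); apply: (avD_lt Hp).
    by apply: le_lt_trans hk.
  by rewrite (av_distC Hp); apply: le_lt_trans hk.
have [i0 _ fG] := Qf G QG; have [e e0 he] := fo i0 G fG.
have [k hk] := c_small e e0; case: (ub k) => _; apply; exists [:: i0] => h [Qh hb].
exists i0; first by rewrite inE.
apply: he => i l; rewrite -(subrKA (u k i l)); apply: (avD_lt Hp); first exact: le_lt_trans hk.
by rewrite (av_distC Hp); apply: le_lt_trans hk.
Qed.

Lemma compact_bounded Q : mx_compact absv Q -> exists C : R,
  forall g, Q g -> forall i k, absv (g i k) <= C.
Proof.
move=> cQ; pose f (N : nat) := [set g : 'M[Omega]_n | forall i k, absv (g i k) < N.+1%:R].
have fo N : mx_open absv (f N).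
  move=> g fg; exists N.+1%:R; first by rewrite ltr0n.
  by move=> h hg i k; rewrite -[h i k](subrK (g i k)); apply: (avD_lt Hp).
have [g Qg|D _ hD] := cQ nat f fo.
  exists (Num.bound (\sum_i \sum_k absv (g i k))) => // i k.
  have h0 : 0 <= \sum_i \sum_k absv (g i k) by apply: sumr_ge0 => i' _; apply: sumr_ge0 => k' _; apply: ge0.
  apply: (@le_lt_trans _ _ (\sum_i \sum_k absv (g i k))).
    rewrite (bigD1 i) //= (bigD1 k) //= -addrA lerDl.
    apply: addr_ge0; apply: sumr_ge0 => l _; first exact: ge0.
    by apply: sumr_ge0 => l' _; exact: ge0.
  by apply: lt_trans (archi_boundP h0) _; rewrite ltr_nat.
exists (\sum_(N <- D) N.+1%:R) => g Qg i k; have [N ND fg] := hD g Qg.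
apply: le_trans (ltW (fg i k)) _; rewrite (big_rem N) //= lerDl.
by apply: sumr_ge0 => l _; rewrite ler0n.
Qed.
End Compact.

(** * The stabilizer of a self-dual norm is a compact subgroup *)

Section Stabilizer.
Variables (R : realType) (p : nat) (Omega : closedFieldType).
Variable absv : Omega -> R.
Variables (K E : set Omega) (q : nat) (tau sigma : Omega -> Omega) (Pi : Omega).
Hypothesis S : ramified_setup p absv K E q tau sigma Pi.

Let Hp := su_Hp S.
Let sE := su_E S.
Local Notation ge0 := (absv_ge0 Hp).

Variables (n : nat) (H : 'M[Omega]_n).
Local Notation h := (herm_form tau H).
Hypotheses (HE : mx_over E H) (Hsym : forall k l, H l k = tau (H k l)).
Variables (Q0 : 'M[Omega]_n) (c0 : 'I_n -> R).
Hypotheses (Q0_E : mx_over E Q0) (Q0_unit : Q0 \in unitmx) (c0_gt0 : forall k, 0 < c0 k).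
Local Notation al := (split_norm absv Q0 c0).
Hypotheses (h_le : forall x y, mx_over E x -> mx_over E y -> absv (h x y) <= al x * al y)
  (h_attained : forall y, mx_over E y -> y != 0 ->
     exists x, [/\ mx_over E x, x != 0 & absv (h x y) = al x * al y]).

Definition stabilizer := [set g | unitary tau H E g /\ fixes g al].

Let isom A := @isometry_unitary _ _ _ _ _ _ _ _ _ _ S _ _ A (herm_nondeg S Q0_unit c0_gt0 h_attained).
Let EM (A : 'M[Omega]_n) x : mx_over E A -> mx_over E x -> mx_over E (A *m x : 'cV_n).
Proof. exact: (mxo_mul sE). Qed.

Lemma unitary_subgroup : is_subgroup (unitary tau H E) (unitary tau H E).
Proof.
split=> //.
- apply: isom => [|x y _ _]; last by rewrite !mul1mx.
  by apply: (mxo_scalar sE); apply: (sf1 sE).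
- move=> g g' ug ug'; have [Eg _ _] := ug; have [Eg' _ _] := ug'.
  apply: isom => [|x y Ex Ey]; first exact: (mxo_mul sE).
  by rewrite -!mulmxA (unitary_herm S _ ug) ?(unitary_herm S _ ug') //; apply: EM.
- move=> g ug; have [Eg Ug _] := ug.
  apply: isom => [|x y Ex Ey]; first exact: (mxo_inv sE).
  by rewrite -(unitary_herm S _ ug) ?mulKVmx //; apply: EM => //; apply: (mxo_inv sE).
Qed.

Lemma stabilizer_subgroup : is_subgroup (unitary tau H E) stabilizer.
Proof.
have [_ u1 uM uV] := unitary_subgroup; split=> [g []//||g g' [ug fg] [ug' fg']|g [ug fg]].
- by split=> // x; rewrite mul1mx.
- by split=> [|x]; [apply: uM|rewrite -mulmxA fg].
- split=> [|x]; first exact: uV.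
  by rewrite -fg mulKVmx //; case: ug.
Qed.

(** In the limit, the form is preserved because al bounds it, and the norm does not increase; by
    [isometry_fixes] a contracting isometry fixes al, so the stabilizer is closed. *)
Lemma stabilizer_compact : mx_compact absv stabilizer.
Proof.
have [C hC] := fixes_bounded Hp Q0_unit c0_gt0.
apply: (closed_bounded_compact S (C := C)) => [g [[]]//|g [_ fg]|g Eg lim].
  exact: hC.
have near (x : 'cV_n) (e : R) : mx_over E x -> 0 < e -> exists2 d : R, 0 < d & forall g' : 'M_n,
    (forall i k, absv (g i k - g' i k) < d) -> al (g *m x - g' *m x) <= e.
  move=> Ex e0; have [d d0 hd] := split_norm_small Hp Q0 c0_gt0 x e0.
  exists d => // g' hg; rewrite -mulmxBl; apply: hd => i k; rewrite !mxE ltW //.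
have le x : mx_over E x -> al (g *m x) <= al x.
  move=> Ex; have [->|x0] := eqVneq x 0; first by rewrite mulmx0.
  have [|d d0 hd] := near x (al x) Ex; first by rewrite (split_norm_gt0 Hp).
  have [g' [_ fg] hg] := lim d d0.
  rewrite -[g *m x](subrK (g' *m x)); apply: (split_normD_le Hp) => //; first exact: hd.
  by rewrite fg.
suff ug : unitary tau H E g.
  split=> //; exact: (isometry_fixes S Q0_E Q0_unit c0_gt0 h_le h_attained).
apply: isom => // x y Ex Ey; apply/eqP; rewrite -subr_eq0 -(av_eq0 Hp) eq_le ge0 andbT.
apply/ler_addgt0Pr => e e0; rewrite add0r.
have ax := split_norm_ge0 absv Q0 c0 x; have ay := split_norm_ge0 absv Q0 c0 y.
have B0 : 0 < al x + al y + 1 by rewrite ltr_wpDl ?ltr01 ?addr_ge0.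
have e'0 : 0 < e / (al x + al y + 1) by rewrite divr_gt0.
have [d d0 hd] := near x _ Ex e'0; have [d' d'0 hd'] := near y _ Ey e'0.
have m0 : 0 < Num.min d d' by rewrite lt_min d0.
have [g' [ug' fg'] hg] := lim _ m0.
have Eg' : mx_over E g' by case: ug'.
have {}hd : al (g *m x - g' *m x) <= e / (al x + al y + 1).
  by apply: hd => i k; apply: lt_le_trans (hg i k) _; rewrite ge_min lexx.
have {}hd' : al (g *m y - g' *m y) <= e / (al x + al y + 1).
  by apply: hd' => i k; apply: lt_le_trans (hg i k) _; rewrite ge_min lexx orbT.
have Egx := EM Eg Ex; have Egy := EM Eg Ey; have Egx' := EM Eg' Ex; have Egy' := EM Eg' Ey.
have Edx : mx_over E (g *m x - g' *m x) by apply: (mxoB sE).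
have Edy : mx_over E (g *m y - g' *m y) by apply: (mxoB sE).
have -> : h (g *m x) (g *m y) - h x y =
    h (g *m x - g' *m x) (g *m y) + h (g' *m x) (g *m y - g' *m y).
  have e1 : h (g' *m x) (g *m y) =
      h (g' *m x) (g *m y - g' *m y) + h (g' *m x) (g' *m y).
    by rewrite -(herm_Dr S HE Hsym) // subrK.
  rewrite -(unitary_herm S x ug' Ey) herm_Bl e1; ring.
have eb (a : R) : 0 <= a -> a <= al x + al y + 1 -> e / (al x + al y + 1) * a <= e.
  by move=> a0 ha; rewrite mulrAC -mulrA ler_piMr ?(ltW e0) // ler_pdivrMr // mul1r.
apply: (avD_le Hp).
  apply: le_trans (h_le Edx Egy) _; apply: le_trans (eb (al y) ay _); last first.
    by rewrite -addrA [al x + _]addrC -addrA lerDl addr_ge0 ?ler01.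
  by apply: ler_pM => //; [exact: split_norm_ge0|exact: split_norm_ge0|exact: le].
apply: le_trans (h_le Egx' Edy) _; rewrite fg' mulrC; apply: le_trans (eb (al x) ax _); last first.
  by rewrite -addrA lerDl addr_ge0 ?ler01.
by rewrite ler_wpM2r.
Qed.
End Stabilizer.

(** * Polynomials with integral coefficients *)

Section IntegralPolynomials.
Variables (R : realType) (p : nat) (Omega : closedFieldType).
Variable absv : Omega -> R.
Hypothesis Hp : padic_closure absv p.
Local Notation ge0 := (absv_ge0 Hp).
Implicit Types (A B C P : {poly Omega}).

Definition gauss_integral P := forall k, absv P`_k <= 1.
Definition small_poly P := forall k, absv P`_k < 1.

Lemma gauss_integralM A B : gauss_integral A -> gauss_integral B -> gauss_integral (A * B).
Proof.
move=> hA hB k; rewrite coefM; apply: (av_sum_le Hp) => // i _.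
by rewrite (avM Hp) mulr_ile1 ?ge0.
Qed.

Lemma gauss_integralB A B : gauss_integral A -> gauss_integral B -> gauss_integral (A - B).
Proof. by move=> hA hB k; rewrite coefB; apply: (avB_le Hp). Qed.

Lemma gauss_integral1 : gauss_integral 1.
Proof. by move=> k; rewrite coef1; case: eqP => _; rewrite ?(av1 Hp) ?(av0 Hp) ?ler01. Qed.

Lemma gauss_integral_prod (I : Type) (r : seq I) (Q : pred I) F :
  (forall i, Q i -> gauss_integral (F i)) -> gauss_integral (\prod_(i <- r | Q i) F i).
Proof.
by move=> h; apply: big_ind => //; [exact: gauss_integral1|exact: gauss_integralM].
Qed.

Lemma gauss_integralX A N : gauss_integral A -> gauss_integral (A ^+ N).
Proof.
by move=> hA; elim: N => [|N IH]; [exact: gauss_integral1|rewrite exprS; apply: gauss_integralM].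
Qed.

Lemma gauss_integral_horner P t : gauss_integral P -> absv t <= 1 -> absv P.[t] <= 1.
Proof.
move=> hP ht; rewrite horner_coef; apply: (av_sum_le Hp) => // i _.
by rewrite (avM Hp) (avX Hp) mulr_ile1 ?ge0 ?exprn_ge0 ?exprn_ile1 ?ge0.
Qed.

Lemma small_horner P t : small_poly P -> absv t <= 1 -> absv P.[t] < 1.
Proof.
move=> hP ht; rewrite horner_coef; apply: (av_sum_lt Hp) => // i _.
rewrite (avM Hp) (avX Hp); apply: le_lt_trans (hP i).
by rewrite ler_piMr ?ge0 // exprn_ile1 ?ge0.
Qed.

(** Divide by a coefficient of largest absolute value; if P is not integral, the scaling factor is
    small. *)
Lemma scale_integral P : P != 0 -> exists2 c, c != 0 &
  [/\ gauss_integral (c *: P), ~ small_poly (c *: P) & (exists k, 1 < absv P`_k) -> absv c < 1].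
Proof.
move=> P0; have sP : (0 < size P)%N by rewrite size_poly_gt0.
case: (@arg_maxP _ _ _ (Ordinal sP) xpredT (fun i => absv P`_i) isT) => i _ hi.
have hi' k : absv P`_k <= absv P`_i.
  have [lt|ge] := ltnP k (size P); first exact: (hi (Ordinal lt)).
  by rewrite nth_default // (av0 Hp) ge0.
have ci : 0 < absv P`_i.
  apply: lt_le_trans (hi' (size P).-1); rewrite (av_gt0 Hp).
  by rewrite -[P`_ _]/(lead_coef P) lead_coef_eq0.
exists (P`_i)^-1; first by rewrite invr_eq0 -(av_gt0 Hp).
split.
- by move=> k; rewrite coefZ (avM Hp) (avV Hp) ler_pdivrMl // mulr1.
- by move=> /(_ i); rewrite coefZ mulVf -?(av_gt0 Hp) // (av1 Hp) ltxx.
- move=> [k hk]; rewrite (avV Hp) invf_lt1 //; exact: lt_le_trans (hi' k).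
Qed.
End IntegralPolynomials.

(** * Gauss's lemma tested on roots of unity *)

Section Gauss.
Variables (R : realType) (p : nat) (Omega : closedFieldType).
Variable absv : Omega -> R.
Variables (K E : set Omega) (q : nat) (tau sigma : Omega -> Omega) (Pi : Omega).
Hypothesis S : ramified_setup p absv K E q tau sigma Pi.
Let Hp := su_Hp S.
Local Notation ge0 := (absv_ge0 Hp).
Implicit Types (A B C P D : {poly Omega}).

Definition unity (t : Omega) := exists n (z : Omega) l, [/\ (0 < n)%N, (q ^ n - 1).-primitive_root z & t = z ^+ l].

Lemma unity_abs t : unity t -> absv t = 1.
Proof. by move=> [n [z [l [n0 hz ->]]]]; rewrite (avX Hp) (zeta_v S hz) expr1n. Qed.

(* The roots of unity have infinitely many residues, so an integral polynomial
   all of whose values on them are small has small coefficients; the residue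
   ring of polynomials being a domain, the same holds for products. *)
Lemma gauss3 A B C : gauss_integral absv A -> gauss_integral absv B -> gauss_integral absv C ->
  (forall t, unity t -> absv (A.[t] * B.[t] * C.[t]) < 1) ->
  [\/ small_poly absv A, small_poly absv B | small_poly absv C].
Proof.
move=> iA iB iC h; have [k [red [r1 rD rM r0]]] := residue_field Hp.
have red0 : red 0 = 0 by apply/eqP; rewrite r0 (av0 Hp) ?ltr01 ?ler01.
have redX t l : absv t <= 1 -> red (t ^+ l) = red t ^+ l.
  move=> ht; elim: l => [|l IH]; first by rewrite r1.
  by rewrite !exprS rM ?IH // (avX Hp) exprn_ile1 ?ge0.
pose rp P : {poly k} := \poly_(i < size P) red P`_i.
have rpE P t : gauss_integral absv P -> absv t <= 1 -> (rp P).[red t] = red P.[t].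
  move=> iP ht; rewrite horner_poly horner_coef.
  suff : absv (\sum_(i < size P) P`_i * t ^+ i) <= 1 /\
      red (\sum_(i < size P) P`_i * t ^+ i) = \sum_(i < size P) red P`_i * red t ^+ i.
    by case=> _ ->.
  elim/big_rec2: _ => [|i y1 y2 _ [hy ey]]; first by rewrite (av0 Hp) ler01.
  have tX : absv (t ^+ i) <= 1 by rewrite (avX Hp) exprn_ile1 ?ge0.
  have pt : absv (P`_i * t ^+ i) <= 1 by rewrite (avM Hp) mulr_ile1 ?ge0.
  by split; [apply: (avD_le Hp)|rewrite rD // rM // redX // ey].
have rp0 P : gauss_integral absv P -> rp P = 0 -> small_poly absv P.
  move=> iP e i; have [lt|ge] := ltnP i (size P).
    by rewrite -r0 //; have := coef_poly (size P) (fun i => red P`_i) i; rewrite -/(rp P) e coef0 lt => <-.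
  by rewrite nth_default // (av0 Hp) ltr01.
suff /eqP : rp A * rp B * rp C = 0.
  rewrite !mulf_eq0 => /orP[/orP[]|] /eqP /rp0 H; [by constructor 1; exact: H|..].
    by constructor 2; exact: H.
  by constructor 3; exact: H.
set G := rp A * rp B * rp C.
apply/eqP/negPn/negP => G0.
(* This degree provides q^n - 1 >= size G distinct residues, more than a nonzero G can have as
   roots. *)
pose n := (size G).+1; have n0 : (0 < n)%N by [].
have [z hz] := su_zeta_exists S n0.
pose rs := [seq red (z ^+ l) | l <- iota 0 (q ^ n - 1)].
have uz l : unity (z ^+ l) by exists n, z, l.
have v1 l : absv (z ^+ l) <= 1 by rewrite (unity_abs (uz l)).
have rts : all (root G) rs.
  apply/allP => _ /mapP[l _ ->]; rewrite /root /G !hornerM !rpE //.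
  by rewrite -!rM ?r0 ?h // ?(avM Hp) ?mulr_ile1 ?ge0 ?mulr_ge0 ?ge0 ?(gauss_integral_horner Hp).
have un : uniq rs.
  rewrite map_inj_in_uniq ?iota_uniq // => l l'; rewrite !mem_iota !add0n /= => ll ll' e.
  have lt : absv (z ^+ l - z ^+ l') < 1.
    rewrite -r0; last by rewrite (avB_le Hp).
    have m1 : absv (-1) <= 1 by rewrite (avN Hp) (av1 Hp).
    have rN : red (-1) = -1.
      by apply/eqP; rewrite -subr_eq0 opprK -r1 -rD ?(av1 Hp) // addNr red0.
    by rewrite -mulN1r rD ?(avM Hp) ?(avN Hp) ?(av1 Hp) ?mul1r // rM // rN e mulN1r subrr.
  have := su_unity S n0 (zX_unity hz l) (zX_unity hz l') lt.
  by move/eqP; rewrite (eq_prim_root_expr hz) !modn_small // => /eqP.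
have := max_poly_roots G0 rts un; rewrite size_map size_iota ltnNge => /negP; apply.
have : (size G < q ^ n)%N.
  apply: leq_trans (ltn_expl n (ltnW (su_q S))); by rewrite /n leqW.
by rewrite subn1 => h1; rewrite -ltnS prednK // (leq_ltn_trans _ h1).
Qed.

(** P / D^N is a function on the points where D is a unit, integral and idempotent there modulo
    small terms; the conclusion says that its reduction is constantly 0 or 1. At the other points
    nothing is known, but the factor D is small there, which is why it is included in the product
    given to [gauss3]. *)
Lemma path_dichotomy D P N : gauss_integral absv D -> D.[0] = 1 ->
  (forall t, unity t -> absv D.[t] = 1 ->
     absv P.[t] <= 1 /\ absv (P.[t] * (P.[t] - D.[t] ^+ N)) < 1) ->
  small_poly absv P \/ small_poly absv (P - D ^+ N).
Proof.
move=> iD D0 hP.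
have [->|P0] := eqVneq P 0; first by left => k; rewrite coef0 (av0 Hp) ltr01.
have nD : ~ small_poly absv D.
  by move=> sD; have := small_horner Hp (t := 0) sD; rewrite D0 (av1 Hp) (av0 Hp) ltxx ler01 => /(_ isT).
have n1 : ~ small_poly absv 1 by move=> /(_ 0%N); rewrite coef1 (av1 Hp) ltxx.
have Dt t : unity t -> absv D.[t] <= 1.
  by move=> ut; apply: (gauss_integral_horner Hp) => //; rewrite (unity_abs ut).
have iP : gauss_integral absv P.
  move=> k; rewrite leNgt; apply/negP => gt.
  have [c c0 [ic nc lc]] := scale_integral Hp P0.
  have {}lc : absv c < 1 by apply: lc; exists k.
  (* If P were not integral, its normalisation c P would have |c| < 1, so c P times D would be small
     on all roots of unity although neither polynomial is small. *)
  have [] // := gauss3 ic iD (gauss_integral1 Hp).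
  move=> t ut; rewrite hornerC mulr1 (avM Hp).
  have [d1|d1] := eqVneq (absv D.[t]) 1.
    rewrite d1 mulr1 hornerZ (avM Hp); apply: le_lt_trans lc.
    by rewrite ler_piMr ?ge0 //; case: (hP t ut d1).
  have dl : absv D.[t] < 1 by rewrite lt_neqAle d1 Dt.
  apply: le_lt_trans dl; rewrite ler_piMl ?ge0 //.
  by apply: (gauss_integral_horner Hp) => //; rewrite (unity_abs ut).
have iPD : gauss_integral absv (P - D ^+ N).
  by apply: (gauss_integralB Hp) => //; apply: (gauss_integralX Hp).
have [] // := gauss3 iP iPD iD; [|by left|by right].
move=> t ut; have ht : absv t <= 1 by rewrite (unity_abs ut).
rewrite (avM Hp); have [d1|d1] := eqVneq (absv D.[t]) 1.
  by rewrite d1 mulr1 hornerD hornerN horner_exp; case: (hP t ut d1).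
have dl : absv D.[t] < 1 by rewrite lt_neqAle d1 Dt.
apply: le_lt_trans dl; rewrite ler_piMl ?ge0 // (avM Hp) mulr_ile1 ?ge0 //.
  exact: (gauss_integral_horner Hp).
exact: (gauss_integral_horner Hp).
Qed.
End Gauss.

(** * The orthogonal sum and its torus *)

Section BlockIndex.
Variables (V : pzRingType) (j : nat) (s : 'I_j -> nat).
Local Notation n := (\sum_i s i)%N.
Local Notation rk := (@tagnat.Rank j s).

Lemma rkP (k : 'I_n) : exists i l, k = rk i l.
Proof. by exists (tagnat.sig1 k), (tagnat.sig2 k); rewrite tagnat.sig2K. Qed.

Lemma big_rank (W : nmodType) (F : 'I_n -> W) :
  \sum_k F k = \sum_i \sum_(l < s i) F (rk i l).
Proof.
rewrite sig_big_dep /= (reindex _ (@tagnat.rank_bij_on j s)) /=.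
by apply: eq_bigr => p _; rewrite tagnat.rankE.
Qed.

Lemma diag_same (B : forall i, 'M[V]_(s i)) i k l :
  (\mxdiag_i B i) (rk i k) (rk i l) = B i k l.
Proof. by have /matrixP/(_ k l) := submxblock_diag B i; rewrite mxE. Qed.

Lemma diag_diff (B : forall i, 'M[V]_(s i)) i i' k l : i != i' ->
  (\mxdiag_i B i) (rk i k) (rk i' l) = 0.
Proof.
move=> ii'; have /matrixP/(_ k l) :=
  mxblockK (fun i i' => if i == i' then conform_mx 0 (B i) else 0 : 'M_(s i, s i')) i i'.
by rewrite (negPf ii') !mxE.
Qed.

Lemma mxdiag_mulv (B : forall i, 'M[V]_(s i)) (y : 'cV_n) i k :
  (\mxdiag_i B i *m y) (rk i k) 0 = \sum_l B i k l * y (rk i l) 0.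
Proof.
rewrite mxE big_rank (bigD1 i) //= [X in _ + X]big1 ?addr0.
  by apply: eq_bigr => l _; rewrite diag_same.
move=> i' ni; rewrite big1 // => l _.
by rewrite diag_diff ?mul0r // eq_sym.
Qed.
End BlockIndex.

Lemma unr_max (R : realType) (Omega : closedFieldType) (absv : Omega -> R) (E : set Omega) m x :
  unr absv E m x -> max_unr absv E x.
Proof. by exists m. Qed.

(** * The space V in coordinates diagonalising the torus *)

Section Sums.
Variables (R : realType) (p : nat) (Omega : closedFieldType).
Variable absv : Omega -> R.
Variables (K E : set Omega) (q : nat) (tau sigma : Omega -> Omega) (Pi : Omega).
Hypothesis S : ramified_setup p absv K E q tau sigma Pi.

Let Hp := su_Hp S.
Let sE := su_E S.
Let sur := su_ur S.
Let EE := su_Eur S.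
Let ht := su_tau S.
Let hs := su_sigma S.
Local Notation ge0 := (absv_ge0 Hp).
Local Notation Eur := (max_unr absv E).
Local Notation Un n := (unr absv E n).

Variables (j : nat) (s : 'I_j -> nat) (b : forall i, 'I_(s i) -> Omega).
Arguments b : clear implicits.
Variables (varpi : nat -> Omega) (kappa : 'I_j -> Omega) (z : 'I_j -> Omega).
Hypotheses (s_cond : forall i, ((0 < s i)%N /\ ~~ odd (s i)) \/ s i = 1%N)
  (w_unif : forall i, uniformizer absv (Lfield absv K E tau sigma (s i)) (varpi (s i)))
  (kappa_L : forall i, Lfield absv K E tau sigma (s i) (kappa i) /\ kappa i <> 0)
  (b_basis : forall i, ext_basis E (Un (s i)) (b i))
  (hz : forall i, (q ^ s i - 1).-primitive_root (z i)).
Local Notation n := (\sum_i s i)%N.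
Local Notation rk := (@tagnat.Rank j s).
Local Notation H := (gram tau sigma b varpi kappa).
Local Notation u := (fun i => kappa i / varpi (s i)).
Local Notation et i := (Defs.eta tau sigma (s i)).
Local Notation ph i := (Defs.phi tau sigma (s i) (varpi (s i)) (kappa i)).
Local Notation sg m := (iter m sigma).
Local Notation r i := ((s i)./2).

Let s_gt0 i : (0 < s i)%N. Proof. by case: (s_cond i) => [[]|->]. Qed.
Let sL i := unr_subfield S (s_gt0 i) (hz i).
Let b_unr i l : Un (s i) (b i l). Proof. by case: (b_basis i). Qed.
Let b_ur i l : Eur (b i l). Proof. exact: unr_max (b_unr l). Qed.
Let sgm m x : Eur x -> Eur (sg m x). Proof. exact: (sg_ur S). Qed.
Let u_unr i : Un (s i) (u i). Proof. exact: (ratio_unr S (s_cond i) (hz i) (w_unif i) (kappa_L i)). Qed.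
Let u_ur i : Eur (u i). Proof. exact: unr_max (u_unr i). Qed.

Definition piece_coord i (x : 'cV[Omega]_n) := \sum_(l < s i) b i l * x (rk i l) 0.
(** On E^n this is sigma^m of the component in E_(s i), but it is extended linearly to Omega^n. For
    fixed i and m < s i these functionals split E_(s i) tensored with E^ur into lines. *)
Definition conj_coord i m (x : 'cV[Omega]_n) := \sum_(l < s i) sg m (b i l) * x (rk i l) 0.

Lemma conj_coordD i m (x y : 'cV_n) : conj_coord i m (x + y) = conj_coord i m x + conj_coord i m y.
Proof. by rewrite -big_split; apply: eq_bigr => l _; rewrite mxE mulrDr. Qed.

Lemma conj_coordZ i m a (x : 'cV_n) : conj_coord i m (a *: x) = a * conj_coord i m x.
Proof. by rewrite mulr_sumr; apply: eq_bigr => l _; rewrite mxE mulrCA. Qed.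

Lemma conj_coord0 i m : conj_coord i m 0 = 0.
Proof. by apply: big1 => l _; rewrite mxE mulr0. Qed.

Lemma conj_coord_sum i m (I : Type) (rr : seq I) (Q : pred I) (F : I -> 'cV_n) :
  conj_coord i m (\sum_(k <- rr | Q k) F k) = \sum_(k <- rr | Q k) conj_coord i m (F k).
Proof. by apply: (big_morph (conj_coord i m)) => [x y|]; rewrite ?conj_coordD ?conj_coord0. Qed.

Lemma conj_coord_period i m x : conj_coord i (m + s i) x = conj_coord i m x.
Proof.
apply: eq_bigr => l _; congr (_ * _).
by rewrite iterD (sg_period S (s_gt0 i) (hz i)).
Qed.

Lemma conj_coord_E i m (x : 'cV_n) : mx_over E x -> conj_coord i m x = sg m (piece_coord i x).
Proof.
move=> Ex; have h := hsg S m; rewrite (fa_sum sur h) => [|l _].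
  by apply: eq_bigr => l _; rewrite (faM h (b_ur l) (EE (Ex _ _))) (sgE S m (Ex _ _)).
by apply: (sfM sur); [exact: b_ur|exact: EE].
Qed.

Lemma conj_coord_ur i m (x : 'cV_n) : mx_over Eur x -> Eur (conj_coord i m x).
Proof.
by move=> Ex; apply: (sf_sum sur) => l _; apply: (sfM sur) => //; apply: sgm; apply: b_ur.
Qed.

Lemma piece_coord_unr i (x : 'cV_n) : mx_over E x -> Un (s i) (piece_coord i x).
Proof.
move=> Ex; apply: (sf_sum (sL i)) => l _; apply: (sfM (sL i)); first exact: b_unr.
exact: (unr_base S (s_gt0 i) (hz i)).
Qed.

Lemma piece_coordD i (x y : 'cV_n) : piece_coord i (x + y) = piece_coord i x + piece_coord i y.
Proof. exact: (conj_coordD i 0). Qed.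
Lemma piece_coordZ i a (x : 'cV_n) : piece_coord i (a *: x) = a * piece_coord i x.
Proof. exact: (conj_coordZ i 0). Qed.
Lemma piece_coord_sum i (I : Type) (rr : seq I) (Q : pred I) (F : I -> 'cV_n) :
  piece_coord i (\sum_(k <- rr | Q k) F k) = \sum_(k <- rr | Q k) piece_coord i (F k).
Proof. exact: (conj_coord_sum i 0). Qed.

Lemma piece_coord_inj (x : 'cV_n) : mx_over E x -> (forall i, piece_coord i x = 0) -> x = 0.
Proof.
move=> Ex h; apply/colP => k; rewrite [RHS]mxE; have [i [l ->]] := rkP k.
have [_ _ bf] := b_basis i.
apply: (bf (fun l => x (rk i l) 0)) => //; rewrite -[RHS](h i).
by apply: eq_bigr => l' _; rewrite mulrC.
Qed.

Lemma piece_coord_surj (v : 'I_j -> Omega) : (forall i, Un (s i) (v i)) ->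
  exists x : 'cV_n, mx_over E x /\ forall i, piece_coord i x = v i.
Proof.
move=> hv; have ex i : exists c : 'I_(s i) -> Omega,
    (forall l, E (c l)) /\ v i = \sum_l c l * b i l.
  by have [_ bs _] := b_basis i; have [c hc e] := bs _ (hv i); exists c.
pose c i := projT1 (cid (ex i)).
have hc i : (forall l, E (c i l)) /\ v i = \sum_l c i l * b i l := projT2 (cid (ex i)).
pose x : 'cV[Omega]_n := \col_k c (tagnat.sig1 k) (tagnat.sig2 k).
exists x; split=> [k l|i]; first by rewrite mxE; case: (hc (tagnat.sig1 k)) => h _; apply: h.
have xr l : x (rk i l) 0 = c i l.
  rewrite mxE; have := tagnat.rankK (Tagged (fun i => 'I_(s i)) l).
  rewrite -[tagnat.rank _]/(rk i l) tagnat.sigE12 => e.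
  by rewrite -[LHS]/((fun t : {i & 'I_(s i)} => c (tag t) (tagged t)) (Tagged _ (tagnat.sig2 (rk i l)))) e.
by rewrite (hc i).2; apply: eq_bigr => l _; rewrite xr mulrC.
Qed.

(** In the split coordinates, coordinate m is paired with coordinate m + r because eta = tau
    sigma^r. This shape makes the norm equation of the torus visible as invariance of the form. *)
Lemma herm_ur (x y : 'cV_n) : mx_over Eur x -> mx_over Eur y ->
  herm_form tau H x y =
  \sum_i \sum_(m < s i) sg m (u i) * conj_coord i m x * tau (conj_coord i (m + r i) y).
Proof.
move=> Ex Ey; rewrite /herm_form -mulmxA mxE big_rank; apply: eq_bigr => i _.
transitivity (\sum_k \sum_l \sum_(m < s i) x (rk i k) 0 * (tau (y (rk i l) 0) *
    sg m (u i * b i k * et i (b i l)))).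
  apply: eq_bigr => k _; rewrite mxE mxdiag_mulv mulr_sumr; apply: eq_bigr => l _.
  rewrite !mxE -mulr_sumr; congr (_ * _); rewrite mulrC -mulr_sumr; congr (_ * _).
rewrite exchange_big /=; under eq_bigr do rewrite exchange_big /=.
rewrite exchange_big /=; apply: eq_bigr => m _.
have h := hsg S m.
have -> : tau (conj_coord i (m + r i) y) = \sum_l sg m (et i (b i l)) * tau (y (rk i l) 0).
  rewrite (fa_sum sur ht) => [|l _]; last by apply: (sfM sur) => //; apply: sgm; apply: b_ur.
  apply: eq_bigr => l _; rewrite (faM ht) //; last by apply: sgm; apply: b_ur.
  by rewrite /Defs.eta iterD (tau_sg S) //; apply: sgm; apply: b_ur.
rewrite mulr_sumr; apply: eq_bigr => l _.
rewrite -mulrA mulr_suml mulr_sumr; apply: eq_bigr => k _.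
have er : Eur (et i (b i l)) by apply: (fa_mem (heta S (s i))); apply: b_ur.
rewrite (faM h (sfM sur (u_ur i) (b_ur k)) er) (faM h (u_ur i) (b_ur k)).
ring.
Qed.

Lemma herm_piece_coord (x y : 'cV_n) : mx_over E x -> mx_over E y ->
  herm_form tau H x y = \sum_i ph i (piece_coord i x) (piece_coord i y).
Proof.
move=> Ex Ey.
rewrite herm_ur => [|i k|i k]; [|exact: EE..]; apply: eq_bigr => i _.
have ux := piece_coord_unr i Ex; have uy := piece_coord_unr i Ey.
apply: eq_bigr => m _; rewrite !conj_coord_E //; have h := hsg S m.
have xr := unr_max ux; have er : Eur (et i (piece_coord i y)).
  by apply: (fa_mem (heta S (s i))); apply: unr_max uy.
rewrite (faM h (sfM sur (u_ur i) xr) er) (faM h (u_ur i) xr) iterD; congr (_ * _).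
by rewrite (tau_sg S) //; apply: sgm; apply: unr_max uy.
Qed.

Definition piece_scale i : R := Num.sqrt (absv (u i)).

Lemma piece_scale_sq i : piece_scale i ^+ 2 = absv (u i).
Proof. by rewrite sqr_sqrtr // ge0. Qed.

Lemma piece_scale_gt0 i : 0 < piece_scale i.
Proof.
rewrite sqrtr_gt0 (av_gt0 Hp).
exact: (ratio_neq0 (w_unif i) (kappa_L i)).
Qed.

Definition zvec (k : 'I_n) : 'cV[Omega]_n := xget 0 [set x | mx_over E x /\
  forall i, piece_coord i x = if i == tagnat.sig1 k then z i ^+ tagnat.sig2 k else 0].

Lemma zvecP k : mx_over E (zvec k) /\
  forall i, piece_coord i (zvec k) = if i == tagnat.sig1 k then z i ^+ tagnat.sig2 k else 0.
Proof.
have [|x hx] := @piece_coord_surj (fun i => if i == tagnat.sig1 k then z i ^+ tagnat.sig2 k else 0).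
  move=> i; case: ifP => _; last exact: (sf0 (sL i)).
  by apply: (sfX (sL i)); apply: (zeta_in S (s_gt0 i) (hz i)).
exact: (@xgetPex _ 0 [set x | mx_over E x /\ forall i, piece_coord i x = _] (ex_intro _ x hx)).
Qed.

Lemma zvec_coord i i' l : piece_coord i (zvec (rk i' l)) = if i == i' then z i ^+ l else 0.
Proof.
rewrite (zvecP _).2; have := tagnat.rankK (Tagged (fun i => 'I_(s i)) l).
rewrite -[tagnat.rank _]/(rk i' l) tagnat.sigE12 => e.
by rewrite -[LHS]/((fun t : {i & 'I_(s i)} => if i == tag t then z i ^+ tagged t else 0)
  (Tagged _ (tagnat.sig2 (rk i' l)))) e.
Qed.

(* The columns of P0 correspond to the powers of z i in E_(s i). *)
Definition P0 : 'M[Omega]_n := \matrix_(k, l) zvec l k 0.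

Lemma col_P0 k : col k P0 = zvec k.
Proof. by apply/colP => i; rewrite !mxE. Qed.

Lemma P0_E : mx_over E P0.
Proof. by move=> k l; rewrite mxE; case: (zvecP l). Qed.

Lemma conj_coord_P0 i m (y : 'cV_n) :
  conj_coord i m (P0 *m y) = \sum_(l < s i) sg m (z i ^+ l) * y (rk i l) 0.
Proof.
rewrite mul_col_sum conj_coord_sum big_rank (bigD1 i) //= [X in _ + X]big1 ?addr0.
  apply: eq_bigr => l _; rewrite conj_coordZ col_P0 conj_coord_E; last by case: (zvecP (rk i l)).
  by rewrite zvec_coord eqxx mulrC.
move=> i' ni; apply: big1 => l _.
rewrite conj_coordZ col_P0 conj_coord_E; last by case: (zvecP (rk i' l)).
by rewrite zvec_coord eq_sym (negPf ni) (fa0 sur (hsg S m)) mulr0.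
Qed.

Lemma sg_zX i m l : sg m (z i ^+ l) = (z i ^+ l) ^+ (q ^ m)%N.
Proof.
have zr := zeta_ur S (s_gt0 i) (hz i).
by rewrite (faX Hp sur (hsg S m) _ zr) (zeta_sg S (s_gt0 i) (hz i)) exprAC.
Qed.

Lemma P0_unit : P0 \in unitmx.
Proof.
rewrite -unitmx_tr unitmxE unitfE; apply/eqP => /(det0_over sE (mxo_tr P0_E)).
move=> [v [v0 Ev vP]]; case/eqP: v0.
have Pv : P0 *m v^T = 0 by rewrite -[P0]trmxK -trmx_mul vP trmx0.
apply/rowP => k; rewrite [RHS]mxE; have [i [l ->]] := rkP k.
have h := v_orthonormal_free Hp (zeta_ortho S (s_gt0 i) (hz i)).
apply: (h (fun l => v 0 (rk i l))) => //.
have := conj_coord_P0 i 0 v^T; rewrite Pv conj_coord0 => e; rewrite -[RHS]/(0 : Omega) {2}e.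
by apply: eq_bigr => l' _; rewrite mxE mulrC.
Qed.

Definition alpha0 : 'cV[Omega]_n -> R := split_norm absv P0 (fun k => piece_scale (tagnat.sig1 k)).

Lemma alpha0_ge i m x : piece_scale i * absv (conj_coord i m x) <= alpha0 x.
Proof.
rewrite -{1}[x](mulKVmx P0_unit) conj_coord_P0 -ler_pdivlMl ?piece_scale_gt0 //.
apply: (av_sum_le Hp) => [|l _].
  rewrite mulr_ge0 ?invr_ge0 ?(ltW (piece_scale_gt0 i)) //.
  exact: split_norm_ge0.
rewrite ler_pdivlMl ?piece_scale_gt0 // sg_zX.
apply: le_trans (split_norm_ge _ _ _ _ (rk i l)); rewrite tagnat.Rank1K.
rewrite ler_wpM2l ?(ltW (piece_scale_gt0 i)) // (avM Hp) ler_piMl ?ge0 //.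
by rewrite !(avX Hp) (zeta_v S (hz i)) !expr1n.
Qed.

(** With [alpha0_ge] this shows that alpha0 is the maximum of the scaled |conj_coord i m x| on all
    of Omega^n, because [zeta_mx] and its inverse are integral. Elements diagonal in these
    coordinates are then easy to compare with alpha0. *)
Lemma alpha0_le x (C : R) : 0 <= C ->
  (forall i (m : 'I_(s i)), piece_scale i * absv (conj_coord i m x) <= C) -> alpha0 x <= C.
Proof.
move=> C0 h; apply: (split_norm_le) => // k.
have [i [l ->]] := rkP k; rewrite tagnat.Rank1K.
pose y := invmx P0 *m x.
have ey : \col_l y (rk i l) 0 = invmx (zeta_mx q (s i) (z i)) *m \col_m conj_coord i m x.
  apply: (canRL (mulKmx (zeta_mx_unit S (s_gt0 i) (hz i)))).
  apply/colP => m; rewrite !mxE -{1}[x](mulKVmx P0_unit) conj_coord_P0.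
  by apply: eq_bigr => l' _; rewrite !mxE sg_zX.
have -> : y (rk i l) 0 = (\col_l y (rk i l) 0) l 0 by rewrite mxE.
rewrite ey mxE -ler_pdivlMl ?piece_scale_gt0 //; apply: (av_sum_le Hp) => [|m _].
  by rewrite mulr_ge0 ?invr_ge0 ?(ltW (piece_scale_gt0 i)).
rewrite ler_pdivlMl ?piece_scale_gt0 //; apply: le_trans (h i m).
rewrite ler_wpM2l ?(ltW (piece_scale_gt0 i)) // !mxE (avM Hp) ler_piMl ?ge0 //.
exact: (zeta_mx_inv_int S (s_gt0 i) (hz i)).
Qed.

Lemma alpha0_leE x (C : R) : mx_over E x -> 0 <= C ->
  (forall i, piece_scale i * absv (piece_coord i x) <= C) -> alpha0 x <= C.
Proof.
move=> Ex C0 h; apply: alpha0_le => // i m.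
rewrite conj_coord_E // (fa_abs (hsg S m)) //.
exact: unr_max (piece_coord_unr i Ex).
Qed.

Lemma alpha0_geE i x : piece_scale i * absv (piece_coord i x) <= alpha0 x.
Proof. exact: (alpha0_ge i 0). Qed.

Local Notation mu i := (mult_mx E (b i)).

Lemma multP i a : Un (s i) a ->
  mx_over E (mu i a) /\ forall l, a * b i l = \sum_k mu i a k l * b i k.
Proof.
move=> ha; have [_ bs _] := b_basis i.
have ex l : exists c : 'I_(s i) -> Omega,
    (forall k, E (c k)) /\ a * b i l = \sum_k c k * b i k.
  by have [c hc e] := bs _ (sfM (sL i) ha (b_unr l)); exists c.
have [c hc] := choice ex.
apply: (@xgetPex _ 0 [set A | mx_over E A /\ forall l, a * b i l = \sum_k A k l * b i k]).
exists (\matrix_(k, l) c l k); split=> [k l|l]; first by rewrite mxE; case: (hc l).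
by rewrite (hc l).2; apply: eq_bigr => k _; rewrite mxE.
Qed.

(** The passage from the coordinates in the basis b to the embeddings; conjugation by it
    diagonalises multiplication by elements of E_(s i). *)
Definition emb_mx i : 'M[Omega]_(s i) := \matrix_(m, l) sg m (b i l).

Lemma conj_coord_emb i (m : 'I_(s i)) (x : 'cV_n) :
  conj_coord i m x = \sum_l emb_mx i m l * x (rk i l) 0.
Proof. by apply: eq_bigr => l _; rewrite mxE. Qed.

Lemma emb_mx_ur i : mx_over Eur (emb_mx i).
Proof. by move=> m l; rewrite mxE; apply: sgm; apply: b_ur. Qed.

Lemma emb_mx_unit i : emb_mx i \in unitmx.
Proof.
have ex l : exists c : 'I_(s i) -> Omega,
    (forall k, E (c k)) /\ b i l = \sum_k c k * z i ^+ k.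
  by have [c hc e] := zeta_gen S (s_gt0 i) (hz i) (b_unr l); exists c.
have [e he] := choice ex.
pose M : 'M[Omega]_(s i) := \matrix_(l, t) e l t.
have EM : mx_over E M by move=> l t; rewrite mxE; case: (he l).
have -> : emb_mx i = zeta_mx q (s i) (z i) *m M^T.
  apply/matrixP => m l; rewrite !mxE (he l).2 (zeta_sum_sg S (s_gt0 i) (hz i)); last by case: (he l).
  by apply: eq_bigr => t _; rewrite !mxE mulrC.
rewrite unitmx_mul (zeta_mx_unit S (s_gt0 i) (hz i)) unitmx_tr unitmxE unitfE.
apply/eqP => /(det0_over sE EM)[v [v0 Ev vM]]; case/eqP: v0.
have [_ _ bf] := b_basis i.
apply/rowP => l; rewrite [RHS]mxE; apply: (bf (fun l => v 0 l)) => //.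
under eq_bigr do rewrite (he _).2 mulr_sumr.
rewrite exchange_big /= big1 // => t _; under eq_bigr do rewrite mulrA.
rewrite -mulr_suml; suff -> : \sum_k v 0 k * e k t = 0 by rewrite mul0r.
move/rowP/(_ t): vM; rewrite !mxE => h; rewrite -[RHS]h.
by apply: eq_bigr => l' _; rewrite mxE.
Qed.

Lemma emb_mult i a : Un (s i) a ->
  emb_mx i *m mu i a = diag_mx (\row_m sg m a) *m emb_mx i.
Proof.
move=> ha; have [EM hM] := multP ha; have ar := unr_max ha.
apply/matrixP => m l; rewrite mul_diag_mx !mxE; have h := hsg S m.
rewrite -(faM h ar (b_ur l)) hM (fa_sum sur h) => [|k _]; last first.
  by apply: (sfM sur); [exact: EE|exact: b_ur].
apply: eq_bigr => k _; rewrite mxE (faM h (EE (EM _ _)) (b_ur k)).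
by rewrite (sgE S m (EM _ _)) mulrC.
Qed.

Lemma emb_mult_sum i (c a : 'I_(s i) -> Omega) : (forall t, Un (s i) (a t)) ->
  emb_mx i *m (\sum_t c t *: mu i (a t)) =
  diag_mx (\row_m \sum_t c t * sg m (a t)) *m emb_mx i.
Proof.
move=> ha; rewrite mulmx_sumr.
under eq_bigr do rewrite -scalemxAr emb_mult // scalemxAl.
rewrite -mulmx_suml; congr (_ *m _); apply/matrixP => m l.
rewrite summxE !mxE -sumrMnl; apply: eq_bigr => t _.
by rewrite !mxE mulrnAr.
Qed.

(** * The torus over K^ur in terms of eigenvalues *)

Definition acts_by (x : 'I_j -> nat -> Omega) (A : 'M[Omega]_n) : Prop :=
  forall (y : 'cV_n) i m, conj_coord i m (A *m y) = x i m * conj_coord i m y.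

(* The eigenvalues of an element of T(K^ur), indexed by the embeddings. *)
Record eigenfamily (x : 'I_j -> nat -> Omega) : Prop := Eigenfamily {
  eigenfamily_ur : forall i m, Eur (x i m);
  eigenfamily_period : forall i m, x i (m + s i)%N = x i m;
  eigenfamily_norm : forall i m, x i m * tau (x i (m + r i)%N) = 1 }.

Lemma periodic_mod (T : Type) (f : nat -> T) d : (forall m, f (m + d)%N = f m) ->
  forall m, f m = f (m %% d)%N.
Proof.
move=> hf m; rewrite {1}(divn_eq m d); elim: (m %/ d)%N => [|l IH].
  by rewrite mul0n add0n.
by rewrite mulSn -addnA addnC hf.
Qed.

Lemma actsI x (B : forall i, 'M[Omega]_(s i)) :
  (forall i m, x i (m + s i)%N = x i m) ->
  (forall i, emb_mx i *m B i = diag_mx (\row_m x i m) *m emb_mx i) ->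
  acts_by x (\mxdiag_i B i).
Proof.
move=> xp hB y i m.
rewrite (periodic_mod (fun m => conj_coord_period i m _)) (periodic_mod (xp i)).
rewrite [conj_coord i m y](periodic_mod (fun m => conj_coord_period i m _)).
have lt : (m %% s i < s i)%N by rewrite ltn_mod.
rewrite -[(m %% s i)%N]/(nat_of_ord (Ordinal lt)); move: (Ordinal lt) => {lt}l.
rewrite !conj_coord_emb mulr_sumr.
transitivity (\sum_k \sum_t emb_mx i l k * B i k t * y (rk i t) 0).
  apply: eq_bigr => k _; rewrite mxdiag_mulv mulr_sumr.
  by apply: eq_bigr => t _; rewrite mulrA.
rewrite exchange_big /=; apply: eq_bigr => t _.
rewrite -mulr_suml mulrA; congr (_ * _).
have /matrixP/(_ l t) := hB i; rewrite [LHS]mxE mul_diag_mx [RHS]mxE => ->.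
by rewrite [X in X * _]mxE.
Qed.

Lemma acts_uniq x A A' : acts_by x A -> acts_by x A' -> A = A'.
Proof.
move=> h h'; apply/matrixP => k l.
have e : A *m delta_mx l 0 - A' *m delta_mx l 0 = 0 :> 'cV[Omega]_n.
  apply/eqP; rewrite -(split_norm_eq0 Hp P0_unit (fun k => piece_scale_gt0 (tagnat.sig1 k))).
  rewrite eq_le split_norm_ge0 andbT; apply: alpha0_le => // i m.
  by rewrite conj_coordD -scaleN1r conj_coordZ h h' mulN1r subrr (av0 Hp) mulr0.
move/eqP: e; rewrite subr_eq0 => /eqP/matrixP/(_ k 0).
by rewrite -!colE !mxE.
Qed.

Lemma actsM x x' A A' : acts_by x A -> acts_by x' A' -> acts_by (fun i m => x i m * x' i m) (A *m A').
Proof. by move=> h h' y i m; rewrite -mulmxA h h' mulrA. Qed.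

Lemma acts1 : acts_by (fun _ _ => 1) 1%:M.
Proof. by move=> y i m; rewrite mul1mx mul1r. Qed.

Lemma eigenfamilyM x x' : eigenfamily x -> eigenfamily x' -> eigenfamily (fun i m => x i m * x' i m).
Proof.
move=> h h'; split=> i m.
- by apply: (sfM sur); apply: eigenfamily_ur.
- by rewrite !eigenfamily_period.
- rewrite (faM ht (eigenfamily_ur h i _) (eigenfamily_ur h' i _)) mulrACA.
  by rewrite (eigenfamily_norm h i m) (eigenfamily_norm h' i m) mulr1.
Qed.

Lemma eigenfamily1 : eigenfamily (fun _ _ => 1).
Proof. by split=> // i m; [apply: (sf1 sur)|rewrite (fa1 Hp sur ht) mulr1]. Qed.

Lemma eigenfamilyV x : eigenfamily x -> eigenfamily (fun i m => (x i m)^-1).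
Proof.
move=> h; split=> i m; first by apply/(sfV sur)/eigenfamily_ur.
  by rewrite eigenfamily_period.
by rewrite (faV Hp sur ht (eigenfamily_ur h i _)) -invfM (eigenfamily_norm h i m) invr1.
Qed.

Lemma eigenfamily_neq0 x i m : eigenfamily x -> x i m != 0.
Proof.
move=> h; apply/eqP => e; have /eqP := eigenfamily_norm h i m.
by rewrite e mul0r eq_sym oner_eq0.
Qed.

Local Notation TKur := (torusKur absv E tau sigma b).

Lemma torusKur_over A : TKur A -> mx_over Eur A.
Proof.
move=> [B hB ->] k l; have [i [k' ->]] := rkP k; have [i' [l' ->]] := rkP l.
have [ii|ii] := eqVneq i i'; last by rewrite diag_diff //; apply: (sf0 sur).
move: l'; rewrite -ii => l'; rewrite diag_same.
have [c hc [-> _]] := hB i; rewrite summxE; apply: (sf_sum sur) => t _; rewrite mxE.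
by apply: (sfM sur) => //; apply: EE; case: (multP (b_unr t)) => h _; apply: h.
Qed.

(** The second factor in the definition of [torus_Kur] has eigenvalues tau(x (m + r)), so the
    equation there becomes x m tau(x (m + r)) = 1. *)
Lemma emb_torus i (c : 'I_(s i) -> Omega) : (forall t, Eur (c t)) ->
  let x m := \sum_t c t * sg m (b i t) in
  emb_mx i *m (\sum_t tau (c t) *: mu i (et i (b i t))) =
    diag_mx (\row_m tau (x (m + r i)%N)) *m emb_mx i.
Proof.
move=> hc x; rewrite emb_mult_sum => [|t]; last first.
  by apply: (eta_unr S (s_gt0 i) (hz i)); apply: b_unr.
congr (diag_mx _ *m _); apply/rowP => m; rewrite !mxE.
rewrite (fa_sum sur ht) => [|t _]; last first.
  by apply: (sfM sur) => //; apply: sgm; apply: b_ur.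
apply: eq_bigr => t _; have br := sgm (m + r i) (b_ur t).
by rewrite (faM ht (hc t) br) /Defs.eta iterD -(tau_sg S m (sgm (r i) (b_ur t))).
Qed.

Lemma torus_eigenfamily A : TKur A -> exists2 x, eigenfamily x & acts_by x A.
Proof.
move=> [B hB ->].
have ex i : exists c : 'I_(s i) -> Omega, (forall t, Eur (c t)) /\
    (B i = \sum_t c t *: mu i (b i t) /\
     B i *m (\sum_t tau (c t) *: mu i (et i (b i t))) = 1%:M).
  by have [c hc hB'] := hB i; exists c.
pose c i := projT1 (cid (ex i)).
have hc i : (forall t, Eur (c i t)) /\ (B i = \sum_t c i t *: mu i (b i t) /\
     B i *m (\sum_t tau (c i t) *: mu i (et i (b i t))) = 1%:M) := projT2 (cid (ex i)).
pose x i m := \sum_t c i t * sg m (b i t).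
have xp i m : x i (m + s i)%N = x i m.
  by apply: eq_bigr => t _; rewrite iterD (sg_period S (s_gt0 i) (hz i) (b_unr t)).
have eB i : emb_mx i *m B i = diag_mx (\row_m x i m) *m emb_mx i.
  by rewrite (hc i).2.1 emb_mult_sum => // t; apply: b_unr.
exists x; last exact: actsI.
split=> // i m.
  apply: (sf_sum sur) => t _; apply: (sfM sur); first by case: (hc i) => h _; apply: h.
  by apply: sgm; apply: b_ur.
have norm (l : 'I_(s i)) : x i l * tau (x i (l + r i)%N) = 1.
  have e := emb_torus (hc i).1; have e1 : emb_mx i *m (B i *m (\sum_t tau (c i t) *: mu i (et i (b i t)))) =
      emb_mx i by rewrite (hc i).2.2 mulmx1.
  rewrite mulmxA eB -mulmxA e mulmxA in e1.
  have := congr1 (fun M => M *m invmx (emb_mx i)) e1.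
  rewrite /= mulmxK ?emb_mx_unit // mulmxV ?emb_mx_unit //.
  by move/matrixP/(_ l l); rewrite mul_diag_mx !mxE eqxx !mulr1n.
have lt : (m %% s i < s i)%N by rewrite ltn_mod.
rewrite -(norm (Ordinal lt)) /= -(periodic_mod (xp i)).
congr (_ * tau _).
by rewrite (periodic_mod (xp i)) [RHS](periodic_mod (xp i)) modnDml.
Qed.

(** [emb_mx] is invertible over E^ur, so any values in E^ur, one for each embedding, come from
    coefficients c in E^ur. *)
Lemma eigenfamily_torus x : eigenfamily x -> exists2 A, TKur A & acts_by x A.
Proof.
move=> hx.
pose c i : 'cV[Omega]_(s i) := invmx (emb_mx i) *m \col_m x i m.
have cur i t : Eur (c i t 0).
  apply: (mxo_mul sur); first exact: (mxo_inv sur (@emb_mx_ur i)).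
  by move=> l l'; rewrite mxE; apply: eigenfamily_ur.
pose x' i m := \sum_t c i t 0 * sg m (b i t).
have x'p i m : x' i (m + s i)%N = x' i m.
  by apply: eq_bigr => t _; rewrite iterD (sg_period S (s_gt0 i) (hz i) (b_unr t)).
have ex i m : x' i m = x i m.
  rewrite (periodic_mod (x'p i)) (periodic_mod (eigenfamily_period hx i)).
  have lt : (m %% s i < s i)%N by rewrite ltn_mod.
  rewrite -[(m %% s i)%N]/(nat_of_ord (Ordinal lt)); move: (Ordinal lt) => {lt}l.
  have := mulKVmx (emb_mx_unit i) (\col_m x i m); rewrite -/(c i).
  move/matrixP/(_ l 0); rewrite !mxE => <-; apply: eq_bigr => t _.
  by rewrite !mxE mulrC.
pose B i := \sum_t c i t 0 *: mu i (b i t).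
have eB i : emb_mx i *m B i = diag_mx (\row_m x i m) *m emb_mx i.
  rewrite emb_mult_sum; last by move=> t; apply: b_unr.
  by congr (diag_mx _ *m _); apply/rowP => m; rewrite !mxE -ex.
exists (\mxdiag_i B i); last by apply: actsI => // i m; apply: eigenfamily_period.
exists B => // i; exists (fun t => c i t 0) => //; split=> //.
apply: (can_inj (mulKmx (emb_mx_unit i))); rewrite mulmx1 mulmxA eB -mulmxA.
rewrite (emb_torus (cur i)) mulmxA.
rewrite (_ : diag_mx _ *m diag_mx _ = 1%:M) ?mul1mx //.
apply/matrixP => m l; rewrite mul_diag_mx !mxE mulrnAr -/(x' i (m + r i)%N) ex.
by rewrite (eigenfamily_norm hx i m).
Qed.

Lemma acts_ext x x' A : (forall i m, x i m = x' i m) -> acts_by x A -> acts_by x' A.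
Proof. by move=> e h y i m; rewrite h e. Qed.

Lemma acts_inv x A : eigenfamily x -> acts_by x A ->
  A \in unitmx /\ acts_by (fun i m => (x i m)^-1) (invmx A).
Proof.
move=> hx hA; have [A' _ hA'] := eigenfamily_torus (eigenfamilyV hx).
have e : A *m A' = 1%:M.
  apply: (acts_uniq _ acts1); apply: acts_ext (actsM hA hA') => i m.
  by rewrite divff // eigenfamily_neq0.
have [uA _] := mulmx1_unit e; split=> //.
suff -> : invmx A = A' by [].
by rewrite -[RHS](mulKmx uA) e mulmx1.
Qed.

Lemma acts_alpha0 x A y : acts_by x A -> (forall i m, absv (x i m) = 1) ->
  alpha0 (A *m y) = alpha0 y.
Proof.
move=> hA x1; apply/eqP; rewrite eq_le; apply/andP; split; apply: alpha0_le => [|i m].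
- exact: split_norm_ge0.
- by rewrite hA (avM Hp) x1 mul1r alpha0_ge.
- exact: split_norm_ge0.
- by rewrite -[absv _]mul1r -(x1 i m) -(avM Hp) -hA alpha0_ge.
Qed.

Lemma acts_unitary (F : set Omega) x A : F `<=` Eur -> mx_over F A -> eigenfamily x -> acts_by x A ->
  unitary tau H F A.
Proof.
move=> FE EA hx hA; have [uA _] := acts_inv hx hA.
apply: (unitary_isometry S) => // k l.
have d0 k' : mx_over Eur (delta_mx k' 0 : 'cV[Omega]_n) by apply: (mxo_delta sur).
have Ad k' : mx_over Eur (A *m delta_mx k' 0 : 'cV[Omega]_n).
  by apply: (mxo_mul sur) => // i i'; apply: FE.
rewrite !herm_ur //; apply: eq_bigr => i _; apply: eq_bigr => m _.
rewrite !hA (faM ht (eigenfamily_ur hx i _) (conj_coord_ur i _ (d0 l))).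
rewrite -[RHS]mulr1 -(eigenfamily_norm hx i m); ring.
Qed.

Lemma bounded_entries : exists C : R, forall A, (forall y, alpha0 (A *m y) = alpha0 y) ->
  forall k l, absv (A k l) <= C.
Proof. exact: (fixes_bounded Hp P0_unit (fun k => piece_scale_gt0 (tagnat.sig1 k))). Qed.

(** All powers of an element of a bounded group are bounded, so its eigenvalues have absolute value
    at most 1; the inverse gives the opposite inequality. *)
Lemma max_bounded_acts A : max_bounded absv TKur A ->
  exists x, [/\ eigenfamily x, acts_by x A & forall i m, absv (x i m) = 1].
Proof.
move=> [Q [[QT Q1 QM QV] [C hC]] QA].
have bound x B : eigenfamily x -> acts_by x B -> (forall e : nat, Q (iter e (mulmx B) 1%:M)) ->
    forall i m, absv (x i m) <= 1.
  move=> hx hB hQ i m; have l0 := Ordinal (s_gt0 i).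
  have actsX e : acts_by (fun i m => x i m ^+ e) (iter e (mulmx B) 1%:M).
    elim: e => [|e IH]; first exact: acts1.
    by apply: acts_ext (actsM hB IH) => i' m'; rewrite exprS.
  (* A test vector with a nonzero coordinate at every embedding of the piece i, so that growth of an
     eigenvalue would show in the entries. *)
  pose d : 'cV[Omega]_n := delta_mx (rk i l0) 0.
  have b0 : b i l0 != 0.
    have [_ _ bf] := b_basis i; apply/eqP => b0.
    have h := bf (fun l => (l == l0)%:R) (fun l => sf_nat sE _).
    suff /h/(_ l0)/eqP : \sum_l (l == l0)%:R * b i l = 0 by rewrite eqxx oner_eq0.
    by apply: big1 => l _; case: eqP => [->|_]; rewrite ?b0 ?mulr0 ?mul0r.
  have cmd : conj_coord i m d = sg m (b i l0).
    rewrite /conj_coord (bigD1 l0) //= mxE !eqxx mulr1 big1 ?addr0 // => l nl.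
    by rewrite mxE -[rk i l == _]val_eqE /= tagnat.eq_Rank eqxx val_eqE (negPf nl) mulr0.
  have v0 : 0 < absv (sg m (b i l0)) by rewrite (fa_abs (hsg S m) (b_ur l0)) (av_gt0 Hp).
  rewrite leNgt; apply/negP => gt1.
  pose B' := \sum_l absv (sg m (b i l)) * `|C|.
  have le e : absv (x i m) ^+ e * absv (sg m (b i l0)) <= B'.
    rewrite -(avX Hp) -(avM Hp) -cmd -actsX; apply: (av_sum_le Hp) => [|l _].
      by apply: sumr_ge0 => l _; rewrite mulr_ge0 ?ge0.
    rewrite (avM Hp); apply: (@le_trans _ _ (absv (sg m (b i l)) * `|C|)).
      rewrite ler_wpM2l ?ge0 // -colE mxE; apply: le_trans (ler_norm _).
      exact: hC.
    by rewrite /B' (bigD1 l) //= lerDl sumr_ge0 // => l' _; rewrite mulr_ge0 ?ge0.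
  have x0 : 0 < absv (x i m) by apply: lt_trans gt1.
  have B0 : 0 < B' + 1.
    by rewrite ltr_wpDl ?ltr01 // sumr_ge0 // => l' _; rewrite mulr_ge0 ?ge0.
  have v1 : 0 < (absv (x i m))^-1 by rewrite invr_gt0.
  have v2 : (absv (x i m))^-1 < 1 by rewrite invf_lt1.
  have [N hN] := geometric_lt (ltW v1) v2 (divr_gt0 v0 B0).
  have := hN N (leqnn N); rewrite exprVn ltr_pdivlMr // ltr_pdivrMl ?exprn_gt0 //.
  rewrite ltNge => /negP[]; apply: le_trans (le N) _.
  by rewrite lerDl ler01.
have iterQ B : Q B -> forall e, Q (iter e (mulmx B) 1%:M).
  by move=> QB; elim=> //= e IH; apply: QM.
have [x hx hA] := torus_eigenfamily (QT _ QA); exists x; split=> // i m.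
have [uA hAi] := acts_inv hx hA.
apply/eqP; rewrite eq_le (bound x A) //=; last exact: iterQ.
have := bound _ _ (eigenfamilyV hx) hAi (iterQ _ (QV _ QA)) i m.
have x0 : 0 < absv (x i m) by rewrite (av_gt0 Hp) eigenfamily_neq0.
by rewrite (avV Hp) invf_le1.
Qed.

(** All families with eigenvalues of absolute value 1 form a group fixing alpha0, and the fixer of a
    split norm has bounded entries. *)
Lemma acts_max_bounded x A : eigenfamily x -> acts_by x A -> (forall i m, absv (x i m) = 1) ->
  max_bounded absv TKur A.
Proof.
move=> hx hA x1.
exists [set A | exists x, [/\ eigenfamily x, acts_by x A & forall i m, absv (x i m) = 1]]; last by exists x.
split; last first.
  have [C hC] := bounded_entries; exists C => B [y [hy hB y1]] k l.
  by apply: hC => v; apply: (acts_alpha0 _ hB).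
split.
- move=> B [y [hy hB y1]]; have [B' TB' hB'] := eigenfamily_torus hy.
  by rewrite (acts_uniq hB hB').
- by exists (fun _ _ => 1); split=> // [||i m]; [exact: eigenfamily1|exact: acts1|exact: (av1 Hp)].
- move=> B B' [y [hy hB y1]] [y' [hy' hB' y1']].
  exists (fun i m => y i m * y' i m); split; [exact: eigenfamilyM|exact: actsM|].
  by move=> i m; rewrite (avM Hp) y1 y1' mulr1.
- move=> B [y [hy hB y1]]; have [uB hBi] := acts_inv hy hB.
  exists (fun i m => (y i m)^-1); split=> //; first exact: eigenfamilyV.
  by move=> i m; rewrite (avV Hp) y1 invr1.
Qed.

Lemma max_bounded_fixes A : max_bounded absv TKur A ->
  unitary tau H Eur A /\ forall y, alpha0 (A *m y) = alpha0 y.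
Proof.
move=> hA; have [x [hx hax x1]] := max_bounded_acts hA.
split; last by move=> y; apply: (acts_alpha0 _ hax).
apply: (acts_unitary _ _ hx hax) => //.
case: hA => Q [[QT _ _ _] _] QA; exact: torusKur_over (QT _ QA).
Qed.

(** * Rational points of the torus, and vectors supported on one piece *)

Definition toral (a : 'I_j -> Omega) : 'M[Omega]_n := \mxdiag_i mu i (a i).

Lemma toralP (a : 'I_j -> Omega) : (forall i, Un (s i) (a i) /\ a i * et i (a i) = 1) ->
  [/\ torusK absv E tau sigma b (toral a), mx_over E (toral a),
      eigenfamily (fun i m => sg m (a i)), acts_by (fun i m => sg m (a i)) (toral a) &
      forall i m, absv (sg m (a i)) = 1].
Proof.
move=> ha; have ar i : Eur (a i) by apply: unr_max (ha i).1.
have v1 i : absv (a i) = 1.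
  have := congr1 absv (ha i).2; rewrite (avM Hp) (fa_abs (heta S (s i)) (ar i)) (av1 Hp).
  by rewrite -expr2 => /eqP; rewrite sqrp_eq1 ?ge0 // => /eqP.
have pa i m : sg (m + s i)%N (a i) = sg m (a i).
  by rewrite iterD (sg_period S (s_gt0 i) (hz i) (ha i).1).
split.
- by exists (fun i => mu i (a i)) => // i; exists (a i).
- move=> k l; have [i [k' ->]] := rkP k; have [i' [l' ->]] := rkP l.
  have [ii|ii] := eqVneq i i'; last by rewrite diag_diff //; apply: (sf0 sE).
  move: l'; rewrite -ii => l'; rewrite diag_same.
  by case: (multP (ha i).1) => h _; apply: h.
- split=> // i m; first exact: sgm.
  have er : Eur (et i (a i)) by apply: (fa_mem (heta S (s i))).
  rewrite iterD (tau_sg S m (sgm (r i) (ar i))).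
  by rewrite -(faM (hsg S m) (ar i) er) (ha i).2 (fa1 Hp sur (hsg S m)).
- by apply: actsI => // i; apply: emb_mult; case: (ha i).
- by move=> i m; rewrite (fa_abs (hsg S m) (ar i)).
Qed.

Lemma torusK_toral A : torusK absv E tau sigma b A -> exists2 a : 'I_j -> Omega,
  (forall i, Un (s i) (a i) /\ a i * et i (a i) = 1) & A = toral a.
Proof.
move=> [B hB ->].
have ex i : exists a, (Un (s i) a /\ a * et i a = 1) /\ B i = mu i a.
  by have [a h1 h2] := hB i; exists a.
have [a ha] := choice ex; exists a; first by move=> i; case: (ha i).
by apply: eq_mxdiag => i; case: (ha i).
Qed.

Lemma piece_coord_toral (a : 'I_j -> Omega) i x : (forall i, Un (s i) (a i) /\ a i * et i (a i) = 1) ->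
  piece_coord i (toral a *m x) = a i * piece_coord i x.
Proof. by move=> ha; have [_ _ _ h _] := toralP ha; apply: (h x i 0%N). Qed.

Lemma toral_unitary (a : 'I_j -> Omega) :
  (forall i, Un (s i) (a i) /\ a i * et i (a i) = 1) -> unitary tau H E (toral a).
Proof. by move=> ha; have [_ Ea hg hac _] := toralP ha; apply: (acts_unitary EE Ea hg hac). Qed.

Definition piece_vector i (v : Omega) : 'cV[Omega]_n :=
  xget 0 [set x | mx_over E x /\ forall i', piece_coord i' x = if i' == i then v else 0].

Lemma piece_vectorP i v : Un (s i) v -> mx_over E (piece_vector i v) /\
  forall i', piece_coord i' (piece_vector i v) = if i' == i then v else 0.
Proof.
move=> hv; have [|x hx] := @piece_coord_surj (fun i' => if i' == i then v else 0).
  by move=> i'; case: eqP => [->//|_]; apply: (sf0 (sL i')).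
exact: (@xgetPex _ 0 [set x | mx_over E x /\ forall i', piece_coord i' x = _] (ex_intro _ x hx)).
Qed.

Lemma piece_coord_ext x y : mx_over E x -> mx_over E y -> (forall i, piece_coord i x = piece_coord i y) -> x = y.
Proof.
move=> Ex Ey h; apply/eqP; rewrite -subr_eq0; apply/eqP/piece_coord_inj; first exact: (mxoB sE).
by move=> i; rewrite piece_coordD -scaleN1r piece_coordZ h mulN1r subrr.
Qed.

Lemma piece_vector_sum x : mx_over E x -> x = \sum_i piece_vector i (piece_coord i x).
Proof.
move=> Ex; have hi i := piece_vectorP (piece_coord_unr i Ex).
apply: piece_coord_ext => // [|i]; first by apply: (mxo_sum sE) => i _; case: (hi i).
rewrite piece_coord_sum (bigD1 i) //= (hi i).2 eqxx big1 ?addr0 // => i' ni.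
by rewrite (hi i').2 eq_sym (negPf ni).
Qed.

Lemma piece_vector_lin i (I : finType) (c v : I -> Omega) : (forall t, E (c t)) ->
  (forall t, Un (s i) (v t)) -> piece_vector i (\sum_t c t * v t) = \sum_t c t *: piece_vector i (v t).
Proof.
move=> hc hv.
have hs' : Un (s i) (\sum_t c t * v t).
  apply: (sf_sum (sL i)) => t _; apply: (sfM (sL i)) => //.
  exact: (unr_base S (s_gt0 i) (hz i)).
have [E1 C1] := piece_vectorP hs'.
apply: piece_coord_ext => // [|i'].
  by apply: (mxo_sum sE) => t _; apply: (mxoZ sE) => //; case: (piece_vectorP (hv t)).
rewrite C1 piece_coord_sum; case: eqP => [->|ni].
  by apply: eq_bigr => t _; rewrite piece_coordZ (piece_vectorP (hv t)).2 eqxx.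
by rewrite big1 // => t _; rewrite piece_coordZ (piece_vectorP (hv t)).2 (introF eqP ni) mulr0.
Qed.

Definition gen_arg i0 i : Omega := if i == i0 then xi tau sigma (s i) (z i) else 1.
Definition gen i0 : 'M[Omega]_n := toral (gen_arg i0).

Lemma gen_argP i0 i : ~~ odd (s i0) ->
  Un (s i) (gen_arg i0 i) /\ gen_arg i0 i * et i (gen_arg i0 i) = 1.
Proof.
move=> ev; rewrite /gen_arg; case: eqP => [->|_].
  split; first exact: (xi_unr S (s_cond i0) (hz i0)).
  exact: (xi_norm S (s_cond i0) (hz i0)).
by split; [apply: (sf1 (sL i))|rewrite (fa1 Hp sur (heta S (s i))) mulr1].
Qed.

Lemma piece_coord_gen i0 i x : ~~ odd (s i0) -> piece_coord i (gen i0 *m x) = gen_arg i0 i * piece_coord i x.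
Proof. by move=> ev; apply: piece_coord_toral => i'; apply: gen_argP. Qed.

Lemma gen_E i0 : ~~ odd (s i0) -> mx_over E (gen i0).
Proof. by move=> ev; have [] := toralP (fun i => gen_argP i ev). Qed.

Hypothesis odd_uniq : forall i i', odd (s i) -> odd (s i') -> i = i'.

(* O_(E_(s i)) is spanned over O_E by the powers of xi, and xi - 1 is a unit:
   the former makes the norm homogeneous on a piece, the latter bounds the
   projection gen i - 1 to that piece. *)
Lemma invariant_norm_shape (be : 'cV[Omega]_n -> R) :
  (forall x, mx_over E x -> 0 <= be x) ->
  (forall x, mx_over E x -> be x = 0 -> x = 0) ->
  (forall x y (C : R), mx_over E x -> mx_over E y -> be x <= C -> be y <= C -> be (x + y) <= C) ->
  (forall a x, E a -> mx_over E x -> be (a *: x) = absv a * be x) ->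
  (forall i x, ~~ odd (s i) -> mx_over E x -> be (gen i *m x) = be x) ->
  exists c : 'I_j -> R, [/\ forall i, 0 < c i,
    forall i v, Un (s i) v -> be (piece_vector i v) = c i * absv v,
    forall i x, mx_over E x -> c i * absv (piece_coord i x) <= be x &
    forall x (C : R), mx_over E x -> 0 <= C -> (forall i, c i * absv (piece_coord i x) <= C) -> be x <= C].
Proof.
move=> be0 beN beD beZ beG.
have be_0 : be 0 = 0.
  have m0 : mx_over E (0 : 'cV[Omega]_n) by apply: (mxo0 sE).
  by have := beZ 0 0 (sf0 sE) m0; rewrite scale0r (av0 Hp) mul0r.
have beS (I : finType) (P : pred I) (F : I -> 'cV_n) (C : R) : 0 <= C ->
    (forall t, mx_over E (F t)) -> (forall t, P t -> be (F t) <= C) -> be (\sum_(t | P t) F t) <= C.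
  move=> C0 EF h.
  suff : mx_over E (\sum_(t | P t) F t) /\ be (\sum_(t | P t) F t) <= C by case.
  apply: (big_ind (fun v : 'cV_n => mx_over E v /\ be v <= C)) => [|x y [Ex hx] [Ey hy]|t Pt].
    - by split; [apply: (mxo0 sE)|rewrite be_0].
    - by split; [apply: (mxoD sE)|apply: beD].
    - by split=> //; apply: h.
have gen_piece_vector i v : ~~ odd (s i) -> Un (s i) v ->
    gen i *m piece_vector i v = piece_vector i (xi tau sigma (s i) (z i) * v).
  move=> ev hv; have [Ev Cv] := piece_vectorP hv.
  have hxv : Un (s i) (xi tau sigma (s i) (z i) * v).
    by apply: (sfM (sL i)) => //; apply: (xi_unr S (s_cond i) (hz i)).
  have [Ex Cx] := piece_vectorP hxv.
  apply: piece_coord_ext => // [|i']; first by apply: (mxo_mul sE) => //; apply: gen_E.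
  by rewrite piece_coord_gen // Cv Cx /gen_arg; case: eqP => [->//|_]; rewrite mulr0.
have contr i y v : Un (s i) y -> Un (s i) v -> be (piece_vector i (y * v)) <= absv y * be (piece_vector i v).
  move=> hy hv; have Ev := (piece_vectorP hv).1.
  have r0 : 0 <= absv y * be (piece_vector i v) by rewrite mulr_ge0 ?ge0 // be0.
  have [od|ev] := boolP (odd (s i)).
    have s1 : s i = 1%N by case: (s_cond i) => // -[_]; rewrite od.
    have Ey : E y by move: hy; rewrite s1 (unr1 _ sE).
    have := @piece_vector_lin i 'I_1 (fun=> y) (fun=> v) (fun=> Ey) (fun=> hv).
    by rewrite !big_ord1 => ->; rewrite beZ.
  have [c hc [ey cy]] := xi_gen S (s_cond i) (hz i) ev hy.
  have xX k : Un (s i) (xi tau sigma (s i) (z i) ^+ k).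
    by apply: (sfX (sL i)); apply: (xi_unr S (s_cond i) (hz i)).
  have hxv k : Un (s i) (xi tau sigma (s i) (z i) ^+ k * v) by apply: (sfM (sL i)).
  have -> : y * v = \sum_k c k * (xi tau sigma (s i) (z i) ^+ k * v).
    by rewrite ey mulr_suml; apply: eq_bigr => k _; rewrite mulrA.
  rewrite piece_vector_lin //; apply: beS => // k.
    by apply: (mxoZ sE) => //; case: (piece_vectorP (hxv k)).
  move=> _; rewrite beZ //; last by case: (piece_vectorP (hxv k)).
  have -> : be (piece_vector i (xi tau sigma (s i) (z i) ^+ k * v)) = be (piece_vector i v).
    elim: (nat_of_ord k) => [|l IH]; first by rewrite expr0 mul1r.
    rewrite exprS -mulrA -gen_piece_vector // beG //; by case: (piece_vectorP (hxv l)).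
  by rewrite ler_wpM2r ?be0.
have hom i v : Un (s i) v -> be (piece_vector i v) = be (piece_vector i 1) * absv v.
  move=> hv; have U1 := sf1 (sL i); have U0 := sf0 (sL i).
  have [->|v0] := eqVneq v 0.
    rewrite (av0 Hp) mulr0 -[RHS]be_0; congr be; apply: piece_coord_ext => [||i'].
    - by case: (piece_vectorP U0).
    - exact: (mxo0 sE).
    by rewrite (piece_vectorP U0).2 if_same -(scale0r 0) piece_coordZ mul0r.
  apply/eqP; rewrite eq_le mulrC -{1}[v]mulr1 contr //=.
  rewrite mulrC -ler_pdivlMr ?(av_gt0 Hp) // mulrC -(avV Hp) -{1}(mulVf v0) contr //.
  exact: (sfV (sL i)).
have c0 i : 0 < be (piece_vector i 1).
  have [E1 C1] := piece_vectorP (sf1 (sL i)).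
  rewrite lt_def be0 // andbT; apply/eqP => /(beN _ E1) e.
  by have /eqP := C1 i; rewrite e -(scale0r 0) piece_coordZ mul0r eqxx eq_sym oner_eq0.
have even_le i x : ~~ odd (s i) -> mx_over E x -> be (piece_vector i (piece_coord i x)) <= be x.
  move=> ev Ex; have hx := piece_coord_unr i Ex.
  set k := xi tau sigma (s i) (z i).
  have kU : Un (s i) k by apply: (xi_unr S (s_cond i) (hz i)).
  have k1 : absv (k - 1) = 1 by apply: (xi_sub1 S (s_cond i) (hz i)).
  have kU1 : Un (s i) (k - 1) by apply: (sfB (sL i)) => //; apply: (sf1 (sL i)).
  have k0 : k - 1 != 0 by rewrite -(av_gt0 Hp) k1 ltr01.
  have hk : Un (s i) ((k - 1) * piece_coord i x) by apply: (sfM (sL i)).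
  have e : gen i *m x - x = piece_vector i ((k - 1) * piece_coord i x).
    have [Ei Ci] := piece_vectorP hk; have Eg : mx_over E (gen i *m x).
      by apply: (mxo_mul sE) => //; apply: gen_E.
    apply: piece_coord_ext => // [|i']; first exact: (mxoB sE).
    rewrite Ci piece_coordD -scaleN1r piece_coordZ piece_coord_gen // /gen_arg mulN1r.
    by case: eqP => [->|_]; rewrite ?mul1r ?subrr // mulrBl mul1r.
  have -> : piece_coord i x = (k - 1)^-1 * ((k - 1) * piece_coord i x) by rewrite mulKf.
  apply: le_trans (contr _ _ _ (sfV (sL i) kU1) hk) _.
  rewrite (avV Hp) k1 invr1 mul1r -e -scaleN1r.
  have Eg : mx_over E (gen i *m x) by apply: (mxo_mul sE) => //; apply: gen_E.
  have EN : E (-1) by apply/(sfN sE)/(sf1 sE).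
  apply: beD => //; [exact: (mxoZ sE)|by rewrite beG|].
  by rewrite beZ // (avN Hp) (av1 Hp) mul1r.
(* No element [gen] exists for the odd piece; its component is x minus the even components, already
   bounded. This works because there is only one odd piece. *)
have le i x : mx_over E x -> be (piece_vector i (piece_coord i x)) <= be x.
  move=> Ex; have [od|] := boolP (odd (s i)); last by move=> ev; apply: even_le.
  have hx i' := piece_vectorP (piece_coord_unr i' Ex).
  have -> : piece_vector i (piece_coord i x) = x + (-1) *: \sum_(i' | i' != i) piece_vector i' (piece_coord i' x).
    have e : x = piece_vector i (piece_coord i x) + \sum_(i' | i' != i) piece_vector i' (piece_coord i' x).
      rewrite -(@bigD1 _ _ _ _ i xpredT (fun i' => piece_vector i' (piece_coord i' x))) //.
      exact: piece_vector_sum.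
    by apply/eqP; rewrite scaleN1r eq_sym subr_eq -e.
  have EN : E (-1) by apply/(sfN sE)/(sf1 sE).
  have ES : mx_over E (\sum_(i' | i' != i) piece_vector i' (piece_coord i' x)).
    by apply: (mxo_sum sE) => i' _; case: (hx i').
  apply: beD => //; first exact: (mxoZ sE).
  rewrite beZ // (avN Hp) (av1 Hp) mul1r; apply: beS => [|i'|i' ni]; first exact: be0.
    by case: (hx i').
  apply: even_le => //; apply/negP => od'; move/eqP: ni; apply.
  exact: odd_uniq.
exists (fun i => be (piece_vector i 1)); split=> // [i x Ex|x C Ex C0 h].
  by rewrite -hom ?le //; apply: piece_coord_unr.
rewrite [x]piece_vector_sum //; apply: beS => // i; first by case: (piece_vectorP (piece_coord_unr i Ex)).
by move=> _; rewrite hom ?h //; apply: piece_coord_unr.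
Qed.

(** * The form on V and the point alpha0 of the building *)

Lemma gram_E : mx_over E H.
Proof.
move=> k l; rewrite -(herm_delta S H) herm_piece_coord; try exact: (mxo_delta sE).
by apply: (sf_sum sE) => i _; apply: (phi_E S (s_cond i) (hz i) (w_unif i) (kappa_L i));
  apply: piece_coord_unr; apply: (mxo_delta sE).
Qed.

Lemma gram_sym k l : H l k = tau (H k l).
Proof.
have Ed k' : mx_over E (delta_mx k' 0 : 'cV[Omega]_n) by apply: (mxo_delta sE).
have ph_sum k' l' : H k' l' = \sum_i ph i (piece_coord i (delta_mx k' 0)) (piece_coord i (delta_mx l' 0)).
  by rewrite -(herm_delta S H) herm_piece_coord.
rewrite !ph_sum (fa_sum sur ht) => [|i _].
  apply: eq_bigr => i _; apply: (phi_herm S (s_cond i) (hz i) (w_unif i) (kappa_L i));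
  exact: piece_coord_unr.
apply: EE; apply: (phi_E S (s_cond i) (hz i) (w_unif i) (kappa_L i)); exact: piece_coord_unr.
Qed.

Lemma alpha0_pos k : 0 < piece_scale (@tagnat.sig1 j s k). Proof. exact: piece_scale_gt0. Qed.

Lemma herm_le x y : mx_over E x -> mx_over E y ->
  absv (herm_form tau H x y) <= alpha0 x * alpha0 y.
Proof.
move=> Ex Ey; have ax := split_norm_ge0 absv P0 (fun k => piece_scale (tagnat.sig1 k)) x.
have ay := split_norm_ge0 absv P0 (fun k => piece_scale (tagnat.sig1 k)) y.
rewrite herm_piece_coord //; apply: (av_sum_le Hp) => [|i _]; first exact: mulr_ge0.
have := phi_le S (s_cond i) (hz i) (w_unif i) (kappa_L i) (piece_coord_unr i Ex) (piece_coord_unr i Ey).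
move/le_trans; apply; rewrite -piece_scale_sq.
have -> : piece_scale i ^+ 2 * absv (piece_coord i x) * absv (piece_coord i y) =
  (piece_scale i * absv (piece_coord i x)) * (piece_scale i * absv (piece_coord i y)) by ring.
by apply: ler_pM; rewrite ?mulr_ge0 ?ge0 ?(ltW (piece_scale_gt0 i)) ?alpha0_geE.
Qed.

Lemma phi0l i v : ph i 0 v = 0.
Proof.
by rewrite /Defs.phi mulr0 mul0r; apply: big1 => m _; apply: (fa0 sur (hsg S m)).
Qed.

Lemma phi0r i v : ph i v 0 = 0.
Proof.
rewrite /Defs.phi (fa0 sur (heta S (s i))) mulr0.
by apply: big1 => m _; apply: (fa0 sur (hsg S m)).
Qed.

Lemma herm_piece_vectorl i v y : Un (s i) v -> mx_over E y ->
  herm_form tau H (piece_vector i v) y = ph i v (piece_coord i y).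
Proof.
move=> hv Ey; have [Ei Ci] := piece_vectorP hv; rewrite herm_piece_coord // (bigD1 i) //= Ci eqxx.
by rewrite big1 ?addr0 // => i' ni; rewrite Ci (negPf ni) phi0l.
Qed.

Lemma herm_piece_vectorr i v x : Un (s i) v -> mx_over E x ->
  herm_form tau H x (piece_vector i v) = ph i (piece_coord i x) v.
Proof.
move=> hv Ex; have [Ei Ci] := piece_vectorP hv; rewrite herm_piece_coord // (bigD1 i) //= Ci eqxx.
by rewrite big1 ?addr0 // => i' ni; rewrite Ci (negPf ni) phi0r.
Qed.

Lemma alpha0_piece_vector i v : Un (s i) v -> alpha0 (piece_vector i v) = piece_scale i * absv v.
Proof.
move=> hv; have [Ei Ci] := piece_vectorP hv; apply/eqP; rewrite eq_le; apply/andP; split.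
  apply: alpha0_leE => // [|i']; first by rewrite mulr_ge0 ?ge0 // ltW ?piece_scale_gt0.
  rewrite Ci; case: eqP => [->//|_]; rewrite (av0 Hp) mulr0.
  by rewrite mulr_ge0 ?ge0 // ltW ?piece_scale_gt0.
by have := alpha0_geE i (piece_vector i v); rewrite Ci eqxx.
Qed.

Lemma alpha0_max x : mx_over E x -> x != 0 -> exists i,
  piece_coord i x != 0 /\ alpha0 x = piece_scale i * absv (piece_coord i x).
Proof.
move=> Ex x0; have [i0 hi0] : exists i, piece_coord i x != 0.
  apply: contrapT => H; case/eqP: x0; apply: piece_coord_inj => // i.
  by apply/eqP/negPn/negP => hi; apply: H; exists i.
have F0 i : 0 <= piece_scale i * absv (piece_coord i x) by rewrite mulr_ge0 ?ge0 // ltW ?piece_scale_gt0.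
case: (@arg_maxP _ _ _ i0 xpredT (fun i => piece_scale i * absv (piece_coord i x)) isT) => i _ hi.
have e : alpha0 x = piece_scale i * absv (piece_coord i x).
  apply/eqP; rewrite eq_le alpha0_geE andbT; apply: alpha0_leE => // i'; exact: hi.
exists i; split=> //; have := hi i0 isT => /=; apply: contraTneq => ->.
by rewrite (av0 Hp) mulr0 -ltNge mulr_gt0 ?piece_scale_gt0 ?(av_gt0 Hp).
Qed.

Lemma herm_attained y : mx_over E y -> y != 0 -> exists x, [/\ mx_over E x, x != 0 &
  absv (herm_form tau H x y) = alpha0 x * alpha0 y].
Proof.
move=> Ey y0; have [i [ci e]] := alpha0_max Ey y0.
have [v [hv v0 ev]] := phi_attained S (s_cond i) (hz i) (w_unif i) (kappa_L i) (piece_coord_unr i Ey) ci.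
have [Ei Ci] := piece_vectorP hv; exists (piece_vector i v); split=> //.
  apply: contraNneq v0 => e0; have := Ci i; rewrite eqxx e0 -{1}(scale0r 0) piece_coordZ mul0r.
  by move=> <-.
by rewrite herm_piece_vectorl // ev alpha0_piece_vector // e -piece_scale_sq; ring.
Qed.

Lemma alpha0_building : building absv E tau H alpha0.
Proof.
split; first exact: (self_dual_split S P0_unit alpha0_pos herm_le herm_attained).
exists P0; split; [exact: P0_E|exact: P0_unit|].
by exists (fun k => piece_scale (tagnat.sig1 k)) => //; exact: alpha0_pos.
Qed.

Lemma building_invariant be : building absv E tau H be ->
  (forall i, ~~ odd (s i) -> fixes (gen i) be) -> be = alpha0.
Proof.
move=> [sd [P [PE uP [c c0 eb]]]] fg; rewrite eb in sd fg *.
have [|||||cc [cc0 hom le max]] := @invariant_norm_shape (split_norm absv P c).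
- by move=> x _; apply: split_norm_ge0.
- by move=> x _ /eqP; rewrite (split_norm_eq0 Hp) // => /eqP.
- by move=> x y C _ _; apply: (split_normD_le Hp).
- by move=> a x _ _; apply: (split_normZ Hp).
- by move=> i x ev _; apply: fg.
have cE i : cc i = piece_scale i.
  have U1 := sf1 (sL i); have [Ei Ci] := piece_vectorP U1.
  have := sd _ Ei; rewrite hom // (av1 Hp) mulr1 (_ : sup _ = piece_scale i ^+ 2 / cc i).
    move=> e; apply/eqP; rewrite -(@eqrXn2 _ 2) ?(ltW (cc0 i)) ?(ltW (piece_scale_gt0 i)) //.
    by rewrite expr2 {1}e divfK // gt_eqF.
  have [v [hv v0 ev]] := phi_attained S (s_cond i) (hz i) (w_unif i) (kappa_L i) U1 (oner_neq0 _).
  have [Ev Cv] := piece_vectorP hv; have v0' : 0 < absv v by rewrite (av_gt0 Hp).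
  apply: sup_max => [|_ [x [Ex x0] <-]].
    exists (piece_vector i v).
      split=> //; rewrite -(split_norm_gt0 Hp uP c0) hom //; exact: mulr_gt0.
    rewrite herm_piece_vectorl // Ci eqxx ev hom // (av1 Hp) mulr1 piece_scale_sq.
    by field; rewrite !gt_eqF.
  have bx : 0 < split_norm absv P c x by rewrite (split_norm_gt0 Hp).
  rewrite herm_piece_vectorr // ler_pdivrMr //.
  apply: le_trans (phi_le S (s_cond i) (hz i) (w_unif i) (kappa_L i) (piece_coord_unr i Ex) U1) _.
  rewrite (av1 Hp) mulr1 -piece_scale_sq.
  have -> : piece_scale i ^+ 2 / cc i * split_norm absv P c x =
    piece_scale i ^+ 2 * ((cc i)^-1 * split_norm absv P c x) by ring.
  by rewrite ler_wpM2l ?exprn_ge0 ?(ltW (piece_scale_gt0 i)) // ler_pdivlMl // le.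
apply: (@split_norm_agree _ _ _ _ Hp E) => //.
- exact: P0_unit.
- exact: P0_E.
- exact: alpha0_pos.
move=> x Ex; apply/eqP; rewrite eq_le -[split_norm absv P0 _ x]/(alpha0 x); apply/andP; split.
  apply: max => //; first exact: split_norm_ge0.
  by move=> i; rewrite cE alpha0_geE.
apply: alpha0_leE => // [|i]; first exact: split_norm_ge0.
by rewrite -cE le.
Qed.

(** * Compact subgroups containing the torus *)

Local Notation stab := (stabilizer absv E tau H P0 (fun k => piece_scale (@tagnat.sig1 j s k))).
Let EM (A : 'M[Omega]_n) (x : 'cV[Omega]_n) : mx_over E A -> mx_over E x -> mx_over E (A *m x).
Proof. exact: (mxo_mul sE). Qed.

Lemma torusK_stab : torusK absv E tau sigma b `<=` stab.
Proof.
move=> A /torusK_toral[a ha ->]; split; first exact: toral_unitary.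
by move=> x; have [_ _ _ hac h1] := toralP ha; apply: (acts_alpha0 _ hac).
Qed.

Lemma gen_torusK i : ~~ odd (s i) -> torusK absv E tau sigma b (gen i).
Proof. by move=> ev; have [] := toralP (fun i' => gen_argP i' ev). Qed.

Lemma stab_compact : compact_subgroup absv (unitary tau H E) stab.
Proof.
split; first exact: (stabilizer_subgroup S P0_unit alpha0_pos herm_attained).
exact: (stabilizer_compact S gram_E gram_sym P0_E P0_unit alpha0_pos herm_le herm_attained).
Qed.

(* c bounds the matrix blocks of Q from one side, its dual norm piece_scale^2 / c
   from the other; the product of the two bounds no longer involves c. *)
Lemma compact_sub_stab Q : compact_subgroup absv (unitary tau H E) Q ->
  torusK absv E tau sigma b `<=` Q -> Q `<=` stab.
Proof.
move=> [[QU Q1 QM QV] cQ] TQ; have [C hC] := compact_bounded S cQ.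
have al0 x : 0 <= alpha0 x by apply: split_norm_ge0.
have QE g : Q g -> mx_over E g by move/QU => [].
pose be x := sup [set alpha0 (g *m x) | g in Q].
have ub x : has_ubound [set alpha0 (g *m x) | g in Q].
  have [B hB] := split_norm_bounded Hp P0 alpha0_pos x C.
  by exists B => _ [g Qg <-]; apply: hB; apply: hC.
have be_ge g x : Q g -> alpha0 (g *m x) <= be x by move=> Qg; apply: ub_le_sup => //; exists g.
have be_le x (B : R) : (forall g, Q g -> alpha0 (g *m x) <= B) -> be x <= B.
  move=> hB; apply: ge_sup; first by exists (alpha0 (1%:M *m x)), 1%:M.
  by move=> _ [g Qg <-]; apply: hB.
have be_al x : alpha0 x <= be x by rewrite -{1}[x]mul1mx; apply: be_ge.
have beZ_le a x : be (a *: x) <= absv a * be x.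
  apply: be_le => g Qg; rewrite -scalemxAr [alpha0 _](split_normZ Hp).
  by rewrite ler_wpM2l ?ge0 //; apply: be_ge.
have beG_le g x : Q g -> be (g *m x) <= be x.
  by move=> Qg; apply: be_le => g' Qg'; rewrite mulmxA; apply: be_ge; apply: QM.
have beG g x : Q g -> be (g *m x) = be x.
  move=> Qg; apply/eqP; rewrite eq_le beG_le //=.
  have [_ ug _] := QU g Qg.
  by rewrite -{1}[x](mulKmx ug); apply: beG_le; apply: QV.
have [|||||cc [cc0 hom le max]] := @invariant_norm_shape be.
- by move=> x _; apply: le_trans (be_al x).
- move=> x _ e; apply/eqP; rewrite -(split_norm_eq0 Hp P0_unit alpha0_pos).
  by rewrite eq_le split_norm_ge0 andbT -e be_al.
- move=> x y B Ex Ey hx hy; apply: be_le => g Qg; rewrite mulmxDr.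
  by apply: (split_normD_le Hp alpha0_pos); apply: le_trans (be_ge g _ Qg) _.
- move=> a x Ea Ex; have [->|a0] := eqVneq a 0.
    apply/eqP; rewrite eq_le beZ_le /= (av0 Hp) mul0r.
    by apply: le_trans (be_al _).
  apply/eqP; rewrite eq_le beZ_le /= -ler_pdivlMl ?(av_gt0 Hp) //.
  by rewrite -(avV Hp) -{1}[x](scalerK a0); apply: beZ_le.
- by move=> i x ev Ex; apply: beG; apply: TQ; apply: gen_torusK.
have up g i l v : Q g -> Un (s i) v -> cc l * absv (piece_coord l (g *m piece_vector i v)) <= cc i * absv v.
  move=> Qg hv; have [Ei _] := piece_vectorP hv.
  apply: le_trans (le _ _ (EM (QE g Qg) Ei)) _.
  by rewrite beG // hom.
(* Pair with a vector attaining duality on the piece l and move g to the other side of the form,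
   where its inverse, again in Q, is bounded by [up]. *)
have dual g i l v : Q g -> Un (s i) v ->
    piece_scale l ^+ 2 * absv (piece_coord l (g *m piece_vector i v)) <= piece_scale i ^+ 2 * (cc l / cc i) * absv v.
  move=> Qg hv; have [Ei Ci] := piece_vectorP hv; have Eg := EM (QE g Qg) Ei.
  have [->|cl0] := eqVneq (piece_coord l (g *m piece_vector i v)) 0.
    by rewrite (av0 Hp) mulr0 !mulr_ge0 ?exprn_ge0 ?ge0 ?invr_ge0 ?(ltW (cc0 _)) ?(ltW (piece_scale_gt0 _)).
  have [w [hw w0 ew]] := phi_attained S (s_cond l) (hz l) (w_unif l) (kappa_L l) (piece_coord_unr l Eg) cl0.
  have w0' : 0 < absv w by rewrite (av_gt0 Hp).
  have [Ew _] := piece_vectorP hw; have [_ ug _] := QU g Qg; have Qi := QV g Qg.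
  have Eiw := EM (QE _ Qi) Ew.
  rewrite -(ler_pM2r w0') mulrAC piece_scale_sq -ew -(herm_piece_vectorl hw Eg).
  rewrite -[piece_vector l w](mulKVmx ug) (unitary_herm S _ (QU g Qg) Ei) herm_piece_vectorr //.
  apply: le_trans (phi_le S (s_cond i) (hz i) (w_unif i) (kappa_L i) (piece_coord_unr i Eiw) hv) _.
  rewrite -piece_scale_sq.
  have -> : piece_scale i ^+ 2 * (cc l / cc i) * absv v * absv w = piece_scale i ^+ 2 * (cc l * absv w / cc i) * absv v.
    by ring.
  rewrite ler_wpM2r ?ge0 // ler_wpM2l ?exprn_ge0 ?(ltW (piece_scale_gt0 _)) //.
  by rewrite ler_pdivlMr // mulrC; apply: up.
have alg g i v : Q g -> Un (s i) v -> alpha0 (g *m piece_vector i v) <= piece_scale i * absv v.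
  move=> Qg hv; have [Ei Ci] := piece_vectorP hv; have Eg := EM (QE g Qg) Ei.
  have r0 : 0 <= piece_scale i * absv v by rewrite mulr_ge0 ?ge0 ?(ltW (piece_scale_gt0 _)).
  apply: alpha0_leE => // l; have a0 := piece_scale_gt0 l; have c0 := cc0 l.
  rewrite -(@ler_pXn2r _ 2) ?nnegrE ?mulr_ge0 ?ge0 ?(ltW (piece_scale_gt0 _)) // -(ler_pM2l c0).
  have p1 : 0 <= cc l * absv (piece_coord l (g *m piece_vector i v)) by rewrite mulr_ge0 ?ge0 ?(ltW c0).
  have p2 : 0 <= piece_scale l ^+ 2 * absv (piece_coord l (g *m piece_vector i v)).
    by rewrite mulr_ge0 ?ge0 ?exprn_ge0 ?(ltW a0).
  have := ler_pM p1 p2 (up g i l v Qg hv) (dual g i l v Qg hv).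
  have -> : cc l * absv (piece_coord l (g *m piece_vector i v)) * (piece_scale l ^+ 2 * absv (piece_coord l (g *m piece_vector i v))) =
     cc l * (piece_scale l * absv (piece_coord l (g *m piece_vector i v))) ^+ 2 by ring.
  have -> : cc i * absv v * (piece_scale i ^+ 2 * (cc l / cc i) * absv v) = cc l * (piece_scale i * absv v) ^+ 2.
    by field; rewrite gt_eqF ?cc0.
  by [].
move=> g Qg; split; first exact: QU.
apply: (isometry_fixes S P0_E P0_unit alpha0_pos herm_le herm_attained) => [|x Ex]; first exact: QU.
rewrite {1}(piece_vector_sum Ex) mulmx_sumr -[X in _ <= X]/(alpha0 x).
apply: (split_norm_sum_le Hp alpha0_pos) => [|i _]; first exact: split_norm_ge0.
apply: le_trans (alg g i _ Qg (piece_coord_unr i Ex)) _; exact: alpha0_geE.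
Qed.

Lemma unique_maximal_compact : exists! Q, maximal_compact absv E tau H Q /\
  torusK absv E tau sigma b `<=` Q.
Proof.
have st := torusK_stab; exists stab; split.
  split=> //; split; first exact: stab_compact.
  move=> Q' cQ' sQ'; apply/seteqP; split=> //.
  by apply: compact_sub_stab => // A TA; apply: sQ'; apply: st.
move=> Q [[cQ mQ] TQ]; apply: (mQ stab) => //; first exact: stab_compact.
exact: compact_sub_stab.
Qed.

(** * The point alpha0 is a facet *)

Let Pi0 : 0 < absv Pi. Proof. exact: (Pi_gt0 S). Qed.
Let Pi_neq0 : absv Pi != 0. Proof. by rewrite gt_eqF. Qed.
(** The value group of E, as opposed to its square roots, which alpha0 may also take as values. *)
Definition integral_value (r : R) := exists m : int, r = absv Pi ^ m.

Lemma integral_valueM r t : integral_value r -> integral_value t -> integral_value (r * t).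
Proof. by move=> [m ->] [l ->]; exists (m + l); rewrite expfzDr. Qed.

Lemma integral_valueV r : integral_value r -> integral_value r^-1.
Proof. by move=> [m ->]; exists (- m); rewrite -invr_expz. Qed.

Lemma integral_value_cancel r t : t != 0 -> integral_value t -> integral_value (r * t) -> integral_value r.
Proof. by move=> t0 vt hrt; rewrite -[r](mulfK t0); apply: integral_valueM => //; apply: integral_valueV. Qed.

Lemma unr_integral i v : Un (s i) v -> v != 0 -> integral_value (absv v).
Proof. by move=> hv v0; have [m ->] := unr_values S (s_gt0 i) (hz i) hv v0; exists m. Qed.

Lemma E_integral v (k : 'I_n) : E v -> v != 0 -> integral_value (absv v).
Proof.
have [i _] := rkP k; move=> Ev; apply: (@unr_integral i).
exact: (unr_base S (s_gt0 i) (hz i)).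
Qed.

Lemma alpha0_sq_integral x : mx_over E x -> x != 0 -> integral_value (alpha0 x ^+ 2).
Proof.
move=> Ex x0; have [i [c0 ->]] := alpha0_max Ex x0.
rewrite exprMn piece_scale_sq; apply: integral_valueM.
  by apply: (unr_integral (u_unr i)); apply: (ratio_neq0 (w_unif i) (kappa_L i)).
by apply: integral_valueM; apply: (unr_integral (piece_coord_unr i Ex) c0).
Qed.

(* If k and nu k are the only indices with values in the value group of E, the
   part of V with such values has dimension at most 2; being a single piece of
   degree at most 2 it is anisotropic modulo smaller values, whereas col k P is
   isotropic. *)
Section EvenPartner.
Variables (P : 'M[Omega]_n) (nu : 'I_n -> 'I_n) (c : 'I_n -> R) (k : 'I_n).
Hypotheses (wb : witt_basis E tau H P nu) (c_gt0 : forall k, 0 < c k)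
  (al_c : alpha0 = split_norm absv P c) (nk : nu k != k) (ck : integral_value (c k))
  (alone : forall l, l != k -> l != nu k -> ~ integral_value (c l)).

Let PE : mx_over E P. Proof. by case: wb => -[]. Qed.
Let uP : P \in unitmx. Proof. by case: wb => -[]. Qed.

Lemma not_integral_off_pair x : mx_over E x -> x != 0 -> (invmx P *m x) k 0 = 0 ->
  (invmx P *m x) (nu k) 0 = 0 -> ~ integral_value (alpha0 x).
Proof.
move=> Ex x0 xk xnk; rewrite al_c.
have [l [cl ->]] := split_norm_attained Hp uP c_gt0 x0.
have Ecl : E ((invmx P *m x) l 0) by apply: EM => //; apply: (mxo_inv sE).
move/(integral_value_cancel _ (E_integral l Ecl cl)) => h.
apply: (alone (l := l)); [| |apply: h; rewrite (av_eq0 Hp) //].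
  by apply: contraNneq cl => ->; rewrite xk.
by apply: contraNneq cl => ->; rewrite xnk.
Qed.

(** Among the combinations of three vectors [zvec] of integral scale, a nonzero one has both
    coordinates k and nu k equal to zero. Its value is integral by the basis [P0] and not integral
    by the basis P. *)
Lemma three_integral k1 k2 k3 : uniq [:: k1; k2; k3] ->
  (forall l, l \in [:: k1; k2; k3] -> integral_value (piece_scale (@tagnat.sig1 j s l))) -> False.
Proof.
move=> un ev; pose f (t : 'I_3) := nth k1 [:: k1; k2; k3] t.
have f_inj t t' : (f t == f t') = (t == t') by rewrite nth_uniq.
have f_in t : f t \in [:: k1; k2; k3] by apply: mem_nth.
have [Z1 Z2] : (forall t, mx_over E (zvec (f t))) /\
    (forall t, invmx P0 *m zvec (f t) = delta_mx (f t) 0).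
  split=> t; first by case: (zvecP (f t)).
  by rewrite -col_P0 colE mulKmx // P0_unit.
(* The two coordinates to be killed, padded by a zero column to a square matrix, which is thus
   singular. *)
pose M : 'M[Omega]_3 := \matrix_(t, l) (if l == 0 then (invmx P *m zvec (f t)) k 0
  else if l == 1 then (invmx P *m zvec (f t)) (nu k) 0 else 0).
have EPz t : mx_over E (invmx P *m zvec (f t)) by apply: EM => //; apply: (mxo_inv sE).
have EMx : mx_over E M.
  move=> t l; rewrite mxE; case: ifP => _; first exact: EPz.
  by case: ifP => _; [exact: EPz|exact: (sf0 sE)].
have dM : \det M = 0.
  apply: contrapT => /eqP dM.
  have uM : M \in unitmx by rewrite unitmxE unitfE.
  have M2 : M *m (delta_mx ord_max 0 : 'cV_3) = 0.
    by rewrite -colE; apply/colP => t; rewrite !mxE.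
  have : (delta_mx ord_max 0 : 'cV[Omega]_3) = 0 by rewrite -[LHS](mulKmx uM) M2 mulmx0.
  by move/colP/(_ ord_max)/eqP; rewrite !mxE !eqxx oner_eq0.
have [v [v0 Ev vM]] := det0_over sE EMx dM.
pose x := \sum_t v 0 t *: zvec (f t).
have Ex : mx_over E x by apply: (mxo_sum sE) => t _; apply: (mxoZ sE).
have Px0 l : (invmx P0 *m x) l 0 = \sum_t v 0 t * (l == f t)%:R.
  rewrite mulmx_sumr summxE; apply: eq_bigr => t _.
  by rewrite -scalemxAr mxE Z2 mxE andbT.
have Px l : (invmx P *m x) l 0 = \sum_t v 0 t * (invmx P *m zvec (f t)) l 0.
  by rewrite mulmx_sumr summxE; apply: eq_bigr => t _; rewrite -scalemxAr mxE.
have x0 : x != 0.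
  apply: contraNneq v0 => e0; apply/eqP/rowP => t; rewrite [RHS]mxE.
  have := Px0 (f t); rewrite e0 mulmx0 mxE (bigD1 t) //= eqxx mulr1 big1 ?addr0 //.
  by move=> t' nt; rewrite f_inj eq_sym (negPf nt) mulr0.
have vMk l : \sum_t v 0 t * M t l = 0 by have /rowP/(_ l) := vM; rewrite !mxE.
apply: (not_integral_off_pair Ex x0).
- by rewrite Px -[RHS](vMk 0); apply: eq_bigr => t _; rewrite [M t 0]mxE.
- by rewrite Px -[RHS](vMk 1); apply: eq_bigr => t _; rewrite [M t 1]mxE.
have [l [cl e]] := split_norm_attained Hp P0_unit alpha0_pos x0.
rewrite [alpha0 x]e; apply: integral_valueM.
  apply: ev; apply: contraNT cl => nl; rewrite Px0 big1 // => t _.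
  by case: eqP => [e1|_]; [move: nl; rewrite e1 f_in|rewrite mulr0].
apply: (E_integral l) => //; apply: EM => //; apply: (mxo_inv sE); exact: P0_E.
Qed.

Lemma isolated_pair_absurd : False.
Proof.
set e := col k P.
have Ee : mx_over E e by move=> i l; rewrite mxE.
have ae : alpha0 e = c k by rewrite al_c (split_norm_col Hp).
have e0 : e != 0 by rewrite -(split_norm_gt0 Hp P0_unit alpha0_pos) -/alpha0 [alpha0 _]ae.
have [i0 [c0 ei0]] := alpha0_max Ee e0.
have vc0 : absv (piece_coord i0 e) != 0 by rewrite (av_eq0 Hp).
have ev0 : integral_value (piece_scale i0).
  apply: (integral_value_cancel vc0 (unr_integral (piece_coord_unr i0 Ee) c0)).
  by rewrite -ei0 ae.
have rk_inj i (l l' : 'I_(s i)) : l != l' -> rk i l != rk i l'.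
  by apply: contraNneq => /(congr1 val) /= /eqP; rewrite tagnat.eq_Rank eqxx val_eqE.
have rk_neq i i' (l : 'I_(s i)) (l' : 'I_(s i')) : i != i' -> rk i l != rk i' l'.
  by apply: contraNneq => h; rewrite -(tagnat.Rank1K l) h tagnat.Rank1K.
have two i i' (l1 l2 : 'I_(s i)) : i != i' -> l1 != l2 -> integral_value (piece_scale i) ->
    integral_value (piece_scale i') -> False.
  move=> ii ll ei ei'.
  apply: (@three_integral (rk i l1) (rk i l2) (rk i' (Ordinal (s_gt0 i')))).
    by rewrite /= !inE !negb_or rk_inj // !rk_neq.
  by move=> l; rewrite !inE => /or3P[] /eqP->; rewrite tagnat.Rank1K.
(* Two integral pieces have total dimension at least 3 unless both have degree 1, which would make
   both odd. *)
have only i : i != i0 -> ~ integral_value (piece_scale i).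
  move=> ni evi; have [s2|s1] := ltnP 1 (s i).
    by apply: (two i i0 (Ordinal (s_gt0 i)) (Ordinal s2)).
  have [s2'|s1'] := ltnP 1 (s i0).
    by apply: (two i0 i (Ordinal (s_gt0 i0)) (Ordinal s2')) => //; rewrite eq_sym.
  have si : s i = 1%N by apply/eqP; rewrite eqn_leq s1 s_gt0.
  have si0 : s i0 = 1%N by apply/eqP; rewrite eqn_leq s1' s_gt0.
  by case/eqP: ni; apply: odd_uniq; rewrite ?si ?si0.
have s2 : (s i0 <= 2)%N.
  rewrite leqNgt; apply/negP => s3.
  apply: (@three_integral (rk i0 (Ordinal (ltn_trans (isT : 0 < 2)%N s3)))
     (rk i0 (Ordinal (ltn_trans (isT : 1 < 2)%N s3))) (rk i0 (Ordinal s3))).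
    by rewrite /= !inE !negb_or !rk_inj.
  by move=> l; rewrite !inE => /or3P[] /eqP->; rewrite tagnat.Rank1K.
have [m hm] := ev0.
have um : absv (u i0) = absv Pi ^ (m * 2) by rewrite -piece_scale_sq hm -exprz_exp.
have an := phi_anisotropic S (s_cond i0) (hz i0) (w_unif i0) (kappa_L i0) s2 um (piece_coord_unr i0 Ee).
have an' : absv (ph i0 (piece_coord i0 e) (piece_coord i0 e)) = alpha0 e ^+ 2.
  by rewrite an -piece_scale_sq ei0 exprMn.
have al_gt : 0 < alpha0 e by rewrite ae.
have small : absv (\sum_(i | i != i0) ph i (piece_coord i e) (piece_coord i e)) < alpha0 e ^+ 2.
  apply: (av_sum_lt Hp) => [|i ni]; first by rewrite exprn_gt0.
  apply: le_lt_trans (phi_le S (s_cond i) (hz i) (w_unif i) (kappa_L i) (piece_coord_unr i Ee) (piece_coord_unr i Ee)) _.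
  rewrite -piece_scale_sq -mulrA -expr2 -exprMn ltr_pXn2r ?nnegrE ?mulr_ge0 ?ge0 ?(ltW (piece_scale_gt0 _)) ?(ltW al_gt) //.
  rewrite lt_neqAle alpha0_geE andbT; apply/eqP => h; apply: (only i ni).
  have ci0 : piece_coord i e != 0.
    by apply/eqP => ci; move: h; rewrite ci (av0 Hp) mulr0 => h; move: al_gt; rewrite -h ltxx.
  apply: (@integral_value_cancel _ (absv (piece_coord i e))); first by rewrite (av_eq0 Hp).
    exact: (unr_integral (piece_coord_unr i Ee) ci0).
  by rewrite h ae.
have [_ _ hne _ _] := wb; have := hne k k; rewrite eq_sym nk => /(_ isT).
rewrite -/e herm_piece_coord // (bigD1 i0) //= addrC => h0.
have := @avD_eqr _ _ _ _ Hp _ (ph i0 (piece_coord i0 e) (piece_coord i0 e)) _; rewrite an' => /(_ _ small).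
by rewrite h0 (av0 Hp) => h1; have := exprn_gt0 2 al_gt; rewrite -h1 ltxx.
Qed.
End EvenPartner.

Lemma facet_alpha0 : facet absv E tau H [set alpha0].
Proof.
have [P [nu [wb [c c_gt0 al_c]]]] :=
  witt_exists S gram_E gram_sym P0_E P0_unit alpha0_pos herm_le herm_attained.
have uP : P \in unitmx by case: wb => -[].
have PE : mx_over E P by case: wb => -[].
have Ec k : mx_over E (col k P) by move=> i l; rewrite mxE.
exists P, nu; split=> //; exists alpha0.
  by split; [exact: alpha0_building|exists c].
apply/seteqP; split=> [_ ->|be [[bb [c' c'_gt0 e']] hr]] /=.
  by split=> //; split; [exact: alpha0_building|exists c].
rewrite e' in bb hr *.
apply: (facet_norm_unique S gram_E gram_sym P0_E P0_unit alpha0_pos herm_le herm_attained wb c_gt0 c'_gt0 al_c).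
- by case: bb.
- by move=> k l v rt rg; case: (hr k l v rt rg).
- move=> k; have := @alpha0_sq_integral (col k P) (Ec k).
  rewrite [alpha0]al_c (split_norm_col Hp) //; apply.
  by rewrite -(split_norm_gt0 Hp uP c_gt0) (split_norm_col Hp).
move=> k a nk ck; apply: contrapT => H0; apply: (isolated_pair_absurd wb c_gt0 al_c nk).
  by exists a.
by move=> l lk lnk [b' hb']; apply: H0; exists l; split=> //; exists b'.
Qed.

(** * The path from 1 to a generator of the torus *)

Section Connected.
Variable i0 : 'I_j.
Hypothesis ev0 : ~~ odd (s i0).

Let zm m := sg m (z i0).
Let zi_ur : Eur (z i0). Proof. exact: (zeta_ur S (s_gt0 i0) (hz i0)). Qed.
Let zm_ur m : Eur (zm m). Proof. exact: sgm. Qed.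
Let zm_abs m : absv (zm m) = 1. Proof. by rewrite (fa_abs (hsg S m)) // (zeta_v S (hz i0)). Qed.
Let zm_tau m : tau (zm m) = zm m.
Proof. by rewrite /zm (tau_sg S) // (zeta_tau S (s_gt0 i0) (hz i0)). Qed.
Let zm_period m : zm (m + s i0)%N = zm m.
Proof.
by rewrite /zm iterD (sg_period S (s_gt0 i0) (hz i0) (zeta_in S (s_gt0 i0) (hz i0))).
Qed.

(* With y_m(t) = 1 + t (sigma^m z - 1), the elements of the torus with
   eigenvalues y_(m + r)(t) / y_m(t) on the piece i0 join 1 at t = 0 to the
   generator at t = 1. *)
Definition path_factor m : {poly Omega} := 1 + (zm m - 1) *: 'X.
Definition path_den : {poly Omega} := \prod_(m < s i0) path_factor m.
Local Notation Y := path_factor.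
Local Notation D := path_den.

(** Points of the path over K^ur: t is fixed by tau, so that the path satisfies the norm equation,
    and the denominators are units. *)
Record path_point (t : Omega) : Prop := PathPoint {
  pp_ur : Eur t; pp_tau : tau t = t; pp_int : absv t <= 1; pp_den : absv D.[t] = 1 }.

Lemma factorE m t : (Y m).[t] = 1 + (zm m - 1) * t.
Proof. by rewrite /path_factor !hornerE. Qed.

Lemma factor_integral m : gauss_integral absv (Y m).
Proof.
move=> k; rewrite coefD coef1 coefZ coefX; apply: (avD_le Hp).
  by case: eqP; rewrite ?(av1 Hp) ?(av0 Hp) ?ler01.
rewrite (avM Hp) mulr_ile1 ?ge0 //; first by apply: (avB_le Hp); rewrite ?zm_abs ?(av1 Hp).
by case: eqP; rewrite ?(av1 Hp) ?(av0 Hp) ?ler01.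
Qed.

Lemma den_integral : gauss_integral absv D.
Proof. by apply: (gauss_integral_prod Hp) => m _; apply: factor_integral. Qed.

Lemma factor_period m : Y (m + s i0)%N = Y m.
Proof. by rewrite /path_factor zm_period. Qed.

Lemma factor_ur m t : Eur t -> Eur (Y m).[t].
Proof.
move=> ut; rewrite factorE; apply: (sfD sur); first exact: (sf1 sur).
by apply: (sfM sur) => //; apply: (sfB sur) => //; exact: (sf1 sur).
Qed.

Lemma factor_tau m t : Eur t -> tau t = t -> tau (Y m).[t] = (Y m).[t].
Proof.
move=> ut tt; have u1 := sf1 sur; have uz : Eur (zm m - 1) by apply: (sfB sur).
rewrite factorE (faD ht u1 (sfM sur uz ut)) (faM ht uz ut) (faB sur ht (zm_ur m) u1).
by rewrite (fa1 Hp sur ht) zm_tau tt.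
Qed.

Lemma factor_abs m t : path_point t -> absv (Y m).[t] = 1.
Proof.
move=> [ut tt t1 d1].
have le (l : nat) : absv (Y l).[t] <= 1 by apply: (gauss_integral_horner Hp) => //; exact: factor_integral.
rewrite (periodic_mod factor_period).
have lt : (m %% s i0 < s i0)%N by rewrite ltn_mod.
rewrite -[(m %% s i0)%N]/(nat_of_ord (Ordinal lt)); move: (Ordinal lt) => l.
apply/eqP; rewrite eq_le le /= -d1 /path_den horner_prod (bigD1 l) //= (avM Hp).
rewrite ler_piMr ?ge0 // (av_prod Hp); apply: prodr_ile1 => l' _.
by rewrite ge0 le.
Qed.

Lemma factor_neq0 m t : path_point t -> (Y m).[t] != 0.
Proof. by move=> pt; rewrite -(av_gt0 Hp) factor_abs // ltr01. Qed.

Definition path_arg t i m := if i == i0 then (Y (m + r i0)).[t] / (Y m).[t] else 1.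

(** Since 2r = s, shifting by r exchanges numerator and denominator, and tau fixes both; the norm
    equation holds identically in t. *)
Lemma path_eigenfamily t : path_point t -> eigenfamily (path_arg t).
Proof.
move=> pt; have [ut tt t1 d1] := pt; split=> i m; rewrite /path_arg.
- by case: eqP => _; [apply: (sf_div sur); apply: factor_ur|exact: (sf1 sur)].
- by case: eqP => // ->; rewrite addnAC !factor_period.
case: eqP => [->|_]; last by rewrite (fa1 Hp sur ht) mulr1.
rewrite (fa_div Hp sur ht (factor_ur _ ut) (factor_ur _ ut)) !factor_tau //.
rewrite -addnA addnn even_halfK // factor_period.
by field; rewrite !factor_neq0.
Qed.

Lemma path_abs t i m : path_point t -> absv (path_arg t i m) = 1.
Proof.
move=> pt; rewrite /path_arg; case: eqP => _; last exact: (av1 Hp).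
by rewrite (avM Hp) (avV Hp) !factor_abs // invr1 mulr1.
Qed.

Definition path_mx t : 'M[Omega]_n := xget 0 [set A | acts_by (path_arg t) A].

Lemma path_mxP t : path_point t -> acts_by (path_arg t) (path_mx t).
Proof.
move=> pt; have [A _ hA] := eigenfamily_torus (path_eigenfamily pt).
exact: (@xgetPex _ 0 [set A | acts_by (path_arg t) A] (ex_intro _ A hA)).
Qed.

Lemma path_bounded t : path_point t -> max_bounded absv TKur (path_mx t).
Proof.
move=> pt; apply: (acts_max_bounded (path_eigenfamily pt) (path_mxP pt)) => i m.
exact: path_abs.
Qed.

Definition ur_poly (P : {poly Omega}) := forall k, Eur P`_k.

Lemma ur_polyM A B : ur_poly A -> ur_poly B -> ur_poly (A * B).
Proof. by move=> hA hB k; rewrite coefM; apply: (sf_sum sur) => i _; apply: (sfM sur). Qed.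

Lemma ur_polyD A B : ur_poly A -> ur_poly B -> ur_poly (A + B).
Proof. by move=> hA hB k; rewrite coefD; apply: (sfD sur). Qed.

Lemma ur_polyC c : Eur c -> ur_poly c%:P.
Proof. by move=> hc k; rewrite coefC; case: eqP => _ //; exact: (sf0 sur). Qed.

Lemma ur_poly_sum (I : Type) (rr : seq I) (Q : pred I) F :
  (forall i, Q i -> ur_poly (F i)) -> ur_poly (\sum_(i <- rr | Q i) F i).
Proof.
move=> h; apply: big_ind => //; last exact: ur_polyD.
by move=> k; rewrite coef0; exact: (sf0 sur).
Qed.

Lemma ur_poly_prod (I : Type) (rr : seq I) (Q : pred I) F :
  (forall i, Q i -> ur_poly (F i)) -> ur_poly (\prod_(i <- rr | Q i) F i).
Proof.
move=> h; apply: big_ind => //; last exact: ur_polyM.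
by apply: ur_polyC; exact: (sf1 sur).
Qed.

Lemma ur_factor m : ur_poly (Y m).
Proof.
move=> k; rewrite coefD coef1 coefZ coefX; apply: (sfD sur); first exact: (sf_nat sur).
apply: (sfM sur); last exact: (sf_nat sur).
by apply: (sfB sur) => //; exact: (sf1 sur).
Qed.

Lemma ur_horner P t : ur_poly P -> Eur t -> Eur P.[t].
Proof.
move=> hP ut; rewrite horner_coef; apply: (sf_sum sur) => i _.
by apply: (sfM sur) => //; apply: (sfX sur).
Qed.

Lemma tau_horner P : ur_poly P -> exists P' : {poly Omega}, forall t, Eur t -> tau t = t ->
  tau P.[t] = P'.[t].
Proof.
move=> hP; exists (\poly_(k < size P) tau P`_k) => t ut tt.
rewrite horner_poly horner_coef (fa_sum sur ht) => [|i _].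
  apply: eq_bigr => i _; rewrite (faM ht (hP i) (sfX sur _ ut)).
  by rewrite (faX Hp sur ht _ ut) tt.
by apply: (sfM sur) => //; apply: (sfX sur).
Qed.

Lemma ur_den : ur_poly D.
Proof. by apply: ur_poly_prod => m _; apply: ur_factor. Qed.

Lemma den_tau t : Eur t -> tau t = t -> tau D.[t] = D.[t].
Proof.
move=> ut tt; rewrite /path_den horner_prod (fa_prod Hp sur ht) => [|m _]; last exact: factor_ur.
by apply: eq_bigr => m _; apply: factor_tau.
Qed.

Lemma path_arg_poly i m : exists2 P : {poly Omega}, ur_poly P & forall t, path_point t ->
  path_arg t i m * D.[t] = P.[t].
Proof.
have [e|ne] := eqVneq i i0; last first.
  by exists D; [exact: ur_den|move=> t _; rewrite /path_arg (negPf ne) mul1r].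
have lt : (m %% s i0 < s i0)%N by rewrite ltn_mod.
pose l := Ordinal lt.
exists (Y (m + r i0) * \prod_(l' < s i0 | l' != l) Y l').
  by apply: ur_polyM; [exact: ur_factor|apply: ur_poly_prod => l' _; exact: ur_factor].
move=> t pt; rewrite /path_arg e eqxx hornerM /path_den (bigD1 l) //= hornerM.
by rewrite [Y m](periodic_mod factor_period) mulrA divfK // factor_neq0.
Qed.

Lemma path_entry k l : exists2 P : {poly Omega}, ur_poly P & forall t, path_point t ->
  path_mx t k l * D.[t] = P.[t].
Proof.
have [i [k' ->]] := rkP k.
have ex (m : 'I_(s i)) : exists P : {poly Omega}, ur_poly P /\ forall t, path_point t ->
    path_arg t i m * D.[t] = P.[t].
  by have [P h1 h2] := path_arg_poly i m; exists P.
have [P hP] := choice ex.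
pose c (m : 'I_(s i)) := invmx (emb_mx i) k' m * conj_coord i m (delta_mx l 0).
have uc m : Eur (c m).
  apply: (sfM sur); first exact: (mxo_inv sur (@emb_mx_ur i)).
  by apply: conj_coord_ur; exact: (mxo_delta sur).
exists (\sum_m (c m)%:P * P m).
  by apply: ur_poly_sum => m _; apply: ur_polyM; [exact: ur_polyC|case: (hP m)].
move=> t pt; pose v : 'cV[Omega]_n := path_mx t *m delta_mx l 0.
have -> : path_mx t (rk i k') l = v (rk i k') 0 by rewrite /v -colE mxE.
have ev : \col_l' v (rk i l') 0 = invmx (emb_mx i) *m \col_m conj_coord i m v.
  apply: (canRL (mulKmx (emb_mx_unit i))).
  by apply/colP => m; rewrite !mxE; apply: eq_bigr => l' _; rewrite !mxE.
have -> : v (rk i k') 0 = (\col_l' v (rk i l') 0) k' 0 by rewrite mxE.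
rewrite ev mxE mulr_suml horner_sum; apply: eq_bigr => m _.
rewrite [X in _ * X * _]mxE /v (path_mxP pt) hornerM hornerC -(hP m).2 // /c; ring.
Qed.

(** Regular functions involve tau, but at t fixed by tau it only conjugates the coefficients of
    polynomials in t. So every regular function restricts to a rational function of t whose
    denominator is a power of D. *)
Lemma path_regular f : regular K E tau f -> exists N (P : {poly Omega}), forall t, path_point t ->
  f (path_mx t) * D.[t] ^+ N = P.[t].
Proof.
elim=> {f} [c _|a k l Ea|f1 f2 _ [N1 [P1 h1]] _ [N2 [P2 h2]]|f1 f2 _ [N1 [P1 h1]] _ [N2 [P2 h2]]].
- by exists 0%N, c%:P => t _; rewrite hornerC mulr1.
- have [P uP hP] := path_entry k l.
  have uaP : ur_poly (a%:P * P) by apply: ur_polyM => //; apply: ur_polyC; apply: EE.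
  have [P' hP'] := tau_horner uaP.
  exists 1%N, (a%:P * P + P') => t pt; have [ut tt _ _] := pt.
  have uA : Eur (path_mx t k l).
    have dn : D.[t] != 0 by rewrite -(av_gt0 Hp) (pp_den pt) ltr01.
    rewrite -[path_mx t k l](mulfK dn) hP //; apply: (sf_div sur); [exact: ur_horner uP ut|exact: ur_horner ur_den ut].
  have uaA : Eur (a * path_mx t k l) by apply: (sfM sur) => //; apply: EE.
  rewrite expr1 mulrDl hornerD -hP' // hornerM hornerC -hP // mulrA; congr (_ + _).
  by rewrite (faM ht uaA (ur_horner ur_den ut)) den_tau.
- exists (N1 + N2)%N, (P1 * D ^+ N2 + P2 * D ^+ N1) => t pt.
  by rewrite hornerD !hornerM !horner_exp -h1 // -h2 // exprD; ring.
- exists (N1 + N2)%N, (P1 * P2) => t pt.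
  by rewrite hornerM -h1 // -h2 // exprD; ring.
Qed.

Lemma path_point0 : path_point 0.
Proof.
split; [exact: (sf0 sur)|exact: (fa0 sur ht)|by rewrite (av0 Hp) ler01|].
rewrite /path_den horner_prod big1 ?(av1 Hp) // => m _.
by rewrite factorE mulr0 addr0.
Qed.

Lemma path_point1 : path_point 1.
Proof.
split; [exact: (sf1 sur)|exact: (fa1 Hp sur ht)|by rewrite (av1 Hp)|].
rewrite /path_den horner_prod (av_prod Hp) big1 // => m _.
by rewrite factorE mulr1 addrC subrK zm_abs.
Qed.

Lemma path_mx0 : path_mx 0 = 1%:M.
Proof.
apply: (acts_uniq (path_mxP path_point0)); apply: acts_ext acts1 => i m.
by rewrite /path_arg; case: eqP => // _; rewrite !factorE !mulr0 !addr0 divr1.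
Qed.

Lemma path_mx1 : path_mx 1 = gen i0.
Proof.
apply: (acts_uniq (path_mxP path_point1)).
have [_ _ _ hac _] := toralP (fun i => gen_argP i ev0).
apply: acts_ext hac => i m; rewrite /path_arg /gen_arg.
case: eqP => [->|_]; last exact: (fa1 Hp sur (hsg S m)).
have ue : Eur (et i0 (z i0)) by apply: (fa_mem (heta S (s i0))).
rewrite !factorE !mulr1 ![1 + _]addrC !subrK (fa_div Hp sur (hsg S m) ue zi_ur).
congr (_ / _); rewrite /Defs.eta -(tau_sg S) //; last exact: sgm.
by rewrite -iterD; exact: zm_tau.
Qed.

Lemma unity_point t : unity q t -> absv D.[t] = 1 -> path_point t.
Proof.
move=> ut d1; have vt := unity_abs S ut; split=> //; last by rewrite vt.
  by case: ut => [m [y [l [m0 hy ->]]]]; apply: (sfX sur); exact: (zeta_ur S m0 hy).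
case: ut => [m [y [l [m0 hy ->]]]].
by rewrite (faX Hp sur ht _ (zeta_ur S m0 hy)) (zeta_tau S m0 hy).
Qed.

Lemma gen_Neron0 : torus_Neron0 absv K E tau sigma b (gen i0).
Proof.
split; [by rewrite -path_mx1; apply: path_bounded; exact: path_point1|exact: gen_E|].
move=> f [[rf f1] f2].
have [N [P hP]] := path_regular rf.
have fP t : path_point t -> f (path_mx t) = P.[t] / D.[t] ^+ N.
  move=> pt; rewrite -hP // mulfK // expf_neq0 // -(av_gt0 Hp) (pp_den pt) ltr01 //.
have vD t : path_point t -> absv (D.[t] ^+ N) = 1.
  by move=> pt; rewrite (avX Hp) (pp_den pt) expr1n.
have D0 : D.[0] = 1.
  rewrite /path_den horner_prod big1 // => m _; by rewrite factorE mulr0 addr0.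
rewrite -path_mx1 -path_mx0.
have p0 := path_point0; have p1 := path_point1.
have [|sP|sP] := path_dichotomy S (D := D) (P := P) (N := N) den_integral D0.
- move=> t ut d1; have pt := unity_point ut d1.
  have nD : D.[t] ^+ N != 0 by rewrite -(av_gt0 Hp) vD // ltr01.
  have eP : P.[t] = f (path_mx t) * D.[t] ^+ N by rewrite fP // divfK.
  rewrite eP (avM Hp) vD // mulr1; split; first by apply: f1; apply: path_bounded.
  have -> : f (path_mx t) * D.[t] ^+ N * (f (path_mx t) * D.[t] ^+ N - D.[t] ^+ N) =
     (f (path_mx t) ^+ 2 - f (path_mx t)) * D.[t] ^+ N * D.[t] ^+ N by ring.
  by rewrite !(avM Hp) vD // !mulr1; apply: f2; apply: path_bounded.
- have sm t : path_point t -> absv (f (path_mx t)) < 1.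
    move=> pt; rewrite fP // (avM Hp) (avV Hp) vD // invr1 mulr1.
    by apply: (small_horner Hp) => //; case: pt.
  by apply: (avB_lt Hp); apply: sm.
have sm t : path_point t -> absv (f (path_mx t) - 1) < 1.
  move=> pt; have nD : D.[t] ^+ N != 0 by rewrite -(av_gt0 Hp) vD // ltr01.
  rewrite fP // -(divff nD) -mulrBl (avM Hp) (avV Hp) vD // invr1 mulr1.
  rewrite -horner_exp -hornerN -hornerD.
  by apply: (small_horner Hp) => //; case: pt.
rewrite (_ : _ - _ = (f (path_mx 1) - 1) - (f (path_mx 0) - 1)); last by ring.
by apply: (avB_lt Hp); apply: sm.
Qed.
End Connected.

(** * Parahoric subgroups containing the neutral component *)

Local Notation Neron0 := (torus_Neron0 absv K E tau sigma b).

(** The bounded torus over K^ur lies in the fixer of alpha0, so an idempotent for the fixer is also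
    one for the torus and cannot separate its neutral component from 1. *)
Lemma Neron0_fixer : Neron0 `<=` identity_component absv K E tau (fixer absv E tau H [set alpha0]).
Proof.
have sub A : max_bounded absv TKur A -> fixer absv E tau H [set alpha0] A.
  by move=> /max_bounded_fixes[uA fA]; split=> // _ ->.
move=> A [mA EA hA]; split=> // [|f [[rf f1] f2]]; first exact: sub.
apply: hA; split; last by move=> g /sub; apply: f2.
by split=> // g /sub; apply: f1.
Qed.

Lemma facet_unique F : facet absv E tau H F ->
  Neron0 `<=` identity_component absv K E tau (fixer absv E tau H F) -> F = [set alpha0].
Proof.
move=> [P [nu [wb [al apt eF]]]] sub.
have F_al : F al by rewrite eF; split.
have all be : F be -> be = alpha0.
  move=> Fbe; have [bb _] : apartment absv E tau H P be by move: Fbe; rewrite eF => -[].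
  apply: building_invariant => // i ev x.
  by have [[_ fg] _ _] := sub _ (gen_Neron0 ev); apply: fg.
by apply/seteqP; split=> [be /all ->//|_ ->]; rewrite -(all _ F_al).
Qed.

Lemma unique_maximal_parahoric : exists! Q, maximal_parahoric absv K E tau H Q /\ Neron0 `<=` Q.
Proof.
have st := Neron0_fixer.
have only Q : parahoric absv K E tau H Q -> Neron0 `<=` Q ->
    Q = identity_component absv K E tau (fixer absv E tau H [set alpha0]).
  by move=> [F fF ->] sub; rewrite (facet_unique fF sub).
have pa : parahoric absv K E tau H
    (identity_component absv K E tau (fixer absv E tau H [set alpha0])).
  by exists [set alpha0] => //; exact: facet_alpha0.
exists (identity_component absv K E tau (fixer absv E tau H [set alpha0])); split.
  split=> //; split=> // Q' pQ' sQ'; apply: only => // A TA.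
  by apply: sQ'; apply: st.
by move=> Q [[pQ _] TQ]; rewrite (only Q).
Qed.

End Sums.

(** * The theorem *)

Theorem corollary5p5
  (R : realType) (p : nat) (p_prime : prime p) (p_neq2 : p <> 2%N)
  (Omega : closedFieldType) (absv : Omega -> R)
  (Omega_closure : padic_closure absv p)
  (K E : set Omega)
  (K_finite : exists d, ext_of_degree (Qp absv) K d)
  (E_quadratic : ext_of_degree K E 2)
  (E_ramified : ~ same_values absv K E)
  (q : nat) (K_residue : residue_card absv K q)
  (tau sigma : Omega -> Omega)
  (tau_gal : gal_aut (max_unr absv E) (max_unr absv K) tau)
  (tau_nontriv : exists2 x, E x & tau x <> x)
  (sigma_gal : gal_aut (max_unr absv E) E sigma)
  (sigma_Frob : forall x, max_unr absv K x -> absv x <= 1 ->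
     absv (sigma x - x ^+ q) < 1)
  (j : nat) (j_gt0 : (0 < j)%N) (s : 'I_j -> nat)
  (s_even : forall i, ((0 < s i)%N /\ ~~ odd (s i)) \/
                      (s i = 1%N /\ i.+1 = j))
  (varpi : nat -> Omega)
  (varpi_unif : forall i,
     uniformizer absv (Lfield absv K E tau sigma (s i)) (varpi (s i)))
  (varpi_trace : forall i, ~~ odd (s i) ->
     traceL tau (varpi (s i)) = 0)
  (kappa : 'I_j -> Omega)
  (kappa_L : forall i,
     Lfield absv K E tau sigma (s i) (kappa i) /\ kappa i <> 0)
  (b : forall i, 'I_(s i) -> Omega)
  (b_basis : forall i, ext_basis E (unr absv E (s i)) (b i)) :
  let H := gram tau sigma b varpi kappa in
  (exists! Q, maximal_compact absv E tau H Q /\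
     torusK absv E tau sigma b `<=` Q) /\
  (exists! Q, maximal_parahoric absv K E tau H Q /\
     torus_Neron0 absv K E tau sigma b `<=` Q).
Proof.
move=> H; have i0 : 'I_j := Ordinal j_gt0.
have s_cond i : ((0 < s i)%N /\ ~~ odd (s i)) \/ s i = 1%N.
  by case: (s_even i) => [|[]]; [left|right].
have s_gt0 i : (0 < s i)%N by case: (s_cond i) => [[]|->].
have sK : is_subfield K by case: K_finite => d [].
have K_L i x : K x -> Lfield absv K E tau sigma (s i) x.
  move=> Kx; rewrite /Lfield; case: eqP => // _.
  have KE : K `<=` E by case: E_quadratic.
  have [bu _ _] := b_basis i; have [L hL _] := bu (Ordinal (s_gt0 i)).
  split; first by exists L => //; case: hL => -[_ EL _] _; apply/EL/KE.
  have sx m : iter m sigma x = x.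
    by elim: m => //= m ->; case: sigma_gal => h _ _ _; apply/h/KE.
  rewrite /Defs.eta sx; case: tau_gal => h _ _ _; apply: h.
  by exists 1%N; rewrite (unr1 absv sK).
(* Discreteness of the values of K is read off from the uniformizer of the first piece, whose field
   contains K. *)
have K_gap : exists2 c : R, c < 1 & forall x, K x -> absv x < 1 -> absv x <= c.
  have [_ _ w1 wmax] := varpi_unif i0.
  by exists (absv (varpi (s i0))) => // x Kx; apply: wmax; apply: K_L.
have [Pi S] := setup_exists p_prime p_neq2 Omega_closure K_finite E_quadratic E_ramified
  K_residue tau_gal tau_nontriv sigma_gal sigma_Frob K_gap.
have [z hz] := choice (fun i => su_zeta_exists S (s_gt0 i)).
(* An odd degree is allowed only at the last index. *)
have odd_uniq i i' : odd (s i) -> odd (s i') -> i = i'.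
  move=> od od'; apply: ord_inj; apply: succn_inj.
  case: (s_even i) => [[_]|[_ ->]]; first by rewrite od.
  by case: (s_even i') => [[_]|[_ ->]]; first by rewrite od'.
split.
  exact: (unique_maximal_compact S s_cond varpi_unif kappa_L b_basis hz odd_uniq).
exact: (unique_maximal_parahoric S s_cond varpi_unif kappa_L b_basis hz odd_uniq).
Qed.
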